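(* Let $\Lambda$ be a tame canonical algebra over $k$. Then there exists $N \in \mathbb{N}$ such that for every dimension vector $\mathbf{d}$ of a regular $\Lambda$-module with $p^{\mathbf{d}} \geq N$, the set $\mathcal{Z}(\mathbf{d})$ of the common zeros in $\mathrm{mod}_\Lambda(\mathbf{d})$ of the semi-invariants of non-zero weight is a complete intersection.
   Context: $k$ is an algebraically closed field of characteristic $0$; $\mathbb{N}$ is the set of non-negative integers; $[i,j]=\{l\in\mathbb{Z}\mid i\le l\le j\}$. Canonical algebras. Let $\mathbf{m}=(m_1,\dots,m_n)$, $n\ge 3$, be integers greater than $1$ and $\boldsymbol{\lambda}=(\lambda_3,\dots,\lambda_n)$ pairwise distinct non-zero elements of $k$ with $\lambda_3=1$. The quiver $\Delta$ has vertices $0$, $\infty$ and $(i,j)$ for $i\in[1,n]$, $j\in[1,m_i-1]$, and arrows $\alpha_{i,j}$ from $(i,j)$ to $(i,j-1)$ for $i\in[1,n]$, $j\in[1,m_i]$, where $(i,0)$ means $0$ and $(i,m_i)$ means $\infty$. The canonical algebra $\Lambda=\Lambda(\mathbf{m},\boldsymbol{\lambda})$ is the path algebra of $\Delta$ modulo the ideal generated by the set $R$ of the $n-2$ relations $\alpha_{1,1}\cdots\alpha_{1,m_1}+\lambda_i\alpha_{2,1}\cdots\alpha_{2,m_2}-\alpha_{i,1}\cdots\alpha_{i,m_i}$, $i\in[3,n]$ (each $\alpha_{i,1}\cdots\alpha_{i,m_i}$ is the path from $\infty$ to $0$ along the $i$-th arm). $\Lambda$-modules (finite dimensional) are identified with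 representations of $\Delta$ satisfying these relations; $\mathbf{dim}\, M\in\mathbb{Z}^{\Delta_0}$ is the dimension vector. Tame means of tame representation type: for each $d$ the indecomposable modules of dimension $d$ can be parameterized by finitely many lines; it is known that $\Lambda$ is tame if and only if $\frac12\bigl(n-2-\frac1{m_1}-\cdots-\frac1{m_n}\bigr)\le 0$. Regular modules. Let $\mathbf{e}_x$ be the standard basis vectors of $\mathbb{Z}^{\Delta_0}$, $\mathbf{e}_{i,j}=\mathbf{e}_{(i,j)}$ for $j\in[1,m_i-1]$, $\mathbf{h}=\sum_{x\in\Delta_0}\mathbf{e}_x$, $\mathbf{e}_{i,0}=\mathbf{h}-\sum_{j\in[1,m_i-1]}\mathbf{e}_{i,j}$. A module is regular if it is a direct sum of indecomposable modules $X$ with $(\mathbf{dim}\,X)_0=(\mathbf{dim}\,X)_\infty$. The dimension vector $\mathbf{d}$ of a regular module has a unique presentation (canonical decomposition) $\mathbf{d}=p^{\mathbf{d}}\mathbf{h}+\sum_{i\in[1,n]}\sum_{j\in[0,m_i-1]}p^{\mathbf{d}}_{i,j}\mathbf{e}_{i,j}$ with $p^{\mathbf{d}}\ge0$, all $p^{\mathbf{d}}_{i,j}\ge0$ integers, and such that for each $i\in[1,n]$ there is $j\in[0,m_i-1]$ with $p^{\mathbf{d}}_{i,j}=0$. This defines $p^{\mathbf{d}}$. Module varieties and semi-invariants. For $\mathbf{d}\in\mathbb{N}^{\Delta_0}$, let $\mathbb{A}(\mathbf{d})$ be the affine space $\prod_{\alpha\in\Delta_1}\mathbb{M}(d_{t\alpha},d_{s\alpha})$,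 where an arrow $\alpha$ goes from $s\alpha$ to $t\alpha$ and $\mathbb{M}(a,b)$ is the space of $a\times b$ matrices over $k$; $\mathrm{mod}_\Lambda(\mathbf{d})\subseteq\mathbb{A}(\mathbf{d})$ is the closed subset of tuples satisfying the relations. $\mathrm{GL}(\mathbf{d})=\prod_x\mathrm{GL}(d_x)$ acts on it by $(g\cdot M)_\alpha=g_{t\alpha}M_\alpha g_{s\alpha}^{-1}$ and on $k[\mathrm{mod}_\Lambda(\mathbf{d})]$ by $(g\cdot f)(M)=f(g^{-1}\cdot M)$. For $\sigma\in\mathbb{Z}^{\Delta_0}$ (with $\sigma_x=0$ whenever $d_x=0$), a semi-invariant of weight $\sigma$ is an $f\in k[\mathrm{mod}_\Lambda(\mathbf{d})]$ with $g\cdot f=\bigl(\prod_{x}\det(g_x)^{\sigma_x}\bigr)f$ for all $g\in\mathrm{GL}(\mathbf{d})$. $\mathcal{Z}(\mathbf{d})\subseteq\mathrm{mod}_\Lambda(\mathbf{d})$ is the set of common zeros of all semi-invariants of non-zero weight. The closed subset $\mathcal{Z}(\mathbf{d})$ of $\mathbb{A}(\mathbf{d})$ being a complete intersection means that it is the zero set of $\dim\mathbb{A}(\mathbf{d})-\dim\mathcal{Z}(\mathbf{d})$ polynomials. *)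

(* Defs.v *)
From HB Require Import structures.
From mathcomp Require Import all_boot all_order all_algebra.
From mathcomp Require Import mpoly.

Set Implicit Arguments.
Unset Strict Implicit.
Unset Printing Implicit Defensive.

Import GRing.Theory.
Local Open Scope ring_scope.

(* Arms are numbered from 0: [arity i] is m_(i+1), and [coeff i] is
   lambda_(i+3), so that [coeff] is attached to the arm of index i+2. *)
Record canonicalData (k : closedFieldType) := CanonicalData {
  narms : nat;
  narms_ge3 : (3 <= narms)%N;
  arity : 'I_narms -> nat;
  arity_gt1 : forall i, (1 < arity i)%N;
  coeff : 'I_(narms - 2) -> k;
  coeff_inj : injective coeff;
  coeff_neq0 : forall i, coeff i != 0;
  coeff_first : forall i, val i = 0%N -> coeff i = 1
}.

Section CanonicalAlgebra.

Context (k : closedFieldType) (C : canonicalData k).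

Notation n := (narms C).
Notation m := (@arity k C).

(* [inl false] is 0, [inl true] is oo, and [inr (Tagged _ j)] over [i] is the
   vertex (i, j+1), for j < m_i - 1. *)
Definition vertex : finType := (bool + {i : 'I_n & 'I_(m i).-1})%type.

Definition v0 : vertex := inl false.
Definition voo : vertex := inl true.

(* The vertex (i, j), with (i, 0) = 0 and (i, m_i) = oo; only meaningful for
   j <= m_i. *)
Definition armv (i : 'I_n) (j : nat) : vertex :=
  if j is j'.+1 then
    if (insub j' : option 'I_(m i).-1) is Some u
    then inr (Tagged (fun i => 'I_(m i).-1) u) else voo
  else v0.

Lemma armv_end (i : 'I_n) : armv i (m i) = voo.
Proof.
have := arity_gt1 i; case E: (m i) => [|r] // _ /=.
by rewrite insubF // E ltnn.
Qed.

(* [Tagged _ j] over [i] is the arrow alpha_(i, j+1) : (i, j+1) -> (i, j). *)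
Definition arrow : finType := {i : 'I_n & 'I_(m i)}.

Definition src (a : arrow) : vertex := armv (tag a) (tagged a).+1.
Definition tgt (a : arrow) : vertex := armv (tag a) (tagged a).

Definition dimvec := vertex -> nat.

(* The space A(d), with coefficients in an arbitrary type. *)
Definition rep (R : Type) (d : dimvec) : Type :=
  forall a : arrow, 'M[R]_(d (tgt a), d (src a)).

Definition arm_arrow (i : 'I_n) (j : nat) (h : (j < m i)%N) : arrow :=
  Tagged (fun i => 'I_(m i)) (Ordinal h).

(* alpha_(i,1) ... alpha_(i,j) *)
Fixpoint path_mx (d : dimvec) (M : rep k d) (i : 'I_n) (j : nat) :
    (j <= m i)%N -> 'M[k]_(d v0, d (armv i j)) :=
  match j return (j <= m i)%N -> 'M[k]_(d v0, d (armv i j)) with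
  | 0 => fun _ => 1%:M
  | j'.+1 => fun h => path_mx M (ltnW h) *m M (arm_arrow h)
  end.

Definition arm_mx (d : dimvec) (M : rep k d) (i : 'I_n) :
    'M[k]_(d v0, d voo) :=
  castmx (erefl, congr1 d (armv_end i)) (path_mx M (leqnn (m i))).

Definition arm_fst : 'I_n := Ordinal (ltn_trans (isT : 0 < 2)%N (narms_ge3 C)).
Definition arm_snd : 'I_n := Ordinal (ltn_trans (isT : 1 < 2)%N (narms_ge3 C)).

Lemma arm_rest_subproof (i : 'I_(n - 2)) : (i.+2 < n)%N.
Proof. by have := ltn_ord i; rewrite ltn_subRL add2n. Qed.

Definition arm_rest (i : 'I_(n - 2)) : 'I_n := Ordinal (arm_rest_subproof i).

(* Membership in mod_Lambda(d). *)
Definition is_module (d : dimvec) (M : rep k d) : Prop :=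
  forall i : 'I_(n - 2),
    arm_mx M arm_fst + coeff i *: arm_mx M arm_snd - arm_mx M (arm_rest i) = 0.

Definition is_hom (d e : dimvec) (M : rep k d) (N : rep k e)
    (f : forall x : vertex, 'M[k]_(e x, d x)) : Prop :=
  forall a : arrow, f (tgt a) *m M a = N a *m f (src a).

Definition isomorphic (d e : dimvec) (M : rep k d) (N : rep k e) : Prop :=
  exists (f : forall x : vertex, 'M[k]_(e x, d x))
         (g : forall x : vertex, 'M[k]_(d x, e x)),
    [/\ is_hom M N f, is_hom N M g,
        forall x, g x *m f x = 1%:M & forall x, f x *m g x = 1%:M].

Definition dsum (d e : dimvec) (M : rep k d) (N : rep k e) :
    rep k (fun x => d x + e x)%N :=
  fun a => block_mx (M a) 0 0 (N a).

Definition zero_dim (d : dimvec) : Prop := forall x, d x = 0%N.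

Definition indecomposable (d : dimvec) (M : rep k d) : Prop :=
  [/\ is_module M, ~ zero_dim d &
      forall (d1 d2 : dimvec) (M1 : rep k d1) (M2 : rep k d2),
        is_module M1 -> is_module M2 -> isomorphic M (dsum M1 M2) ->
        zero_dim d1 \/ zero_dim d2].

(* A morphism from the affine line to A(d) is a point of A(d) over k[T]. *)
Definition specialize (d : dimvec) (F : rep {poly k} d) (t : k) : rep k d :=
  fun a => map_mx (fun q : {poly k} => q.[t]) (F a).

Definition tame : Prop :=
  forall d : dimvec, exists (s : nat) (F : 'I_s -> rep {poly k} d),
    (forall i t, is_module (specialize (F i) t)) /\
    (forall M : rep k d, indecomposable M ->
       exists i t, isomorphic M (specialize (F i) t)).

Inductive regular : forall d : dimvec, rep k d -> Prop :=
| regular_zero (d : dimvec) (M : rep k d) : zero_dim d -> regular M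
| regular_dsum (d e f : dimvec) (X : rep k d) (Y : rep k e) (M : rep k f) :
    indecomposable X -> d v0 = d voo -> regular Y ->
    isomorphic M (dsum X Y) -> regular M.

Definition regular_dim (d : dimvec) : Prop := exists M : rep k d, regular M.

Definition unit_vec (x : vertex) : {ffun vertex -> int} :=
  [ffun y => (y == x)%:Z].

Definition h_vec : {ffun vertex -> int} := \sum_(x : vertex) unit_vec x.

(* e_(i,j) for j < m_i, with e_(i,0) = h - \sum_(1 <= j < m_i) e_(i,j). *)
Definition e_vec (i : 'I_n) (j : nat) : {ffun vertex -> int} :=
  if j is 0 then h_vec - \sum_(1 <= l < m i) unit_vec (armv i l)
  else unit_vec (armv i j).

(* [p] and [q] are the coefficients p^d and p^d_(i,j) of the canonical
   decomposition of [d]. *)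
Definition canonical_decomposition (d : dimvec) (p : nat)
    (q : forall i : 'I_n, 'I_(m i) -> nat) : Prop :=
  [ffun x => (d x)%:Z] =
     h_vec *+ p + \sum_(i < n) \sum_(j < m i) e_vec i j *+ q i j
  /\ forall i : 'I_n, exists j : 'I_(m i), q i j = 0%N.

Definition coord (d : dimvec) : finType :=
  {a : arrow & ('I_(d (tgt a)) * 'I_(d (src a)))%type}.

Definition entry (d : dimvec) (M : rep k d) (c : coord d) : k :=
  M (tag c) (tagged c).1 (tagged c).2.

Definition polyfun (d : dimvec) := {mpoly k[#|coord d|]}.

Definition evalp (d : dimvec) (f : polyfun d) (M : rep k d) : k :=
  f.@[fun c => entry M (enum_val c)].

Definition subvar (d : dimvec) (V W : rep k d -> Prop) : Prop :=
  forall M, V M -> W M.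

Definition zariski_closed (d : dimvec) (V : rep k d -> Prop) : Prop :=
  exists S : polyfun d -> Prop,
    forall M, V M <-> (forall f, S f -> evalp f M = 0).

Definition irreducible_closed (d : dimvec) (V : rep k d -> Prop) : Prop :=
  [/\ zariski_closed V, exists M, V M &
      forall V1 V2 : rep k d -> Prop,
        zariski_closed V1 -> zariski_closed V2 ->
        subvar V (fun M => V1 M \/ V2 M) -> subvar V V1 \/ subvar V V2].

Definition has_chain (d : dimvec) (V : rep k d -> Prop) (r : nat) : Prop :=
  exists X : nat -> rep k d -> Prop,
    (forall i, (i <= r)%N -> irreducible_closed (X i) /\ subvar (X i) V) /\
    (forall i, (i < r)%N -> subvar (X i) (X i.+1) /\ ~ subvar (X i.+1) (X i)).

(* Krull dimension of a closed subset. *)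
Definition has_dim (d : dimvec) (V : rep k d -> Prop) (r : nat) : Prop :=
  has_chain V r /\ forall r', has_chain V r' -> (r' <= r)%N.

Definition complete_intersection (d : dimvec) (V : rep k d -> Prop) : Prop :=
  exists r s : nat,
    [/\ has_dim (fun _ : rep k d => True) r, has_dim V s &
        exists f : 'I_(r - s) -> polyfun d,
          forall M, V M <-> (forall i, evalp (f i) M = 0)].

Definition act (d : dimvec) (g : forall x : vertex, 'M[k]_(d x))
    (M : rep k d) : rep k d :=
  fun a => g (tgt a) *m M a *m invmx (g (src a)).

(* Regular functions on mod_Lambda(d) are represented by polynomials on A(d),
   evaluated only at points of mod_Lambda(d). *)
Definition semi_invariant (d : dimvec) (sigma : {ffun vertex -> int})
    (f : polyfun d) : Prop :=
  forall g : (forall x : vertex, 'M[k]_(d x)),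
    (forall x, g x \in unitmx) ->
    forall M : rep k d, is_module M ->
      evalp f (act (fun x => invmx (g x)) M)
      = (\prod_(x : vertex) \det (g x) ^ sigma x) * evalp f M.

Definition weight (d : dimvec) (sigma : {ffun vertex -> int}) : Prop :=
  forall x, d x = 0%N -> sigma x = 0.

Definition Zset (d : dimvec) (M : rep k d) : Prop :=
  is_module M /\
  forall (sigma : {ffun vertex -> int}) (f : polyfun d),
    weight d sigma -> sigma != 0 -> semi_invariant sigma f -> evalp f M = 0.

End CanonicalAlgebra.

(* Main.v *)
From HB Require Import structures.
From mathcomp Require Import all_boot all_order all_algebra.
From mathcomp Require Import perm mpoly.
From mathcomp Require Import zify ring.
From Stdlib Require Import ClassicalEpsilon FunctionalExtensionality.
Require Import Defs.

(** Write A_i for the composite of the maps along the i-th arm. Let Z' be cut out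
    by the relations, by one determinant for each pair of consecutive equal values
    of j |-> p^d_(i,j) around the cycle obtained from the i-th arm, and by p - n + 1
    coefficients of the polynomial det(A_1 + T A_2). Except for the relations these
    are semi-invariants of non-zero weight, so Z(d) is contained in Z'. The theorem
    follows from two facts: the codimension of Z' is its number of equations, and
    Z' = Z(d).

    On Z' the polynomial det(A_1 + T A_2) vanishes identically, since the other
    equations force too many roots; hence the largest defect
    s = max_X (dim X - dim sum_i X A_i) is positive. Splitting off a submodule of
    maximal defect bounds the codimension of the stratum of defect s from below.
    Tameness enters here: the Tits form of the star of the arms is non-negative, as
    modules vanishing at infinity satisfy no relation. The codimension is at least
    2p if s > 1, or if s = 1 and both the row and the column kernels common to all
    A_i are non-zero, and at least the number of equations in any case. For large p
    the number of equations other than the relations is less than 2p. A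
    semi-invariant not vanishing on Z' is therefore non-zero at some module of
    defect 1 lacking one of the two kernels, and King's inequalities for the
    submodules and quotients of that module force its weight to be zero.

    Dimensions are bounded above by the growth of algebras of functions, and below
    by chains of irreducible closed sets through a point of a set defined by
    c equations. *)

Set Implicit Arguments.
Unset Strict Implicit.
Unset Printing Implicit Defensive.

Import Order.TTheory GRing.Theory Num.Theory.
Local Open Scope ring_scope.

(** Neither the ring of semi-invariants nor the components of Z(d) are known, so only a few explicit
    semi-invariants are used. Every point of Z' lies on a piece of Z' of codimension at most the
    number of equations, also inside the open part where a further semi-invariant f is non-zero.
    Beyond the relations this codimension is below 2p, too small for the exceptional strata; hence f
    is non-zero on the generic one, where King's inequalities decide. The number of pairs on arm i
    is at most 2 m_i^2, independently of d, so N is uniform. The count p - n + 1 plays two parts: it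
    is what makes the forced roots of det(A_1 + T A_2), with infinity, exceed the size of the
    matrices by one, and it is what defect one yields, namely p + 1 together with one entry q of the
    decomposition per arm from the Euler form, against at most q + 1 pairs lost on each arm. Growth
    of spans makes sense on arbitrary sets of modules, so strata are bounded by parametrizing them,
    without a dimension theory of images and fibres; submodules are handled through the pivots of
    echelon forms. *)

Lemma dep_choice (A : Type) (B : A -> Type) (R : forall a, B a -> Prop) :
  (forall a, exists b, R a b) -> exists f : forall a, B a, forall a, R a (f a).
Proof.
move=> H; exists (fun a => proj1_sig (constructive_indefinite_description _ (H a))).
by move=> a; case: constructive_indefinite_description.
Qed.

(** * Growth of algebras of functions *)

Section Growth.

Context (k : fieldType).

Definition monof (I : finType) (X : Type) (z : I -> X -> k) (e : {ffun I -> nat})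
    (x : X) : k := \prod_i z i x ^+ e i.

(** Equality is asked only on [P], so [f] is a regular function on that locus. The exponents are
    bounded one by one, and the bounds add under products. *)
Definition poly_upto (I : finType) (X : Type) (P : X -> Prop) (z : I -> X -> k)
    (t : nat) (f : X -> k) : Prop :=
  exists2 s : seq (k * {ffun I -> nat}),
    forall ce, ce \in s -> forall i, (ce.2 i <= t)%N &
    forall x, P x -> f x = \sum_(ce <- s) ce.1 * monof z ce.2 x.

Definition in_alg_gen (I : finType) (X : Type) (P : X -> Prop) (z : I -> X -> k)
    (f : X -> k) : Prop := exists t, poly_upto P z t f.

Definition in_span (T : finType) (X : Type) (P : X -> Prop) (g : T -> X -> k)
    (f : X -> k) : Prop :=
  exists c : T -> k, forall x, P x -> f x = \sum_i c i * g i x.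

(* The functions z have transcendence degree at most D on P, in the form that
   monomials of degree at most t in each of them span O(t^D) functions. *)
Definition growth_le (I : finType) (X : Type) (P : X -> Prop) (z : I -> X -> k)
    (D : nat) : Prop :=
  exists C : nat, forall t : nat, exists (T : finType) (g : T -> X -> k),
    (#|T| <= C * t.+1 ^ D)%N /\
    forall e : {ffun I -> nat}, (forall i, (e i <= t)%N) ->
      in_span P g (monof z e).

Section Fixed.

Context (I : finType) (X : Type) (P : X -> Prop) (z : I -> X -> k).

Notation pu := (poly_upto P z).
Notation alg := (in_alg_gen P z).

Lemma poly_upto_eq t (f g : X -> k) :
  (forall x, P x -> f x = g x) -> pu t f -> pu t g.
Proof. by move=> fg [s s1 s2]; exists s => // x px; rewrite -fg // s2. Qed.

Lemma poly_upto_le t t' (f : X -> k) : (t <= t')%N -> pu t f -> pu t' f.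
Proof.
by move=> tt' [s s1 s2]; exists s => // ce /s1 H i; apply: leq_trans tt'.
Qed.

Lemma poly_upto_const t (a : k) : pu t (fun=> a).
Proof.
exists [:: (a, [ffun=> 0%N])] => [ce|x _].
  by rewrite inE => /eqP -> i; rewrite ffunE.
rewrite big_seq1 /= /monof big1 ?mulr1 // => i _.
by rewrite ffunE.
Qed.

Lemma poly_upto_var t i : (0 < t)%N -> pu t (z i).
Proof.
move=> t0; exists [:: (1, [ffun j => (j == i) : nat])] => [ce|x _].
  by rewrite inE => /eqP -> j; rewrite ffunE; case: eqP.
rewrite big_seq1 mul1r /monof (bigD1 i) //= ffunE eqxx big1 ?mulr1 //.
by move=> j /negPf; rewrite ffunE => ->.
Qed.

Lemma poly_uptoD t (f g : X -> k) : pu t f -> pu t g -> pu t (fun x => f x + g x).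
Proof.
move=> [s s1 s2] [r r1 r2]; exists (s ++ r) => [ce|x px].
  by rewrite mem_cat => /orP [/s1|/r1].
by rewrite big_cat s2 // r2.
Qed.

Lemma poly_uptoM t t' (f g : X -> k) :
  pu t f -> pu t' g -> pu (t + t') (fun x => f x * g x).
Proof.
move=> [s s1 s2] [r r1 r2].
pose mk (a b : k * {ffun I -> nat}) : k * {ffun I -> nat} :=
  (a.1 * b.1, [ffun i => (a.2 i + b.2 i)%N]).
exists [seq mk a b | a <- s, b <- r] => [ce|x px].
  move=> /allpairsP [[a b] [/= /s1 Ha /r1 Hb ->]] i; rewrite ffunE.
  exact: leq_add.
rewrite s2 // r2 // big_distrlr big_allpairs_dep /=.
apply: eq_bigr => a _; apply: eq_bigr => b _.
rewrite mulrACA; congr (_ * _); rewrite /monof -big_split /=.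
by apply: eq_bigr => i _; rewrite ffunE exprD.
Qed.

Lemma poly_uptoX t n (f : X -> k) : pu t f -> pu (n * t) (fun x => f x ^+ n).
Proof.
move=> Hf; elim: n => [|n IH].
  by apply: (@poly_upto_eq _ (fun=> 1)) (poly_upto_const _ _) => x _.
rewrite mulSn; apply: poly_upto_eq (poly_uptoM Hf IH) => x _.
by rewrite exprS.
Qed.

Lemma poly_upto_prod (J : finType) t (f : J -> X -> k) :
  (forall j, pu t (f j)) -> pu (#|J| * t) (fun x => \prod_j f j x).
Proof.
move=> Hf; rewrite cardE.
apply: (@poly_upto_eq _ (fun x => \prod_(j <- enum J) f j x)).
  by move=> x _; rewrite big_enum.
elim: (enum J) => [|j s IH].
  apply: poly_upto_eq (poly_upto_const _ 1) => x _; by rewrite big_nil.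
rewrite /=; apply: poly_upto_eq (poly_uptoM (Hf j) IH) => x _.
by rewrite big_cons.
Qed.

Lemma alg_eq (f g : X -> k) : (forall x, P x -> f x = g x) -> alg f -> alg g.
Proof. by move=> H [t Ht]; exists t; apply: poly_upto_eq Ht. Qed.

Lemma alg_const a : alg (fun=> a).
Proof. by exists 0%N; apply: poly_upto_const. Qed.

Lemma alg_var i : alg (z i).
Proof. by exists 1%N; apply: poly_upto_var. Qed.

Lemma algD f g : alg f -> alg g -> alg (fun x => f x + g x).
Proof.
move=> [t Hf] [t' Hg]; exists (t + t')%N.
by apply: poly_uptoD; [apply: poly_upto_le Hf|apply: poly_upto_le Hg];
  rewrite ?leq_addr ?leq_addl.
Qed.

Lemma algM f g : alg f -> alg g -> alg (fun x => f x * g x).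
Proof. by move=> [t Hf] [t' Hg]; exists (t + t')%N; apply: poly_uptoM. Qed.

Lemma algN f : alg f -> alg (fun x => - f x).
Proof.
move=> Hf; apply: alg_eq (algM (alg_const (-1)) Hf) => x _.
by rewrite mulN1r.
Qed.

Lemma algB f g : alg f -> alg g -> alg (fun x => f x - g x).
Proof. by move=> Hf Hg; apply: algD => //; apply: algN. Qed.

Lemma algX n f : alg f -> alg (fun x => f x ^+ n).
Proof. by move=> [t Hf]; exists (n * t)%N; apply: poly_uptoX. Qed.

Lemma alg_sum_seq (J : Type) (s : seq J) (Q : pred J) (f : J -> X -> k) :
  (forall j, Q j -> alg (f j)) -> alg (fun x => \sum_(j <- s | Q j) f j x).
Proof.
move=> Hf; elim: s => [|j s IH].
  by apply: alg_eq (alg_const 0) => x _; rewrite big_nil.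
case Qj: (Q j).
  by apply: alg_eq (algD (Hf j Qj) IH) => x _; rewrite big_cons Qj.
by apply: alg_eq IH => x _; rewrite big_cons Qj.
Qed.

Lemma alg_prod_seq (J : Type) (s : seq J) (Q : pred J) (f : J -> X -> k) :
  (forall j, Q j -> alg (f j)) -> alg (fun x => \prod_(j <- s | Q j) f j x).
Proof.
move=> Hf; elim: s => [|j s IH].
  by apply: alg_eq (alg_const 1) => x _; rewrite big_nil.
case Qj: (Q j).
  by apply: alg_eq (algM (Hf j Qj) IH) => x _; rewrite big_cons Qj.
by apply: alg_eq IH => x _; rewrite big_cons Qj.
Qed.

Lemma growth_poly_upto D : growth_le P z D ->
  exists C : nat, forall t : nat, exists (T : finType) (g : T -> X -> k),
    (#|T| <= C * t.+1 ^ D)%N /\ forall f, pu t f -> in_span P g f.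
Proof.
move=> [C H]; exists C => t; have [T [g [cT Hg]]] := H t.
exists T, g; split=> // f [s s1 s2].
elim: s f s1 s2 => [|ce s IH] f s1 s2.
  exists (fun=> 0) => x px; rewrite s2 // big_nil big1 // => i _.
  by rewrite mul0r.
have [c Hc] := Hg ce.2 (s1 ce (mem_head _ _)).
have [|//|c' Hc'] := IH (fun x => \sum_(ce <- s) ce.1 * monof z ce.2 x).
  by move=> ce' Hce'; apply: s1; rewrite inE Hce' orbT.
exists (fun i => ce.1 * c i + c' i) => x px.
rewrite s2 // big_cons Hc // Hc' // mulr_sumr -big_split /=.
by apply: eq_bigr => i _; rewrite mulrDl mulrA.
Qed.

Lemma growth_le_free : growth_le P z #|I|.
Proof.
exists 1%N => t; exists {ffun I -> 'I_t.+1}.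
exists (fun (e : {ffun I -> 'I_t.+1}) x => \prod_i z i x ^+ e i); split.
  by rewrite card_ffun card_ord mul1n.
move=> e He; exists (fun e' => (e' == [ffun i => inord (e i)])%:R) => x px.
rewrite (bigD1 [ffun i => inord (e i)]) //= eqxx mul1r [X in _ + X]big1 ?addr0.
  by apply: eq_bigr => i _; rewrite ffunE inordK // ltnS.
by move=> e' /negPf ->; rewrite mul0r.
Qed.

Lemma growth_le_weak D D' : (D <= D')%N -> growth_le P z D -> growth_le P z D'.
Proof.
move=> DD' [C H]; exists C => t; have [T [g [cT Hg]]] := H t.
exists T, g; split=> //; apply: leq_trans cT _.
by rewrite leq_mul2l leq_pexp2l ?orbT.
Qed.

End Fixed.

Lemma growth_le_sub (I : finType) X X' (h : X' -> X) (P : X -> Prop)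
    (P' : X' -> Prop) (z : I -> X -> k) D :
  (forall x, P' x -> P (h x)) -> growth_le P z D ->
  growth_le P' (fun i x => z i (h x)) D.
Proof.
move=> HP [C H]; exists C => t; have [T [g [cT Hg]]] := H t.
exists T, (fun i x => g i (h x)); split=> // e /Hg [c Hc].
by exists c => x px; rewrite -Hc //; apply: HP.
Qed.

Lemma alg_sub (I : finType) X X' (h : X' -> X) (P : X -> Prop)
    (P' : X' -> Prop) (z : I -> X -> k) f :
  (forall x, P' x -> P (h x)) -> in_alg_gen P z f ->
  in_alg_gen P' (fun i x => z i (h x)) (fun x => f (h x)).
Proof.
move=> HP [t [s s1 s2]]; exists t; exists s => // x px.
by rewrite s2 //; apply: HP.
Qed.

(** Clearing denominators: a monomial of exponents at most [t] in [y], times the fixed power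
    [dl ^+ (#|J| * t)], is a polynomial in [z] of degree linear in [t]. Dividing the spanning
    functions by that power does not change their number. *)
Lemma growth_le_rat (I J : finType) X (P : X -> Prop) (z : I -> X -> k)
    (y : J -> X -> k) (dl : X -> k) D :
  in_alg_gen P z dl -> (forall x, P x -> dl x != 0) ->
  (forall j, in_alg_gen P z (fun x => y j x * dl x)) ->
  growth_le P z D -> growth_le P y D.
Proof.
move=> [t0 Hdl] dl0 Hy Hg.
have [T0 HT0] : exists T0, poly_upto P z T0 dl /\
    forall j, poly_upto P z T0 (fun x => y j x * dl x).
  have [Tj HTj] := dep_choice Hy.
  exists (t0 + \sum_j Tj j)%N; split; first by apply: poly_upto_le Hdl; rewrite leq_addr.
  move=> j; apply: poly_upto_le (HTj j).
  by rewrite (bigD1 j) // addnCA leq_addr.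
have [C HC] := growth_poly_upto Hg.
exists (C * (#|J| * T0).+1 ^ D)%N => t.
have [T [g [cT Hs]]] := HC (#|J| * (t * T0))%N.
exists T, (fun i x => g i x / dl x ^+ (#|J| * t)); split.
  apply: leq_trans cT _; rewrite -mulnA leq_mul2l -expnMn; apply/orP; right.
  have H : ((#|J| * (t * T0)).+1 <= (#|J| * T0).+1 * t.+1)%N by nia.
  by case: (D) => [|D']; rewrite // leq_exp2r.
move=> e He.
have [] := Hs (fun x => \prod_j ((y j x * dl x) ^+ e j * dl x ^+ (t - e j))).
  apply: poly_upto_prod => j; rewrite -[X in (X * T0)%N](subnKC (He j)) mulnDl.
  by apply: poly_uptoM; apply: poly_uptoX; apply HT0.
move=> c Hc; exists c => x px.
under eq_bigr do rewrite mulrA.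
rewrite -mulr_suml -Hc //.
have -> : \prod_j ((y j x * dl x) ^+ e j * dl x ^+ (t - e j)) =
    monof y e x * dl x ^+ (#|J| * t).
  rewrite mulnC exprM -prodr_const -big_split /=; apply: eq_bigr => j _.
  by rewrite exprMn -mulrA -exprD subnKC.
by rewrite mulfK // expf_neq0 // dl0.
Qed.

Lemma growth_le_alg (I J : finType) X (P : X -> Prop) (z : I -> X -> k)
    (y : J -> X -> k) D :
  (forall j, in_alg_gen P z (y j)) ->
  growth_le P z D -> growth_le P y D.
Proof.
move=> Hy; apply: (@growth_le_rat _ _ _ _ _ _ (fun=> 1)).
- exact: alg_const.
- by move=> x _; apply: oner_neq0.
- by move=> j; apply: alg_eq (Hy j) => x _; rewrite mulr1.
Qed.

(** The spanning functions in [growth_le] are arbitrary. They may be multiplied by the indicator of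
    the piece chosen for each point, so the spans over the finitely many pieces simply add up. *)
Lemma growth_le_cover (I F : finType) X (P : X -> Prop) (z : I -> X -> k) D
    (Q : F -> X -> Prop) :
  (forall x, P x -> exists f, Q f x) ->
  (forall f, growth_le (Q f) z D) -> growth_le P z D.
Proof.
move=> cov Hg.
have [Cf HCf] := dep_choice Hg.
exists (\sum_f Cf f)%N => t.
have [Tf HTf] := dep_choice (fun f => HCf f t).
have [gf Hgf] := dep_choice HTf.
have [a Ha] : exists a : X -> option F, forall x, P x -> exists2 f, a x = Some f & Q f x.
  have ex x : exists o : option F, P x -> exists2 f, o = Some f & Q f x.
    case: (classic (P x)) => px; last by exists None.
    by have [f Qf] := cov x px; exists (Some f) => _; exists f.
  exact: dep_choice ex.
exists {f : F & Tf f}, (fun i x => (a x == Some (tag i))%:R * gf (tag i) (tagged i) x).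
split.
  rewrite card_tagged sumnE big_map big_enum big_distrl /=.
  by apply: leq_sum => f _; case: (Hgf f).
move=> e He.
have Hc f : exists c : Tf f -> k, forall x, Q f x ->
    monof z e x = \sum_i c i * gf f i x by have [_ H] := Hgf f; apply: H.
have [cf Hcf] := dep_choice Hc.
exists (fun i => cf (tag i) (tagged i)) => x px.
have [f af Qf] := Ha x px.
rewrite (Hcf f x Qf).
have -> : \sum_(i : {f : F & Tf f}) cf (tag i) (tagged i) *
      ((a x == Some (tag i))%:R * gf (tag i) (tagged i) x) =
   \sum_f \sum_(i : Tf f) cf f i * ((a x == Some f)%:R * gf f i x).
  by rewrite sig_big_dep.
rewrite (bigD1 f) //= [X in _ + X]big1 ?addr0 => [|f' ff'].
  by apply: eq_bigr => i _; rewrite af eqxx mul1r.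
rewrite big1 // => i _; rewrite af.
by case: eqP => [[E]|_]; rewrite ?mul0r ?mulr0 //; rewrite E eqxx in ff'.
Qed.

Lemma growth_le_pair (I J : finType) X (P : X -> Prop) (z : I -> X -> k)
    (y : J -> X -> k) D D' :
  growth_le P z D -> growth_le P y D' ->
  growth_le P (fun (i : I + J) x => match i with inl i => z i x | inr j => y j x end)
    (D + D').
Proof.
move=> [C H] [C' H']; exists (C * C')%N => t.
have [T [g [cT Hg]]] := H t; have [T' [g' [cT' Hg']]] := H' t.
exists (T * T')%type, (fun i x => g i.1 x * g' i.2 x); split.
  by rewrite card_prod expnD mulnACA leq_mul.
move=> e He.
have [c Hc] := Hg [ffun i => e (inl i)] (fun i => ltac:(rewrite ffunE; exact: He)).
have [c' Hc'] := Hg' [ffun i => e (inr i)] (fun i => ltac:(rewrite ffunE; exact: He)).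
exists (fun i => c i.1 * c' i.2) => x px.
have -> : monof (fun i x => match i with inl i => z i x | inr j => y j x end) e x =
   monof z [ffun i => e (inl i)] x * monof y [ffun i => e (inr i)] x.
  rewrite /monof big_sumType; congr (_ * _); apply: eq_bigr => i _; by rewrite ffunE.
rewrite Hc // Hc' // big_distrlr pair_big /=.
by apply: eq_bigr => i _; rewrite mulrACA.
Qed.

End Growth.

(** * Matrices with entries in an algebra of functions, and Cramer's rule *)

Section MatrixGrowth.

Context (k : fieldType).

Section Fixed.

Context (I : finType) (X : Type) (P : X -> Prop) (z : I -> X -> k).

Definition mx_alg m n (A : X -> 'M[k]_(m, n)) : Prop :=
  forall i j, in_alg_gen P z (fun x => A x i j).

Lemma mx_alg_eq m n (A B : X -> 'M[k]_(m, n)) :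
  (forall x, P x -> A x = B x) -> mx_alg A -> mx_alg B.
Proof. by move=> AB HA i j; apply: alg_eq (HA i j) => x /AB ->. Qed.

Lemma mx_alg_const m n (A : 'M[k]_(m, n)) : mx_alg (fun=> A).
Proof. by move=> i j; apply: alg_const. Qed.

Lemma mx_algD m n (A B : X -> 'M[k]_(m, n)) :
  mx_alg A -> mx_alg B -> mx_alg (fun x => A x + B x).
Proof.
by move=> HA HB i j; apply: alg_eq (algD (HA i j) (HB i j)) => x _; rewrite mxE.
Qed.

Lemma mx_algN m n (A : X -> 'M[k]_(m, n)) : mx_alg A -> mx_alg (fun x => - A x).
Proof. by move=> HA i j; apply: alg_eq (algN (HA i j)) => x _; rewrite mxE. Qed.

Lemma mx_algB m n (A B : X -> 'M[k]_(m, n)) :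
  mx_alg A -> mx_alg B -> mx_alg (fun x => A x - B x).
Proof. by move=> HA HB; apply: mx_algD => //; apply: mx_algN. Qed.

Lemma mx_algZ m n (a : X -> k) (A : X -> 'M[k]_(m, n)) :
  in_alg_gen P z a -> mx_alg A -> mx_alg (fun x => a x *: A x).
Proof. by move=> Ha HA i j; apply: alg_eq (algM Ha (HA i j)) => x _; rewrite mxE. Qed.

Lemma mx_algM m n p (A : X -> 'M[k]_(m, n)) (B : X -> 'M[k]_(n, p)) :
  mx_alg A -> mx_alg B -> mx_alg (fun x => A x *m B x).
Proof.
move=> HA HB i j.
apply: (@alg_eq _ _ _ _ _ (fun x => \sum_l A x i l * B x l j)).
  by move=> x _; rewrite mxE.
by apply: alg_sum_seq => l _; apply: algM.
Qed.

Lemma alg_det n (A : X -> 'M[k]_n) :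
  mx_alg A -> in_alg_gen P z (fun x => \det (A x)).
Proof.
move=> HA; apply: alg_sum_seq => s _.
by apply: algM; [apply: alg_const | apply: alg_prod_seq].
Qed.

Lemma mx_alg_adj n (A : X -> 'M[k]_n) : mx_alg A -> mx_alg (fun x => \adj (A x)).
Proof.
move=> HA i j; apply: (@alg_eq _ _ _ _ _ (fun x => cofactor (A x) j i)).
  by move=> x _; rewrite mxE.
rewrite /cofactor; apply: algM; first exact: alg_const.
apply: alg_det => a b; apply: alg_eq (HA (lift j a) (lift i b)) => x _.
by rewrite !mxE.
Qed.

End Fixed.

(* A surjective linear system whose coefficients are functions of z cuts the
   number of free coordinates by its number of equations: Cramer's rule on an
   invertible maximal minor. *)
Lemma growth_le_fiber (I J K : finType) X (P : X -> Prop) (z : I -> X -> k)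
    (y : J -> X -> k) (N : K -> J -> X -> k) (b : K -> X -> k) D D' :
  growth_le P z D ->
  (forall c j, in_alg_gen P z (N c j)) -> (forall c, in_alg_gen P z (b c)) ->
  (forall x, P x -> forall c, \sum_j N c j x * y j x = b c x) ->
  (forall x, P x -> forall v : K -> k, exists u : J -> k,
     forall c, \sum_j N c j x * u j = v c) ->
  (D + #|J| <= D' + #|K|)%N ->
  growth_le P
    (fun (i : I + J) x => match i with inl i => z i x | inr j => y j x end) D'.
Proof.
move=> Hz HN Hb Hy Hsurj leD.
pose Nf (f : {ffun K -> J}) x : 'M[k]_#|K| :=
  \matrix_(a, c) N (enum_val a) (f (enum_val c)) x.
pose Q (f : {ffun K -> J}) x := [/\ P x, injective f & \det (Nf f x) != 0].
apply: (@growth_le_cover _ _ {ffun K -> J} _ _ _ _ Q).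
  move=> x px.
  pose A : 'M[k]_(#|J|, #|K|) := \matrix_(j, c) N (enum_val c) (enum_val j) x.
  have Afull : row_full A.
    apply/row_fullP.
    have /(@dep_choice _ (fun _ => J -> k) (fun (c : 'I_#|K|) u => forall c',
       \sum_j N c' j x * u j = (c' == enum_val c)%:R)) [u Hu] :
       forall c : 'I_#|K|, exists u : J -> k, forall c',
       \sum_j N c' j x * u j = (c' == enum_val c)%:R.
      by move=> c; apply: (Hsurj x px (fun c' => (c' == enum_val c)%:R)).
    exists (\matrix_(c, j) u c (enum_val j)); apply/matrixP => c c'.
    rewrite !mxE eq_sym.
    transitivity (\sum_j N (enum_val c') j x * u c j); last first.
      by rewrite Hu (inj_eq enum_val_inj).
    rewrite [RHS](reindex_onto enum_val enum_rank) /=; last by move=> j _; rewrite enum_rankK.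
    apply: eq_big => [j|j _]; first by rewrite enum_valK eqxx.
    by rewrite !mxE mulrC.
  have [g ginj gunit] : exists2 g : 'I_#|K| -> 'I_#|J|, injective g &
      rowsub g A \in unitmx.
    exists (fullrankfun Afull); first exact: fullrankfun_inj.
    exact: fullrowsub_unit.
  exists [ffun c => enum_val (g (enum_rank c))]; split=> //.
    move=> c c'; rewrite !ffunE => /enum_val_inj gE.
    by apply: enum_rank_inj; apply: ginj.
  have := gunit; rewrite unitmxE unitfE -det_tr.
  congr (_ != 0); congr (\det _); apply/matrixP => a c.
  by rewrite !mxE ffunE enum_valK.
move=> f.
case: (classic (exists x, Q f x)) => [[x0 [_ injf _]]|noQ]; last first.
  exists 0%N => t; exists ('I_0), (fun _ _ => 0); split; first by rewrite card_ord.
  by move=> e _; exists (fun=> 0) => x Qx; case: noQ; exists x.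
pose J' := {j : J | j \notin codom f}.
have cardJ' : (#|{: J'}| + #|K| = #|J|)%N.
  rewrite card_sig -(card_codom injf) addnC -(cardC (mem (codom f))).
  by [].
pose z' := fun (i : I + J') x => match i with inl i => z i x | inr j => y (val j) x end.
have Hz' : growth_le (Q f) z' (D + #|{: J'}|).
  apply: growth_le_pair; last exact: growth_le_free.
  by apply: (@growth_le_sub _ _ _ _ id P) Hz => x [].
have subalg g : in_alg_gen P z g -> in_alg_gen (Q f) z' g.
  move=> [t [s s1 s2]].
  have H i : in_alg_gen (Q f) z' (z i) by exact: (alg_var _ z' (inl i)).
  apply: (@alg_eq _ _ _ _ _ (fun x => \sum_(ce <- s) ce.1 * monof z ce.2 x)).
    by move=> x [px _ _]; rewrite s2.
  apply: alg_sum_seq => ce _; apply: algM; first exact: alg_const.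
  by apply: alg_prod_seq => i _; apply: algX.
apply: (@growth_le_weak _ _ _ _ _ (D + #|{: J'}|)); first lia.
have Halg : mx_alg (Q f) z' (Nf f).
  move=> a c; apply: alg_eq (subalg _ (HN (enum_val a) (f (enum_val c)))) => x _.
  by rewrite mxE.
apply: growth_le_rat Hz'.
- exact: (alg_det Halg).
- by move=> x [].
case=> [i|j].
  by apply: algM; [exact: (alg_var _ z' (inl i)) | exact: alg_det].
case: (boolP (j \in codom f)) => [/codomP [c ->]|jf]; last first.
  by apply: algM; [exact: (alg_var _ z' (inr (exist _ j jf))) | exact: alg_det].
(* The columns outside the minor are free coordinates and go to the right-hand side; the adjugate
   then expresses the determinant times each remaining unknown. *)
pose r x : 'cV[k]_#|K| := \col_a (b (enum_val a) x -
   \sum_(j : J') N (enum_val a) (val j) x * y (val j) x).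
have Hr : mx_alg (Q f) z' r.
  move=> a o; apply: (@alg_eq _ _ _ _ _ (fun x => b (enum_val a) x -
   \sum_(j : J') N (enum_val a) (val j) x * y (val j) x)).
    by move=> x _; rewrite mxE.
  apply: algB; first exact: subalg.
  apply: alg_sum_seq => j' _; apply: algM; first exact: subalg.
  exact: (alg_var _ z' (inr j')).
apply: alg_eq (mx_algM (mx_alg_adj Halg) Hr (enum_rank c) 0) => x [px _ _].
pose u : 'cV[k]_#|K| := \col_a y (f (enum_val a)) x.
have E : Nf f x *m u = r x.
  apply/matrixP => a o; rewrite !mxE -(Hy x px (enum_val a)).
  rewrite (bigID (mem (codom f))) /=.
  rewrite [X in _ = _ + X - _](_ : _ = \sum_(j : J') N (enum_val a) (val j) x * y (val j) x).
    rewrite addrK [RHS](reindex_onto (f \o enum_val)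
      (fun j => if [pick c | f c == j] is Some c then enum_rank c else a)) /=; last first.
      move=> jj /codomP [c' ->]; case: pickP => [c'' /eqP|/(_ c')]; last by rewrite eqxx.
      by rewrite enum_rankK.
    apply: eq_big => [c'|c' _]; last by rewrite !mxE.
    rewrite codom_f; case: pickP => [c'' /eqP /injf ->|/(_ (enum_val c'))].
      by rewrite enum_valK eqxx.
    by rewrite eqxx.
  by rewrite big_sub.
rewrite -[r x]E mulmxA mul_adj_mx mul_scalar_mx !mxE enum_rankK.
by rewrite mulrC.
Qed.

End MatrixGrowth.

(** * Algebraic independence bounded by growth *)

Section AlgebraicIndependence.

Context (k : fieldType).

Definition alg_indep (X : Type) (P : X -> Prop) (r : nat) (f : 'I_r -> X -> k) : Prop :=
  forall t (c : {ffun 'I_r -> 'I_t.+1} -> k),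
    (forall x, P x -> \sum_e c e * \prod_i f i x ^+ e i = 0) -> forall e, c e = 0.

Lemma span_card_le (E T : finType) X (P : X -> Prop) (h : E -> X -> k) (g : T -> X -> k) :
  (forall c : E -> k, (forall x, P x -> \sum_e c e * h e x = 0) -> forall e, c e = 0) ->
  (forall e, in_span P g (h e)) -> (#|E| <= #|T|)%N.
Proof.
move=> ind /dep_choice [a Ha].
pose A : 'M[k]_(#|E|, #|T|) := \matrix_(i, j) a (enum_val i) (enum_val j).
rewrite leqNgt; apply/negP => lt.
have : kermx A != 0.
  rewrite -mxrank_eq0 mxrank_ker -lt0n subn_gt0.
  exact: leq_ltn_trans (rank_leq_col _) lt.
case/rowV0Pn => v /sub_kermxP vA /negP[]; apply/eqP/rowP => i; rewrite mxE.
rewrite -[i]enum_valK; apply: (ind (fun e => v 0 (enum_rank e))) => x px.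
under eq_bigr => e _ do rewrite (Ha e x px) mulr_sumr.
rewrite exchange_big big1 //= => j _.
have /matrixP/(_ 0 (enum_rank j)) := vA.
rewrite !mxE => E0; transitivity ((\sum_i v 0 i * A i (enum_rank j)) * g j x); last first.
  by rewrite E0 mul0r.
rewrite mulr_suml.
rewrite [LHS](reindex_onto enum_val enum_rank) /=; last by move=> e _; rewrite enum_rankK.
apply: eq_big => [e|e _]; first by rewrite enum_valK eqxx.
by rewrite mxE enum_valK enum_rankK mulrA.
Qed.

(** Independence provides [t.+1 ^ r] linearly independent monomials inside a span of size O(t^D). *)
Lemma alg_indep_growth (I : finType) X (P : X -> Prop) (z : I -> X -> k) D r
    (f : 'I_r -> X -> k) :
  alg_indep P f -> (forall i, in_alg_gen P z (f i)) -> growth_le P z D ->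
  (r <= D)%N.
Proof.
move=> ind /dep_choice [Tf HTf] /growth_poly_upto [C HC].
pose T0 := (\sum_i Tf i)%N.
have Hf i : poly_upto P z T0 (f i).
  by apply: poly_upto_le (HTf i); rewrite /T0 (bigD1 i) // leq_addr.
have main t : (t.+1 ^ r <= C * (r * T0).+1 ^ D * t.+1 ^ D)%N.
  have [T [g [cT Hg]]] := HC (r * (t * T0))%N.
  have : (#|{ffun 'I_r -> 'I_t.+1}| <= #|T|)%N.
    apply: (@span_card_le {ffun 'I_r -> 'I_t.+1} T X P
      (fun (e : {ffun 'I_r -> 'I_t.+1}) x => \prod_i f i x ^+ e i) g).
      exact: ind.
    move=> e; apply: Hg; rewrite -[X in poly_upto _ _ (X * _)]card_ord.
    apply: poly_upto_prod => i; apply: poly_upto_le (poly_uptoX (e i) (Hf i)).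
    by rewrite leq_mul2r -ltnS ltn_ord orbT.
  rewrite card_ffun !card_ord => /leq_trans; apply; apply: leq_trans cT _.
  rewrite -mulnA leq_mul2l -expnMn; apply/orP; right.
  have H : ((r * (t * T0)).+1 <= (r * T0).+1 * t.+1)%N by nia.
  by case: (D) => [|D']; rewrite // leq_exp2r.
rewrite leqNgt; apply/negP => lt.
(* Taking for [t] the constant [B] itself gives B (B+1)^D < (B+1)^(D+1), against the bound just
   proved. *)
have := main (C * (r * T0).+1 ^ D)%N; set B := (C * _)%N.
apply/negP; rewrite -ltnNge.
have B1 : (B * B.+1 ^ D < B.+1 ^ D.+1)%N by rewrite expnS ltn_pmul2r ?expn_gt0.
by apply: leq_trans B1 _; rewrite leq_pexp2l.
Qed.

End AlgebraicIndependence.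

Lemma digits_inj n B (e e' : 'I_n -> nat) :
  (forall i, e i < B)%N -> (forall i, e' i < B)%N ->
  (\sum_i e i * B ^ i = \sum_i e' i * B ^ i)%N -> e =1 e'.
Proof.
elim: n e e' => [|n IH] e e' He He' E; first by case.
have B0 : (0 < B)%N by apply: leq_ltn_trans (He ord0).
have S (u : 'I_n.+1 -> nat) : (\sum_i u i * B ^ i =
   u ord0 + (\sum_i u (lift ord0 i) * B ^ i) * B)%N.
  rewrite big_ord_recl muln1; congr (_ + _)%N; rewrite big_distrl.
  by apply: eq_bigr => i _; rewrite expnSr mulnA.
rewrite !S in E.
have E0 : e ord0 = e' ord0.
  have := congr1 (modn^~ B) E; rewrite !(addnC _ (_ * B)%N) !modnMDl.
  by rewrite !modn_small.
have E1 : (\sum_i e (lift ord0 i) * B ^ i = \sum_i e' (lift ord0 i) * B ^ i)%N.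
  move: E; rewrite E0 => /addnI /eqP; rewrite eqn_pmul2r // => /eqP; exact.
move=> i; case: (unliftP ord0 i) => [j|] -> //.
exact: (IH (fun j => e (lift ord0 j)) (fun j => e' (lift ord0 j))).
Qed.

(** * Non-vanishing of polynomials in characteristic zero *)

Section InfiniteField.

Context (k : fieldType) (hk : [pchar k] =i pred0).

Lemma nat_char0_inj : injective (fun n : nat => n%:R : k).
Proof.
have H m n : (m <= n)%N -> m%:R = n%:R :> k -> m = n.
  move=> mn E; have : (n - m)%:R == 0 :> k by rewrite natrB // E subrr.
  rewrite ((pcharf0P _).1 hk) => /eqP H; apply/eqP.
  by lia.
move=> m n E; case: (leqP m n) => [mn|/ltnW nm]; first exact: H.
by apply/esym/H.
Qed.

Lemma poly_nonroot (p : {poly k}) : p != 0 -> exists x, p.[x] != 0.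
Proof.
move=> p0; apply: NNPP => H.
have : (size p <= size [seq n%:R : k | n <- iota 0 (size p)])%N by rewrite size_map size_iota.
rewrite leqNgt (max_poly_roots p0) //.
  apply/allP => x _; apply/negP => /negP nr; apply: H; exists x.
  by [].
by rewrite map_inj_uniq ?iota_uniq //; apply: nat_char0_inj.
Qed.

(** Kronecker substitution: [B] exceeds every exponent, so sending the i-th variable to
    [x ^+ (B ^ i)] keeps distinct monomials distinct, by uniqueness of digits in base [B]. *)
Lemma mpoly_nonroot n (p : {mpoly k[n]}) : p != 0 -> exists x, p.@[x] != 0.
Proof.
move=> p0; pose B := msize p.
pose N (m : 'X_{1..n}) := (\sum_i m i * B ^ i)%N.
pose u : {poly k} := \sum_(m <- msupp p) p@_m *: 'X^(N m).
have Hu x : u.[x] = p.@[fun i => x ^+ (B ^ i)].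
  rewrite horner_sum mevalE; apply: eq_bigr => m _.
  rewrite hornerZ hornerXn /N; congr (_ * _).
  rewrite (big_morph (fun e => x ^+ e) (exprD x) (expr0 x)).
  by apply: eq_bigr => i _; rewrite mulnC exprM.
have u0 : u != 0.
  have m0 := mlead_supp p0; apply/eqP => E.
  have := congr1 (fun q : {poly k} => q`_(N (mlead p))) E; rewrite coef_sum coef0.
  rewrite (bigD1_seq (mlead p)) //= coefZ coefXn eqxx mulr1.
  rewrite [X in _ + X]big1_seq ?addr0.
    by apply/eqP; rewrite mleadc_eq0.
  move=> m /andP [mp ms]; rewrite coefZ coefXn; case: eqP => [EN|_]; last by rewrite mulr0.
  have bd (m' : 'X_{1..n}) i : m' \in msupp p -> (m' i < B)%N.
    by move=> /msize_mdeg_lt; apply: leq_ltn_trans; rewrite mdegE (bigD1 i) // leq_addr.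
  case/eqP: mp; apply/mnmP; apply: (@digits_inj _ B) => [i|i|]; last exact: esym EN.
    exact: bd.
  exact: bd.
by have [x] := poly_nonroot u0; rewrite Hu; exists (fun i => x ^+ (B ^ i)).
Qed.

End InfiniteField.

(** * Noetherian property of affine space *)

(** Each new index is one at which [u] attains its minimum over all indices after the current
    one. *)
Lemma monotone_subseq (u : nat -> nat) :
  exists f : nat -> nat, (forall i, f i < f i.+1)%N /\ forall i, (u (f i) <= u (f i.+1))%N.
Proof.
have nextP m : exists j, (m < j)%N /\ forall j', (m < j')%N -> (u j <= u j')%N.
  have [v] : exists v, exists j, (m < j)%N /\ u j = v by exists (u m.+1), m.+1.
  elim/ltn_ind: v => v IH [j [mj uj]].
  case: (classic (exists j', (m < j')%N /\ (u j' < u j)%N)) => [[j' [mj' lt]]|no].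
    by apply: (IH (u j')); [rewrite -uj | exists j'].
  exists j; split=> // j' mj'; rewrite leqNgt; apply/negP => lt.
  by apply: no; exists j'.
have [nx Hnx] := dep_choice nextP.
exists (fun i => iter i nx (nx 0%N)); split => i /=; have [H1 H2] := Hnx (iter i nx (nx 0%N)).
  exact: H1.
case: i H1 H2 => [|i] H1 H2 /=.
  by have [_ H] := Hnx 0%N; apply: H; apply: leq_trans H1.
have [H0 H] := Hnx (iter i nx (nx 0%N)); apply: H; exact: ltn_trans H0 H1.
Qed.

Lemma dickson n (s : nat -> 'X_{1..n}) : exists i j, (i < j)%N /\ (s i <= s j)%MM.
Proof.
have H l : (l <= n)%N -> exists f : nat -> nat, (forall i, f i < f i.+1)%N /\
    forall (c : 'I_n) i, (c < l)%N -> (s (f i) c <= s (f i.+1) c)%N.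
  elim: l => [_|l IH ln]; first by exists id.
  have [f [f1 f2]] := IH (ltnW ln).
  have [g [g1 g2]] := monotone_subseq (fun i => s (f i) (Ordinal ln)).
  have fmono a b : (a < b)%N -> (f a < f b)%N.
    elim: b => // b IHb; rewrite ltnS leq_eqVlt => /orP [/eqP ->|/IHb H]; first exact: f1.
    exact: ltn_trans H (f1 b).
  have fc (c : 'I_n) a b : (c < l)%N -> (a <= b)%N -> (s (f a) c <= s (f b) c)%N.
    move=> cl ab; rewrite -(subnK ab); elim: (b - a)%N => [|d IHd] //.
    by rewrite addSn; apply: leq_trans IHd (f2 c _ cl).
  exists (f \o g); split=> [i|c i] /=; first exact: fmono.
  rewrite ltnS leq_eqVlt => /orP [/eqP cl|cl]; last by apply: fc => //; apply: ltnW.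
  by have -> : c = Ordinal ln by exact: val_inj.
have [f [f1 f2]] := H n (leqnn n).
by exists (f 0%N), (f 1%N); split=> //; apply/mnm_lepP => c; apply: f2.
Qed.

Section Noether.

Context (k : fieldType) (n : nat).

Notation poly := {mpoly k[n]}.
Notation pt := ('I_n -> k).

Definition is_ideal (I : poly -> Prop) : Prop :=
  (forall f g, I f -> I g -> I (f + g)) /\ (forall f g, I g -> I (f * g)).

Definition ideal_gen (s : seq poly) (f : poly) : Prop :=
  exists u : nat -> poly, f = \sum_(i < size s) u i * s`_i.

Lemma ideal_gen_ideal s : is_ideal (ideal_gen s).
Proof.
split=> [f g [u ->] [v ->]|f g [u ->]].
  exists (fun i => u i + v i); rewrite -big_split /=.
  by apply: eq_bigr => i _; rewrite mulrDl.
by exists (fun i => f * u i); rewrite mulr_sumr; apply: eq_bigr => i _; rewrite mulrA.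
Qed.

Lemma ideal_gen0 s : ideal_gen s 0.
Proof. by exists (fun=> 0); rewrite big1 // => i _; rewrite mul0r. Qed.

Lemma ideal_gen_mem (s : seq poly) f : f \in s -> ideal_gen s f.
Proof.
move=> fs; exists (fun i => (i == index f s)%:R).
have lt : (index f s < size s)%N by rewrite index_mem.
rewrite (bigD1 (Ordinal lt)) //= eqxx mul1r nth_index // big1 ?addr0 // => i.
by rewrite -val_eqE => /negPf ->; rewrite mul0r.
Qed.

Lemma ideal_gen_sub (s : seq poly) (I : poly -> Prop) f :
  is_ideal I -> I 0 -> (forall g, g \in s -> I g) -> ideal_gen s f -> I f.
Proof.
move=> [ID IM] I0 sI [u ->]; apply: big_ind => // i _.
by apply: IM; apply: sI; apply: mem_nth.
Qed.

(** Otherwise one can add forever an element of [I] outside the ideal generated so far, with least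
    possible leading monomial. By Dickson's lemma one of these leading monomials divides a later
    one; subtracting a multiple of the earlier element from the later one lowers its leading
    monomial, against minimality. *)
Lemma hilbert_basis (I : poly -> Prop) : is_ideal I -> I 0 ->
  exists s : seq poly, (forall f, f \in s -> I f) /\ (forall f, I f -> ideal_gen s f).
Proof.
move=> idI I0; apply: NNPP => no.
have nextP (s : seq poly) : exists g, (forall f, f \in s -> I f) ->
    [/\ I g, ~ ideal_gen s g & forall f, I f -> ~ ideal_gen s f -> (mlead g <= mlead f)%O].
  case: (classic (forall f, f \in s -> I f)) => [sI|]; last by exists 0.
  have [f [If Hf]] : exists f, I f /\ ~ ideal_gen s f.
    apply: NNPP => no'; apply: no; exists s; split=> // f If.
    by apply: NNPP => nf; apply: no'; exists f.
  have [m fm] : exists m, mlead f = m by exists (mlead f).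
  elim: (ltom_wf m) f fm If Hf => {}m _ IH f fm If Hf.
  case: (classic (exists f', [/\ I f', ~ ideal_gen s f' & (mlead f' < mlead f)%O])).
    by move=> [f' [If' Hf' lt]]; apply: (IH (mlead f') _ f'); rewrite -?fm.
  move=> no'; exists f => _; split=> // f' If' Hf'; rewrite leNgt.
  by apply/negP => lt; apply: no'; exists f'.
have [nx Hnx] := dep_choice nextP.
pose s i := iter i (fun t => rcons t (nx t)) [::].
have sI i : forall f, f \in s i -> I f.
  elim: i => [|i IH] f //=; rewrite mem_rcons => /orP [/eqP ->|/IH //].
  by case: (Hnx (s i) IH).
have smem i j : (i < j)%N -> nx (s i) \in s j.
  elim: j => // j IH; rewrite ltnS leq_eqVlt => /orP [/eqP ->|/IH H] /=.
    by rewrite mem_rcons mem_head.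
  by rewrite mem_rcons inE H orbT.
have [i [j [ij le]]] := dickson (fun i => mlead (nx (s i))).
have [Ii ni _] := Hnx _ (sI i); have [Ij nj minj] := Hnx _ (sI j).
set gi := nx (s i) in le Ii ni; set gj := nx (s j) in le Ij nj minj.
have gi0 : gi != 0 by apply/eqP => E; apply: ni; rewrite E; apply: ideal_gen0.
have gj0 : gj != 0 by apply/eqP => E; apply: nj; rewrite E; apply: ideal_gen0.
pose h : poly := (mleadc gj / mleadc gi) *: 'X_[(mlead gj - mlead gi)%MM] * gi.
have hgen : ideal_gen (s j) h.
  by apply: (ideal_gen_ideal _).2; apply: ideal_gen_mem; apply: smem.
have Ih : I h by apply: idI.2.
have c0 : mleadc gj / mleadc gi != 0 by rewrite mulf_neq0 ?invr_eq0 // mleadc_eq0.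
have X0 : 'X_[(mlead gj - mlead gi)%MM] != 0 :> poly.
  by apply/eqP => /(congr1 (fun p => p@_(mlead gj - mlead gi)%MM)) /eqP;
    rewrite mcoeffX eqxx mcoeff0 oner_eq0.
have hl : mlead h = mlead gj.
  rewrite mleadM ?scaler_eq0 ?negb_or ?c0 // mleadZ // mleadXm.
  by rewrite submK.
have hc : h@_(mlead gj) = mleadc gj.
  have -> : h@_(mlead gj) = mleadc h by rewrite hl.
  by rewrite mleadM ?scaler_eq0 ?negb_or ?c0 // mleadcM mleadcZE mleadXm mcoeffX eqxx mulr1 divfK // mleadc_eq0.
have ID f g : I f -> I g -> I (f - g).
  by move=> If Ig; apply: idI.1 => //; rewrite -mulN1r; apply: idI.2.
have Hd : ~ ideal_gen (s j) (gj - h).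
  move=> H; apply: nj; rewrite -(subrK h gj); exact: (ideal_gen_ideal _).1.
have := minj _ (ID _ _ Ij Ih) Hd.
have d0 : gj - h != 0 by apply/eqP => E; apply: Hd; rewrite E; apply: ideal_gen0.
have le2 : (mlead (gj - h) <= mlead gj)%O.
  by apply: le_trans (mleadB_le _ _) _; rewrite hl joinxx.
move=> le3; have E : mlead (gj - h) = mlead gj.
  by apply/eqP; rewrite eq_le le2.
have : (gj - h)@_(mlead (gj - h)) != 0 by rewrite mleadc_eq0.
by rewrite E mcoeffB hc subrr eqxx.
Qed.

Definition closed_set (V : pt -> Prop) : Prop :=
  exists S : poly -> Prop, forall x, V x <-> (forall f, S f -> f.@[x] = 0).

Definition irreducible_set (V : pt -> Prop) : Prop :=
  [/\ closed_set V, exists x, V x &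
      forall V1 V2 : pt -> Prop, closed_set V1 -> closed_set V2 ->
        (forall x, V x -> V1 x \/ V2 x) ->
        (forall x, V x -> V1 x) \/ (forall x, V x -> V2 x)].

Definition vanishing (V : pt -> Prop) (f : poly) : Prop := forall x, V x -> f.@[x] = 0.

Lemma vanishing_ideal V : is_ideal (vanishing V).
Proof.
by split=> [f g Hf Hg|f g Hg] x Vx; rewrite ?mevalD ?mevalM ?Hf ?Hg ?addr0 ?mulr0.
Qed.

Lemma vanishing0 V : vanishing V 0.
Proof. by move=> x _; rewrite meval0. Qed.

Lemma closed_vanishing V x : closed_set V -> (forall f, vanishing V f -> f.@[x] = 0) -> V x.
Proof.
by move=> [S HS] H; apply/HS => f Sf; apply: H => y /HS; apply.
Qed.

Lemma closed_setI V W : closed_set V -> closed_set W -> closed_set (fun x => V x /\ W x).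
Proof.
move=> [S HS] [T HT]; exists (fun f => S f \/ T f) => x; split.
  by move=> [/HS Vx /HT Wx] f [/Vx|/Wx].
by move=> H; split; [apply/HS|apply/HT] => f Hf; apply: H; [left|right].
Qed.

Lemma closed_zeros (f : poly) : closed_set (fun x => f.@[x] = 0).
Proof.
exists (eq f) => x; split=> [fx g <-|]; exact.
Qed.

(** Noetherian induction in the form of an infinite strictly decreasing sequence of closed sets
    without decomposition. The union of their vanishing ideals is finitely generated, so the
    sequence must stop. *)
Lemma irreducible_decomposition (V : pt -> Prop) : closed_set V ->
  exists r (W : 'I_r -> pt -> Prop), (forall i, irreducible_set (W i)) /\
    forall x, V x <-> exists i, W i x.
Proof.
move=> clV; apply: NNPP => noV.
pose bad V := closed_set V /\ ~ exists r (W : 'I_r -> pt -> Prop),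
  (forall i, irreducible_set (W i)) /\ forall x, V x <-> exists i, W i x.
have nextP (U : pt -> Prop) : exists U', bad U ->
    [/\ bad U', forall x, U' x -> U x & exists x, U x /\ ~ U' x].
  case: (classic (bad U)) => [[clU noU]|]; last by exists U.
  case: (classic (exists x, U x)) => [neU|no]; last first.
    case: noU; exists 0%N, (fun _ _ => True); split=> [[] //|x].
    by split=> [Ux|[[]] //]; case: no; exists x.
  have nirr : ~ irreducible_set U.
    move=> irrU; case: noU; exists 1%N, (fun _ => U); split=> // x.
    by split=> [Ux|[_ //]]; exists ord0.
  have [V1 [V2 [c1 c2 UV n1 n2]]] : exists V1 V2 : pt -> Prop, [/\ closed_set V1,
      closed_set V2, forall x, U x -> V1 x \/ V2 x,
      ~ (forall x, U x -> V1 x) & ~ (forall x, U x -> V2 x)].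
    apply: NNPP => no; apply: nirr; split=> // V1 V2 c1 c2 UV.
    apply: NNPP => n12; apply: no; exists V1, V2; split=> // H; apply: n12; by [left|right].
  have sm V' : closed_set V' -> ~ (forall x, U x -> V' x) ->
      [/\ closed_set (fun x => U x /\ V' x), forall x, U x /\ V' x -> U x &
          exists x, U x /\ ~ (U x /\ V' x)].
    move=> c nV; split=> [|x []//|]; first exact: closed_setI.
    apply: NNPP => no; apply: nV => x Ux; apply: NNPP => nx; apply: no.
    by exists x; split=> // [[]].
  have [a1 a2 a3] := sm V1 c1 n1; have [b1 b2 b3] := sm V2 c2 n2.
  case: (classic (bad (fun x => U x /\ V1 x))) => [B1|N1].
    by exists (fun x => U x /\ V1 x).
  case: (classic (bad (fun x => U x /\ V2 x))) => [B2|N2].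
    by exists (fun x => U x /\ V2 x).
  case: noU.
  have [r1 [W1 [i1 H1]]] : exists r (W : 'I_r -> pt -> Prop),
      (forall i, irreducible_set (W i)) /\ forall x, U x /\ V1 x <-> exists i, W i x.
    by apply: NNPP => H; apply: N1.
  have [r2 [W2 [i2 H2]]] : exists r (W : 'I_r -> pt -> Prop),
      (forall i, irreducible_set (W i)) /\ forall x, U x /\ V2 x <-> exists i, W i x.
    by apply: NNPP => H; apply: N2.
  exists (r1 + r2)%N, (fun i => match split i with inl a => W1 a | inr b => W2 b end).
  split=> [i|x]; first by case: (split i).
  split=> [Ux|[i]]; last by case: (split i) => a Wa; [have [] := (H1 x).2 (ex_intro _ a Wa) |
     have [] := (H2 x).2 (ex_intro _ a Wa)].
  have [V1x|V2x] := UV x Ux.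
    have [a Wa] := (H1 x).1 (conj Ux V1x).
    by exists (lshift r2 a); rewrite (unsplitK (inl a)).
  have [b Wb] := (H2 x).1 (conj Ux V2x).
  by exists (rshift r1 b); rewrite (unsplitK (inr b)).
have [nx Hnx] := dep_choice nextP.
pose U i := iter i nx V.
have badU i : bad (U i) by elim: i => [|i IH] //=; case: (Hnx _ IH).
have sub i j : (i <= j)%N -> forall x, U j x -> U i x.
  move=> ij; rewrite -(subnK ij); elim: (j - i)%N => [|d IH] x //.
  by rewrite addSn => H; apply: IH; case: (Hnx _ (badU (d + i)%N)) => _ H' _; apply: H'.
pose I f := exists i, vanishing (U i) f.
have idI : is_ideal I.
  split=> [f g [i Hf] [j Hg]|f g [i Hg]].
    exists (maxn i j); apply: (vanishing_ideal _).1 => x /sub Ux.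
      by apply: Hf; apply: Ux; rewrite leq_maxl.
    by apply: Hg; apply: Ux; rewrite leq_maxr.
  by exists i; apply: (vanishing_ideal _).2.
have I0 : I 0 by exists 0%N; apply: vanishing0.
have [s [sI Is]] := hilbert_basis idI I0.
have [N HN] : exists N, forall f, f \in s -> vanishing (U N) f.
  elim: s sI {Is} => [|g s IH] sI; first by exists 0%N.
  have [N HN] : exists N, forall f, f \in s -> vanishing (U N) f.
    by apply: IH => f fs; apply: sI; rewrite inE fs orbT.
  have [i Hi] := sI g (mem_head _ _).
  exists (maxn N i) => f; rewrite inE => /orP [/eqP ->|fs] x /sub Ux.
    by apply: Hi; apply: Ux; rewrite leq_maxr.
  by apply: (HN f) => //; apply: Ux; rewrite leq_maxl.
have [[clU _] _ [x [Ux nUx]]] := Hnx _ (badU N); apply: nUx.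
apply: closed_vanishing => // f Hf.
have /Is : I f by exists N.+1.
by move=> /(ideal_gen_sub (vanishing_ideal (U N)) (@vanishing0 _) HN); apply.
Qed.

End Noether.

(** * Nullstellensatz *)

(* A common zero modulo a monic polynomial: multiplication by f on A[T]/(G) has
   a determinant lying in the ideal (f, G). *)
Lemma norm_in_ideal (A : comNzRingType) (f G : {poly A}) d :
  G \is monic -> size G = d.+1 -> (0 < d)%N ->
  exists (r : A) (u v : {poly A}), r%:P = u * f + v * G /\
    forall (B : comNzRingType) (phi : {rmorphism A -> B}),
      map_poly phi f = 1 -> phi r = 1.
Proof.
move=> mG sG d0.
pose R i := Pdiv.Ring.rmodp ('X^i * f) G; pose q i := Pdiv.Ring.rdivp ('X^i * f) G.
have E i : 'X^i * f = q i * G + R i by apply: Pdiv.RingMonic.rdivp_eq.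
have sR i : (size (R i) <= d)%N.
  by rewrite -ltnS -sG Pdiv.Ring.ltn_rmodpN0 // monic_neq0.
case: d d0 sG sR => // d _ sG sR.
pose F : 'M[A]_d.+1 := \matrix_(i, j) (R i)`_j.
exists (\det F), (\sum_i (\adj F 0 i)%:P * 'X^i), (- \sum_i (\adj F 0 i)%:P * q i).
split=> [|B phi Hf].
  rewrite mulNr !mulr_suml -sumrB.
  under eq_bigr => i _ do rewrite -!mulrA -mulrBr E addrAC subrr add0r.
  have HR i : R i = \sum_(j < d.+1) (R i)`_j *: 'X^j.
    apply/polyP => l; rewrite -(poly_def d.+1 (fun j => (R i)`_j)) coef_poly.
    by case: ltnP => // H; rewrite nth_default // (leq_trans (sR i)).
  under eq_bigr => i _ do rewrite HR mulr_sumr.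
  rewrite exchange_big /=.
  transitivity (\sum_(j < d.+1) ((\adj F *m F) 0 j) *: 'X^j : {poly A}).
    rewrite mul_adj_mx (bigD1 0) //= mxE eqxx mulr1n expr0 alg_polyC.
    rewrite big1 ?addr0 // => j; rewrite eq_sym => /negPf j0.
    by rewrite mxE j0 mulr0n scale0r.
  apply: eq_bigr => j _; rewrite mxE scaler_suml; apply: eq_bigr => i _.
  have -> : F i j = (R i)`_j by rewrite mxE.
  by rewrite -!mul_polyC polyCM mulrA.
(* When [phi] sends [f] to 1, the image of ['X^i * f] is already reduced modulo the image of [G], so
   the matrix of multiplication becomes the identity. *)
suff FE : map_mx phi F = 1%:M by rewrite -det_map_mx FE det1.
apply/matrixP => i j; rewrite !mxE.
have H := congr1 (map_poly phi) (E i).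
rewrite rmorphM rmorphD /= rmorphM /= map_polyXn Hf mulr1 in H.
have mG' : map_poly phi G \is monic by rewrite monic_map.
have sG' : size (map_poly phi G) = d.+2.
  by rewrite size_map_poly_id0 // (monicP mG) rmorph1 oner_neq0.
have q0 : map_poly phi (q i) = 0.
  apply/eqP; apply/negPn/negP => qn0.
  have : (size (map_poly phi (q i) * map_poly phi G)%R <= d.+1)%N.
    rewrite -(addrK (map_poly phi (R i)) (_ * _)) -H (leq_trans (size_polyD _ _)) //.
    rewrite size_polyXn size_polyN geq_max ltn_ord.
    by apply: leq_trans (size_poly _ _) _.
  rewrite size_Mmonic // sG'; move: qn0; rewrite -size_poly_gt0.
  by case: (size _) => // s _; rewrite !addSn /= !addnS !ltnS; lia.
rewrite q0 mul0r add0r in H.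
have := congr1 (fun p : {poly B} => p`_j) H; rewrite /= coefXn coef_map => <-.
by rewrite eq_sym.
Qed.

Section TopCoefficient.

Context (A : comNzRingType).

(** Here [c] may be zero: [d] only bounds the degree. This makes the notion multiplicative over any
    ring. *)
Definition top_coef (p : {poly A}) (d : nat) (c : A) := (size p <= d.+1)%N /\ p`_d = c.

Lemma top_coefM p q d e c c' :
  top_coef p d c -> top_coef q e c' -> top_coef (p * q) (d + e) (c * c').
Proof.
move=> [sp <-] [sq <-]; split.
  by apply: leq_trans (size_polyMleq _ _) _; lia.
rewrite coefM (bigD1 (inord d)) //= inordK ?leq_addr // addKn big1 ?addr0 // => i.
rewrite -val_eqE /= inordK ?leq_addr // => id.
case: (ltngtP i d) id => // lt _.
  by rewrite [q`__]nth_default ?mulr0 // (leq_trans sq); lia.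
by rewrite nth_default ?mul0r // (leq_trans sp).
Qed.

Lemma top_coef1 : top_coef 1 0 1.
Proof. by split; rewrite ?size_poly1 ?coef1. Qed.

Lemma top_coefX p d c n : top_coef p d c -> top_coef (p ^+ n) (n * d) (c ^+ n).
Proof.
move=> H; elim: n => [|n IH]; first by rewrite !expr0; apply: top_coef1.
by rewrite !exprS; apply: top_coefM.
Qed.

Lemma top_coef_prod (I : finType) (p : I -> {poly A}) d c :
  (forall i, top_coef (p i) (d i) (c i)) ->
  top_coef (\prod_i p i) (\sum_i d i) (\prod_i c i).
Proof.
move=> H; apply: (big_rec3 (fun a b c => top_coef b a c)) => [|i a b u _ Hu].
  exact: top_coef1.
exact: top_coefM.
Qed.

Lemma top_coef_sum (I : eqType) (s : seq I) (p : I -> {poly A}) d c :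
  (forall i, i \in s -> top_coef (p i) d (c i)) ->
  top_coef (\sum_(i <- s) p i) d (\sum_(i <- s) c i).
Proof.
elim: s => [|i s IH] H; first by rewrite !big_nil; split; rewrite ?size_poly0 ?coef0.
have [s1 c1] := H i (mem_head _ _).
have [|s2 c2] := IH; first by move=> j js; apply: H; rewrite inE js orbT.
rewrite !big_cons; split; last by rewrite coefD c1 c2.
by apply: leq_trans (size_polyD _ _) _; rewrite geq_max s1.
Qed.

Lemma top_coef_lt p d e c : top_coef p d c -> (d < e)%N -> top_coef p e 0.
Proof.
move=> [s _] lt; split; first by lia.
by rewrite nth_default // (leq_trans s).
Qed.

End TopCoefficient.

Section Nullstellensatz.

Context (k : closedFieldType) (hk : [pchar k] =i pred0).

Section Line.

Context (n : nat) (a : 'I_n.+1 -> k).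

(** Noether's change of coordinates: the variable of index 0 becomes [a ord0 *: 'X], and the others
    are shifted by multiples of ['X]. The top coefficient in ['X] of a polynomial is then its top
    homogeneous part evaluated at [a]. *)
Definition line_var (i : 'I_n.+1) : {poly {mpoly k[n]}} :=
  (if unlift ord0 i is Some j then ('X_j)%:P else 0) + (a i)%:MP *: 'X.

Definition line_poly (f : {mpoly k[n.+1]}) : {poly {mpoly k[n]}} :=
  mmap (polyC \o @mpolyC n k) line_var f.

Definition line_pt (x : 'I_n -> k) (t : k) (i : 'I_n.+1) : k :=
  (if unlift ord0 i is Some j then x j else 0) + a i * t.

HB.instance Definition _ := GRing.RMorphism.copy line_poly
  (mmap (polyC \o @mpolyC n k) line_var).

Lemma line_polyE f x t :
  (map_poly (meval x) (line_poly f)).[t] = f.@[line_pt x t].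
Proof.
rewrite mevalE rmorph_sum horner_sum; apply: eq_bigr => m _.
rewrite rmorphM hornerM /= map_polyC hornerC /= mevalC; congr (_ * _).
rewrite rmorph_prod horner_prod; apply: eq_bigr => i _.
rewrite rmorphXn /= horner_exp; congr (_ ^+ _).
rewrite rmorphD hornerD /= /line_pt map_polyZ map_polyX hornerZ hornerX /= mevalC.
congr (_ + _); case: (unlift ord0 i) => [j|]; last by rewrite rmorph0 horner0.
by rewrite map_polyC hornerC /= mevalXU.
Qed.

Lemma line_poly_top (g : {mpoly k[n.+1]}) :
  top_coef (line_poly g) (msize g).-1
   ((\sum_(m <- msupp g | mdeg m == (msize g).-1) g@_m *: 'X_[m]).@[a])%:MP.
Proof.
rewrite (big_morph (meval a) (mevalD a) (meval0 a)).
rewrite (big_morph (@mpolyC n k) (@mpolyCD n k) (mpolyC0 n k)) big_mkcond.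
apply: top_coef_sum => m ms.
have Hm : top_coef ((polyC \o @mpolyC n k) g@_m * mmap1 line_var m) (mdeg m)
   ((g@_m *: 'X_[m]).@[a])%:MP.
  rewrite mevalZ mpolyCM -[mdeg m]add0n; apply: top_coefM.
    by split; rewrite ?coefC // size_polyC; case: eqP.
  rewrite mevalX rmorph_prod mdegE; apply: top_coef_prod => i.
  rewrite -[X in top_coef _ X]muln1 rmorphXn; apply: top_coefX; split.
    apply: leq_trans (size_polyD _ _) _; rewrite geq_max.
    rewrite (leq_trans (size_scale_leq _ _)) ?size_polyX // andbT.
    case: (unlift ord0 i) => [j|]; last by rewrite size_poly0.
    exact: leq_trans (size_polyC_leq1 _) _.
  rewrite coefD coefZ coefX mulr1.
  by case: (unlift ord0 i) => [j|]; rewrite ?coefC add0r.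
case: eqP => [<- //|neq]; apply: top_coef_lt Hm _.
have := msize_mdeg_lt ms; case: (msize g) neq => //= s neq; rewrite ltnS leq_eqVlt.
by lia.
Qed.

Hypothesis a0 : a ord0 != 0.

Lemma line_poly_surj p : exists f, line_poly f = p.
Proof.
have imD f g : (exists f', line_poly f' = f) -> (exists f', line_poly f' = g) ->
   exists f', line_poly f' = f + g.
  by move=> [f' <-] [g' <-]; exists (f' + g'); rewrite rmorphD.
have imM f g : (exists f', line_poly f' = f) -> (exists f', line_poly f' = g) ->
   exists f', line_poly f' = f * g.
  by move=> [f' <-] [g' <-]; exists (f' * g'); rewrite rmorphM.
have imC c : exists f', line_poly f' = (c%:MP)%:P.
  by exists (c%:MP); rewrite /line_poly mmapC.
have imX : exists f', line_poly f' = 'X.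
  exists ((a ord0)^-1 *: 'X_ord0); rewrite /line_poly mmapZ mmapX mmap1U /line_var.
  by rewrite unlift_none add0r mul_polyC scalerA -mpolyCM mulVf // scale1r.
have imV j : exists f', line_poly f' = ('X_j)%:P.
  have [f Hf] := imD _ _ (ex_intro _ 'X_(lift ord0 j) erefl)
    (imM _ _ (imC (- a (lift ord0 j))) imX).
  exists f; rewrite {}Hf {1}/line_poly mmapX mmap1U /line_var liftK.
  by rewrite mpolyCN polyCN mulNr mul_polyC addrK.
have im1 : exists f', line_poly f' = 1 by exists 1; rewrite rmorph1.
have imXn f e : (exists f', line_poly f' = f) -> exists f', line_poly f' = f ^+ e.
  by move=> Hf; elim: e => [|e IH]; rewrite // exprS; apply: (imM).
elim/poly_ind: p => [|p c IH]; first by exists 0; rewrite rmorph0.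
apply: (imD); first exact: imM.
elim/mpolyind: c => [|c m q _ _ IHq]; first by exists 0; rewrite rmorph0.
rewrite polyCD; apply: (imD) => //; rewrite -mul_mpolyC polyCM; apply: (imM) => //.
rewrite mpolyXE_id rmorph_prod /=; apply: (big_ind (fun p => exists f', line_poly f' = p)) => // i _.
by rewrite rmorphXn; apply: imXn (imV i).
Qed.

Lemma line_poly_inj : injective line_poly.
Proof.
move=> f g E; apply/eqP; rewrite -subr_eq0; apply/negPn/negP => /(mpoly_nonroot hk) [y].
rewrite mevalB; pose t := y ord0 / a ord0; pose x j := y (lift ord0 j) - a (lift ord0 j) * t.
have yE : y =1 line_pt x t.
  move=> i; rewrite /line_pt; case: (unliftP ord0 i) => [j|] ->.
    by rewrite subrK.
  by rewrite add0r mulrC divfK.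
by rewrite (meval_eq _ yE) (meval_eq g yE) -!line_polyE E subrr eqxx.
Qed.

End Line.

(** Induction on the number of variables. After a change of coordinates some element [G] of the
    ideal is monic in the last variable. A zero [x] of the contraction of the ideal is found by
    induction, and the norm modulo [G] shows that specializing at [x] leaves a proper ideal of k[T],
    which has a root. *)
Theorem weak_nullstellensatz n (I : {mpoly k[n]} -> Prop) :
  is_ideal I -> I 0 -> ~ I 1 -> exists x, forall f, I f -> f.@[x] = 0.
Proof.
elim: n I => [|n IH] I [ID IM] I0 I1.
  exists (fun=> 0) => f If; apply/eqP; apply/negPn/negP => fx0; apply: I1.
  have fE : f = (f.@[fun=> 0])%:MP.
    apply/eqP; rewrite -subr_eq0; apply/negPn/negP => /(mpoly_nonroot hk) [y].
    rewrite mevalB mevalC (@meval_eq _ _ y (fun=> 0)) ?subrr ?eqxx; by case.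
  have := IM (f.@[fun=> 0])^-1%:MP f If; rewrite {2}fE -mpolyCM mulVf //.
case: (classic (exists g, I g /\ g != 0)) => [[g [Ig g0]]|no]; last first.
  exists (fun=> 0) => f If; case: (eqVneq f 0) => [->|f0]; first exact: meval0.
  by case: no; exists f.
pose d := (msize g).-1.
pose tg := \sum_(m <- msupp g | mdeg m == d) g@_m *: 'X_[m] : {mpoly k[n.+1]}.
have tg0 : tg != 0.
  apply/eqP => /(congr1 (fun p => p@_(mlead g))); rewrite mcoeff0 /tg.
  rewrite raddf_sum big_mkcond (bigD1_seq (mlead g)) ?mlead_supp //=.
  rewrite {1}/d -mlead_deg // eqxx mcoeffZ mcoeffX eqxx mulr1 big1 ?addr0.
    by apply/eqP; rewrite mleadc_eq0.
  move=> m /negPf H; case: ifP => // _; by rewrite mcoeffZ mcoeffX H mulr0.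
(* A single direction at which the top form of [g] and the coordinate of index 0 are both
   non-zero. *)
have [a] : exists a, (tg * 'X_ord0).@[a] != 0.
  apply: (mpoly_nonroot hk); rewrite mulf_neq0 //.
  by apply/eqP => /(congr1 (fun p => p@_U_(ord0))) /eqP;
    rewrite mcoeffXU mcoeff0 oner_eq0.
rewrite mevalM mevalXU mulf_eq0 negb_or => /andP [c0 a0].
set c := tg.@[a] in c0.
have d0 : (0 < d)%N.
  rewrite /d; case sg: (msize g) => [|[|s]] //.
    by move: g0; rewrite -msize_poly_eq0 sg.
  case: I1; have := sg; move/eqP/msize_poly1P => [b b0 gE].
  by have := IM b^-1%:MP g Ig; rewrite gE -mpolyCM mulVf.
pose G := line_poly a (c^-1 *: g).
have GE : G = (c^-1)%:MP *: line_poly a g.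
  by rewrite /G /line_poly mmapZ mul_polyC.
have [sG cG] : top_coef G d 1.
  have [s1 s2] := line_poly_top a g.
  split; first by rewrite GE; apply: leq_trans (size_scale_leq _ _) s1.
  by rewrite GE coefZ s2 -mpolyCM mulVf.
have sG1 : size G = d.+1.
  apply/eqP; rewrite eqn_leq sG ltnNge; apply/negP => le.
  by move: cG; rewrite nth_default // => /eqP; rewrite eq_sym oner_eq0.
have mG : G \is monic by rewrite monicE lead_coefE sG1 cG.
pose J p := exists2 f, I f & line_poly a f = p.
have IG : J G by exists (c^-1 *: g) => //; rewrite -mul_mpolyC; apply: IM.
have JD p q : J p -> J q -> J (p + q).
  by move=> [f If <-] [f' If' <-]; exists (f + f'); [apply: ID | rewrite rmorphD].
have JM p q : J q -> J (p * q).
  have [f' <-] := line_poly_surj a0 p.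
  by move=> [f If <-]; exists (f' * f); [apply: IM | rewrite rmorphM].
have J1 : ~ J 1.
  move=> [f If] E; apply: I1.
  by have -> : 1 = f by apply: (line_poly_inj a0); rewrite rmorph1.
pose I' r := J (r%:P).
have [||x Hx] := IH I' _ _ J1.
- split=> [r s|r s] H; rewrite /I' ?polyCD ?polyCM; [exact: JD | exact: JM].
- by exists 0; rewrite ?rmorph0.
pose K (p : {poly k}) := exists2 f, I f & map_poly (meval x) (line_poly a f) = p.
have K1 : ~ K 1.
  move=> [f If Hf].
  (* If the specialized ideal contained 1, the norm [r] would lie in the contraction and yet take
     the value 1 at its zero [x]. *)
  have [r [u [v [E Hr]]]] := norm_in_ideal (line_poly a f) mG sG1 d0.
  have Jf : J (line_poly a f) by exists f.
  have : I' r by rewrite /I' E; exact: JD (JM _ _ Jf) (JM _ _ IG).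
  by move=> /Hx; rewrite (Hr _ _ Hf) => /eqP; rewrite oner_eq0.
have KM p q : K q -> K (p * q).
  move=> [f If <-].
  have [f' Hf'] := line_poly_surj a0 (map_poly (@mpolyC n k) p).
  exists (f' * f); first exact: IM.
  rewrite !rmorphM /= Hf'; congr (_ * _).
  rewrite -map_poly_comp_id0 ?raddf0 //; apply/polyP => i.
  by rewrite coef_map_id0 /= mevalC.
have KD p q : K p -> K q -> K (p + q).
  by move=> [f If <-] [f' If' <-]; exists (f + f'); [apply: ID | rewrite !rmorphD].
pose Gx := map_poly (meval x) G.
have Gx0 : Gx != 0 by rewrite monic_neq0 // monic_map.
have KG : K Gx by exists (c^-1 *: g) => //; rewrite -mul_mpolyC; apply: IM.
have [p [Kp p0 minp]] : exists p, [/\ K p, p != 0 & forall q, K q -> q != 0 -> (size p <= size q)%N].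
  have [s] : exists s, size Gx = s by exists (size Gx).
  elim/ltn_ind: s Gx Gx0 KG => s IHs p p0 Kp sp.
  case: (classic (exists q, [/\ K q, q != 0 & (size q < size p)%N])) => [[q [Kq q0 lt]]|no].
    by apply: (IHs (size q) _ q); rewrite -?sp.
  by exists p; split=> // q Kq q0; rewrite leqNgt; apply/negP => lt; apply: no; exists q.
have sp : size p != 1%N.
  apply/negP => /size_poly1P [b b0 pE]; apply: K1.
  by have := KM (b^-1)%:P p Kp; rewrite pE -polyCM mulVf.
have [t /rootP pt] := closed_rootP p sp.
exists (line_pt a x t) => f If; rewrite -line_polyE.
have : p %| map_poly (meval x) (line_poly a f).
  apply/modp_eq0P/eqP/negPn/negP => m0.
  suff Km : K (map_poly (meval x) (line_poly a f) %% p).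
    by have := minp _ Km m0; rewrite leqNgt ltn_modp p0.
  have E := divp_eq (map_poly (meval x) (line_poly a f)) p.
  have -> : map_poly (meval x) (line_poly a f) %% p =
    map_poly (meval x) (line_poly a f) + (- (map_poly (meval x) (line_poly a f) %/ p)) * p.
    by rewrite {2}E mulNr addrAC addrN add0r.
  by apply: KD; [exists f | exact: KM].
by move=> /dvdpP [q ->]; rewrite hornerM pt mulr0.
Qed.

End Nullstellensatz.

Section StrongNullstellensatz.

Context (k : closedFieldType) (hk : [pchar k] =i pred0) (n : nat).

Local Notation P := {mpoly k[n]}.
Local Notation F := (@tofrac {mpoly k[n]}).

Let up : P -> {mpoly k[n.+1]} := mmap (@mpolyC n.+1 k) (fun i => 'X_(lift ord0 i)).

Let upE (f : P) y : (up f).@[y] = f.@[fun i => y (lift ord0 i)].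
Proof.
rewrite (big_morph _ (mevalD _) (meval0 _)) mevalE.
apply: eq_bigr => m _; rewrite mevalM mevalC; congr (_ * _).
rewrite rmorph_prod; apply: eq_bigr => i _; by rewrite rmorphXn /= mevalXU.
Qed.

(** Rabinowitsch's trick: adjoin a variable and the equation [1 - 'X_ord0 * f], so that no common
    zero is left. In the resulting expression of 1 the new variable is replaced by the inverse of
    [f] in the fraction field, and denominators are cleared. *)
Theorem nullstellensatz (s : seq P) (f : P) :
  (forall x, (forall g, g \in s -> g.@[x] = 0) -> f.@[x] = 0) ->
  exists e, ideal_gen s (f ^+ e).
Proof.
move=> Hf; case: (eqVneq f 0) => [->|f0].
  by exists 1%N; apply: ideal_gen0.
pose g0 : {mpoly k[n.+1]} := 1 - 'X_ord0 * up f.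
pose s' := rcons (map up s) g0.
have [u Hu] : ideal_gen s' 1.
  apply: NNPP => no.
  have [x Hx] := weak_nullstellensatz hk (ideal_gen_ideal s') (ideal_gen0 s') no.
  have : g0.@[x] = 0 by apply/Hx/ideal_gen_mem; rewrite mem_rcons mem_head.
  rewrite mevalB mevalM meval1 upE Hf ?mulr0 ?subr0.
    by move/eqP; rewrite oner_eq0.
  move=> g gs; rewrite -upE; apply/Hx/ideal_gen_mem.
  by rewrite mem_rcons inE map_f ?orbT.
pose th : {rmorphism {mpoly k[n.+1]} -> {fraction {mpoly k[n]}}} :=
  mmap (F \o @mpolyC n k)
   (fun i => if unlift ord0 i is Some j then F 'X_j else (F f)^-1).
have thup g : th (up g) = F g.
  rewrite /= /up; elim/mpolyind: g => [|c m p _ _ IH]; first by rewrite !raddf0.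
  rewrite raddfD raddfD /= IH raddfD /=; congr (_ + _).
  rewrite mmapZ mmapX rmorphM /= mmapC -mul_mpolyC rmorphM /=; congr (_ * _).
  rewrite rmorph_prod mpolyXE_id rmorph_prod /=; apply: eq_bigr => i _.
  by rewrite !rmorphXn /= mmapX mmap1U liftK.
have fF0 : F f != 0 by rewrite tofrac_eq0.
have den u0 : exists e w, th u0 * F f ^+ e = F w.
  elim/mpolyind: u0 => [|c m p _ _ [e [w Hw]]].
    by exists 0%N, 0; rewrite !raddf0 mul0r.
  pose mw : P := c%:MP * \prod_(i < n) 'X_i ^+ m (lift ord0 i).
  exists (e + m ord0)%N, (w * f ^+ m ord0 + mw * f ^+ e).
  rewrite rmorphD /= mulrDl addrC.
  rewrite exprD mulrA Hw rmorphD !rmorphM !rmorphXn /=; congr (_ + _).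
  rewrite mmapZ mmapX /mmap1 big_ord_recl unlift_none /=.
  rewrite (eq_bigr (fun i => F 'X_i ^+ m (lift ord0 i))); last by move=> i _; rewrite liftK.
  rewrite rmorph_prod exprVn; under [in RHS]eq_bigr do rewrite rmorphXn.
  set A := F c%:MP; set B := \prod_(i < n) _; set C := F f ^+ m ord0; set D := F f ^+ e.
  have C0 : C != 0 by rewrite expf_neq0.
  by rewrite (mulrC D) -!mulrA (mulrCA B) mulKf.
have [ew Hew] := dep_choice (fun i => den (u i)).
have [w Hw] := dep_choice Hew.
pose E := (\sum_(i < size s') ew i)%N.
have /dep_choice [v Hv] i : exists v : P, (i < size s')%N -> th (u i) * F f ^+ E = F v.
  case: (ltnP i (size s')) => [lt|_]; last by exists 0.
  exists (w i * f ^+ (E - ew i)) => _; rewrite rmorphM rmorphXn /= -Hw -mulrA -exprD subnKC //.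
  by rewrite /E (bigD1 (Ordinal lt)) // leq_addr.
exists E; exists v.
have tosum : th 1 * F f ^+ E = F (\sum_(i < size s) v i * s`_i).
  rewrite Hu rmorph_sum mulr_suml size_rcons big_ord_recr /= nth_rcons size_map.
  rewrite ltnn eqxx [X in _ + X](_ : _ = 0) ?addr0; last first.
    rewrite -[mmap _ _ _]/(th _) rmorphM rmorphB rmorph1 rmorphM thup.
    by rewrite /= mmapX mmap1U unlift_none mulVf // subrr mulr0 mul0r.
  rewrite rmorph_sum; apply: eq_bigr => i _ /=.
  rewrite -[mmap _ _ _]/(th _) nth_rcons size_map ltn_ord rmorphM (nth_map 0) // thup.
  rewrite mulrAC Hv ?rmorphM //.
  by rewrite size_rcons size_map ltnS ltnW.
apply/eqP; rewrite -tofrac_eq -tosum rmorph1 mul1r rmorphXn //.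
Qed.

End StrongNullstellensatz.

(** * Local dimension of the zero set of c polynomials *)

Lemma not_forall_imply T (A : T -> Prop) (B : T -> Prop) :
  ~ (forall x, A x -> B x) -> exists x, A x /\ ~ B x.
Proof.
move=> H; apply: NNPP => no; apply: H => x Ax; apply: NNPP => Bx.
by apply: no; exists x.
Qed.

Section Local.

Context (k : closedFieldType) (hk : [pchar k] =i pred0) (n : nat).

Local Notation P := {mpoly k[n]}.

(** Order of vanishing at the origin: a finite substitute for working in the local ring there. *)
Definition ord_ge (t : nat) (p : P) : Prop := forall m, (mdeg m < t)%N -> p@_m = 0.

Lemma ord_ge0 t : ord_ge t 0.
Proof. by move=> m _; rewrite mcoeff0. Qed.

Lemma ord_geD t p q : ord_ge t p -> ord_ge t q -> ord_ge t (p + q).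
Proof. by move=> Hp Hq m mt; rewrite mcoeffD Hp // Hq // addr0. Qed.

Lemma ord_geN t p : ord_ge t p -> ord_ge t (- p).
Proof. by move=> Hp m mt; rewrite mcoeffN Hp // oppr0. Qed.

Lemma ord_ge_le t t' p : (t <= t')%N -> ord_ge t' p -> ord_ge t p.
Proof. by move=> tt Hp m mt; apply: Hp; apply: leq_trans tt. Qed.

Lemma ord_geM a b p q : ord_ge a p -> ord_ge b q -> ord_ge (a + b) (p * q).
Proof.
move=> Hp Hq m mt; rewrite mcoeffM big1 // => -[m1 m2] /= /eqP E.
have : (mdeg m1 + mdeg m2 < a + b)%N by rewrite -mdegD -E.
case: (ltnP (mdeg m1) a) => [lt _|ge lt]; first by rewrite Hp ?mul0r.
by rewrite Hq ?mulr0 //; lia.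
Qed.

Lemma ord_ge_sum t (I : Type) (r : seq I) (Q : pred I) (F : I -> P) :
  (forall i, Q i -> ord_ge t (F i)) -> ord_ge t (\sum_(i <- r | Q i) F i).
Proof. by move=> H; apply: big_ind => //; [apply: ord_ge0 | exact: ord_geD]. Qed.

Lemma ord_ge_mulr t p q : ord_ge t p -> ord_ge t (q * p).
Proof. by move=> H; rewrite -[t]add0n; apply: ord_geM. Qed.

Lemma meval_0 (p : P) : p.@[fun=> 0] = p@_0%MM.
Proof.
elim/mpolyind: p => [|c m p _ _ IH]; first by rewrite meval0 mcoeff0.
rewrite mevalD mcoeffD IH mevalZ mevalX mcoeffZ mcoeffX; congr (_ * _ + _).
case: eqP => [->|m0]; first by rewrite big1 // => i _; rewrite mnm0E.
have [i mi] : exists i, m i != 0%N.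
  apply: NNPP => no; apply: m0; apply/mnmP => i; rewrite mnm0E.
  by apply/eqP; apply/negPn/negP => mi; apply: no; exists i.
by rewrite (bigD1 i) //= expr0n (negPf mi) mul0r.
Qed.

Lemma ord_ge1 (p : P) : p.@[fun=> 0] = 0 -> ord_ge 1 p.
Proof.
by rewrite meval_0 => H m; rewrite ltnS leqn0 mdeg_eq0 => /eqP ->.
Qed.

Lemma inverse_mod_power (H : P) t : H.@[fun=> 0] != 0 ->
  exists H', ord_ge t (H * H' - 1).
Proof.
set c := H.@[_] => c0.
pose N : P := 1 - c^-1 *: H.
have N1 : ord_ge 1 N.
  by apply: ord_ge1; rewrite mevalB meval1 mevalZ mulVf // subrr.
exists (c^-1 *: \sum_(i < t) N ^+ i).
have -> : H * (c^-1 *: \sum_(i < t) N ^+ i) - 1 = - N ^+ t.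
  rewrite -scalerAr scalerAl.
  have -> : c^-1 *: H = - (N - 1) by rewrite addrAC subrr add0r opprK.
  by rewrite mulNr -subrX1 opprB addrAC subrr add0r.
apply: ord_geN; elim: t => [|t IH] //.
by rewrite exprS -add1n; apply: ord_geM.
Qed.

(** By the Nullstellensatz some power ['X_i ^+ E] lies locally in the ideal of [s]. Up to any given
    order, every polynomial is then a combination of monomials in the elements of [s] times
    monomials in the variables with exponents below [E]. With fewer than [n] elements in [s] there
    are too few of these. *)
Lemma isolated_zero0 (s : seq P) (H : P) :
  (forall g, g \in s -> g.@[fun=> 0] = 0) -> H.@[fun=> 0] != 0 ->
  (forall x, (forall g, g \in s -> g.@[x] = 0) -> forall i, (H * 'X_i).@[x] = 0) ->
  (n <= size s)%N.
Proof.
move=> s0 H0 Hs.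
have [E0 HE0] := dep_choice (fun i => nullstellensatz hk (fun x Hx => Hs x Hx i)).
pose E := (\sum_i E0 i).+1.
have HE i : ideal_gen s ((H * 'X_i) ^+ E).
  rewrite -(@subnK (E0 i) E); last by []|| (rewrite /E (bigD1 i) //=; lia).
  by rewrite exprD; apply: (ideal_gen_ideal s).2.
set r := size s.
(* Up to order [t] the factor [H] is invertible at the origin and can be removed from the membership
   [HE]. *)
have red t i : exists u : nat -> P, ord_ge t ('X_i ^+ E - \sum_(j < r) u j * s`_j).
  have [H' HH'] := inverse_mod_power t H0.
  have [u Hu] := HE i.
  exists (fun j => H' ^+ E * u j).
  under eq_bigr do rewrite -mulrA.
  rewrite -mulr_sumr -Hu exprMn mulrA -exprMn -mulNr -[X in X + _]mul1r -mulrDl mulrC.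
  apply: ord_ge_mulr; rewrite -opprB; apply: ord_geN.
  rewrite subrX1 mulrC [H' * H]mulrC; exact: ord_ge_mulr.
have claim1 t (p : P) : exists (c : seq (k * {ffun 'I_n -> nat})) (v : nat -> P),
   (forall a, a \in c -> forall i, (a.2 i < E)%N) /\
   ord_ge t (p - \sum_(a <- c) a.1 *: \prod_i 'X_i ^+ a.2 i - \sum_(j < r) v j * s`_j).
  elim/mpolyind: p => [|b m p _ _ [c [v [Hc Hv]]]].
    exists [::], (fun=> 0); split=> //; rewrite big_nil big1 ?subr0; first exact: ord_ge0.
    by move=> j _; rewrite mul0r.
  case: (boolP [forall i, (m i < E)%N]) => [/forallP mE|].
    exists ((b, [ffun i => m i]) :: c), v; split=> [a|].
      by rewrite inE => /orP [/eqP ->|/Hc //] i; rewrite ffunE.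
    rewrite big_cons /= (eq_bigr (fun i => 'X_i ^+ m i)); last by move=> i _; rewrite ffunE.
    by rewrite -mpolyXE_id opprD addrACA subrr add0r.
  rewrite negb_forall => /existsP [i]; rewrite -leqNgt => Ei.
  have [u Hu] := red t i.
  pose m' := (m - (U_(i) *+ E))%MM.
  have mE : 'X_[m] = 'X_[m'] * 'X_i ^+ E :> P.
    rewrite mpolyXn -mpolyXD submK //; apply/mnm_lepP => j.
    by rewrite mulmnE mnm1E; case: eqP => [<-|]; rewrite ?mul1n.
  exists c, (fun j => v j + b *: 'X_[m'] * u j); split=> //.
  have -> : b *: 'X_[m] + p - \sum_(a <- c) a.1 *: \prod_i0 'X_i0 ^+ a.2 i0 -
     \sum_(j < r) (v j + b *: 'X_[m'] * u j) * s`_j =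
     (p - \sum_(a <- c) a.1 *: \prod_i0 'X_i0 ^+ a.2 i0 - \sum_(j < r) v j * s`_j) +
     b *: 'X_[m'] * ('X_i ^+ E - \sum_(j < r) u j * s`_j).
    have -> : \sum_(j < r) (v j + b *: 'X_[m'] * u j) * s`_j =
      \sum_(j < r) v j * s`_j + b *: 'X_[m'] * \sum_(j < r) u j * s`_j.
      by rewrite mulr_sumr -big_split; apply: eq_bigr => j _; rewrite mulrDl mulrA.
    rewrite mulrBr -[b *: 'X_[m'] * 'X_i ^+ E]scalerAl -mE.
    move: (b *: 'X_[m]) (\sum_(a <- c) _) (\sum_(j < r) v j * _) (_ * _) => A B C D.
    ring.
  by apply: ord_geD => //; apply: ord_ge_mulr.
pose mono2 (b : {ffun 'I_r -> nat}) (a : {ffun 'I_n -> nat}) : P :=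
  (\prod_(j < r) s`_j ^+ b j) * \prod_i 'X_i ^+ a i.
(* [claim1] is applied again to its own coefficients: an element of [s] vanishes at the origin, so
   each factor taken out of [s] gains one order. *)
have claim2 t tau : (tau <= t)%N -> forall p : P,
   exists L : seq (k * {ffun 'I_r -> nat} * {ffun 'I_n -> nat}),
   (forall l, l \in L -> (forall j, (l.1.2 j < tau)%N) /\ (forall i, (l.2 i < E)%N)) /\
   ord_ge tau (p - \sum_(l <- L) l.1.1 *: mono2 l.1.2 l.2).
  elim: tau => [_ p|tau IH lt p].
    by exists [::].
  have [c [v [Hc Hv]]] := claim1 t p.
  have [Lv HLv] := dep_choice (fun j => IH (ltnW lt) (v j)).
  pose up (j : 'I_r) (l : k * {ffun 'I_r -> nat} * {ffun 'I_n -> nat}) :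
    k * {ffun 'I_r -> nat} * {ffun 'I_n -> nat} :=
    (l.1.1, [ffun j' => ((j' == j) + l.1.2 j')%N], l.2).
  have upE j l : mono2 (up j l).1.2 (up j l).2 = mono2 l.1.2 l.2 * s`_j.
    rewrite /= [RHS]mulrAC; congr (_ * _).
    rewrite (bigD1 j) // [in RHS](bigD1 j) //= ffunE eqxx exprS [RHS]mulrC -mulrA.
    by congr (_ * (_ * _)); apply: eq_bigr => j' /negPf ne; rewrite ffunE ne.
  pose emb (a : k * {ffun 'I_n -> nat}) : k * {ffun 'I_r -> nat} * {ffun 'I_n -> nat} :=
    (a.1, [ffun=> 0%N], a.2).
  have embE a : mono2 (emb a).1.2 (emb a).2 = \prod_i 'X_i ^+ a.2 i.
    by rewrite /mono2 big1 ?mul1r // => j _; rewrite ffunE.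
  exists (map emb c ++ flatten [seq map (up j) (Lv j) | j <- index_enum 'I_r]); split.
    move=> l; rewrite mem_cat => /orP [/mapP [a /Hc aE ->]|/flatten_mapP [j _ /mapP [l' Hl' ->]]].
      by split=> // j; rewrite ffunE.
    have [H1 H2] := (HLv j).1 l' Hl'; split=> // j'; rewrite ffunE.
    by have := H1 j'; case: (j' == j) => /=; lia.
  rewrite big_cat big_map big_flatten big_map /=.
  rewrite (eq_bigr (fun a : k * {ffun 'I_n -> nat} => a.1 *: \prod_i 'X_i ^+ a.2 i));
    last by move=> a _; rewrite embE.
  have -> : \sum_(j < r) \sum_(l <- [seq up j l | l <- Lv j]) l.1.1 *: mono2 l.1.2 l.2 =
     \sum_(j < r) (\sum_(l <- Lv j) l.1.1 *: mono2 l.1.2 l.2) * s`_j.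
    apply: eq_bigr => j _; rewrite big_map mulr_suml; apply: eq_bigr => l _.
    by rewrite upE scalerAl.
  rewrite (_ : p - _ = (p - \sum_(a <- c) a.1 *: \prod_i 'X_i ^+ a.2 i - \sum_(j < r) v j * s`_j)
     + \sum_(j < r) (v j - \sum_(l <- Lv j) l.1.1 *: mono2 l.1.2 l.2) * s`_j); last first.
    have -> : \sum_(j < r) (v j - \sum_(l <- Lv j) l.1.1 *: mono2 l.1.2 l.2) * s`_j =
      \sum_(j < r) v j * s`_j - \sum_(j < r) (\sum_(l <- Lv j) l.1.1 *: mono2 l.1.2 l.2) * s`_j.
      by rewrite -sumrB; apply: eq_bigr => j _; rewrite mulrBl.
    move: (\sum_(a <- c) _) (\sum_(j < r) v j * _) (\sum_(j < r) _) => A B C.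
    ring.
  apply: ord_geD; first exact: ord_ge_le Hv.
  apply: ord_ge_sum => j _; rewrite -addn1; apply: ord_geM; first by case: (HLv j).
  by apply: ord_ge1; apply: s0; apply: mem_nth.
rewrite leqNgt; apply/negP => rn.
(* Chosen so that (nT)^r E^n < T^n when r < n. A monomial with exponents below [T] has degree below
   [n * T], so working up to that order loses none of them. *)
pose T := (n ^ r * E ^ n).+1.
have [L HL] := dep_choice (fun e : {ffun 'I_n -> 'I_T} =>
  claim2 (n * T)%N (n * T)%N (leqnn _) (\prod_i 'X_i ^+ e i)).
have : (#|{: {ffun 'I_n -> 'I_T}}| <=
    #|{: {ffun 'I_r -> 'I_(n * T)} * {ffun 'I_n -> 'I_E}}|)%N.
  pose cast1 (b : {ffun 'I_r -> 'I_(n * T)}) := [ffun j => b j : nat].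
  pose cast2 (a : {ffun 'I_n -> 'I_E}) := [ffun i => a i : nat].
  apply: (@span_card_le _ _ _ 'X_{1..n} (fun m => (mdeg m < n * T)%N)
    (fun (e : {ffun 'I_n -> 'I_T}) m => (\prod_i 'X_i ^+ e i : P)@_m)
    (fun (ba : {ffun 'I_r -> 'I_(n * T)} * {ffun 'I_n -> 'I_E}) m =>
       (mono2 (cast1 ba.1) (cast2 ba.2))@_m)).
    move=> c Hc e.
    pose m : 'X_{1..n} := [multinom e i | i < n].
    have mm (e' : {ffun 'I_n -> 'I_T}) :
      (\prod_i 'X_i ^+ e' i : P) = 'X_[[multinom e' i | i < n]].
      by rewrite mpolyXE_id; apply: eq_bigr => i _; rewrite mnmE.
    have := Hc m; rewrite (bigD1 e) //= [X in _ + X]big1 ?addr0.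
      rewrite mm mcoeffX eqxx mulr1; apply.
      rewrite mdegE (@leq_ltn_trans (\sum_(i < n) (n ^ r * E ^ n))%N) //.
        by apply: leq_sum => i _; rewrite mnmE -ltnS.
      by rewrite sum_nat_const card_ord ltn_pmul2l // (leq_ltn_trans _ rn).
    move=> e' ne; rewrite mm mcoeffX; case: eqP => [E'|]; last by rewrite mulr0.
    case/eqP: ne; apply/ffunP => i; apply: val_inj.
    by have /mnmP/(_ i) := E'; rewrite !mnmE.
  move=> e; have [H1 H2] := HL e.
  exists (fun ba => \sum_(l <- L e | (l.1.2 == cast1 ba.1) && (l.2 == cast2 ba.2)) l.1.1) => m Hm.
  have := H2 m Hm; rewrite mcoeffB => /eqP; rewrite subr_eq0 => /eqP ->.
  rewrite raddf_sum /=.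
  under [RHS]eq_bigr do rewrite mulr_suml big_mkcond /=.
  rewrite [RHS]exchange_big /= big_seq [RHS]big_seq; apply: eq_bigr => l lL.
  have [l1 l2] := H1 l lL.
  pose b0 := [ffun j => Ordinal (l1 j)]; pose a0 := [ffun i => Ordinal (l2 i)].
  have E1 : cast1 b0 = l.1.2 by apply/ffunP => j; rewrite !ffunE.
  have E2 : cast2 a0 = l.2 by apply/ffunP => j; rewrite !ffunE.
  rewrite (bigD1 (b0, a0)) //= E1 E2 !eqxx mcoeffZ big1 ?addr0 // => -[b a] /= ne.
  case: ifP => // /andP [/eqP F1 /eqP F2]; case/eqP: ne; congr pair.
    by apply/ffunP => j; apply: val_inj; have /ffunP/(_ j) := F1; rewrite !ffunE.
  by apply/ffunP => j; apply: val_inj; have /ffunP/(_ j) := F2; rewrite !ffunE.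
rewrite card_prod !card_ffun !card_ord.
apply/negP; rewrite -ltnNge expnMn.
have lt : (n ^ r * E ^ n * T ^ r < T ^ n)%N.
  apply: (@leq_trans (T ^ r.+1)); last by rewrite leq_pexp2l.
  by rewrite expnS ltn_pmul2r ?expn_gt0.
by lia.
Qed.

Local Notation pt := ('I_n -> k).

Lemma isolated_zero (s : seq P) (H : P) (x0 : pt) :
  (forall g, g \in s -> g.@[x0] = 0) -> H.@[x0] != 0 ->
  (forall x, (forall g, g \in s -> g.@[x] = 0) -> H.@[x] = 0 \/ x = x0) ->
  (n <= size s)%N.
Proof.
move=> s0 H0 Hs.
pose lq : n.-tuple P := [tuple 'X_i + (x0 i)%:MP | i < n].
have shE (p : P) x : (p \mPo lq).@[x] = p.@[fun i => x i + x0 i].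
  rewrite comp_mpoly_meval; apply: meval_eq => i.
  by rewrite tnth_mktuple mevalD mevalXU mevalC.
have e0 : (fun i => 0 + x0 i) = x0 by apply: functional_extensionality => i; rewrite add0r.
have := @isolated_zero0 [seq p \mPo lq | p <- s] (H \mPo lq); rewrite size_map; apply.
- by move=> g /mapP [p ps ->]; rewrite shE e0 s0.
- by rewrite shE e0.
- move=> x Hx i; rewrite mevalM shE mevalXU.
  case: (Hs (fun i => x i + x0 i)) => [g gs|->|E]; first by rewrite -shE Hx // map_f.
    by rewrite mul0r.
  have := congr1 (fun f => f i) E; rewrite -[RHS]add0r => /addIr ->.
  by rewrite mulr0.
Qed.

Lemma closed_setU (V W : pt -> Prop) : closed_set V -> closed_set W ->
  closed_set (fun x => V x \/ W x).
Proof.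
move=> [S HS] [T HT].
exists (fun f => exists g h, [/\ S g, T h & f = g * h]) => x; split.
  by move=> [/HS H|/HT H] f [g [h [Sg Th ->]]]; rewrite mevalM; [rewrite (H g Sg) mul0r|rewrite (H h Th) mulr0].
move=> H; apply: NNPP => no.
have [g [Sg g0]] : exists g, S g /\ ~ g.@[x] = 0.
  by apply: not_forall_imply => V0; apply: no; left; apply/HS.
have [h [Th h0]] : exists h, T h /\ ~ h.@[x] = 0.
  by apply: not_forall_imply => V0; apply: no; right; apply/HT.
have /eqP := H (g * h) (ex_intro _ g (ex_intro _ h (And3 Sg Th (erefl _)))).
by rewrite mevalM mulf_eq0 => /orP [] /eqP.
Qed.

Lemma closed_set0 : closed_set (fun _ : pt => False).
Proof.
exists (eq 1) => x; split=> // /(_ 1 (erefl _)) /eqP; by rewrite meval1 oner_eq0.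
Qed.

Lemma closed_set_point (x0 : pt) : closed_set (eq x0).
Proof.
exists (fun f => exists i, f = 'X_i - (x0 i)%:MP) => x; split.
  by move=> <- f [i ->]; rewrite mevalB mevalXU mevalC subrr.
move=> H; apply: functional_extensionality => i; apply/eqP.
by rewrite eq_sym -subr_eq0 -(H _ (ex_intro _ i (erefl _))) mevalB mevalXU mevalC.
Qed.

Lemma irreducible_point (x0 : pt) : irreducible_set (eq x0).
Proof.
split; [exact: closed_set_point|by exists x0|].
by move=> V1 V2 _ _ /(_ x0 erefl) [H|H]; [left|right] => x <-.
Qed.

Lemma irreducible_union r (W : 'I_r -> pt -> Prop) (X : pt -> Prop) :
  irreducible_set X -> (forall i, closed_set (W i)) ->
  (forall x, X x -> exists i, W i x) -> exists i, forall x, X x -> W i x.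
Proof.
move=> [clX [x1 Xx1] irX].
elim: r W => [|r IH] W clW cov; first by case: (cov _ Xx1) => -[].
have clU : closed_set (fun x => exists i : 'I_r, W (lift ord0 i) x).
  elim: r {IH} W clW {cov} => [|r IH] W clW.
    by have [S HS] := closed_set0; exists S => x; rewrite -HS; split=> // -[[]].
  have [S HS] := closed_setU (clW (lift ord0 ord0)) (IH (fun i => W (lift ord0 i)) (fun i => clW _)).
  exists S => x; rewrite -HS; split.
    move=> [i]; case: (unliftP ord0 i) => [j|] -> H; last by left.
    by right; exists j.
  by move=> [H|[i H]]; [exists ord0|exists (lift ord0 i)].
case: (irX _ _ (clW ord0) clU).
- move=> x /cov [i]; case: (unliftP ord0 i) => [j|] -> H; last by left.
  by right; exists j.
- by move=> H; exists ord0.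
- move=> H; have [i Hi] := IH (fun i => W (lift ord0 i)) (fun i => clW _) H.
  by exists (lift ord0 i).
Qed.

Lemma irreducible_mul (X : pt -> Prop) (f g : P) : irreducible_set X ->
  vanishing X (f * g) -> vanishing X f \/ vanishing X g.
Proof.
move=> [_ _ H] fg; apply: (H _ _ (closed_zeros f) (closed_zeros g)) => x /fg /eqP.
by rewrite mevalM mulf_eq0 => /orP [] /eqP; [left|right].
Qed.

(** All members contain [x0]; this lets the chain be intersected with an open neighbourhood of [x0]
    without becoming shorter. *)
Definition chain_at (V : pt -> Prop) (x0 : pt) (r : nat) (X : nat -> pt -> Prop) : Prop :=
  (forall i, (i <= r)%N -> [/\ irreducible_set (X i), forall x, X i x -> V x & X i x0]) /\
  (forall i, (i < r)%N -> (forall x, X i x -> X i.+1 x) /\ ~ (forall x, X i.+1 x -> X i x)).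

Lemma avoiding_form r (y : 'I_r -> pt) (x0 : pt) :
  exists l : P, l.@[x0] = 0 /\ forall i, y i <> x0 -> l.@[y i] != 0.
Proof.
have [Q HQ] : exists Q : P, Q != 0 /\ forall a, Q.@[a] != 0 -> forall i, y i <> x0 ->
     \sum_j a j * (y i j - x0 j) != 0.
  elim: r y => [|r IH] y; first by exists 1; rewrite oner_eq0; split=> // a _ [].
  have [E|ne] := classic (y ord0 = x0).
    have [Q' [Q'0 HQ']] := IH (fun i => y (lift ord0 i)).
    exists Q'; split=> // a Qa i; case: (unliftP ord0 i) => [j|] -> //; exact: HQ'.
  have [Q' [Q'0 HQ']] := IH (fun i => y (lift ord0 i)).
  pose L : P := \sum_j (y ord0 j - x0 j) *: 'X_j.
  have LE a : L.@[a] = \sum_j a j * (y ord0 j - x0 j).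
    by rewrite raddf_sum; apply: eq_bigr => j _; rewrite /= mevalZ mevalXU mulrC.
  exists (L * Q'); split.
    rewrite mulf_neq0 //; apply/eqP => L0; apply: ne; apply: functional_extensionality => j.
    apply/eqP; rewrite -subr_eq0; have := LE (fun i => (i == j)%:R).
    rewrite L0 meval0 (bigD1 j) //= eqxx mul1r big1 ?addr0; first by move=> <-.
    by move=> i /negPf ->; rewrite mul0r.
  move=> a; rewrite mevalM mulf_eq0 negb_or LE => /andP [La Qa] i.
  case: (unliftP ord0 i) => [j|] -> // H; exact: HQ'.
have [Q0 {}HQ] := HQ; have [a Qa] := mpoly_nonroot hk Q0.
exists (\sum_j a j *: ('X_j - (x0 j)%:MP)); split.
  rewrite raddf_sum big1 // => j _.
  by rewrite /= mevalZ mevalB mevalXU mevalC subrr mulr0.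
move=> i /(HQ a Qa i); congr (_ != 0); rewrite raddf_sum; apply: eq_bigr => j _.
by rewrite /= mevalZ mevalB mevalXU mevalC.
Qed.

(** Induction on [n - size s]. If some component through [x0] is larger than the point, a linear
    form through [x0] that cuts every component other than that point is added to the equations. The
    top of the chain found for these is properly contained in a component of the original set, which
    extends it by one. Otherwise [x0] is isolated and there are at least [n] equations. *)
Lemma chain_through_point (s : seq P) (x0 : pt) :
  (forall g, g \in s -> g.@[x0] = 0) ->
  exists r X, (n <= size s + r)%N /\
    chain_at (fun x => forall g, g \in s -> g.@[x] = 0) x0 r X.
Proof.
have [m] := ubnP (n - size s); elim: m s => [//|m IH] s lt s0.
have one : exists X, chain_at (fun x => forall g, g \in s -> g.@[x] = 0) x0 0 X.
  exists (fun=> eq x0); split=> // i _; split=> //; first exact: irreducible_point.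
  by move=> x <-.
have [ns|sn] := leqP n (size s).
  by have [X HX] := one; exists 0%N, X; rewrite addn0.
have clV : closed_set (fun x : pt => forall g, g \in s -> g.@[x] = 0).
  by exists (fun g => g \in s).
have [R [W [irW VW]]] := irreducible_decomposition clV.
have [HW|noW] := classic (exists j, W j x0 /\ ~ (forall x, W j x -> x = x0)); last first.
  (* The product of these [h j] separates [x0] from all components that miss it, as [isolated_zero]
     requires. *)
  have /dep_choice [h Hh] j : exists h : P, h.@[x0] != 0 /\ (~ W j x0 -> vanishing (W j) h).
    have [Wx|nW] := classic (W j x0); first by exists 1; rewrite meval1 oner_eq0.
    have [clW _ _] := irW j.
    apply: NNPP => no; apply: nW; apply: closed_vanishing clW _ => f fv.
    by apply/eqP/negPn/negP => f0; apply: no; exists f.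
  have ns : (n <= size s)%N.
    apply: (@isolated_zero s (\prod_j h j) x0) => //.
      by rewrite rmorph_prod; apply/prodf_neq0 => j _; case: (Hh j).
    move=> x Hx; have [j Wjx] := (VW x).1 Hx.
    have [Wx0|nW] := classic (W j x0).
      right; have [//|ne] := classic (x = x0).
      by case: noW; exists j; split=> // /(_ x Wjx).
    by left; rewrite rmorph_prod (bigD1 j) //= (Hh j).2 // mul0r.
  by lia.
have /dep_choice [y Hy] j : exists y, W j y /\ (~ (forall x, W j x -> x = x0) -> y <> x0).
  have [_ [y Wy] _] := irW j.
  have [H|H] := classic (forall x, W j x -> x = x0); first by exists y.
  have [z [Wz zx]] := not_forall_imply H.
  by exists z.
have [l [l0 ly]] := avoiding_form y x0.
have [||r [X [nr [X1 X2]]]] := IH (l :: s); first by move=> /=; lia.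
  by move=> g; rewrite inE => /orP [/eqP ->|/s0].
have [irX subX X0] := X1 r (leqnn r).
have [j [Wj Wx Wn]] : exists j, [/\ forall x, X r x -> W j x, W j x0 & ~ (forall x, W j x -> x = x0)].
  have [j Hj] : exists j, forall x, X r x -> W j x.
    apply: irreducible_union irX _ _ => [j|x /subX Hx]; first by case: (irW j).
    by apply/VW => g gs; apply: Hx; rewrite inE gs orbT.
  (* If the component found is the point itself, so is the top of the chain, and any larger
     component through [x0] will do. *)
  have [H|H] := classic (forall x, W j x -> x = x0); last by exists j; split=> //; apply: Hj.
  have [j' [W1 W2]] := HW; exists j'; split=> // x /Hj /H -> //.
exists r.+1, (fun i => if (i <= r)%N then X i else W j); split.
  by move: nr => /=; lia.
split=> i ir.
  case: leqP => H; last by split=> // x Wjx; apply/VW; exists j.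
  have [H1 H2 H3] := X1 i H; split=> // x /H2 Hx g gs; by apply: Hx; rewrite inE gs orbT.
have [{}ir|ir'] := ltnP i r; first by rewrite (ltnW ir); apply: X2.
have -> : i = r by lia.
rewrite leqnn.
split=> // H; have [Wy yx] := Hy j.
have := ly j (yx Wn); rewrite (subX _ (H _ Wy)) ?eqxx //; exact: mem_head.
Qed.

(** [g i] vanishes on [X i] but not on [X i.+1]. A relation on [X l.+1] can be divided by the least
    power of [g l] that occurs; restricting the quotient to [X l] keeps only the terms of that
    exponent and shortens the relation. The factor [f] is harmless because [X r] is irreducible and
    [f] is non-zero at [x0]. *)
Lemma chain_alg_indep V x0 r X (f : P) : chain_at V x0 r X -> f.@[x0] != 0 ->
  exists g : 'I_r -> P, alg_indep (fun x => X r x /\ f.@[x] != 0) (fun i x => (g i).@[x]).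
Proof.
move=> [X1 X2] f0.
have /dep_choice [g Hg] (i : 'I_r) : exists g : P, vanishing (X i) g /\ ~ vanishing (X i.+1) g.
  have [_ ne] := X2 i (ltn_ord i); apply: NNPP => no; apply: ne => x Xx.
  have [[cl _ _] _ _] := X1 i (ltnW (ltn_ord i)).
  apply: closed_vanishing cl _ => h hv; apply: NNPP => hx; apply: no; exists h; split=> //.
  by move/(_ x Xx).
exists g => t c Hc.
have claim l : (l <= r)%N -> forall c : {ffun 'I_r -> 'I_t.+1} -> k,
   (forall e e', c e != 0 -> c e' != 0 -> forall i : 'I_r, (l <= i)%N -> e i = e' i) ->
   vanishing (X l) (\sum_e c e *: \prod_(i < r | (i < l)%N) g i ^+ e i) ->
   forall e, c e = 0.
  elim: l {c Hc} => [|l IH] lr c Hc Hv e.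
    have [[_ [x Xx] _] _ _] := X1 0%N lr.
    apply/eqP/negPn/negP => ce.
    have := Hv x Xx; rewrite raddf_sum (bigD1 e) //= [X in _ + X]big1 ?addr0.
      rewrite big_pred0 // mevalZ meval1 mulr1 => E; by rewrite E eqxx in ce.
    move=> e' ne; have [->|ce'] := eqVneq (c e') 0; first by rewrite scale0r meval0.
    by case/eqP: ne; apply/ffunP => i; apply: Hc.
  pose il := Ordinal lr.
  apply/eqP/negPn/negP => ce.
  have ex : exists j, [exists e, (c e != 0) && (e il == j :> nat)].
    by exists (e il : nat); apply/existsP; exists e; rewrite ce eqxx.
  case: (ex_minnP ex) => j /existsP [e1 /andP [ce1 /eqP e1j]] jmin.
  have jle e' : c e' != 0 -> (j <= e' il)%N.
    by move=> ce'; apply: jmin; apply/existsP; exists e'; rewrite ce' eqxx.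
  (* The relation divided by the common factor [g il ^+ j], with [j] the least exponent of [g il] in
     it. *)
  pose F := \sum_e c e *: ((\prod_(i < r | (i < l)%N) g i ^+ e i) * g il ^+ (e il - j)).
  have FE : \sum_e c e *: \prod_(i < r | (i < l.+1)%N) g i ^+ e i = F * g il ^+ j.
    rewrite mulr_suml; apply: eq_bigr => e' _.
    have [->|ce'] := eqVneq (c e') 0; first by rewrite !scale0r mul0r.
    rewrite -scalerAl; congr (_ *: _); rewrite -mulrA -exprD subnK ?jle //.
    rewrite (bigD1 il) //= mulrC; congr (_ * _); apply: eq_bigl => i.
    by rewrite [RHS]ltn_neqAle andbC.
  have [irX _ _] := X1 l.+1 lr.
  have FX : vanishing (X l.+1) F.
    move: Hv; rewrite FE; elim: (j) => [|j' IHj]; first by rewrite mulr1.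
    rewrite exprS mulrCA => /(irreducible_mul irX) [|/IHj //].
    by case: (Hg il).
  pose c' (e' : {ffun 'I_r -> 'I_t.+1}) := if e' il == j :> nat then c e' else 0.
  have := IH (ltnW lr) c' _ _ e1; rewrite /c' e1j eqxx => H; move/eqP: ce1; apply; apply: H.
    move=> e2 e3; have [E2|_] := eqVneq (e2 il : nat) j; last by rewrite eqxx.
    have [E3|_] := eqVneq (e3 il : nat) j; last by rewrite eqxx.
    move=> c2 c3 i; rewrite leq_eqVlt => /orP [/eqP li|]; last exact: Hc.
    have -> : i = il by apply: val_inj.
    by apply: val_inj; rewrite /= E3.
  move=> x Xx; have [sub _] := X2 l lr; rewrite -[RHS](FX x (sub x Xx)) !raddf_sum /=.
  apply: eq_bigr => e' _; rewrite !mevalZ mevalM rmorphXn /=.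
  case: eqP => [->|ne]; first by rewrite subnn mulr1.
  have [->|ce'] := eqVneq (c e') 0; first by rewrite !mul0r.
  rewrite ((Hg il).1 x Xx) expr0n subn_eq0 leqNgt ltn_neqAle jle // andbT eq_sym.
  by have /eqP/negPf -> := ne; rewrite mulr0 mulr0 mul0r.
apply: (claim r (leqnn r)).
  by move=> e e' _ _ i; rewrite leqNgt ltn_ord.
have [irX _ Xx0] := X1 r (leqnn r).
set G := \sum_e _; have : vanishing (X r) (f * G).
  move=> x Xx; rewrite mevalM; have [->|fx] := eqVneq (f.@[x]) 0; first by rewrite mul0r.
  rewrite -[RHS](mulr0 (f.@[x])) -(Hc x (conj Xx fx)); congr (_ * _).
  rewrite raddf_sum; apply: eq_bigr => e _; rewrite /= mevalZ rmorph_prod; congr (_ * _).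
  by apply: eq_big => i; rewrite ?ltn_ord // => _; rewrite rmorphXn.
case/(irreducible_mul irX) => // /(_ x0 Xx0) E; by rewrite E eqxx in f0.
Qed.

End Local.

(** * Matrices supported on coordinate sets *)

Section Projectors.

Context (k : fieldType) (E : nat).

Local Notation mx := 'M[k]_E.

Definition pr (S : {set 'I_E}) : mx := diag_mx (\row_j (j \in S)%:R).

Lemma pr_mulE S p (A : 'M[k]_(E, p)) i j : (pr S *m A) i j = if i \in S then A i j else 0.
Proof. by rewrite mul_diag_mx !mxE; case: (i \in S); rewrite ?mul1r ?mul0r. Qed.

Lemma mul_prE S p (A : 'M[k]_(p, E)) i j : (A *m pr S) i j = if j \in S then A i j else 0.
Proof. by rewrite mul_mx_diag !mxE; case: (j \in S); rewrite ?mulr1 ?mulr0. Qed.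

Lemma prE S i j : pr S i j = ((i == j) && (i \in S))%:R.
Proof. by rewrite !mxE; have [->|ne] := eqVneq i j. Qed.

Lemma pr_pr S T : pr S *m pr T = pr (S :&: T).
Proof.
apply/matrixP => i j; rewrite pr_mulE !prE inE.
by case: (i \in S); rewrite // andbF.
Qed.

Lemma pr_id S : pr S *m pr S = pr S.
Proof. by rewrite pr_pr setIid. Qed.

Lemma pr0 : pr set0 = 0.
Proof. by apply/matrixP => i j; rewrite prE inE andbF mxE. Qed.

Lemma prT : pr setT = 1%:M.
Proof. by apply/matrixP => i j; rewrite prE inE andbT mxE. Qed.

Lemma pr_sub (S T : {set 'I_E}) : S \subset T -> pr S *m pr T = pr S.
Proof. by move=> ST; rewrite pr_pr (setIidPl ST). Qed.

Lemma pr_subr (S T : {set 'I_E}) : S \subset T -> pr T *m pr S = pr S.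
Proof. by move=> ST; rewrite pr_pr (setIidPr ST). Qed.

Lemma pr_setD (S T : {set 'I_E}) : T \subset S -> pr T + pr (S :\: T) = pr S.
Proof.
move=> TS; apply/matrixP => i j; rewrite mxE !prE !inE.
case: (i == j) => /=; last by rewrite addr0.
case iT: (i \in T) => /=; last by rewrite add0r.
by rewrite (subsetP TS) // addr0.
Qed.

Lemma prD_pr S T : pr (S :\: T) *m pr T = 0.
Proof. by rewrite pr_pr setDE -setIA [_ :&: T]setIC setICr setI0 pr0. Qed.

Lemma pr_prD S T : pr T *m pr (S :\: T) = 0.
Proof. by rewrite pr_pr setDE setIA [T :&: S]setIC -setIA setICr setI0 pr0. Qed.

Lemma rank_pr S : \rank (pr S) = #|S|.
Proof.
pose F : 'M[k]_(E, #|S|) := \matrix_(i, j) (i == enum_val j)%:R.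
have FF : F^T *m F = 1%:M.
  apply/matrixP => a b; rewrite !mxE (bigD1 (enum_val a)) //= !mxE eqxx mul1r big1 ?addr0.
    by rewrite (inj_eq enum_val_inj).
  by move=> i /negPf ne; rewrite !mxE ne mul0r.
have -> : pr S = F *m F^T.
  apply/matrixP => a b; rewrite prE !mxE.
  have [aS|aS] := boolP (a \in S); last first.
    rewrite andbF big1 // => j _; rewrite !mxE; case: eqP => [E0|]; last by rewrite mul0r.
    by rewrite E0 enum_valP in aS.
  rewrite andbT (bigD1 (enum_rank_in aS a)) //= !mxE enum_rankK_in // eqxx mul1r big1 ?addr0.
    by rewrite eq_sym.
  move=> j ne; rewrite !mxE; case: eqP => [E0|]; last by rewrite mul0r.
  by case/eqP: ne; apply: enum_val_inj; rewrite enum_rankK_in.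
apply/eqP; rewrite eqn_leq; apply/andP; split.
  exact: leq_trans (mulmx_max_rank _ _).
have := mulmx_max_rank F^T F; rewrite FF => _.
have : (\rank (F^T *m (F *m F^T) *m F) <= \rank (F *m F^T))%N.
  exact: leq_trans (mxrankM_maxl _ _) (mxrankM_maxr _ _).
by rewrite mulmxA FF mul1mx FF mxrank1.
Qed.

Lemma sub_prP S p (A : 'M[k]_(p, E)) : reflect (A *m pr S = A) (A <= pr S)%MS.
Proof.
apply: (iffP idP) => [/submxP [B ->]|<-]; last exact: submxMl.
by rewrite -mulmxA pr_id.
Qed.

Definition supp S T (A : mx) : Prop := pr S *m A = A /\ A *m pr T = A.

Lemma suppE S T A i j : supp S T A -> A i j != 0 -> (i \in S) && (j \in T).
Proof.
move=> [<- <-]; rewrite mul_prE pr_mulE; case: (j \in T); last by rewrite eqxx.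
by case: (i \in S); rewrite ?eqxx.
Qed.

Lemma supp_out S T A i j : supp S T A -> ~~ ((i \in S) && (j \in T)) -> A i j = 0.
Proof. by move=> sA; apply: contraNeq; apply: suppE. Qed.

Lemma supp_cut S T A : supp S T (pr S *m A *m pr T).
Proof. by split; rewrite -?mulmxA ?pr_id // !mulmxA pr_id. Qed.

(* Reduced echelon form: a subspace is the graph of a linear map over a set of
   pivot columns. *)
Lemma chart S p (U : 'M[k]_(p, E)) : (U <= pr S)%MS ->
  exists (T : {set 'I_E}) (u : mx),
    [/\ T \subset S, supp T (S :\: T) u, #|T| = \rank U & (U :=: pr T *m (1%:M + u))%MS].
Proof.
move=> US; set r := \rank U.
have [f [B' [finj B'f B'U]]] : exists (f : 'I_r -> 'I_E) (B' : 'M[k]_(r, E)),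
    [/\ injective f, forall a b, B' a (f b) = (a == b)%:R & (B' :=: U)%MS].
  pose B := row_base U.
  have fullB : row_full B^T by rewrite /row_full mxrank_tr eq_row_base.
  pose f := fullrankfun fullB; pose C := (rowsub f B^T)^T.
  have Cu : C \in unitmx by rewrite unitmx_tr -row_full_unit; apply: mxrowsub_fullrank_full || apply: fullrowsub_full.
  exists f, (invmx C *m B); split; first exact: fullrankfun_inj.
    move=> a b; have : (invmx C *m C) a b = (a == b)%:R by rewrite mulVmx // mxE.
    by rewrite !mxE => <-; apply: eq_bigr => c _; rewrite !mxE.
  apply: eqmx_trans (eq_row_base U); apply: eqmxMfull; by rewrite row_full_unit unitmx_inv.
pose T := [set f a | a : 'I_r].
pose F : 'M[k]_(E, r) := \matrix_(i, a) (i == f a)%:R.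
have FF : F^T *m F = 1%:M.
  apply/matrixP => a b; rewrite !mxE (bigD1 (f a)) //= !mxE eqxx mul1r big1 ?addr0.
    by rewrite (inj_eq finj).
  by move=> i /negPf ne; rewrite !mxE ne mul0r.
have FT : F *m F^T = pr T.
  apply/matrixP => a b; rewrite prE !mxE; have [/imsetP [c _ ->]|aT] := boolP (a \in T).
    rewrite andbT (bigD1 c) //= !mxE eqxx mul1r big1 ?addr0; first by rewrite eq_sym.
    by move=> i ne; rewrite !mxE (inj_eq finj) eq_sym (negPf ne) mul0r.
  rewrite andbF big1 // => c _; rewrite !mxE; case: eqP => [E0|]; last by rewrite mul0r.
  by case/negP: aT; rewrite E0; apply: imset_f.
have B'F : B' *m F = 1%:M.
  apply/matrixP => a b; rewrite !mxE (bigD1 (f b)) //= !mxE eqxx mulr1 big1 ?addr0 //.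
  by move=> i /negPf ne; rewrite !mxE ne mulr0.
have B'S : B' *m pr S = B' by apply/sub_prP; rewrite B'U.
have TS : T \subset S.
  apply/subsetP => i /imsetP [a _ ->]; apply/negPn/negP => nS.
  have := B'f a a; rewrite -B'S mul_prE (negPf nS) eqxx => /eqP.
  by rewrite eq_sym oner_eq0.
pose u := F *m B' *m (1%:M - pr T).
have Tu : pr T *m u = u by rewrite /u -FT -!mulmxA ![F^T *m (F *m _)]mulmxA FF !mul1mx.
have FB : pr T *m (1%:M + u) = F *m B'.
  rewrite mulmxDr mulmx1 Tu /u mulmxBr mulmx1 -FT mulmxA -(mulmxA F B' F) B'F mulmx1.
  by rewrite addrC subrK.
exists T, u; split=> //.
- split=> //; rewrite /u -mulmxA mulmxBl mul1mx pr_prD subr0 -!mulmxA; congr (F *m _).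
  by rewrite mulmxBr mulmx1 -{2}B'S -(pr_setD TS) mulmxDr addrAC subrr add0r.
- by rewrite card_imset // card_ord.
- rewrite FB; apply: eqmx_trans (eqmx_sym B'U) _; apply/eqmxP; rewrite submxMl andbT.
  by rewrite -{1}[B']mul1mx -FF -mulmxA submxMl.
Qed.

End Projectors.

Lemma tr_pr (k : fieldType) E (T : {set 'I_E}) : (pr k T)^T = pr k T.
Proof.
by apply/matrixP => a b; rewrite mxE !prE; case: eqVneq => [->|].
Qed.

(** * Composites along an arm *)

Section Composites.

Context (k : fieldType) (E : nat).

Local Notation mx := 'M[k]_E.

Implicit Type F : nat -> mx.

Fixpoint path F (a l : nat) : mx :=
  if l is l'.+1 then F a *m path F a.+1 l' else 1%:M.

Definition cp F (a b : nat) : mx := path F a (b - a).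

Lemma cp_id F a : cp F a a = 1%:M.
Proof. by rewrite /cp subnn. Qed.

Lemma cp_l F a b : (a < b)%N -> cp F a b = F a *m cp F a.+1 b.
Proof. by move=> ab; rewrite /cp -(subnSK ab). Qed.

Lemma cp_cat F a b c : (a <= b)%N -> (b <= c)%N -> cp F a c = cp F a b *m cp F b c.
Proof.
move=> ab bc; have := subnK ab; move: (b - a)%N => l; elim: l a {ab} => [|l IH] a.
  by rewrite add0n => ->; rewrite cp_id mul1mx.
rewrite addSnnS => H; have lt : (a < b)%N by lia.
by rewrite (cp_l _ lt) cp_l ?(leq_trans lt) // (IH a.+1) // mulmxA.
Qed.

Lemma cp1 F a : cp F a a.+1 = F a.
Proof. by rewrite cp_l // cp_id mulmx1. Qed.

Lemma cp_r F a b : (a <= b)%N -> cp F a b.+1 = cp F a b *m F b.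
Proof. by move=> ab; rewrite (@cp_cat F a b) // cp1. Qed.

Lemma eq_cp F G a b : (forall j, (a <= j < b)%N -> F j = G j) -> cp F a b = cp G a b.
Proof.
have [ab|ba] := leqP a b; last by move=> _; rewrite /cp (_ : b - a = 0)%N //; lia.
have := subnK ab; move: (b - a)%N => l; elim: l a {ab} => [|l IH] a.
  by rewrite add0n => ->; rewrite !cp_id.
rewrite addSnnS => H FG; have lt : (a < b)%N by lia.
rewrite !(cp_l _ lt) FG ?leqnn // (IH a.+1) // => j ajb; apply: FG; lia.
Qed.

Lemma cp_supp F (S : nat -> {set 'I_E}) a b : (a < b)%N ->
  (forall j, (a <= j < b)%N -> supp (S j) (S j.+1) (F j)) -> supp (S a) (S b) (cp F a b).
Proof.
move=> ab H; split.
  by rewrite cp_l // mulmxA (H a _).1 ?leqnn.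
case: b ab H => // b ab H; rewrite cp_r // -mulmxA (H b _).2 //; lia.
Qed.

End Composites.

Lemma sum_sig (V : nmodType) (I : finType) (p : pred I) (F : I -> V) :
  \sum_(d : {i | p i}) F (val d) = \sum_(i | p i) F i.
Proof.
rewrite [RHS](reindex_omap (val : {x | p x} -> I) insub) /=; last first.
  by move=> i pi; rewrite insubT.
by apply: eq_bigl => -[x px]; rewrite px insubT eqxx.
Qed.

(** * Parametrizations by matrices with prescribed support *)

Section GrowthTools.

Context (k : fieldType).

Lemma alg_trans (I J : finType) X (P : X -> Prop) (z : I -> X -> k) (w : J -> X -> k) f :
  (forall i, in_alg_gen P w (z i)) -> in_alg_gen P z f -> in_alg_gen P w f.
Proof.
move=> Hz [t [s _ Hs]].
apply: (@alg_eq _ _ _ _ _ (fun x => \sum_(ce <- s) ce.1 * monof z ce.2 x)).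
  by move=> x /Hs.
apply: alg_sum_seq => ce _; apply: algM; first exact: alg_const.
by rewrite /monof; apply: alg_prod_seq => i _; apply: algX.
Qed.

Lemma mx_alg_trans (I J : finType) X (P : X -> Prop) (z : I -> X -> k) (w : J -> X -> k)
    m n (A : X -> 'M[k]_(m, n)) :
  (forall i, in_alg_gen P w (z i)) -> mx_alg P z A -> mx_alg P w A.
Proof. by move=> H HA i j; apply: alg_trans (HA i j). Qed.

Lemma growth_le_empty (I : finType) X (P : X -> Prop) (z : I -> X -> k) D :
  ~ (exists x, P x) -> growth_le P z D.
Proof.
move=> no; exists 1%N => t; exists void, (fun v : void => match v with end).
rewrite card_void; split=> // e _; exists (fun v : void => match v with end) => x Px.
by case: no; exists x.
Qed.

Lemma growth_le_image (I : finType) X X' (P : X -> Prop) (P' : X' -> Prop) (h : X' -> X)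
    (z : I -> X -> k) D :
  (forall x, P x -> exists x', P' x' /\ forall i, z i x = z i (h x')) ->
  growth_le P' (fun i x' => z i (h x')) D -> growth_le P z D.
Proof.
move=> H G; have [[x0 Px0]|] := classic (exists x, P x); last exact: growth_le_empty.
have [x0' _] := H x0 Px0.
have /dep_choice [g Hg] x : exists x', P x -> P' x' /\ forall i, z i x = z i (h x').
  by have [/H [x' Hx']|nP] := classic (P x); [exists x'|exists x0'].
have := growth_le_sub (h := g) (fun x Px => (Hg x Px).1) G.
apply: growth_le_alg => i; apply: (@alg_eq _ _ _ _ _ (fun x => z i (h (g x)))).
  by move=> x /Hg [_ ->].
exact: (@alg_var _ _ _ _ (fun i x => z i (h (g x)))).
Qed.

Definition pairf (I J : finType) X (z : I -> X -> k) (y : J -> X -> k) (i : I + J) (x : X) :=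
  match i with inl i => z i x | inr j => y j x end.

Lemma mx_alg_pairl (I J : finType) X (P : X -> Prop) (z : I -> X -> k) (w : J -> X -> k)
    m n (A : X -> 'M[k]_(m, n)) : mx_alg P z A -> mx_alg P (pairf z w) A.
Proof.
by apply: mx_alg_trans => i; apply: (@alg_var _ _ _ _ (pairf z w) (inl i)).
Qed.

Lemma mx_alg_pairr (I J : finType) X (P : X -> Prop) (z : I -> X -> k) (w : J -> X -> k)
    m n (A : X -> 'M[k]_(m, n)) : mx_alg P w A -> mx_alg P (pairf z w) A.
Proof.
by apply: mx_alg_trans => i; apply: (@alg_var _ _ _ _ (pairf z w) (inr i)).
Qed.

Lemma mx_alg_path E (I : finType) X (P : X -> Prop) (z : I -> X -> k)
    (F : X -> nat -> 'M[k]_E) a b :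
  (forall j, (a <= j < b)%N -> mx_alg P z (fun x => F x j)) ->
  mx_alg P z (fun x => cp (F x) a b).
Proof.
have [ab|ba] := leqP a b; last first.
  move=> _; rewrite /cp (_ : b - a = 0)%N; last by lia.
  exact: mx_alg_const.
have := subnK ab; move: (b - a)%N => l; elim: l a {ab} => [|l IH] a.
  by rewrite add0n => -> _; apply: mx_alg_eq (mx_alg_const _ _ 1%:M) => x _; rewrite cp_id.
rewrite addSnnS => H HF; have lt : (a < b)%N by lia.
apply: (@mx_alg_eq _ _ _ _ _ _ _ (fun x => F x a *m cp (F x) a.+1 b)).
  by move=> x _; rewrite (cp_l _ lt).
apply: mx_algM; first by apply: HF; rewrite leqnn.
by apply: IH => // j ajb; apply: HF; lia.
Qed.

Section SupportedMatrices.

Context (E : nat) (J : finType) (X : Type) (P : X -> Prop) (R T : J -> {set 'I_E}).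

Definition slot (C : J -> {set 'I_E}) : finType :=
  {c : J * ('I_E * 'I_E) | (c.2.1 \in R c.1) && (c.2.2 \in C c.1)}.

Lemma card_slot C : #|slot C| = (\sum_j #|R j| * #|C j|)%N.
Proof.
rewrite card_sig -sum1_card (eq_bigl (fun c : J * ('I_E * 'I_E) => true && ((c.2.1 \in R c.1) && (c.2.2 \in C c.1)))) //.
rewrite -(pair_big_dep predT (fun j c => (c.1 \in R j) && (c.2 \in C j)) (fun _ _ => 1%N)) /=.
apply: eq_bigr => j _; rewrite sum1_card -cardsX; apply: eq_card => c.
by rewrite !inE.
Qed.

Lemma sum_slot C (F : J * ('I_E * 'I_E) -> k) :
  \sum_(d : slot C) F (val d) = \sum_(c | (c.2.1 \in R c.1) && (c.2.2 \in C c.1)) F c.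
Proof. exact: (@sum_sig _ _ (fun c => (c.2.1 \in R c.1) && (c.2.2 \in C c.1)) F). Qed.

Lemma free_matrices (C : J -> {set 'I_E}) (Y : J -> X -> 'M[k]_E) :
  (forall x, P x -> forall j, supp (R j) (C j) (Y j x)) ->
  exists z : slot C -> X -> k,
    growth_le P z (\sum_j #|R j| * #|C j|)%N /\ forall j, mx_alg P z (Y j).
Proof.
move=> sY; pose z (c : slot C) x := Y (val c).1 x (val c).2.1 (val c).2.2.
exists z; rewrite -card_slot; split; first exact: growth_le_free.
move=> j a b; have [H|H] := boolP ((a \in R j) && (b \in C j)).
  exact: (@alg_var _ _ _ _ z (exist _ (j, (a, b)) H)).
by apply: alg_eq (alg_const _ _ 0) => x Px; rewrite (supp_out (sY x Px j)).
Qed.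

(* Unknown matrices Y_j subject to the linear equations Y_j W_j = B_j, where
   W_j is onto: each equation lowers the number of parameters by one. *)
Lemma solve_matrices (I : finType) (z : I -> X -> k) (C : J -> {set 'I_E})
    (Y W B : J -> X -> 'M[k]_E) D :
  growth_le P z D -> (exists x, P x) ->
  (forall x, P x -> forall j, supp (R j) (C j) (Y j x)) ->
  (forall j, mx_alg P z (W j)) -> (forall j, mx_alg P z (B j)) ->
  (forall x, P x -> forall j, supp (C j) (T j) (W j x)) ->
  (forall x, P x -> forall j, Y j x *m W j x = B j x) ->
  (forall x, P x -> forall j, R j != set0 -> (pr k (T j) <= W j x)%MS) ->
  exists D' (w : I + slot C -> X -> k),
    [/\ growth_le P w D', (D' + \sum_j #|R j| * #|T j| = D + \sum_j #|R j| * #|C j|)%N,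
        forall i, w (inl i) = z i & forall j, mx_alg P w (Y j)].
Proof.
move=> Gz [x0 Px0] sY aW aB sW eqY surj.
pose y (c : slot C) x := Y (val c).1 x (val c).2.1 (val c).2.2.
have le : (\sum_j #|R j| * #|T j| <= D + \sum_j #|R j| * #|C j|)%N.
  rewrite -[X in (X <= _)%N]add0n leq_add //; apply: leq_sum => j _.
  have [R0|R0] := eqVneq (R j) set0; first by rewrite R0 cards0.
  rewrite leq_mul2l; apply/orP; right; rewrite -(rank_pr k (T j)) -(rank_pr k (C j)).
  apply: leq_trans (mxrankS (surj x0 Px0 j R0)) _.
  by have [<- _] := sW x0 Px0 j; apply: mxrankM_maxl.
exists (D + \sum_j #|R j| * #|C j| - \sum_j #|R j| * #|T j|)%N, (pairf z y).
split=> //; last 2 first.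
- by lia.
- move=> j a b; have [H|H] := boolP ((a \in R j) && (b \in C j)).
    exact: (@alg_var _ _ _ _ (pairf z y) (inr (exist _ (j, (a, b)) H))).
  by apply: alg_eq (alg_const _ _ 0) => x Px; rewrite (supp_out (sY x Px j)).
pose N (c : slot T) (d : slot C) x :=
  ((val c).1 == (val d).1)%:R * ((val c).2.1 == (val d).2.1)%:R * W (val d).1 x (val d).2.2 (val c).2.2.
have sumN (f : J * ('I_E * 'I_E) -> k) (c : slot T) x : P x ->
    (forall d, ~~ ((d.2.1 \in R d.1) && (d.2.2 \in C d.1)) -> f d = 0) ->
    \sum_d N c d x * f (val d) = \sum_b f ((val c).1, ((val c).2.1, b)) * W (val c).1 x b (val c).2.2.
  move=> Px f0.
  pose G (d : J * ('I_E * 'I_E)) := ((val c).1 == d.1)%:R * ((val c).2.1 == d.2.1)%:R * W d.1 x d.2.2 (val c).2.2 * f d.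
  have -> : \sum_d N c d x * f (val d) = \sum_d G d.
    rewrite [RHS](bigID (fun d => (d.2.1 \in R d.1) && (d.2.2 \in C d.1))) /= [X in _ + X]big1 ?addr0.
      by rewrite -(sum_slot C G).
    by move=> d /f0; rewrite /G => ->; rewrite mulr0.
  have -> : \sum_d G d = \sum_j \sum_a \sum_b G (j, (a, b)).
    by under [RHS]eq_bigr do rewrite pair_bigA; rewrite pair_bigA; apply: eq_bigr => -[j [a b]].
  rewrite (bigD1 (val c).1) //= [X in _ + X]big1 ?addr0.
    rewrite (bigD1 (val c).2.1) //= [X in _ + X]big1 ?addr0.
      by apply: eq_bigr => b _; rewrite /G !eqxx !mul1r mulrC.
    by move=> a ne; apply: big1 => b _; rewrite /G [_ == a]eq_sym (negPf ne) mulr0 !mul0r.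
  by move=> a ne; apply: big1 => b _; apply: big1 => b' _; rewrite /G [_ == a]eq_sym (negPf ne) !mul0r.
apply: (@growth_le_fiber _ _ _ (slot T) _ _ _ _ N (fun c x => B (val c).1 x (val c).2.1 (val c).2.2) D) => //.
- move=> c d; apply: algM; first exact: alg_const.
  exact: aW.
- by move=> c; apply: aB.
- move=> x Px c; rewrite -eqY // mxE.
  rewrite (sumN (fun d => Y d.1 x d.2.1 d.2.2)) // => d nd.
  by rewrite (supp_out (sY x Px d.1)).
- move=> x Px v.
  pose V j : 'M[k]_E := \matrix_(a, b) if insub (j, (a, b)) is Some c then v c else 0.
  have VT j : V j *m pr k (T j) = V j.
    apply/matrixP => a b; rewrite mul_prE !mxE; case: ifP => // bT.
    by case: insubP => // c /andP [_]; rewrite bT.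
  have /dep_choice [U HU] j : exists U, R j != set0 -> U *m W j x = V j.
    have [R0|R0] := eqVneq (R j) set0; first by exists 0.
    have /submxP [L HL] := surj x Px j R0.
    by exists (V j *m L) => _; rewrite -mulmxA -HL.
  exists (fun d => (pr k (R (val d).1) *m U (val d).1 *m pr k (C (val d).1)) (val d).2.1 (val d).2.2) => c.
  rewrite (sumN (fun d => (pr k (R d.1) *m U d.1 *m pr k (C d.1)) d.2.1 d.2.2)) //; last first.
    by move=> d nd; rewrite (supp_out (supp_cut _ _ _)).
  case: c => -[j [a b]] Hc; have /andP [/= aR bT] := Hc.
  have R0 : R j != set0 by apply/set0Pn; exists a.
  have : (pr k (R j) *m U j *m pr k (C j) *m W j x) a b = v (exist _ (j, (a, b)) Hc).
    rewrite -mulmxA (sW x Px j).1 -mulmxA HU // pr_mulE aR mxE.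
    by case: insubP => [c _ E0|]; [congr v; apply: val_inj|rewrite Hc].
  by rewrite mxE => <-.
- by rewrite !card_slot subnK.
Qed.

End SupportedMatrices.

End GrowthTools.

(** * Codimension of classes of modules *)

Section PaddedModules.

Context (k : closedFieldType) (C : canonicalData k) (E : nat).

Local Notation n := (narms C).
Local Notation m := (@arity k C).
Local Notation mx := 'M[k]_E.
Local Notation sets := (vertex C -> {set 'I_E}).

(* Representations of all dimension vectors below E live in the same space of
   matrices, the one of dimension vector d being cut out by supports S with
   |S x| = d x. Rows are acted upon from the right, so that a submodule is a
   family of row spaces. *)
Definition prep := 'I_n -> nat -> mx.

Definition isrep (S : sets) (M : prep) : Prop :=
  forall i j, (j < m i)%N -> supp (S (armv i j)) (S (armv i j.+1)) (M i j).

Definition amx (M : prep) (i : 'I_n) : mx := cp (M i) 0 (m i).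

Lemma arity_gt0 (i : 'I_n) : (0 < m i)%N.
Proof. exact: ltnW (arity_gt1 i). Qed.

(* The i-th arm composite is x_i A + y_i B for a point (x_i : y_i) of the
   projective line. *)
Definition slope (i : 'I_n) : k * k :=
  if val i is j.+2 then (1, if insub j is Some u then @coeff k C u else 0)
  else if val i is 1%N then (0, 1) else (1, 0).

(** The Plücker coordinate of the two points on the projective line; it is non-zero because the
    parameters of the arms are distinct. *)
Definition plu (i l : 'I_n) : k := (slope i).1 * (slope l).2 - (slope i).2 * (slope l).1.

Lemma plu_neq0 i l : i != l -> plu i l != 0.
Proof.
have H (a b : 'I_n) : (a < b)%N -> plu a b != 0 /\ plu b a != 0.
  move=> ab; rewrite (_ : plu b a = - plu a b) ?oppr_eq0; last by rewrite /plu; ring.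
  suff : plu a b != 0 by [].
  case: a b ab => [a an] [b bn] /= ab; rewrite /plu /slope /=.
  case: b bn ab => [|[|b]] bn //=; first by case: a an => //= _ _; rewrite mul1r mulr0 subr0 oner_eq0.
  have bn2 : (b < n - 2)%N by lia.
  rewrite (insubT (fun j => (j < n - 2)%N) bn2).
  case: a an => [|[|a]] an ab.
  - by rewrite mul1r mul0r subr0 coeff_neq0.
  - by rewrite mul0r mul1r sub0r oppr_eq0 oner_eq0.
  - have an2 : (a < n - 2)%N by lia.
    rewrite (insubT (fun j => (j < n - 2)%N) an2) /= mul1r mulr1 subr_eq0.
    by apply/eqP => /coeff_inj [] E0; rewrite E0 ltnn in ab.
rewrite neq_ltn => /orP [/H []//|/H []//].
Qed.

(** A symmetric form of the relations: any two arm composites determine the others, so any two arms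
    may be taken as the free ones. *)
Definition rels (M : prep) : Prop := forall i j l,
  plu i j *: amx M l = plu l j *: amx M i + plu i l *: amx M j.

Definition cut (T : sets) (M : prep) : prep :=
  fun i j => pr k (T (armv i j)) *m M i j *m pr k (T (armv i j.+1)).

(** Block triangularity: the coordinate rows in [T] form a submodule. *)
Definition tri (T : sets) (M : prep) : Prop := forall i j, (j < m i)%N ->
  pr k (T (armv i j)) *m M i j *m pr k (T (armv i j.+1)) = pr k (T (armv i j)) *m M i j.

Lemma isrep_cut T M : isrep T (cut T M).
Proof. by move=> i j _; apply: supp_cut. Qed.

(* The number of coordinates minus the number of relations. *)
Definition Ed (d : dimvec C) : int :=
  \sum_(a : arrow C) (d (tgt a))%:Z * (d (src a))%:Z
  - (n - 2)%:Z * ((d (v0 C))%:Z * (d (voo C))%:Z).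

(** Minus the Euler form of the algebra at [(e, d)]. For a submodule of dimension [d] with quotient
    of dimension [e] it counts the entries that vanish, minus the relations in that block, minus the
    parameters of the choice of the submodule. *)
Definition chi (d e : dimvec C) : int :=
  \sum_(a : arrow C) (d (tgt a))%:Z * (e (src a))%:Z
  - (n - 2)%:Z * ((d (v0 C))%:Z * (e (voo C))%:Z) - \sum_x (d x)%:Z * (e x)%:Z.

Definition coords : finType := (arrow C * ('I_E * 'I_E))%type.

Definition cz (c : coords) (M : prep) : k := M (tag c.1) (tagged c.1) c.2.1 c.2.2.

(* Codimension at least c, relative to the expected dimension. *)
Definition cod (P : prep -> Prop) (d : dimvec C) (c : int) : Prop :=
  (exists M, P M) -> exists D : nat, D%:Z + c <= Ed d /\ growth_le P cz D.

Lemma cod_sub (P Q : prep -> Prop) d c :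
  (forall M, P M -> Q M) -> cod Q d c -> cod P d c.
Proof.
move=> PQ H [M PM]; have [D [HD G]] := H (ex_intro _ M (PQ M PM)).
exists D; split=> //; exact: (growth_le_sub (h := id) PQ G).
Qed.

Lemma cod_weak (P : prep -> Prop) d c c' : c' <= c -> cod P d c -> cod P d c'.
Proof.
move=> cc H /H [D [HD G]]; exists D; split=> //.
by lia.
Qed.

Lemma cod_cover (F : finType) (P : prep -> Prop) (Q : F -> prep -> Prop) d c :
  (forall M, P M -> exists f, Q f M) -> (forall f, cod (Q f) d c) -> cod P d c.
Proof.
move=> cov HQ [M PM].
have [D HD] : exists D : nat, D%:Z = Ed d - c.
  have [f QfM] := cov M PM; have [D [HD _]] := HQ f (ex_intro _ M QfM).
  have : 0 <= Ed d - c by lia.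
  by case: (Ed d - c) => // D' _; exists D'.
exists D; split; first by lia.
apply: growth_le_cover cov _ => f.
have [ne|] := classic (exists M, Q f M); last exact: growth_le_empty.
by have [D' [HD' G]] := HQ f ne; apply: growth_le_weak G; lia.
Qed.

Lemma codI (P : prep -> Prop) d c (I : finType) (z : I -> prep -> k) D :
  growth_le P z D -> D%:Z + c <= Ed d ->
  (forall i j, (j < m i)%N -> mx_alg P z (fun M => M i j)) -> cod P d c.
Proof.
move=> G HD Hz _; exists D; split=> //.
by apply: growth_le_alg G => c0; apply: Hz.
Qed.

Lemma cod_image X (P : prep -> Prop) (P' : X -> Prop) (h : X -> prep) d c
    (I : finType) (z : I -> X -> k) D :
  (forall M, P M -> exists x, P' x /\ forall i j, (j < m i)%N -> M i j = h x i j) ->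
  growth_le P' z D -> D%:Z + c <= Ed d ->
  (forall i j, (j < m i)%N -> mx_alg P' z (fun x => h x i j)) -> cod P d c.
Proof.
move=> H G HD Hz _; exists D; split=> //.
apply: (@growth_le_image _ _ _ _ _ P' h).
  by move=> M /H [x [Px Ex]]; exists x; split=> // -[a [b c0]]; rewrite /cz Ex.
by apply: growth_le_alg G => c0; apply: Hz.
Qed.

Lemma sum_arrow (V : nmodType) (F : forall i : 'I_n, nat -> V) :
  \sum_(a : arrow C) F (tag a) (tagged a) = \sum_(i < n) \sum_(j < m i) F i j.
Proof. by rewrite [RHS]sig_big_dep. Qed.

Lemma sum_first (V : nmodType) (p : pred 'I_n) (f : 'I_n -> V) :
  \sum_(a : arrow C) (if p (tag a) && (tagged a == 0 :> nat)%N then f (tag a) else 0)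
  = \sum_(i | p i) f i.
Proof.
rewrite (sum_arrow (fun i j => if p i && (j == 0)%N then f i else 0)) [RHS]big_mkcond.
apply: eq_bigr => i _; rewrite (bigD1 (Ordinal (arity_gt0 i))) //= andbT big1 ?addr0 //.
move=> j; rewrite -val_eqE => /negPf ->; by rewrite andbF.
Qed.

Lemma card_pivots (i j : 'I_n) : i != j -> #|[pred l | (l != i) && (l != j)]| = (n - 2)%N.
Proof.
move=> ij; have := cardC (pred2 i j); rewrite card2 ij => E0.
have -> : #|[pred l | (l != i) && (l != j)]| = #|[predC pred2 i j]|.
  by apply: eq_card => l; rewrite !inE negb_or.
have E1 : (2 + #|[predC pred2 i j]|)%N = n by rewrite -[RHS]card_ord.
move: E1; move: #|_| => c; lia.
Qed.

(* In a rep whose relations involve A_i and A_j as free data, the others are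
   solved for the first edge of each remaining arm. *)
Lemma solve_first (X : Type) (P : X -> Prop) (h : X -> prep) (R0 Roo : {set 'I_E})
    (R1 : 'I_n -> {set 'I_E}) (i j : 'I_n) (I : finType) (z : I -> X -> k) D
    (Y W B : 'I_n -> X -> mx) :
  i != j -> growth_le P z D -> (exists x, P x) ->
  (forall l, l != i -> l != j -> forall x, P x ->
     [/\ supp R0 (R1 l) (Y l x), supp (R1 l) Roo (W l x), Y l x *m W l x = B l x
       & R0 != set0 -> (pr k Roo <= W l x)%MS]) ->
  (forall l, l != i -> l != j -> mx_alg P z (W l) /\ mx_alg P z (B l)) ->
  exists D' (I' : finType) (w : I' -> X -> k),
    [/\ growth_le P w D',
        (D' + (n - 2) * (#|R0| * #|Roo|)
          = D + \sum_(l | (l != i) && (l != j)) #|R0| * #|R1 l|)%N,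
        forall f, in_alg_gen P z f -> in_alg_gen P w f
      & forall l, l != i -> l != j -> mx_alg P w (Y l)].
Proof.
move=> ij G ne H HA; pose p l := (l != i) && (l != j).
have Hp l (pl : p l) := H l (proj1 (elimT andP pl)) (proj2 (elimT andP pl)).
pose cd (l : 'I_n) (A : {set 'I_E}) := if p l then A else set0.
pose c0 (l : 'I_n) (A : X -> mx) x := if p l then A x else 0.
have [||||||D' [w [Gw HD' zw Yw]]] := @solve_matrices k E 'I_n X P
   (fun l => cd l R0) (fun l => cd l Roo) I z (fun l => cd l (R1 l))
   (fun l => c0 l (Y l)) (fun l => c0 l (W l)) (fun l => c0 l (B l)) D G ne.
- move=> x Px l; rewrite /cd /c0; case: ifP => [/Hp /(_ x Px) []//|_].
  by split; rewrite ?mulmx0 ?mul0mx.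
- move=> l; rewrite /c0; case pl: (p l); last exact: mx_alg_const.
  by have /andP [li lj] := pl; case: (HA l li lj).
- move=> l; rewrite /c0; case pl: (p l); last exact: mx_alg_const.
  by have /andP [li lj] := pl; case: (HA l li lj).
- move=> x Px l; rewrite /cd /c0; case: ifP => [/Hp /(_ x Px) []//|_].
  by split; rewrite ?mulmx0 ?mul0mx.
- move=> x Px l; rewrite /c0; case: ifP => [/Hp /(_ x Px) []//|_].
  by rewrite mul0mx.
- move=> x Px l; rewrite /cd /c0; case: ifP => [/Hp /(_ x Px) []//|_].
  by rewrite eqxx.
exists D', (I + slot (fun l => cd l R0) (fun l => cd l (R1 l)))%type, w; split=> //.
- have E1 (A : 'I_n -> {set 'I_E}) :
     (\sum_l #|cd l R0| * #|cd l (A l)| = \sum_(l | p l) #|R0| * #|A l|)%N.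
    rewrite [RHS]big_mkcond; apply: eq_bigr => l _; rewrite /cd.
    by case: (p l); rewrite ?cards0.
  have := HD'; rewrite (E1 (fun=> Roo)) E1 sum_nat_const.
  by rewrite card_pivots.
- move=> f; apply: alg_trans => c; rewrite -zw; exact: alg_var.
- by move=> l li lj; have := Yw l; rewrite /c0 /p li lj.
Qed.

Definition nil_conj (u : vertex C -> mx) (M : prep) : prep :=
  fun i j => (1%:M - u (armv i j)) *m M i j *m (1%:M + u (armv i j.+1)).

Lemma cut_cp (T : sets) (M : prep) i a b : (a <= b)%N -> (b <= m i)%N -> tri T M ->
  pr k (T (armv i a)) *m cp (M i) a b = pr k (T (armv i a)) *m cp (cut T M i) a b.
Proof.
move=> ab bm TM; have := subnK ab; move: (b - a)%N => l; elim: l a {ab} => [|l IH] a.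
  by rewrite add0n => ->; rewrite !cp_id.
rewrite addSnnS => H; have lt : (a < b)%N by lia.
rewrite !(cp_l _ lt) mulmxA -TM; last by lia.
rewrite -[in LHS]mulmxA IH // mulmxA [in RHS]mulmxA /cut.
by rewrite !mulmxA pr_id.
Qed.

Lemma cp_cut (T : sets) (M : prep) i a b : (a < b)%N -> (b <= m i)%N -> tri T M ->
  pr k (T (armv i a)) *m cp (M i) a b = cp (cut T M i) a b.
Proof.
move=> ab bm TM; rewrite cut_cp ?(ltnW ab) //.
have [-> _ //] : supp (T (armv i a)) (T (armv i b)) (cp (cut T M i) a b).
by apply: (@cp_supp _ _ _ (fun j => T (armv i j))) => // j jab; apply: supp_cut.
Qed.

(** An extension is described by its submodule, its quotient, the remaining block, and the unipotent
    change of basis [u]. In that block the relations are linear in the first edges of all arms but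
    two; the surjectivity hypothesis makes these equations independent, so [solve_first] removes
    exactly one parameter for each. *)
Lemma ext_growth (P1 P2 P : prep -> Prop) (T Q : sets) (i j : 'I_n) (d1 d2 d : dimvec C) c1 c2 :
  i != j ->
  (forall x, #|T x| = d1 x) -> (forall x, #|Q x| = d2 x) ->
  (forall x, d x = d1 x + d2 x)%N -> (forall x, T x :&: Q x = set0) ->
  cod P1 d1 c1 -> cod P2 d2 c2 ->
  (forall M, P M -> exists u M',
     [/\ forall x, supp (T x) (Q x) (u x),
         forall i j, (j < m i)%N -> M i j = nil_conj u M' i j,
         isrep (fun x => T x :|: Q x) M' /\ tri T M',
         P1 (cut T M') /\ P2 (cut Q M') &
         rels M' /\ (forall l, l != i -> l != j -> Q (v0 C) != set0 ->
            (pr k (T (voo C)) <= pr k (T (armv l 1)) *m cp (cut T M' l) 1 (m l))%MS)]) ->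
  cod P d (c1 + c2 + chi d1 d2).
Proof.
move=> ij dT dQ dE TQ H1 H2 HP.
pose X := ((vertex C -> mx) * prep)%type.
pose P' (x : X) :=
  [/\ forall v, supp (T v) (Q v) (x.1 v),
      isrep (fun v => T v :|: Q v) x.2 /\ tri T x.2,
      P1 (cut T x.2) /\ P2 (cut Q x.2) &
      rels x.2 /\ (forall l, l != i -> l != j -> Q (v0 C) != set0 ->
         (pr k (T (voo C)) <= pr k (T (armv l 1)) *m cp (cut T x.2 l) 1 (m l))%MS)].
have cov M : P M -> exists x : X, P' x /\ forall i j, (j < m i)%N -> M i j = nil_conj x.1 x.2 i j.
  by move=> /HP [u [M' [h1 h2 h3 h4 h5]]]; exists (u, M').
move=> [M0 PM0]; have [x0 [Px0 _]] := cov M0 PM0.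
have [_ _ [P10 P20] _] := Px0.
have [D1 [HD1 G1]] := H1 (ex_intro _ _ P10); have [D2 [HD2 G2]] := H2 (ex_intro _ _ P20).
have {}G1 : growth_le P' (fun c (x : X) => cz c (cut T x.2)) D1.
  by apply: growth_le_sub G1 => x [_ _ []].
have {}G2 : growth_le P' (fun c (x : X) => cz c (cut Q x.2)) D2.
  by apply: growth_le_sub G2 => x [_ _ []].
pose piv (l : 'I_n) := (l != i) && (l != j).
pose fst_piv (a : arrow C) := piv (tag a) && (tagged a == 0 :> nat)%N.
have [zu [Gu Au]] := @free_matrices k E (vertex C) X P' T Q (fun v x => x.1 v) (fun x Px v => let: And4 a _ _ _ := Px in a v).
(* First edges of the arms other than [i] and [j] are left out here, since the relations will
   determine them. *)
pose off (a : arrow C) (x : X) := if fst_piv a then 0 else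
  pr k (Q (tgt a)) *m x.2 (tag a) (tagged a) *m pr k (T (src a)).
have [zo [Go Ao]] := @free_matrices k E (arrow C) X P'
    (fun a => if fst_piv a then set0 else Q (tgt a)) (fun a => T (src a)) off
    (fun x _ a => ltac:(rewrite /off; case: (fst_piv a);
       [split; rewrite ?mulmx0 ?mul0mx //|exact: supp_cut])).
pose z := pairf (pairf (fun c (x : X) => cz c (cut T x.2)) (fun c (x : X) => cz c (cut Q x.2))) (pairf zu zo).
have Gz : growth_le P' z _ := growth_le_pair (growth_le_pair G1 G2) (growth_le_pair Gu Go).
have A1 l a : (a < m l)%N -> mx_alg P' z (fun x => cut T x.2 l a).
  move=> am; do 2 apply: mx_alg_pairl; move=> b c.
  exact: (@alg_var _ _ _ P' (fun c (x : X) => cz c (cut T x.2)) (Tagged _ (Ordinal am) : arrow C, (b, c))).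
have A2 l a : (a < m l)%N -> mx_alg P' z (fun x => cut Q x.2 l a).
  move=> am; apply: mx_alg_pairl; apply: mx_alg_pairr; move=> b c.
  exact: (@alg_var _ _ _ P' (fun c (x : X) => cz c (cut Q x.2)) (Tagged _ (Ordinal am) : arrow C, (b, c))).
have A3 v : mx_alg P' z (fun x => x.1 v) by apply: mx_alg_pairr; apply: mx_alg_pairl.
have A4 (a : arrow C) : ~~ fst_piv a -> mx_alg P' z (fun x =>
     pr k (Q (tgt a)) *m x.2 (tag a) (tagged a) *m pr k (T (src a))).
  move=> na; have := Ao a; rewrite /off (negPf na) => H.
  by apply: mx_alg_pairr; apply: mx_alg_pairr.
have dec x l a : P' x -> (a < m l)%N -> x.2 l a = cut T x.2 l a + cut Q x.2 l a +
    pr k (Q (armv l a)) *m x.2 l a *m pr k (T (armv l a.+1)).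
  move=> [_ [rM tM] _ _] am; have [e1 e2] := rM l a am.
  have prU v : pr k (T v :|: Q v) = pr k (T v) + pr k (Q v).
    rewrite -(pr_setD k (subsetUl (T v) (Q v))) setDUl setDv set0U; congr (_ + pr k _).
    by apply/setDidPl; rewrite -setI_eq0 setIC TQ.
  rewrite -{1}e1 -{1}e2 !prU !mulmxDl !mulmxDr !mulmxA /cut.
  have -> : pr k (T (armv l a)) *m x.2 l a *m pr k (Q (armv l a.+1)) = 0.
    by rewrite -(tM l a am) -mulmxA pr_pr TQ pr0 mulmx0.
  by rewrite addr0 -!addrA; congr (_ + _); rewrite addrC.
have A5 l a : (a < m l)%N -> ~~ (piv l && (a == 0)%N) -> mx_alg P' z (fun x => x.2 l a).
  move=> am na; apply: mx_alg_eq (mx_algD (mx_algD (A1 l a am) (A2 l a am))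
     (A4 (Tagged _ (Ordinal am) : arrow C) na)) => x Px.
  by rewrite -dec.
have cpA l a : (0 < a)%N -> mx_alg P' z (fun x => cp (x.2 l) a (m l)).
  move=> a0; apply: mx_alg_path => b ab; apply: A5; first by lia.
  by lia.
have amxA l : ~~ piv l -> mx_alg P' z (fun x => amx x.2 l).
  move=> nl; apply: mx_alg_path => b ab; apply: A5; first by [].
  by lia.
pose Y (l : 'I_n) (x : X) := pr k (Q (v0 C)) *m x.2 l 0%N *m pr k (T (armv l 1)).
pose W (l : 'I_n) (x : X) := pr k (T (armv l 1)) *m cp (x.2 l) 1 (m l) *m pr k (T (voo C)).
pose B (l : 'I_n) (x : X) :=
  pr k (Q (v0 C)) *m ((plu i j)^-1 *: (plu l j *: amx x.2 i + plu i l *: amx x.2 j)) *m pr k (T (voo C))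
  - cut Q x.2 l 0%N *m cp (x.2 l) 1 (m l) *m pr k (T (voo C)).
have [||D' [I' [w [Gw HD' zw Yw]]]] := @solve_first X P' (fun x => x.2) (Q (v0 C)) (T (voo C))
    (fun l => T (armv l 1)) i j _ z _ Y W B ij Gz (ex_intro _ x0 Px0).
- move=> l li lj x Px; split; first exact: supp_cut.
  + exact: supp_cut.
  + have [_ [rM tM] _ [relM _]] := Px.
    have := relM i j l; move/(congr1 (fun A => (plu i j)^-1 *: A)).
    rewrite scalerA mulVf ?plu_neq0 // scale1r => relE.
    rewrite /B -relE /Y /W /amx (cp_l _ (arity_gt0 l)).
    have [e1 e2] := rM l 0%N (arity_gt0 l).
    rewrite -!mulmxA [pr k (T _) *m (pr k (T _) *m _)]mulmxA pr_id !mulmxA.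
    apply/eqP; rewrite eq_sym subr_eq -mulmxDl -mulmxDl; apply/eqP; congr (_ *m _ *m _).
    rewrite {1}(dec x l 0%N Px (arity_gt0 l)) !mulmxDr /cut /=.
    by rewrite !mulmxA ![pr k (Q _) *m pr k (T _)]pr_pr [Q _ :&: T _]setIC TQ pr0 !mul0mx add0r pr_id addrC.
  + move=> Q0; have [_ [rM tM] _ [_ sj]] := Px.
    have := sj l li lj Q0; rewrite /W -cut_cp //; last exact: ltnW (arity_gt1 l).
    move=> /submxP [L HL]; apply/submxP; exists L.
    by rewrite !mulmxA -(mulmxA L) -HL pr_id.
- move=> l li lj; split.
    apply: mx_algM; last exact: mx_alg_const.
    by apply: mx_algM; [apply: mx_alg_const|apply: cpA].
  apply: mx_algB.
    apply: mx_algM; last exact: mx_alg_const.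
    apply: mx_algM; first exact: mx_alg_const.
    apply: mx_algZ; first exact: alg_const.
    by apply: mx_algD; apply: mx_algZ; try exact: alg_const; apply: amxA; rewrite /piv eqxx ?andbF.
  apply: mx_algM; last exact: mx_alg_const.
  by apply: mx_algM; [apply: A2; apply: arity_gt0|apply: cpA].
have zwm p q (A : X -> 'M[k]_(p, q)) : mx_alg P' z A -> mx_alg P' w A.
  by move=> H a b; apply: zw.
have A6 l a : (a < m l)%N -> mx_alg P' w (fun x => x.2 l a).
  move=> am; have [/andP [/andP [li lj] /eqP a0]|na] := boolP (piv l && (a == 0)%N); last first.
    by apply: zwm; apply: A5.
  subst a; apply: mx_alg_eq (mx_algD (mx_algD (zwm _ _ _ (A1 l 0%N am)) (zwm _ _ _ (A2 l 0%N am))) (Yw l li lj)) => x Px.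
  exact: esym (dec x l 0%N Px am).
apply: (@cod_image X P P' (fun x => nil_conj x.1 x.2) d _ _ w D' cov Gw); last first.
  - by exists M0.
  - move=> l a am; apply: mx_algM; last first.
      by apply: mx_algD; [apply: mx_alg_const|apply: zwm].
    apply: mx_algM; last exact: A6.
    by apply: mx_algB; [apply: mx_alg_const|apply: zwm].
have E1 : (\sum_v #|T v| * #|Q v|)%N%:Z = \sum_v (d1 v)%:Z * (d2 v)%:Z :> int.
  by rewrite -[LHS]natz natr_sum; apply: eq_bigr => v _; rewrite !natz dT dQ.
have E2 : ((\sum_(a : arrow C) #|if fst_piv a then set0 else Q (tgt a)| * #|T (src a)|) +
     \sum_(l | piv l) #|Q (v0 C)| * #|T (armv l 1)|)%N%:Z
     = \sum_(a : arrow C) (d2 (tgt a))%:Z * (d1 (src a))%:Z :> int.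
  rewrite -(sum_first piv (fun l => (#|Q (v0 C)| * #|T (armv l 1)|)%N)) -big_split /=.
  rewrite -[LHS]natz natr_sum; apply: eq_bigr => -[l b] _; rewrite -/(fst_piv _) -dQ -dT.
  rewrite /fst_piv /=; case: ifP => [/andP [_ /eqP b0]|_]; last by lia.
  by rewrite cards0 !natz /tgt /src b0.
have E3 : Ed d = Ed d1 + Ed d2 + (\sum_(a : arrow C) (d1 (tgt a))%:Z * (d2 (src a))%:Z)
   + (\sum_(a : arrow C) (d2 (tgt a))%:Z * (d1 (src a))%:Z)
   - (n - 2)%:Z * ((d1 (v0 C))%:Z * (d2 (voo C))%:Z + (d2 (v0 C))%:Z * (d1 (voo C))%:Z).
  rewrite /Ed !dE !PoszD.
  have -> : \sum_(a : arrow C) (d (tgt a))%:Z * (d (src a))%:Z =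
     \sum_(a : arrow C) (d1 (tgt a))%:Z * (d1 (src a))%:Z + \sum_(a : arrow C) (d2 (tgt a))%:Z * (d2 (src a))%:Z +
     \sum_(a : arrow C) (d1 (tgt a))%:Z * (d2 (src a))%:Z + \sum_(a : arrow C) (d2 (tgt a))%:Z * (d1 (src a))%:Z.
    by rewrite -!big_split; apply: eq_bigr => a _; rewrite !dE; ring.
  ring.
rewrite E3 /chi.
have {}HD' : D'%:Z + (n - 2)%:Z * ((d2 (v0 C))%:Z * (d1 (voo C))%:Z) = D1%:Z + D2%:Z +
    \sum_v (d1 v)%:Z * (d2 v)%:Z + \sum_(a : arrow C) (d2 (tgt a))%:Z * (d1 (src a))%:Z.
  rewrite -E1 -E2 -dQ -dT -!PoszD HD'; ring.
move: HD' HD1 HD2; move: (Ed d1) (Ed d2) => e1 e2.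
move: (\sum_v (d1 v)%:Z * _) (\sum_(a : arrow C) (d1 (tgt a))%:Z * _) => s1 s2.
move: (\sum_(a : arrow C) (d2 (tgt a))%:Z * _) => s3.
rewrite mulrDr; move: ((n - 2)%:Z * _) ((n - 2)%:Z * _) => s4 s5.
lia.
Qed.

Definition subrep (S : sets) (M : prep) (U : vertex C -> mx) : Prop :=
  (forall x, (U x <= pr k (S x))%MS) /\
  forall i j, (j < m i)%N -> (U (armv i j) *m M i j <= U (armv i j.+1))%MS.

Definition compl (S T : sets) : sets := fun x => S x :\: T x.

(** [T] collects pivot columns of [U], and [M'] is [M] in the basis where [U] becomes the coordinate
    submodule [T]. *)
Definition is_chart (S : sets) (M : prep) (U : vertex C -> mx) (T : sets)
    (u : vertex C -> mx) (M' : prep) : Prop :=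
  [/\ forall x, T x \subset S x /\ #|T x| = \rank (U x),
      forall x, supp (T x) (compl S T x) (u x),
      forall x, (U x :=: pr k (T x) *m (1%:M + u x))%MS,
      forall i j, M' i j = (1%:M + u (armv i j)) *m M i j *m (1%:M - u (armv i j.+1)) &
      isrep S M' /\ tri T M'].

Lemma scale_sandwich a (L X R : mx) : a *: (L *m X *m R) = L *m (a *: X) *m R.
Proof. by rewrite scalemxAl scalemxAr. Qed.

Lemma supp_sqr0 (T Q : {set 'I_E}) (u : mx) : T :&: Q = set0 -> supp T Q u -> u *m u = 0.
Proof.
move=> TQ [e1 e2]; rewrite -{1}e2 -{2}e1 -!mulmxA [pr k Q *m (_ *m _)]mulmxA pr_pr setIC TQ pr0.
by rewrite mul0mx mulmx0.
Qed.

Lemma unip_mul (u : mx) : u *m u = 0 -> (1%:M - u) *m (1%:M + u) = 1%:M.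
Proof. by move=> uu; rewrite mulmxDr mulmx1 mulmxBl mul1mx uu subr0 subrK. Qed.

Lemma unip_mul' (u : mx) : u *m u = 0 -> (1%:M + u) *m (1%:M - u) = 1%:M.
Proof. by move=> uu; rewrite mulmxBr mulmx1 mulmxDl mul1mx uu addr0 addrK. Qed.

Lemma unip_free (u : mx) : u *m u = 0 -> row_free (1%:M + u).
Proof. by move=> /unip_mul /mulmx1_unit []; rewrite row_free_unit. Qed.

Lemma setI_compl (S T : {set 'I_E}) : T :&: (S :\: T) = set0.
Proof. by rewrite setDE setICA setICr setI0. Qed.

Lemma chart_unip S M U T u M' x : is_chart S M U T u M' -> u x *m u x = 0.
Proof. by move=> [_ H _ _ _]; apply: supp_sqr0 (H x); apply: setI_compl. Qed.

Lemma isrep_eq (S S' : sets) M : (forall x, S x = S' x) -> isrep S M -> isrep S' M.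
Proof. by move=> e H i j jm; have := H i j jm; rewrite !e. Qed.

Lemma chart_exists S M U : isrep S M -> subrep S M U ->
  exists T u M', is_chart S M U T u M' /\
    forall i j, (j < m i)%N -> M i j = nil_conj u M' i j.
Proof.
move=> rM [US cU].
have /dep_choice [f Hf] x : exists Tu : {set 'I_E} * mx,
   [/\ Tu.1 \subset S x, supp Tu.1 (S x :\: Tu.1) Tu.2, #|Tu.1| = \rank (U x)
     & (U x :=: pr k Tu.1 *m (1%:M + Tu.2))%MS].
  by have [T [u H]] := chart (US x); exists (T, u).
pose T x := (f x).1; pose u x := (f x).2.
pose M' : prep := fun i j => (1%:M + u (armv i j)) *m M i j *m (1%:M - u (armv i j.+1)).
have uu x : u x *m u x = 0.
  by have [_ H _ _] := Hf x; apply: supp_sqr0 H; apply: setI_compl.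
have uS x : supp (S x) (S x) (u x).
  have [TS [e1 e2] _ _] := Hf x; split.
    by rewrite /u -e1 mulmxA pr_subr.
  by rewrite /u -e2 -mulmxA pr_sub ?subsetDl.
exists T, u, M'; split; last first.
  move=> i j _; rewrite /nil_conj !mulmxA unip_mul // mul1mx -mulmxA unip_mul // mulmx1 //.
split=> //.
- by move=> x; have [h1 _ h3 _] := Hf x.
- by move=> x; have [_ h2 _ _] := Hf x.
- by move=> x; have [_ _ _ h4] := Hf x.
split=> i j jm.
  have [e1 e2] := rM i j jm; have [a1 a2] := uS (armv i j); have [b1 b2] := uS (armv i j.+1).
  split.
    rewrite !mulmxA; congr (_ *m _); rewrite mulmxDr mulmxDl [in RHS]mulmxDl mulmx1 mul1mx a1.
    by rewrite e1.
  rewrite -[LHS]mulmxA -[LHS]mulmxA -[RHS]mulmxA; congr (_ *m _).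
  by rewrite mulmxA !mulmxBr mulmx1 mulmxBl e2 -mulmxA b2.
have [_ _ _ h4] := Hf (armv i j); have [_ _ _ h4'] := Hf (armv i j.+1).
apply/sub_prP; rewrite !mulmxA.
have : (pr k (T (armv i j)) *m (1%:M + u (armv i j)) *m M i j <= pr k (T (armv i j.+1)) *m (1%:M + u (armv i j.+1)))%MS.
  by rewrite -h4'; apply: submx_trans (cU i j jm); rewrite (eqmxMr _ h4).
move=> /submxP [L HL]; rewrite HL -!mulmxA unip_mul' // mulmx1; exact: submxMl.
Qed.

Section Fixed.

Context (S : sets) (M : prep) (U : vertex C -> mx) (T : sets) (u : vertex C -> mx) (M' : prep).
Hypothesis (ch : is_chart S M U T u M').

Let uu x : u x *m u x = 0.
Proof. exact: chart_unip ch. Qed.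

Lemma chart_cp i a b : cp (M' i) a b *m (1%:M + u (armv i b)) = (1%:M + u (armv i a)) *m cp (M i) a b
  \/ (b < a)%N.
Proof.
have [ab|] := leqP a b; [left|by lia].
have := subnK ab; move: (b - a)%N => l; elim: l a {ab} => [|l IH] a.
  by rewrite add0n => ->; rewrite !cp_id mulmx1 mul1mx.
rewrite addSnnS => H; have lt : (a < b)%N by lia.
have [_ _ _ hM _] := ch.
rewrite !(cp_l _ lt) -mulmxA IH // hM -!mulmxA.
by rewrite [(1%:M - _) *m (_ *m _)]mulmxA unip_mul // mul1mx.
Qed.

Lemma chart_cpE i a b : (a <= b)%N ->
  cp (M' i) a b *m (1%:M + u (armv i b)) = (1%:M + u (armv i a)) *m cp (M i) a b.
Proof. by move=> ab; case: (chart_cp i a b) => //; rewrite ltnNge ab. Qed.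

Lemma chart_amx i : amx M' i *m (1%:M + u (voo C)) = (1%:M + u (v0 C)) *m amx M i.
Proof. by have := chart_cpE i (leq0n (m i)); rewrite armv_end. Qed.

Lemma chart_amx' i : amx M' i = (1%:M + u (v0 C)) *m amx M i *m (1%:M - u (voo C)).
Proof. by rewrite -chart_amx -mulmxA unip_mul' // mulmx1. Qed.

Lemma chart_rels : rels M -> rels M'.
Proof.
move=> r i j l; rewrite !chart_amx' !scale_sandwich -mulmxDl -mulmxDr.
by congr (_ *m _ *m _).
Qed.

Lemma cutT_cp i a b : (a < b)%N -> (b <= m i)%N ->
  cp (cut T M' i) a b = pr k (T (armv i a)) *m cp (M' i) a b.
Proof. by move=> ab bm; rewrite cp_cut; case: ch => _ _ _ _ []. Qed.

(** A path that enters [T] never leaves it, so composites of the quotient are obtained by projecting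
    at the two ends only. *)
Lemma cutQ_cp i a b : (a < b)%N -> (b <= m i)%N ->
  cp (cut (compl S T) M' i) a b
  = pr k (compl S T (armv i a)) *m cp (M' i) a b *m pr k (compl S T (armv i b)).
Proof.
move=> ab bm; have [TS _ _ _ [rM tM]] := ch.
have H l : (l < m i)%N -> M' i l *m pr k (compl S T (armv i l.+1)) = cut (compl S T) M' i l.
  move=> lm; have [e1 e2] := rM i l lm; rewrite /cut -{1}e1 -(pr_setD k (TS (armv i l)).1).
  have e3 : pr k (T (armv i l)) *m M' i l *m pr k (compl S T (armv i l.+1)) = 0.
    by rewrite -(tM i l lm) -mulmxA pr_prD mulmx0.
  by rewrite !mulmxDl e3 add0r.
have := subnK ab; rewrite addnS; move: (b - a.+1)%N => l; elim: l a {ab} => [|l IH] a Hl.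
  by rewrite -Hl !cp1.
have lt : (a < b)%N by lia.
rewrite !(cp_l _ lt) IH; [|lia].
rewrite -!mulmxA; have e : (a < m i)%N by lia.
rewrite [in RHS]mulmxA; have [e1 e2] := rM i a e.
rewrite -{2}e2 -(pr_setD k (TS (armv i a.+1)).1) -!mulmxA; congr (_ *m (_ *m _)).
rewrite mulmxDl -/(compl S T _) [X in _ = X + _](_ : _ = 0) ?add0r.
  by rewrite !mulmxA pr_id.
have lt2 : (a.+1 < b)%N by lia.
have := cutT_cp lt2 bm; rewrite /= => E0; rewrite mulmxA -E0.
have [_ <-] : supp (T (armv i a.+1)) (T (armv i b)) (cp (cut T M' i) a.+1 b).
  by apply: (@cp_supp _ _ _ (fun j => T (armv i j))) => // j _; apply: supp_cut.
by rewrite -mulmxA pr_prD mulmx0.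
Qed.

Lemma cutT_amx i : amx (cut T M') i = pr k (T (v0 C)) *m amx M' i.
Proof. by rewrite /amx cutT_cp ?arity_gt0. Qed.

Lemma cutQ_amx i : amx (cut (compl S T) M') i
  = pr k (compl S T (v0 C)) *m amx M' i *m pr k (compl S T (voo C)).
Proof. by rewrite /amx cutQ_cp ?arity_gt0 // armv_end. Qed.

Lemma rels_cutT : rels M -> rels (cut T M').
Proof.
move=> /chart_rels r i j l; rewrite !cutT_amx !scalemxAr -mulmxDr; congr (_ *m _); exact: r.
Qed.

Lemma rels_cutQ : rels M -> rels (cut (compl S T) M').
Proof.
move=> /chart_rels r i j l; rewrite !cutQ_amx !scale_sandwich -mulmxDl -mulmxDr.
by congr (_ *m _ *m _).
Qed.

Lemma chart_sub x p (A : 'M[k]_(p, E)) : (A *m (1%:M + u x) <= U x)%MS = (A <= pr k (T x))%MS.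
Proof.
have [_ _ /(_ x) -> _ _] := ch.
apply/idP/idP => [H|]; last exact: submxMr.
have := submxMr (1%:M - u x) H; by rewrite -!mulmxA unip_mul' // !mulmx1.
Qed.

Lemma chart_onto i a b : (a < b)%N -> (b <= m i)%N ->
  (U (armv i b) <= U (armv i a) *m cp (M i) a b)%MS ->
  (pr k (T (armv i b)) <= pr k (T (armv i a)) *m cp (cut T M' i) a b)%MS.
Proof.
move=> ab bm H; rewrite cutT_cp // mulmxA pr_id.
have [_ _ hU _ _] := ch; move: H; rewrite hU (eqmxMr _ (hU _)) -mulmxA -chart_cpE ?(ltnW ab) // mulmxA.
move/(submxMr (1%:M - u (armv i b))); by rewrite -!mulmxA unip_mul' // !mulmx1.
Qed.

End Fixed.

(** Finitely many pivot sets cover all submodules of dimension [d1], so the bound of [ext_growth] on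
    each chart suffices. *)
Lemma ext_cod (P : prep -> Prop) (P1 P2 : sets -> prep -> Prop) (S : sets) (i j : 'I_n)
    (d1 d2 d : dimvec C) c1 c2 :
  i != j -> (forall x, #|S x| = d x) -> (forall x, d x = d1 x + d2 x)%N ->
  (forall T : sets, (forall x, #|T x| = d1 x) -> cod (P1 T) d1 c1) ->
  (forall T : sets, (forall x, #|T x| = d2 x) -> cod (P2 T) d2 c2) ->
  (forall M, P M -> [/\ isrep S M, rels M & exists U,
     [/\ subrep S M U, forall x, \rank (U x) = d1 x,
         forall l, l != i -> l != j -> d2 (v0 C) != 0%N ->
           (U (voo C) <= U (armv l 1) *m cp (M l) 1 (m l))%MS &
         forall T u M', is_chart S M U T u M' ->
           P1 T (cut T M') /\ P2 (compl S T) (cut (compl S T) M')]]) ->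
  cod P d (c1 + c2 + chi d1 d2).
Proof.
move=> ij dS dE H1 H2 HP.
pose Q (f : {ffun vertex C -> {set 'I_E}}) (M : prep) :=
  P M /\ exists U u M', [/\ is_chart S M U f u M', forall x, #|f x| = d1 x,
    forall i j, (j < m i)%N -> M i j = nil_conj u M' i j,
    rels M' /\ (P1 f (cut f M') /\ P2 (compl S f) (cut (compl S f) M')) &
    forall l, l != i -> l != j -> d2 (v0 C) != 0%N ->
         (pr k (f (voo C)) <= pr k (f (armv l 1)) *m cp (cut f M' l) 1 (m l))%MS].
apply: (@cod_cover _ P Q).
  move=> M PM; have [rM eM [U [sU rU oU HU]]] := HP M PM.
  have [T [u [M' [ch conj]]]] := chart_exists rM sU.
  pose f : {ffun vertex C -> {set 'I_E}} := [ffun y => T y].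
  have eT : @eq (vertex C -> {set 'I_E}) f T by apply: functional_extensionality => x; rewrite ffunE.
  exists f; split=> //; exists U, u, M'; rewrite eT; split=> //.
  - by move=> x; have [/(_ x) [_ ->] _ _ _ _] := ch.
  - by split; [apply: chart_rels ch eM|apply: HU ch].
  - move=> l li lj d20; have := chart_onto ch (arity_gt1 l) (leqnn _).
    by rewrite armv_end; apply; apply: oU.
move=> f; have [[M0 [PM0 [U0 [u0 [M0' [ch0 df _ _ _]]]]]]|no] := classic (exists M, Q f M); last first.
  by [].
have [sf _ _ _ _] := ch0.
have dc x : #|compl S f x| = d2 x.
  by rewrite cardsD (setIidPr (sf x).1) dS df dE addKn.
apply: (@ext_growth (P1 f) (P2 (compl S f)) _ f (compl S f) i j d1 d2 d c1 c2) => //.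
- by move=> x; apply: setI_compl.
- exact: H1.
- exact: H2.
move=> M [PM [U [u [M' [ch _ conj [rM' PP] oM]]]]]; exists u, M'; split=> //.
- by case: ch.
- have [_ _ _ _ [r t]] := ch; split=> //; apply: isrep_eq r => x.
  by lia|| (apply/setP => y; rewrite !inE; case: (y \in f x) (subsetP (sf x).1 y) => //= ->).
- split=> // l li lj c0; apply: oM => //; rewrite -dc cards_eq0 //.
Qed.

End PaddedModules.

(** * Growth bounded by a rewriting system on monomials *)

Section NormalForm.

Context (k : fieldType) (X : Type) (P : X -> Prop) (V I : finType) (z : V -> X -> k).
Context (w : V -> nat) (mm : I -> {set V}).

Local Notation expo := {ffun V -> nat}.

Definition edeg (e : expo) : nat := \sum_v e v.
Definition ecost (e : expo) : nat := \sum_v e v * w v.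

(** An exponent vector divisible by none of the monomials vanishes at a chosen variable of each. By
    disjointness the choice is injective, so [#|I|] exponents are fixed and the others are free. *)
Lemma card_avoiding N : (forall i j, i != j -> [disjoint mm i & mm j]) -> (forall i, mm i != set0) ->
  (0 < N)%N -> (#|I| <= #|V|)%N /\
  (#|[set e : {ffun V -> 'I_N} | [forall i, [exists v in mm i, e v == 0 :> nat]]]| <= #|V| ^ #|I| * N ^ (#|V| - #|I|))%N.
Proof.
move=> dis ne N0.
have sinj (s : {ffun I -> V}) : (forall i, s i \in mm i) -> injective s.
  move=> Hs i j E; apply/eqP; apply: contraT => /dis /pred0P /(_ (s i)) /=.
  by rewrite Hs E Hs.
have /dep_choice [s0 Hs0] i : exists v, v \in mm i by apply/set0Pn.
split.
  have inj := sinj [ffun i => s0 i] (fun i => ltac:(rewrite ffunE; exact: Hs0)).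
  exact: leq_card inj.
pose A (s : {ffun I -> V}) := pffun_on (Ordinal N0) (mem (~: (s @: I))) (mem 'I_N).
have cA (s : {ffun I -> V}) : injective s -> #|A s| = (N ^ (#|V| - #|I|))%N.
  move=> inj; rewrite card_pffun_on card_ord cardsCs setCK card_imset //.
apply: leq_trans (_ : (\sum_(s : {ffun I -> V} | injectiveb s) #|A s| <= _)%N).
  apply: leq_trans (_ : #|\bigcup_(s : {ffun I -> V} | injectiveb s) [set e in A s]| <= _)%N.
    apply: subset_leq_card; apply/subsetP => e; rewrite inE => /forallP He.
    have /dep_choice [s Hs] i : exists v, (v \in mm i) && (e v == 0 :> nat).
      by have /existsP := He i.
    have inj : injective [ffun i => s i].
      by apply: sinj => i; rewrite ffunE; case/andP: (Hs i).
    apply/bigcupP; exists [ffun i => s i]; first by apply/injectiveP.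
    rewrite inE; apply/pffun_onP; split.
      apply/subsetP => v; rewrite !inE => ev; apply: contra ev => /imsetP [i _ ->].
      by rewrite ffunE; case/andP: (Hs i).
    by [].
  elim/big_ind2: _ => [|a b a' b' Ha Hb|s _]; first by rewrite cards0.
    by apply: leq_trans (leq_card_setU _ _) _; apply: leq_add.
  by rewrite cardsE.
rewrite (eq_bigr (fun=> N ^ (#|V| - #|I|))%N); last by move=> s /injectiveP /cA.
rewrite sum_nat_const leq_mul2r; apply/orP; right.
by rewrite -card_ffun; apply: max_card.
Qed.

(* Each relation rewrites a squarefree monomial into monomials of the same
   degree and larger cost, so the monomials divisible by none of these span. *)
Lemma growth_normal_form :
  (forall i j, i != j -> [disjoint mm i & mm j]) -> (forall i, mm i != set0) ->
  (forall i, exists2 s : seq (k * expo),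
     forall ce, ce \in s -> edeg ce.2 = #|mm i| /\ (\sum_(v in mm i) w v < ecost ce.2)%N &
     forall x, P x -> \prod_(v in mm i) z v x = \sum_(ce <- s) ce.1 * monof z ce.2 x) ->
  (#|I| <= #|V|)%N /\ growth_le P z (#|V| - #|I|).
Proof.
move=> dis ne rel.
split; first by have [] := @card_avoiding 1 dis ne isT.
exists (#|V| ^ #|I| * (#|V|.+1) ^ (#|V| - #|I|))%N => t.
pose N := (#|V| * t).+1.
have [_ cA] := @card_avoiding N dis ne isT.
pose T := {e : {ffun V -> 'I_N} | [forall i, [exists v in mm i, e v == 0 :> nat]]}.
exists T, (fun e x => \prod_v z v x ^+ (val e : {ffun V -> 'I_N}) v); split.
  rewrite card_sig -(cardsE (fun e : {ffun V -> 'I_N} => [forall i, [exists v in mm i, e v == 0 :> nat]])).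
  apply: leq_trans cA _; rewrite -mulnA leq_mul2l; apply/orP; right.
  rewrite -expnMn; case: (#|V| - #|I|)%N => [|r] //.
  by rewrite leq_exp2r; nia.
move=> e0 He0.
have dmax : (edeg e0 <= #|V| * t)%N.
  by rewrite -sum_nat_const; apply: leq_sum.
pose W := \max_v w v.
have cmax e : (ecost e <= edeg e * W)%N.
  rewrite big_distrl; apply: leq_sum => v _; rewrite leq_mul2l.
  by apply/orP; right; apply: leq_bigmax.
(* Rewriting preserves the degree and raises the cost, and the cost is at most the degree times [W];
   hence it terminates. *)
have [b] := ubnP (edeg e0 * W - ecost e0); elim: b e0 {He0} dmax => // b IH e0 dmax Hb.
have [av|] := boolP [forall i, [exists v in mm i, e0 v == 0%N]].
  have lt v : (e0 v < N)%N.
    by rewrite ltnS; apply: leq_trans dmax; rewrite /edeg (bigD1 v) // leq_addr.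
  pose e : {ffun V -> 'I_N} := [ffun v => Ordinal (lt v)].
  have He : [forall i, [exists v in mm i, e v == 0 :> nat]].
    by apply/forallP => i; have /forallP/(_ i)/existsP [v Hv] := av; apply/existsP; exists v; rewrite ffunE.
  exists (fun e' => (e' == exist _ e He)%:R) => x Px.
  rewrite -[LHS]addr0 (bigD1 (exist _ e He)) // eqxx mul1r; congr (_ + _); last first.
    by rewrite big1 // => e' ne0; rewrite (negPf ne0) mul0r.
  by rewrite /monof; apply: eq_bigr => v _; rewrite ffunE.
rewrite negb_forall => /existsP [i /existsPn Hi].
have ge v : v \in mm i -> (0 < e0 v)%N by move=> vi; have := Hi v; rewrite vi lt0n.
pose e1 : expo := [ffun v => (e0 v - (v \in mm i))%N].
have e01 v : e0 v = (e1 v + (v \in mm i))%N.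
  by rewrite ffunE subnK; case: (boolP (v \in mm i)) => // /ge.
have [s Hs relx] := rel i.
pose add (e : expo) : expo := [ffun v => (e1 v + e v)%N].
have degE (e : expo) : edeg (add e) = (edeg e1 + edeg e)%N.
  by rewrite -big_split; apply: eq_bigr => v _; rewrite ffunE.
have costE (e : expo) : ecost (add e) = (ecost e1 + ecost e)%N.
  by rewrite -big_split; apply: eq_bigr => v _; rewrite ffunE mulnDl.
have deg0 : edeg e0 = (edeg e1 + #|mm i|)%N.
  rewrite -sum1_card [in RHS]big_mkcond -big_split; apply: eq_bigr => v _ /=.
  by [].
have cost0 : ecost e0 = (ecost e1 + \sum_(v in mm i) w v)%N.
  rewrite [X in (_ + X)%N]big_mkcond -big_split; apply: eq_bigr => v _ /=.
  by rewrite e01 mulnDl; case: (v \in mm i); rewrite ?mul1n.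
have IHs ce : ce \in s -> in_span P (fun (e : T) x => \prod_v z v x ^+ (val e : {ffun V -> 'I_N}) v) (monof z (add ce.2)).
  move=> /Hs [dE cE]; apply: IH; first by rewrite degE dE -deg0.
  have := cmax (add ce.2); rewrite degE costE; lia.
have {}IHs : exists c : (k * expo) -> T -> k, forall ce, ce \in s -> forall x, P x ->
    monof z (add ce.2) x = \sum_e c ce e * \prod_v z v x ^+ (val e : {ffun V -> 'I_N}) v.
  have /dep_choice [c Hc] ce : exists c : T -> k, ce \in s -> forall x, P x ->
     monof z (add ce.2) x = \sum_e c e * \prod_v z v x ^+ (val e : {ffun V -> 'I_N}) v.
    by case: (boolP (ce \in s)) => [/IHs [c Hc]|_]; [exists c|exists (fun=> 0)].
  by exists c.
have [c Hc] := IHs.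
exists (fun e => \sum_(ce <- s) ce.1 * c ce e) => x Px.
have -> : monof z e0 x = monof z e1 x * \prod_(v in mm i) z v x.
  rewrite [X in _ * X]big_mkcond -big_split; apply: eq_bigr => v _ /=.
  by rewrite e01 exprD; case: (v \in mm i).
rewrite relx // mulr_sumr.
under [RHS]eq_bigr do rewrite mulr_suml.
rewrite [RHS]exchange_big /= big_seq [RHS]big_seq; apply: eq_bigr => ce ces.
rewrite mulrCA -[RHS]mulr1.
have -> : monof z e1 x * monof z ce.2 x = monof z (add ce.2) x.
  by rewrite -big_split; apply: eq_bigr => v _; rewrite [in RHS]ffunE exprD.
rewrite mulr1 (Hc ce ces x Px) mulr_sumr; apply: eq_bigr => e _; by rewrite mulrA.
Qed.

End NormalForm.

(** * Chains of matrices with singular composites *)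

Section LinearChain.

Context (k : fieldType) (E : nat) (X : Type) (P : X -> Prop).
Context (lo hi : nat) (T : nat -> {set 'I_E}) (F : X -> nat -> 'M[k]_E).
Hypothesis (sF : forall x, P x -> forall t, (lo <= t < hi)%N -> supp (T t) (T t.+1) (F x t)).

Local Notation V := ('I_hi * ('I_E * 'I_E))%type.
Local Notation expo := {ffun V -> nat}.

Definition rk (t : nat) (y : 'I_E) : nat := index y (enum (T t)).

Definition zv (v : V) (x : X) : k := F x v.1 v.2.1 v.2.2.

(** The square is strictly convex, so a fixed total of ranks over one edge is cheapest exactly when
    it is spread evenly. *)
Definition wv (v : V) : nat := (rk v.1 v.2.1 + rk v.1.+1 v.2.2) ^ 2.

Lemma cauchy_binet_expand p D (A : 'M[k]_(D, p)) (B : 'M[k]_(p, D)) :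
  \det (A *m B) = \sum_(f : {ffun 'I_D -> 'I_p} | injectiveb f)
     (\prod_i A i (f i)) * \det (\matrix_(i, j) B (f i) j).
Proof.
have -> : \det (A *m B) = \sum_(f : {ffun 'I_D -> 'I_p})
     (\prod_i A i (f i)) * \det (\matrix_(i, j) B (f i) j).
  rewrite /determinant; under eq_bigr => s _.
    have -> : \prod_i (A *m B) i (s i) = \sum_(f : {ffun 'I_D -> 'I_p}) \prod_i (A i (f i) * B (f i) (s i)).
      rewrite -(bigA_distr_bigA (fun i y => A i y * B y (s i))).
      by apply: eq_bigr => i _; rewrite mxE.
    rewrite mulr_sumr; over.
  rewrite exchange_big; apply: eq_bigr => f _ /=; rewrite mulr_sumr; apply: eq_bigr => s _.
  rewrite big_split /= mulrCA; congr (_ * (_ * _)); by apply: eq_bigr => i _; rewrite mxE.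
rewrite [RHS]big_mkcond; apply: eq_bigr => f _; case: injectiveP => // ninj.
have [i1 [i2 [ne E12]]] : exists i1 i2, i1 != i2 /\ f i1 = f i2.
  apply: NNPP => no; apply: ninj => i1 i2 E12; apply/eqP/negPn/negP => ne; apply: no.
  by exists i1, i2.
rewrite [\det _](determinant_alternate ne) ?mulr0 // => j; by rewrite !mxE E12.
Qed.

Lemma rk_inj t y y' : y \in T t -> y' \in T t -> rk t y = rk t y' -> y = y'.
Proof.
move=> yT y'T E0; rewrite -(nth_index y (s := enum (T t)) (x := y)) ?mem_enum //.
by rewrite -[RHS](nth_index y (s := enum (T t))) ?mem_enum // -/(rk t y) E0.
Qed.

Section OneTarget.

Context (b : nat).
Hypothesis (bhi : (b <= hi)%N) (b0 : T b != set0).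

Local Notation D := #|T b|.

Let y0 : 'I_E := xchoose (set0Pn _ b0).

Definition xt (t : nat) (r : 'I_D) : 'I_E := nth y0 (enum (T t)) r.

Hypothesis (DT : forall t, (lo <= t <= b)%N -> (D <= #|T t|)%N).

Lemma xt_in t r : (lo <= t <= b)%N -> xt t r \in T t.
Proof. by move=> /DT H; rewrite -mem_enum mem_nth // -cardE (leq_trans (ltn_ord r)). Qed.

Lemma rk_xt t r : (lo <= t <= b)%N -> rk t (xt t r) = r.
Proof. by move=> /DT H; rewrite /rk index_uniq ?enum_uniq // -cardE (leq_trans (ltn_ord r)). Qed.

(** Antidiagonal entries of the leading [D] by [D] corner of one step of the chain. *)
Definition lead_var (p : 'I_hi * 'I_D) : V := (p.1, (xt p.1 p.2, xt p.1.+1 (rev_ord p.2))).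

Definition lead_set (a : nat) : {set V} := [set lead_var p | p : 'I_hi * 'I_D & (a <= p.1 < b)%N].

Lemma lead_var_inj a : (lo <= a)%N ->
  {in [pred p : 'I_hi * 'I_D | (a <= p.1 < b)%N] &, injective lead_var}.
Proof.
move=> la [t r] [t' r'] /=; rewrite !inE /= => H H' [e1 e2 _].
move: e2; rewrite -e1 => e2; congr pair => //; apply: val_inj => /=.
by rewrite -(@rk_xt t r) ?e2 ?rk_xt //; lia.
Qed.

Lemma sum_ord_D : (\sum_(r < D) r * 2 = D * D.-1)%N.
Proof.
elim: (D) => [|c IH]; first by rewrite big_ord0.
by rewrite big_ord_recr /= IH; case: (c) => [|c'] /=; lia.
Qed.

Lemma sum_inj_ge N (f : 'I_N -> nat) : injective f ->
  (\sum_(i < N) i <= \sum_i f i)%N.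
Proof.
elim: N f => [|N IH] f inj; first by rewrite !big_ord0.
have [i0 Hi0] : exists i0, (N <= f i0)%N.
  apply: NNPP => no.
  have lt i : (f i < N)%N by rewrite ltnNge; apply/negP => H; apply: no; exists i.
  have := leq_card (fun i => Ordinal (lt i)) (fun i j e => inj i j (congr1 val e)).
  by rewrite !card_ord ltnn.
rewrite big_ord_recr /= (bigD1_ord i0) //= addnC leq_add //.
by apply: IH => i j /inj /lift_inj.
Qed.

(* The antidiagonal is the unique cheapest way to pass through one edge. *)
Lemma edge_cost (a c : 'I_D -> nat) : injective a -> injective c ->
  (D * D.-1 ^ 2 <= \sum_i (a i + c i) ^ 2)%N /\
  ((\sum_i (a i + c i) ^ 2 <= D * D.-1 ^ 2)%N -> forall i, (a i + c i = D.-1)%N).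
Proof.
move=> ia ic.
have Ha := sum_inj_ge ia; have Hc := sum_inj_ge ic.
have HD := sum_ord_D; rewrite -big_distrl /= in HD.
pose s i := (a i + c i)%N.
have Hs : (D * D.-1 <= \sum_i s i)%N.
  have -> : (\sum_i s i = \sum_i a i + \sum_i c i)%N by rewrite -big_split.
  by rewrite -HD muln2 -addnn leq_add.
pose df i := (s i)%:Z - (D.-1)%:Z.
have E1 : (\sum_i (s i) ^ 2)%N%:Z = \sum_i df i ^+ 2 + 2 * (D.-1)%:Z * (\sum_i s i)%N%:Z - D%:Z * (D.-1)%:Z ^+ 2.
  have sumZ (f : 'I_D -> nat) : (\sum_i f i)%N%:Z = \sum_i (f i)%:Z by rewrite -[LHS]natz natr_sum; apply: eq_bigr => i _; rewrite natz.
  have -> : D%:Z * (D.-1)%:Z ^+ 2 = \sum_(i < D) (D.-1)%:Z ^+ 2 by rewrite sumr_const card_ord -mulr_natl natz.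
  rewrite !sumZ mulr_sumr -big_split -sumrB /=; apply: eq_bigr => i _.
  by rewrite /df -mulnn PoszM; ring.
have df0 : 0 <= \sum_i df i ^+ 2 by apply: sumr_ge0 => i _; apply: sqr_ge0.
move: E1 Hs; rewrite -/(s _); move: (\sum_i s i)%N => S1.
have -> : (\sum_i (a i + c i) ^ 2 = \sum_i s i ^ 2)%N by [].
move: (\sum_i s i ^ 2)%N => S2 E1 Hs; split; first by nia.
move=> le i; have : \sum_i df i ^+ 2 = 0 by nia.
move/eqP; rewrite psumr_eq0; last by move=> j _; apply: sqr_ge0.
by move=> /allP /(_ i (mem_index_enum i)); rewrite implyTb sqrf_eq0 subr_eq0 eqz_nat => /eqP.
Qed.

Lemma lead_sum a (h : V -> nat) : (lo <= a)%N ->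
  (\sum_(v in lead_set a) h v = \sum_(t < hi | (a <= t < b)%N) \sum_(r < D) h (lead_var (t, r)))%N.
Proof.
move=> la; rewrite big_imset /=; last first.
  by move=> p p'; rewrite !inE => H H'; apply: (lead_var_inj la); rewrite ?inE.
rewrite pair_big_dep /=; apply: eq_big => [[t r]|[t r] _] //=; by rewrite inE andbT.
Qed.

Lemma lead_count a : (a <= b)%N -> (\sum_(t < hi | (a <= t < b)%N) 1 = b - a)%N.
Proof.
move=> ab; rewrite -(big_mkord (fun t => (a <= t < b)%N) (fun=> 1%N)) sum1_count.
have -> : index_iota 0 hi = index_iota 0 a ++ index_iota a b ++ index_iota b hi.
  rewrite /index_iota subn0; have -> : hi = (a + (b - a) + (hi - b))%N by lia.
  by rewrite !iotaD !add0n -catA subn0; congr (_ ++ (iota _ _ ++ iota _ _)); lia.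
rewrite !count_cat (_ : count _ (index_iota 0 a) = 0)%N; last first.
  by apply/eqP; rewrite -leqn0 leqNgt -has_count -all_predC; apply/allP => t; rewrite mem_index_iota /=; lia.
rewrite (_ : count _ (index_iota b hi) = 0)%N; last first.
  by apply/eqP; rewrite -leqn0 leqNgt -has_count -all_predC; apply/allP => t; rewrite mem_index_iota /=; lia.
rewrite addn0 add0n -[RHS](size_iota a); apply/eqP; rewrite -all_count; apply/allP => t.
by rewrite mem_index_iota.
Qed.

Lemma lead_card a : (lo <= a <= b)%N -> #|lead_set a| = (D * (b - a))%N.
Proof.
move=> /andP [la ab]; rewrite -sum1_card (lead_sum (fun=> 1%N)) // -lead_count // big_distrr /=.
by apply: eq_bigr => t _; rewrite sum1_card card_ord muln1.
Qed.

Lemma lead_cost a : (lo <= a <= b)%N ->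
  (\sum_(v in lead_set a) wv v = D * D.-1 ^ 2 * (b - a))%N.
Proof.
move=> /andP [la ab]; rewrite lead_sum // -lead_count // big_distrr /=; apply: eq_bigr => t Ht.
rewrite muln1; transitivity (\sum_(r < D) D.-1 ^ 2)%N; last by rewrite sum_nat_const card_ord.
apply: eq_bigr => r _.
rewrite /wv /lead_var /= !rk_xt /=; try lia.
by congr (_ ^ 2)%N; have := ltn_ord r; move: (nat_of_ord r) => r'; move: #|_| => D'; lia.
Qed.

Definition low a (f : 'I_D -> 'I_E) : Prop := forall i, (rk a (f i) < D)%N.

Let g (j : 'I_D) : 'I_E := xt b j.

Lemma minor_expansion a (f : 'I_D -> 'I_E) : (lo <= a <= b)%N ->
  injective f -> (forall i, f i \in T a) ->
  exists (c0 : k) (s : seq (k * expo)),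
    [/\ forall x, P x -> \det (\matrix_(i, j) cp (F x) a b (f i) (g j)) =
          c0 * \prod_(v in lead_set a) zv v x + \sum_(ce <- s) ce.1 * monof zv ce.2 x,
        forall ce, ce \in s -> edeg ce.2 = (D * (b - a))%N /\ (D * D.-1 ^ 2 * (b - a) < ecost wv ce.2)%N
      & (low a f -> c0 != 0) /\ (~ low a f -> c0 = 0)].
Proof.
move=> ab; have [l Hl] : exists l, (b - a = l)%N by exists (b - a)%N.
elim: l a f ab Hl => [|l IH] a f ab El finj fT.
  have {El} ea : a = b by lia.
  subst a; have le0 : lead_set b = set0.
    by apply/setP => v; rewrite !inE; apply/negbTE/imsetP => -[p]; rewrite inE; lia.
  have lowf : low b f by move=> i; rewrite /rk -[X in (_ < X)%N]cardE_ || (rewrite /rk cardE index_mem mem_enum fT).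
  (* For an empty composite the minor is that of a permutation matrix, so the coefficient is a
     sign. *)
  pose s := perm (fun i j (e : Ordinal (lowf i) = Ordinal (lowf j)) => finj i j (rk_inj (fT i) (fT j) (congr1 val e))).
  exists (\det (perm_mx s)), [::]; split=> //; last first.
    by split=> // _; rewrite det_perm signr_eq0.
  move=> x Px; rewrite le0 big_set0 mulr1 big_nil addr0; congr (\det _); apply/matrixP => i j.
  rewrite !mxE cp_id mxE permE; congr ((nat_of_bool _)%:R).
  apply/eqP/eqP => [e|<-]; first by apply: val_inj; rewrite /= e rk_xt.
  by apply: (@rk_inj b) => //; [apply: xt_in|rewrite rk_xt].
have lt : (a < b)%N by lia.
have ahi : (a < hi)%N by lia.
pose oa : 'I_hi := Ordinal ahi.
have ab1 : (lo <= a.+1 <= b)%N by lia.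
have IH' (f' : {ffun 'I_D -> 'I_E}) : exists cs : k * seq (k * expo), injective f' -> (forall i, f' i \in T a.+1) ->
    [/\ forall x, P x -> \det (\matrix_(i, j) cp (F x) a.+1 b (f' i) (g j)) =
          cs.1 * \prod_(v in lead_set a.+1) zv v x + \sum_(ce <- cs.2) ce.1 * monof zv ce.2 x,
        forall ce, ce \in cs.2 -> edeg ce.2 = (D * (b - a.+1))%N /\ (D * D.-1 ^ 2 * (b - a.+1) < ecost wv ce.2)%N
      & (low a.+1 f' -> cs.1 != 0) /\ (~ low a.+1 f' -> cs.1 = 0)].
  have [[i1 i2]|no] := classic (injective f' /\ (forall i, f' i \in T a.+1)); last first.
    by exists (0, [::]) => i1 i2; case: no.
  by have [|c0 [s H]] := IH a.+1 f' ab1 _ i1 i2; [lia|exists (c0, s)].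
have /dep_choice [cs Hcs] := IH'.
pose good (f' : {ffun 'I_D -> 'I_E}) := injectiveb f' && [forall i, f' i \in T a.+1].
pose ev (f' : 'I_D -> 'I_E) : expo := [ffun v => \sum_i (v == (oa, (f i, f' i)))]%N.
have evmon (f' : 'I_D -> 'I_E) x : monof zv (ev f') x = \prod_i F x a (f i) (f' i).
  rewrite /monof; under eq_bigr do rewrite ffunE -prodrXr.
  rewrite exchange_big; apply: eq_bigr => i _ /=.
  rewrite (bigD1 (oa, (f i, f' i))) //= eqxx expr1 big1 ?mulr1 // => v /negPf ->; by rewrite expr0.
have evsum (h : V -> nat) (f' : 'I_D -> 'I_E) : (\sum_v ev f' v * h v = \sum_i h (oa, (f i, f' i)))%N.
  under eq_bigr do rewrite ffunE big_distrl /=.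
  rewrite exchange_big; apply: eq_bigr => i _ /=.
  rewrite (bigD1 (oa, (f i, f' i))) //= eqxx mul1n big1 ?addn0 // => v /negPf ->; by rewrite mul0n.
have evdeg f' : edeg (ev f') = D.
  have := evsum (fun=> 1%N) f'; rewrite sum1_card card_ord => <-.
  by apply: eq_bigr => v _; rewrite muln1.
have rka_inj : injective (fun i => rk a (f i)) by move=> i j /(rk_inj (fT i) (fT j)) /finj.
have evcost (f' : {ffun 'I_D -> 'I_E}) : good f' -> (D * D.-1 ^ 2 <= ecost wv (ev f'))%N /\
    ((ecost wv (ev f') <= D * D.-1 ^ 2)%N -> forall i, (rk a (f i) + rk a.+1 (f' i) = D.-1)%N).
  move=> /andP [/injectiveP inj /forallP inT]; rewrite /ecost evsum /wv /=.
  by apply: edge_cost => // i j /(rk_inj (inT i) (inT j)) /inj.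
pose lexp : expo := [ffun v => (v \in lead_set a.+1 : nat)].
have lsum (h : V -> nat) : (\sum_v lexp v * h v = \sum_(v in lead_set a.+1) h v)%N.
  rewrite [RHS]big_mkcond; apply: eq_bigr => v _; rewrite ffunE.
  by case: (v \in _); rewrite ?mul1n ?mul0n.
have ldeg : edeg lexp = (D * (b - a.+1))%N.
  rewrite -lead_card // -sum1_card -lsum; by apply: eq_bigr => v _; rewrite muln1.
have lcost : ecost wv lexp = (D * D.-1 ^ 2 * (b - a.+1))%N by rewrite -lead_cost // -lsum.
have lmon x : \prod_(v in lead_set a.+1) zv v x = monof zv lexp x.
  rewrite big_mkcond; apply: eq_bigr => v _; rewrite ffunE.
  by case: (v \in _); rewrite ?expr1 ?expr0.
pose addx (e e' : expo) : expo := [ffun v => (e v + e' v)%N].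
have addmon e e' x : monof zv (addx e e') x = monof zv e x * monof zv e' x.
  by rewrite /monof -big_split; apply: eq_bigr => v _; rewrite ffunE exprD.
have adddeg e e' : edeg (addx e e') = (edeg e + edeg e')%N.
  by rewrite /edeg -big_split; apply: eq_bigr => v _; rewrite ffunE.
have addcost e e' : ecost wv (addx e e') = (ecost wv e + ecost wv e')%N.
  by rewrite /ecost -big_split; apply: eq_bigr => v _; rewrite ffunE mulnDl.
(* The intermediate rows that reach the least cost on the first edge; there is exactly one such
   choice when [f] is low, and none otherwise. *)
pose isrev (f' : {ffun 'I_D -> 'I_E}) := [forall i, rk a (f i) + rk a.+1 (f' i) == D.-1]%N.
have expand x : P x -> \det (\matrix_(i, j) cp (F x) a b (f i) (g j)) =
   \sum_(f' | good f') monof zv (ev f') x * \det (\matrix_(i, j) cp (F x) a.+1 b (f' i) (g j)).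
  move=> Px.
  have -> : (\matrix_(i, j) cp (F x) a b (f i) (g j)) =
     (\matrix_(i, y) F x a (f i) y) *m (\matrix_(y, j) cp (F x) a.+1 b y (g j)) :> 'M_D.
    apply/matrixP => i j; rewrite !mxE cp_l // mxE; apply: eq_bigr => y _; by rewrite !mxE.
  rewrite cauchy_binet_expand [LHS]big_mkcond [RHS]big_mkcond; apply: eq_bigr => f' _.
  rewrite /good; case: (injectiveb f') => //=; case: forallP => [_|nT].
    rewrite evmon; congr (_ * _); first by apply: eq_bigr => i _; rewrite mxE.
    by congr (\det _); apply/matrixP => i j; rewrite !mxE.
  have [i Hi] : exists i, f' i \notin T a.+1.
    by apply: NNPP => no; apply: nT => i; apply/negPn/negP => H; apply: no; exists i.
  by rewrite (bigD1 i) //= mxE (supp_out (sF Px (t := a) _)) ?(negPf Hi) ?andbF ?mul0r //; lia.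
have revP (f' : {ffun 'I_D -> 'I_E}) : good f' -> isrev f' ->
    low a f /\ low a.+1 f' /\ forall x, monof zv (ev f') x * \prod_(v in lead_set a.+1) zv v x = \prod_(v in lead_set a) zv v x.
  move=> /andP [_ /forallP inT] /forallP Hr.
  have D0 : (0 < D)%N by rewrite card_gt0.
  have lowf : low a f by move=> i; have /eqP := Hr i; lia.
  split=> //; split; first by move=> i; have /eqP := Hr i; lia.
  have lp (p : 'I_hi * 'I_D) : (a <= p.1 < b)%N -> (lo <= p.1 < b)%N.
    by case/andP: ab => la _ /andP [ap ->]; rewrite (leq_trans la ap).
  have lp' (p : 'I_hi * 'I_D) : (a < p.1 < b)%N -> (lo <= p.1 < b)%N.
    by move=> /andP [ap pb]; apply: lp; rewrite (ltnW ap).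
  move=> x; rewrite /lead_set !big_imset /=; first last.
  - by move=> p p'; rewrite !inE => Hp Hp'; apply: (@lead_var_inj lo); rewrite ?inE ?lp'.
  - by move=> p p'; rewrite !inE => Hp Hp'; apply: (@lead_var_inj lo); rewrite ?inE ?lp.
  rewrite evmon [RHS](bigID (fun p : 'I_hi * 'I_D => p.1 == oa)) /=; congr (_ * _); last first.
    apply: eq_bigl => -[t r]; rewrite !inE /= -val_eqE /=; lia.
  pose sg := perm (fun i j (e : Ordinal (lowf i) = Ordinal (lowf j)) => rka_inj i j (congr1 val e)).
  transitivity (\prod_(r < D) zv (lead_var (oa, r)) x).
    rewrite [RHS](reindex_inj (@perm_inj _ sg)) /=; apply: eq_bigr => i _; rewrite /zv /=.
    have -> : xt a (sg i) = f i.
      by apply: (@rk_inj a) => //; [apply: xt_in; lia|rewrite rk_xt ?permE //; lia].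
    congr (F x a _ _); apply: (@rk_inj a.+1) => //; first by apply: xt_in.
    rewrite rk_xt //= permE /=; have /eqP := Hr i; have : (rk a (f i) < D)%N := lowf i.
    move: (rk a (f i)) (rk a.+1 (f' i)) => r1 r2; move: #|_| => D'; lia.
  transitivity (\prod_(t < hi | t == oa) \prod_(r < D) zv (lead_var (t, r)) x).
    by rewrite big_pred1_eq.
  rewrite pair_big_dep /=.
  apply: eq_big => [[t r]|[t r] _] //=; rewrite inE /= -val_eqE /=; lia.
pose terms (f' : {ffun 'I_D -> 'I_E}) : seq (k * expo) :=
  (if isrev f' then [::] else [:: ((cs f').1, addx (ev f') lexp)]) ++
  [seq (ce.1, addx (ev f') ce.2) | ce : k * expo <- (cs f').2].
exists (\sum_(f' | good f' && isrev f') (cs f').1).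
exists (flatten [seq terms f' | f' <- [seq f' <- index_enum {ffun 'I_D -> 'I_E} | good f']]).
split.
- move=> x Px; rewrite expand // big_flatten big_map big_filter /=.
  have -> : (\sum_(f' | good f' && isrev f') (cs f').1) * \prod_(v in lead_set a) zv v x =
     \sum_(f' | good f') (if isrev f' then (cs f').1 else 0) * \prod_(v in lead_set a) zv v x.
    by rewrite big_mkcondr mulr_suml.
  rewrite -big_split /=; apply: eq_bigr => f' gf.
  have [/injectiveP inj /forallP inT] := andP gf.
  have [H1 _ _] := Hcs f' inj inT; rewrite (H1 x Px) mulrDr big_cat /= big_map /=.
  rewrite addrA mulr_sumr; congr (_ + _); last first.
    by apply: eq_bigr => ce _; rewrite addmon mulrCA.
  case: ifP => rf; last by rewrite big_seq1 /= addmon lmon mul0r add0r mulrCA.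
  have [_ [_ <-]] := revP f' gf rf; by rewrite big_nil addr0 mulrCA.
- move=> ce /flatten_mapP [f']; rewrite mem_filter => /andP [gf _].
  have [/injectiveP inj /forallP inT] := andP gf.
  have [_ H2 _] := Hcs f' inj inT; have [c1 c2] := evcost f' gf.
  have ba : (b - a = (b - a.+1).+1)%N by lia.
  rewrite mem_cat => /orP [|/mapP [ce' /H2 [d1 d2] ->]]; last first.
    rewrite /= adddeg addcost evdeg d1 ba !mulnS; split=> //.
    by rewrite -addnS leq_add.
  case: ifP => // rf; rewrite inE => /eqP -> /=; rewrite adddeg addcost evdeg ldeg lcost ba !mulnS.
  split=> //; rewrite ltn_add2r ltnNge; apply/negP => /c2 H.
  by move/negP: rf; apply; apply/forallP => i; rewrite H.
split.
  move=> lowf.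
  pose f0 : {ffun 'I_D -> 'I_E} := [ffun i => xt a.+1 (rev_ord (Ordinal (lowf i)))].
  have gf0 : good f0.
    apply/andP; split; last by apply/forallP => i; rewrite ffunE xt_in.
    apply/injectiveP => i j; rewrite !ffunE => /(congr1 (rk a.+1)); rewrite !rk_xt // => /val_inj /rev_ord_inj.
    by move=> /(congr1 val) /= /rka_inj.
  have rf0 : isrev f0.
    apply/forallP => i; rewrite ffunE rk_xt //=; have : (rk a (f i) < D)%N := lowf i.
    by move: (rk _ _) #|_| => r' D'; lia.
  rewrite (big_pred1 f0) => [|f'].
    have [/injectiveP inj /forallP inT] := andP gf0.
    have [_ _ [H _]] := Hcs f0 inj inT; apply: H.
    by have [_ []] := revP f0 gf0 rf0.
  apply/andP/eqP => [[gf rf]|->//].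
  apply/ffunP => i; apply: (@rk_inj a.+1).
  - by have /andP [_ /forallP] := gf.
  - by have /andP [_ /forallP] := gf0.
  - by have /forallP/(_ i)/eqP := rf; have /forallP/(_ i)/eqP <- := rf0; move/addnI.
move=> nl; apply: big1 => f' /andP [gf rf]; case: nl; by have [] := revP f' gf rf.
Qed.

(** A killed column makes the leading minor vanish; solving for its cheapest monomial gives a
    rewriting rule as in [growth_normal_form]. *)
Lemma singular_relation a : (lo <= a < b)%N -> #|T a| = D ->
  (forall x, P x -> exists psi : 'cV[k]_E, [/\ psi != 0, pr k (T b) *m psi = psi
     & pr k (T a) *m cp (F x) a b *m psi = 0]) ->
  exists2 s : seq (k * expo),
    forall ce, ce \in s -> edeg ce.2 = #|lead_set a| /\ (\sum_(v in lead_set a) wv v < ecost wv ce.2)%N &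
    forall x, P x -> \prod_(v in lead_set a) zv v x = \sum_(ce <- s) ce.1 * monof zv ce.2 x.
Proof.
move=> ab TaD sing.
have ab' : (lo <= a <= b)%N by lia.
have bb : (lo <= b <= b)%N by lia.
have xinj t : (lo <= t <= b)%N -> injective (xt t).
  by move=> tb i j /(congr1 (rk t)); rewrite !rk_xt // => /val_inj.
have [c0 [s [H1 H2 [H3 _]]]] := minor_expansion ab' (xinj a ab') (fun i => xt_in i ab').
have c00 : c0 != 0 by apply: H3 => i; rewrite rk_xt.
exists [seq (- c0^-1 * ce.1, ce.2) | ce <- s] => [ce /mapP [ce' /H2 [h1 h2] ->]|x Px].
  by rewrite lead_card // lead_cost.
rewrite big_map /=.
have := H1 x Px.
have -> : \det (\matrix_(i, j) cp (F x) a b (xt a i) (xt b j)) = 0.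
  have [psi [p0 pT pK]] := sing x Px.
  rewrite -det_tr; apply/eqP/det0P; exists (\row_j psi (xt b j) 0).
    apply: contra p0 => /eqP p0; apply/eqP/matrixP => y c; rewrite ord1 -pT pr_mulE [RHS]mxE.
    case: ifP => // yT.
    have lt : (rk b y < D)%N by rewrite /rk cardE index_mem mem_enum.
    have -> : y = xt b (Ordinal lt) by apply: (@rk_inj b) => //; [apply: xt_in|rewrite rk_xt].
    by have /matrixP/(_ 0 (Ordinal lt)) := p0; rewrite !mxE.
  apply/matrixP => c i; rewrite ord1 !mxE.
  have /matrixP/(_ (xt a i) 0) := pK; rewrite -mulmxA pr_mulE xt_in // mxE [RHS]mxE => E0.
  rewrite -[RHS]E0 [RHS](bigID (fun y => y \in T b)) /= [X in _ + X]big1 ?addr0; last first.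
    by move=> y yT; rewrite -pT pr_mulE (negPf yT) mulr0.
  rewrite (reindex_onto (xt b) (fun y => insubd i (rk b y))) /=; last first.
    move=> y yT; have lt : (rk b y < D)%N by rewrite /rk cardE index_mem mem_enum.
    by apply: (@rk_inj b) => //; [apply: xt_in|rewrite rk_xt // val_insubd lt].
  apply: eq_big => [j|j _]; last by rewrite !mxE mulrC.
  rewrite xt_in //=; apply/esym/eqP; apply: val_inj; rewrite val_insubd rk_xt // ltn_ord //.
move/eqP; rewrite eq_sym addr_eq0 => /eqP E0.
transitivity (c0^-1 * (c0 * \prod_(v in lead_set a) zv v x)); first by rewrite mulKf.
rewrite E0 mulrN -mulNr mulr_sumr; apply: eq_bigr => ce _; by rewrite mulrA.
Qed.

End OneTarget.

End LinearChain.

(** * A chain with several singular intervals *)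

Section SingularChain.

Context (k : fieldType) (E : nat) (X : Type) (P : X -> Prop).
Context (lo hi : nat) (T : nat -> {set 'I_E}) (F : X -> nat -> 'M[k]_E).
Hypothesis (sF : forall x, P x -> forall t, (lo <= t < hi)%N -> supp (T t) (T t.+1) (F x t)).
Hypothesis F_lo : forall x, P x -> forall t, (t < lo)%N -> F x t = 0.

Local Notation V := ('I_hi * ('I_E * 'I_E))%type.
Local Notation expo := {ffun V -> nat}.
Local Notation zv := (zv (hi := hi) F).
Local Notation wv := (wv T).

Definition inner (v : V) : bool :=
  [&& (lo <= v.1)%N, v.2.1 \in T v.1 & v.2.2 \in T v.1.+1].

Lemma card_inner : #|[pred v | inner v]| = (\sum_(t < hi | (lo <= t)%N) #|T t| * #|T t.+1|)%N.
Proof.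
rewrite -sum1_card (eq_bigl (fun v : V => (lo <= v.1)%N && ((v.2.1 \in T v.1) && (v.2.2 \in T v.1.+1)))) //.
rewrite -(pair_big_dep (fun t : 'I_hi => (lo <= t)%N) (fun t c => (c.1 \in T t) && (c.2 \in T t.+1)) (fun _ _ => 1%N)) /=.
apply: eq_bigr => t _; rewrite sum1_card -cardsX; apply: eq_card => c.
by rewrite !inE.
Qed.

(** Each interval contributes one leading monomial. Two of these are disjoint: a variable on an
    antidiagonal determines the size [D], and two intervals of the same [D] over a common step
    coincide because dimensions inside an interval are strictly larger. Every interval therefore
    lowers the growth by one. *)
Lemma singular_chain_growth (Q : seq (nat * nat)) : uniq Q -> (exists x, P x) ->
  (forall ab, ab \in Q -> [/\ (lo <= ab.1 < ab.2)%N, (ab.2 <= hi)%N, #|T ab.1| = #|T ab.2|,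
     forall t, (ab.1 < t < ab.2)%N -> (#|T ab.2| < #|T t|)%N &
     forall x, P x -> exists psi : 'cV[k]_E, [/\ psi != 0, pr k (T ab.2) *m psi = psi
        & pr k (T ab.1) *m cp (F x) ab.1 ab.2 *m psi = 0]]) ->
  exists2 D, growth_le P zv D & (D + size Q <= \sum_(t < hi | (lo <= t)%N) #|T t| * #|T t.+1|)%N.
Proof.
move=> uQ [x0 Px0] HQ.
(* Entries outside the supports are zero, so they also enter as rewriting rules, with empty
   right-hand side. *)
pose I := ({v : V | ~~ inner v} + 'I_(size Q))%type.
pose pq (i : 'I_(size Q)) := tnth (in_tuple Q) i.
have pqQ i : pq i \in Q by apply: mem_tnth.
have Tn0 i : T (pq i).2 != set0.
  have [_ _ _ _ /(_ x0 Px0) [psi [p0 pT _]]] := HQ _ (pqQ i).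
  by apply: contra p0 => /eqP T0; rewrite -pT T0 pr0 mul0mx.
have DT i t : ((pq i).1 <= t <= (pq i).2)%N -> (#|T (pq i).2| <= #|T t|)%N.
  have [_ _ e lt _] := HQ _ (pqQ i) => /andP [h1 h2].
  move: h1; rewrite leq_eqVlt => /orP [/eqP <-|h1]; first by rewrite e.
  move: h2; rewrite leq_eqVlt => /orP [/eqP ->|h2] //.
  by apply: ltnW; apply: lt; rewrite h1.
pose LS (i : 'I_(size Q)) : {set V} := lead_set hi (Tn0 i) (pq i).1.
have LSP i v : v \in LS i -> [/\ ((pq i).1 <= v.1 < (pq i).2)%N, inner v &
     (rk T v.1 v.2.1 + rk T v.1.+1 v.2.2).+1 = #|T (pq i).2|].
  have [/andP [lq q12] qhi _ _ _] := HQ _ (pqQ i).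
  move=> /imsetP [[t r]]; rewrite inE /= => ht -> /=.
  have h1 : ((pq i).1 <= t <= (pq i).2)%N by case/andP: ht => -> /ltnW ->.
  have h2 : ((pq i).1 <= t.+1 <= (pq i).2)%N by case/andP: ht => /leqW -> ->.
  split=> //.
    apply/and3P; split; first by case/andP: ht => h _; apply: leq_trans lq h.
      by apply: (xt_in (lo := (pq i).1)) => //; apply: DT.
    by apply: (xt_in (lo := (pq i).1)) => //; apply: DT.
  rewrite !(rk_xt (lo := (pq i).1)) //; try exact: DT.
  by rewrite /= -addnS subnSK ?subnKC // ltnW.
pose mm (i : I) : {set V} := match i with inl v => [set val v] | inr i => LS i end.
have disLS i j v : v \in LS i -> v \in LS j -> i = j.
  move=> /LSP [h1 _ e1] /LSP [h2 _ e2].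
  have [_ _ eT1 lt1 _] := HQ _ (pqQ i); have [_ _ eT2 lt2 _] := HQ _ (pqQ j).
  have eD : #|T (pq i).2| = #|T (pq j).2| by rewrite -e1 e2.
  have L (a b a' b' : nat) : (a <= v.1 < b)%N -> (a' <= v.1 < b')%N -> #|T a'| = #|T b'| -> #|T b| = #|T b'| ->
     (forall t : nat, (a < t < b)%N -> (#|T b| < #|T t|)%N) -> (a' <= a)%N.
    move=> ha ha' ea eb lt; rewrite leqNgt; apply/negP => h.
    by have := lt a' ltac:(lia); rewrite ea eb ltnn.
  have L' (a b a' b' : nat) : (a <= v.1 < b)%N -> (a' <= v.1 < b')%N -> #|T b| = #|T b'| ->
     (forall t : nat, (a < t < b)%N -> (#|T b| < #|T t|)%N) -> (b <= b')%N.
    move=> ha ha' eb lt; rewrite leqNgt; apply/negP => h.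
    by have := lt b' ltac:(lia); rewrite eb ltnn.
  have ea : (pq i).1 = (pq j).1.
    by apply/eqP; rewrite eqn_leq (L _ _ _ _ h1 h2 eT2 eD lt1) (L _ _ _ _ h2 h1 eT1 (esym eD) lt2).
  have eb : (pq i).2 = (pq j).2.
    by apply/eqP; rewrite eqn_leq (L' _ _ _ _ h1 h2 eD lt1) (L' _ _ _ _ h2 h1 (esym eD) lt2).
  have e : pq i = pq j by rewrite [pq i]surjective_pairing ea eb -surjective_pairing.
  have pqE i' : pq i' = nth (0%N, 0%N) Q i' by rewrite /pq (tnth_nth (0%N, 0%N)).
  by apply/val_inj/eqP; rewrite -(nth_uniq (0%N, 0%N) (ltn_ord i) (ltn_ord j) uQ) -!pqE e.
have [|||cI G] := @growth_normal_form k X P V I zv wv mm.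
- move=> [v|i] [w|j] ne /=; rewrite ?disjoints1 ?inE.
  + by apply: contra ne => /eqP/val_inj ->.
  + by apply/negP => /LSP [_ inn _]; have := valP v; rewrite inn.
  + rewrite disjoint_sym disjoints1; by apply/negP => /LSP [_ inn _]; have := valP w; rewrite inn.
  + by apply/pred0P => v /=; apply/andP => -[v1 v2]; case/eqP: ne; rewrite (disLS _ _ _ v1 v2).
- move=> [v|i] /=; first by apply/set0Pn; exists (val v); rewrite inE.
  have [/andP [lq q12] qhi _ _ _] := HQ _ (pqQ i).
  have D0 : (0 < #|T (pq i).2|)%N by rewrite card_gt0.
  apply/set0Pn; exists (lead_var (Tn0 i) (Ordinal (leq_trans q12 qhi), Ordinal D0)).
  by apply: imset_f; rewrite inE /= leqnn.
- move=> [v|i] /=.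
    exists [::] => // x Px; rewrite big_set1 big_nil.
    have := valP v; rewrite /= /inner /zv; have [vlo _|vlo] := ltnP (val v).1 lo; first by rewrite F_lo // mxE.
    by move=> /= H; apply: supp_out (sF Px _) H; rewrite vlo ltn_ord.
  have [q12 qhi eT _ sing] := HQ _ (pqQ i).
  apply: (singular_relation (lo := (pq i).1)) => //.
  + move=> x Px t /andP [h1 h2]; apply: sF => //; rewrite h2 andbT.
    by case/andP: q12 => h _; apply: leq_trans h h1.
  + exact: DT.
  + by rewrite leqnn; case/andP: q12.
exists (#|{: V}| - #|{: I}|)%N => //.
have cV : (#|{: V}| = #|[pred v | inner v]| + #|[pred v | ~~ inner v]|)%N by rewrite -(cardC [pred v | inner v]).
move: cI; rewrite -card_inner card_sum card_sig card_ord cV; move: #|[pred v | inner v]| #|[pred v | ~~ inner v]| => c1 c2; lia.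
Qed.

End SingularChain.

Local Arguments armv : simpl never.

Lemma bounded_max (P : nat -> Prop) N : (exists x, P x) -> (forall x, P x -> (x <= N)%N) ->
  exists x, P x /\ forall y, P y -> (y <= x)%N.
Proof.
elim: N => [|N IH] [x Px] H.
  by exists x; split=> // y /H; lia.
have [PN|nPN] := classic (P N.+1); first by exists N.+1.
apply: IH; first by exists x.
move=> y Py; have := H y Py; rewrite leq_eqVlt => /orP [/eqP e|//].
by case: nPN; rewrite -e.
Qed.

(* Intervals of equal level covering a common step have distinct levels. *)
Lemma level_count (r d : nat -> nat) (lo hi : nat) (Q : seq (nat * nat)) : uniq Q ->
  (forall t, (lo <= t < hi)%N -> (d t <= d t.+1)%N) ->
  (forall ab, ab \in Q -> [/\ (lo <= ab.1)%N, (ab.1 < ab.2 <= hi)%N,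
     (r ab.1 + d ab.1 = r ab.2 + d ab.2)%N,
     forall t, (ab.1 < t < ab.2)%N -> (r ab.2 + d ab.2 < r t + d t)%N & (d ab.1 < d ab.2)%N]) ->
  (size Q <= \sum_(lo <= t < hi) r t * (d t.+1 - d t))%N.
Proof.
move=> uQ dm HQ.
have dmono a b : (lo <= a)%N -> (a <= b)%N -> (b <= hi)%N -> (d a <= d b)%N.
  move=> la ab bh; have := subnK ab; move: (b - a)%N => l; elim: l a la {ab} => [|l IH] a la E0.
    by have -> : a = b by [].
  by apply: leq_trans (dm a _) (IH a.+1 _ _); lia.
pose cov t (ab : nat * nat) := (ab.1 <= t < ab.2)%N && (d t < d t.+1)%N.
apply: (@leq_trans (\sum_(lo <= t < hi) count (cov t) Q)).
  rewrite -sum1_size; under [X in (_ <= X)%N]eq_bigr do rewrite -sum1_count.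
  under [X in (_ <= X)%N]eq_bigr do rewrite big_mkcond.
  rewrite exchange_big /= big_seq [X in (_ <= X)%N]big_seq; apply: leq_sum => ab abQ.
  have [la /andP [ab1 bh] _ _ lt] := HQ ab abQ.
  have [t [ht dt]] : exists t, (ab.1 <= t < ab.2)%N /\ (d t < d t.+1)%N.
    apply: NNPP => no.
    have H l : (ab.1 + l <= ab.2)%N -> (d (ab.1 + l) <= d ab.1)%N.
      elim: l => [|l IH] hl; first by rewrite addn0.
      rewrite addnS in hl *; apply: leq_trans (IH (ltnW hl)); rewrite leqNgt; apply/negP => h.
      by apply: no; exists (ab.1 + l)%N; lia.
    by have := H (ab.2 - ab.1)%N; rewrite subnKC; lia.
  rewrite (big_rem t) /=; last by rewrite mem_index_iota; lia.
  by rewrite /cov ht dt.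
rewrite big_nat [X in (_ <= X)%N]big_nat; apply: leq_sum => t ht.
have [dt|nd] := ltnP (d t) (d t.+1); last first.
  rewrite (_ : count _ Q = 0)%N //; apply/eqP; rewrite -leqn0 leqNgt -has_count -all_predC.
  by apply/allP => ab _; rewrite /= /cov [(d t < _)%N]ltnNge nd andbF.
apply: (@leq_trans (r t)); last by rewrite leq_pmulr // subn_gt0.
rewrite -size_filter -(size_map (fun ab => r ab.2 + d ab.2)%N) -(size_iota (d t).+1 (r t)).
apply: uniq_leq_size.
  rewrite map_inj_in_uniq ?filter_uniq // => -[a b] [a' b']; rewrite !mem_filter /cov /=.
  move=> /andP [/andP [h1 _] /HQ [/= _ l1 e1 b1 _]] /andP [/andP [h2 _] /HQ [/= _ l2 e2 b2 _]] e.
  have ea : a = a' by case: (ltngtP a a') => // h; [have := b1 a' ltac:(lia)|have := b2 a ltac:(lia)]; lia.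
  have eb : b = b' by case: (ltngtP b b') => // h; [have := b2 b ltac:(lia)|have := b1 b' ltac:(lia)]; lia.
  by rewrite ea eb.
move=> c /mapP [[a b]]; rewrite mem_filter /cov /= => /andP [/andP [h1 _] /HQ [/= la /andP [l1 bh] e1 b1 _]] ->.
rewrite mem_iota.
have le1 : (d t.+1 <= d b)%N by apply: dmono; lia.
have le2 : (r b + d b <= r t + d t)%N.
  have [E0|ne] := eqVneq a t; first by subst t; rewrite e1.
  by apply: ltnW; apply: b1; lia.
lia.
Qed.

(** The cycle of length [mm] is opened at the edge [j0]: the window after it, together with that
    edge, runs once through all edges. *)
Lemma unroll_sum (V : nmodType) (f g : nat -> V) (j0 mm : nat) : (j0 < mm)%N ->
  (forall t, (t < mm)%N -> f t = g t) -> (forall a, (a < j0)%N -> f (mm + a)%N = g a) ->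
  \sum_(j0.+1 <= t < j0 + mm) f t + g j0 = \sum_(a < mm) g a.
Proof.
move=> jm fg fg'.
have -> : \sum_(j0.+1 <= t < j0 + mm) f t = \sum_(j0.+1 <= t < mm) g t + \sum_(0 <= a < j0) g a.
  rewrite (@big_cat_nat _ _ _ mm) //=; last by lia.
  congr (_ + _); first by apply: eq_big_nat => t /andP [_ /fg].
  rewrite -{1}[mm]add0n big_addn addnK; apply: eq_big_nat => a aj.
  by rewrite addnC fg'.
rewrite -(big_mkord predT g) (@big_cat_nat _ _ _ j0 0 mm) //=; last exact: ltnW.
rewrite [X in _ = _ + X](big_ltn jm).
move: (\sum_(j0.+1 <= t < mm) g t) (\sum_(0 <= a < j0) g a) (g j0) => A B c.
by rewrite (addrC A) -addrA (addrC A).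
Qed.

(** * Codimension of classes of modules without defect *)

Section ClassBounds.

Context (k : closedFieldType) (C : canonicalData k) (E : nat).

Local Notation n := (narms C).
Local Notation m := (@arity k C).
Local Notation mx := 'M[k]_E.
Local Notation sets := (vertex C -> {set 'I_E}).
Local Notation prep := (prep C E).

Definition injon (S : {set 'I_E}) (A : mx) : Prop :=
  forall X : mx, (X <= pr k S)%MS -> X *m A = 0 -> X = 0.

Lemma injon_rank S A : injon S A -> \rank (pr k S *m A) = #|S|.
Proof.
move=> inj; rewrite -(rank_pr k S) -(mxrank_mul_ker (pr k S) A) -[LHS]addn0; congr addn.
apply/esym/eqP; rewrite mxrank_eq0; apply/eqP; apply: inj; first exact: capmxSl.
by apply/sub_kermxP; apply: capmxSr.
Qed.

Lemma rank_injon S A : \rank (pr k S *m A) = #|S| -> injon S A.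
Proof.
move=> r X XS XA; have := mxrank_mul_ker (pr k S) A; rewrite r rank_pr.
move/eqP; rewrite -[X in _ == X]addn0 eqn_add2l mxrank_eq0 => /eqP c0.
by apply/eqP; rewrite -submx0 -c0 sub_capmx XS; apply/sub_kermxP.
Qed.

Lemma onto_injon S T A : supp S T A -> #|S| = #|T| -> (pr k T <= A)%MS -> injon S A.
Proof.
move=> [sA sA'] c on; apply: rank_injon; rewrite sA c -(rank_pr k T); apply/eqP.
rewrite eqn_leq (mxrankS on) andbT; apply: mxrankS; by apply/sub_prP.
Qed.

Lemma injon_onto S T A : supp S T A -> #|S| = #|T| -> injon S A -> (pr k T <= A)%MS.
Proof.
move=> [sA sA'] c /injon_rank; rewrite sA c => r.
have AT : (A <= pr k T)%MS by apply/sub_prP.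
have := mxrank_leqif_sup AT; rewrite rank_pr => -[_]; by lia.
Qed.

Lemma isrep_cp (T : sets) (M : prep) i a b : isrep T M -> (a < b)%N -> (b <= m i)%N ->
  supp (T (armv i a)) (T (armv i b)) (cp (M i) a b).
Proof.
move=> rM ab bm; apply: (@cp_supp _ _ _ (fun j => T (armv i j))) => // j jab; apply: rM; lia.
Qed.

Lemma isrep_amx (T : sets) (M : prep) i : isrep T M -> supp (T (v0 C)) (T (voo C)) (amx M i).
Proof. by move=> rM; have := isrep_cp rM (arity_gt0 i) (leqnn _); rewrite armv_end. Qed.

Lemma sum_arrow_split (d : dimvec C) (i : 'I_n) :
  (\sum_(a : arrow C) d (tgt a) * d (src a)
   = \sum_(a < m i) d (armv i a) * d (armv i a.+1)
     + \sum_(a : arrow C | tag a != i) d (tgt a) * d (src a))%N.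
Proof.
rewrite (bigID (fun a : arrow C => tag a == i)) /=; congr addn.
rewrite big_mkcond /=.
have -> : (\sum_(a : arrow C) (if tag a == i then d (tgt a) * d (src a) else 0)
  = \sum_l \sum_(j < m l) (if l == i then d (armv l j) * d (armv l j.+1) else 0))%N.
  by rewrite -(sum_arrow (fun l j => if l == i then d (armv l j) * d (armv l j.+1) else 0)%N).
rewrite (bigD1 i) //= [X in (_ + X)%N]big1 ?addn0; first by apply: eq_bigr => j _; rewrite eqxx.
by move=> l /negPf ->; apply: big1.
Qed.

Lemma EdE (d : dimvec C) : Ed d = (\sum_(a : arrow C) d (tgt a) * d (src a))%N%:Z
  - ((n - 2) * (d (v0 C) * d (voo C)))%N%:Z.
Proof.
rewrite /Ed; congr (_ - _); rewrite -[RHS]natz natr_sum; apply: eq_bigr => a _.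
by lia.
Qed.

(** The functions [z] need to determine arm [i] only together with the entries of arm [j]. This form
    suits a cycle closed through the inverse of the composite of arm [j]. *)
Lemma solve_arm (P : prep -> Prop) (T : sets) (d : dimvec C) (i j : 'I_n) (c : int)
    (I : finType) (z : I -> prep -> k) D :
  i != j -> (forall x, #|T x| = d x) -> growth_le P z D ->
  (forall M, P M -> [/\ isrep T M, rels M & forall l, l != i -> l != j -> T (v0 C) != set0 ->
     (pr k (T (voo C)) <= cp (M l) 1 (m l))%MS]) ->
  (forall (I' : finType) (w : I' -> prep -> k),
     (forall f, in_alg_gen P z f -> in_alg_gen P w f) ->
     (forall b, (b < m j)%N -> mx_alg P w (fun M => M j b)) ->
     forall a, (a < m i)%N -> mx_alg P w (fun M => M i a)) ->
  D%:Z + c <= (\sum_(a < m i) d (armv i a) * d (armv i a.+1))%N%:Z ->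
  cod P d c.
Proof.
move=> ij dT Gz HP Az HD; move=> [M0 PM0].
pose piv (l : 'I_n) := (l != i) && (l != j).
pose bad (a : arrow C) := (tag a == i) || (piv (tag a) && (tagged a == 0 :> nat)%N).
pose fr (a : arrow C) (M : prep) := if bad a then 0 else M (tag a) (tagged a).
have [|zo [Go Ao]] := @free_matrices k E (arrow C) prep P
    (fun a => if bad a then set0 else T (tgt a)) (fun a => T (src a)) fr.
  move=> M PM a; rewrite /fr; case: ifP => _; first by split; rewrite ?mulmx0 ?mul0mx.
  by have [rM _ _] := HP M PM; apply: rM (tag a) (tagged a) (ltn_ord _).
have Gzo := growth_le_pair Gz Go; rewrite -/(pairf _ _) in Gzo.
have A5 l a : (a < m l)%N -> ~~ (piv l && (a == 0)%N) -> mx_alg P (pairf z zo) (fun M => M l a).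
  move=> am na; have [E0|li] := eqVneq l i.
    subst l; apply: (Az _ (pairf z zo)) => // [f|b bm].
      by apply: alg_trans => i'; apply: (@alg_var _ _ _ _ (pairf z zo) (inl i')).
    apply: mx_alg_pairr; have := Ao (Tagged _ (Ordinal bm) : arrow C).
    by rewrite /fr /bad eq_sym (negPf ij) /piv eqxx andbF.
  apply: mx_alg_pairr; have := Ao (Tagged _ (Ordinal am) : arrow C).
  by rewrite /fr /bad (negPf li) (negPf na).
have amxA l : ~~ piv l -> mx_alg P (pairf z zo) (fun M => amx M l).
  by move=> nl; apply: mx_alg_path => b ab; apply: A5; [lia|rewrite (negPf nl)].
have [|||D' [I' [w [Gw HD' zw Yw]]]] := @solve_first k C E prep P id (T (v0 C)) (T (voo C))
   (fun l => T (armv l 1)) i j _ (pairf z zo) _ (fun l M => M l 0%N) (fun l M => cp (M l) 1 (m l))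
   (fun l M => (plu i j)^-1 *: (plu l j *: amx M i + plu i l *: amx M j)) ij Gzo.
- by exists M0.
- move=> l li lj M PM; have [rM eM on] := HP M PM; split.
  + exact: rM (arity_gt0 l).
  + by have := isrep_cp rM (arity_gt1 l) (leqnn _); rewrite armv_end.
  + have := eM i j l; move/(congr1 (fun A => (plu i j)^-1 *: A)).
    by rewrite scalerA mulVf ?plu_neq0 // scale1r => <-; rewrite /amx (cp_l _ (arity_gt0 l)).
  + exact: on.
- move=> l li lj; split.
    by apply: mx_alg_path => b ab; apply: A5; [lia|rewrite negb_and; lia].
  apply: mx_algZ; first exact: alg_const.
  by apply: mx_algD; apply: mx_algZ; try exact: alg_const; apply: amxA; rewrite /piv eqxx ?andbF.
apply: (codI Gw); last first.
- by exists M0.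
- move=> l a am; have [/andP [/andP [li lj] /eqP ->]|na] := boolP (piv l && (a == 0)%N).
    exact: Yw.
  by move=> x y; apply: zw; apply: A5.
rewrite EdE (sum_arrow_split d i).
have E1 : (\sum_(a : arrow C) #|if bad a then set0 else T (tgt a)| * #|T (src a)|
   + \sum_(l | piv l) #|T (v0 C)| * #|T (armv l 1)| = \sum_(a : arrow C | tag a != i) d (tgt a) * d (src a))%N.
  rewrite -(sum_first piv (fun l => (#|T (v0 C)| * #|T (armv l 1)|)%N)) -big_split /= [RHS]big_mkcond.
  apply: eq_bigr => -[l b] _; rewrite /bad /=; have [E0|li] := eqVneq l i.
    have np : piv l = false by rewrite /piv E0 eqxx.
    by rewrite np cards0.
  rewrite /=; case: ifP => [/andP [_ /eqP b0]|_]; last by rewrite addn0 !dT.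
  by rewrite cards0 /tgt /src b0 !dT.
rewrite -E1 -!dT.
have e4 (u v : nat) : u = v -> u%:Z = v%:Z by lia.
have {HD'} : (D' + (n - 2) * (#|T (v0 C)| * #|T (voo C)|)
   = D + \sum_(a : arrow C) #|if bad a then set0 else T (tgt a)| * #|T (src a)|
     + \sum_(l | piv l) #|T (v0 C)| * #|T (armv l 1)|)%N := HD'.
move/e4; rewrite !PoszD; move: HD.
move: (\sum_(a < m i) _)%N (\sum_(a : arrow C) _)%N (\sum_(l | piv l) _)%N => s1 s2 s3.
move: ((n - 2) * _)%N => s4.
lia.
Qed.

Lemma free_arm (P : prep -> Prop) (T : sets) (i : 'I_n) :
  (forall M, P M -> isrep T M) ->
  exists (I : finType) (z : I -> prep -> k),
    growth_le P z (\sum_(a < m i) #|T (armv i a)| * #|T (armv i a.+1)|)%N /\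
    forall a, (a < m i)%N -> mx_alg P z (fun M => M i a).
Proof.
move=> HP.
have [|z [G A]] := @free_matrices k E 'I_(m i) prep P (fun a => T (armv i a)) (fun a => T (armv i a.+1))
   (fun a M => M i a).
  by move=> M /HP rM a; apply: rM.
by eexists; exists z; split=> // a am; apply: (A (Ordinal am)).
Qed.

Lemma cod_onto (P : prep -> Prop) (T : sets) (d : dimvec C) (i j : 'I_n) :
  i != j -> (forall x, #|T x| = d x) ->
  (forall M, P M -> [/\ isrep T M, rels M & forall l, l != i -> l != j -> T (v0 C) != set0 ->
     (pr k (T (voo C)) <= cp (M l) 1 (m l))%MS]) -> cod P d 0.
Proof.
move=> ij dT HP; have [I [z [G A]]] := free_arm i (fun M PM => let: And3 r _ _ := HP M PM in r).
apply: (solve_arm (c := 0) ij dT G HP).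
  by move=> I' w zw _ a am x y; apply: zw; apply: A.
rewrite addr0.
by under eq_bigr do rewrite !dT.
Qed.

Lemma injon_pred (T : sets) (M : prep) l : isrep T M -> injon (T (v0 C)) (amx M l) ->
  (pr k (T (v0 C)) <= (cp (M l) 0 (m l).-1)^T)%MS.
Proof.
move=> rM inj; rewrite submxE; apply/eqP.
have := mulmx_coker ((cp (M l) 0 (m l).-1)^T); set K := cokermx _ => H.
have {}H : K^T *m cp (M l) 0 (m l).-1 = 0 by apply: trmx_inj; rewrite trmx_mul trmxK trmx0.
apply: trmx_inj; rewrite trmx_mul tr_pr trmx0; apply: inj; first exact: submxMl.
have m1 : (0 < (m l).-1)%N by have := arity_gt1 l; case: (m l) => [|[]].
have em : ((m l).-1.+1 = m l)%N by lia.
have [e _] := isrep_cp rM m1 (leq_pred (m l)).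
have amxE : amx M l = cp (M l) 0 (m l).-1 *m M l (m l).-1 by rewrite -cp_r ?em.
by rewrite amxE !mulmxA -(mulmxA K^T) e H mul0mx.
Qed.

Lemma tr_supp (A B : {set 'I_E}) (X : mx) : supp A B X -> supp B A X^T.
Proof. by move=> [e1 e2]; split; rewrite -tr_pr -trmx_mul ?e1 ?e2. Qed.

Lemma mx_alg_tr X (P : X -> Prop) (I : finType) (z : I -> X -> k) (A : X -> mx) :
  mx_alg P z A -> mx_alg P z (fun x => (A x)^T).
Proof. by move=> H i j; apply: alg_eq (H j i) => x _; rewrite mxE. Qed.

(** Transposed version of [cod_onto]: injectivity of a whole arm makes the product of all edges but
    the last injective, so the relations are solved for the last edges. *)
Lemma cod_inj (P : prep -> Prop) (T : sets) (d : dimvec C) (i j : 'I_n) :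
  i != j -> (forall x, #|T x| = d x) ->
  (forall M, P M -> [/\ isrep T M, rels M & forall l, l != i -> l != j -> injon (T (v0 C)) (amx M l)]) ->
  cod P d 0.
Proof.
move=> ij dT HP [M0 PM0].
pose piv (l : 'I_n) := (l != i) && (l != j).
pose bad (a : arrow C) := piv (tag a) && ((tagged a).+1 == m (tag a) :> nat)%N.
pose fr (a : arrow C) (M : prep) := if bad a then 0 else M (tag a) (tagged a).
have [|zo [Go Ao]] := @free_matrices k E (arrow C) prep P
    (fun a => if bad a then set0 else T (tgt a)) (fun a => T (src a)) fr.
  move=> M PM a; rewrite /fr; case: ifP => _; first by split; rewrite ?mulmx0 ?mul0mx.
  by have [rM _ _] := HP M PM; apply: rM (tag a) (tagged a) (ltn_ord _).
have A5 l a : (a < m l)%N -> ~~ (piv l && (a.+1 == m l)%N) -> mx_alg P zo (fun M => M l a).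
  by move=> am na; have := Ao (Tagged _ (Ordinal am) : arrow C); rewrite /fr /bad (negPf na).
have amxA l : ~~ piv l -> mx_alg P zo (fun M => amx M l).
  by move=> nl; apply: mx_alg_path => b ab; apply: A5; [lia|rewrite (negPf nl)].
have em l : ((m l).-1.+1 = m l)%N by rewrite prednK ?arity_gt0.
have m1 l : (0 < (m l).-1)%N by have := arity_gt1 l; case: (m l) => [|[]].
have amxE M l : amx M l = cp (M l) 0 (m l).-1 *m M l (m l).-1.
  by rewrite -cp_r // em.
have vE l : armv l (m l).-1.+1 = voo C by rewrite em armv_end.
have [|||D' [I' [w [Gw HD' zw Yw]]]] := @solve_first k C E prep P id (T (voo C)) (T (v0 C))
   (fun l => T (armv l (m l).-1)) i j _ zo _ (fun l M => (M l (m l).-1)^T) (fun l M => (cp (M l) 0 (m l).-1)^T)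
   (fun l M => ((plu i j)^-1 *: (plu l j *: amx M i + plu i l *: amx M j))^T) ij Go.
- by exists M0.
- move=> l li lj M PM; have [rM eM inj] := HP M PM; split.
  + by apply: tr_supp; rewrite -(vE l); apply: rM; rewrite em.
  + by apply: tr_supp; apply: isrep_cp rM (m1 l) (leq_pred _).
  + have := eM i j l; move/(congr1 (fun A => (plu i j)^-1 *: A)).
    by rewrite scalerA mulVf ?plu_neq0 // scale1r => <-; rewrite amxE trmx_mul.
  + by move=> _; apply: injon_pred rM (inj l li lj).
- move=> l li lj; split.
    by apply: mx_alg_tr; apply: mx_alg_path => b ab; apply: A5; [lia|rewrite negb_and; lia].
  apply: mx_alg_tr; apply: mx_algZ; first exact: alg_const.
  by apply: mx_algD; apply: mx_algZ; try exact: alg_const; apply: amxA; rewrite /piv eqxx ?andbF.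
apply: (codI Gw); last first.
- by exists M0.
- move=> l a am; have [/andP [/andP [li lj] /eqP ea]|na] := boolP (piv l && (a.+1 == m l)%N).
    have -> : a = (m l).-1 by lia.
    by apply: mx_alg_eq (mx_alg_tr (Yw l li lj)) => x _; rewrite trmxK.
  by move=> x y; apply: zw; apply: A5.
rewrite EdE.
have E1 : (\sum_(a : arrow C) #|if bad a then set0 else T (tgt a)| * #|T (src a)|
   + \sum_(l | piv l) #|T (voo C)| * #|T (armv l (m l).-1)| = \sum_(a : arrow C) d (tgt a) * d (src a))%N.
  have -> : (\sum_(l | piv l) #|T (voo C)| * #|T (armv l (m l).-1)| =
     \sum_(a : arrow C) if bad a then d (tgt a) * d (src a) else 0)%N.
    rewrite big_mkcond.
    have -> : (\sum_(a : arrow C) (if bad a then d (tgt a) * d (src a) else 0)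
      = \sum_l \sum_(b < m l) (if piv l && (b.+1 == m l) then d (armv l b) * d (armv l b.+1) else 0))%N.
      by rewrite -(sum_arrow (fun l b => if piv l && (b.+1 == m l) then d (armv l b) * d (armv l b.+1) else 0)%N).
    apply: eq_bigr => l _; have lt : ((m l).-1 < m l)%N by rewrite em.
    rewrite (bigD1 (Ordinal lt)) //= big1 ?addn0.
      by rewrite em eqxx andbT !dT armv_end mulnC.
    move=> b; rewrite /= => nb; case: ifP => // /andP [_ /eqP eb]; case/negP: nb; change (b.+1.-1 == (m l).-1); by lia.
  rewrite -big_split; apply: eq_bigr => a _ /=; by case: (bad a); rewrite ?cards0 ?addn0 ?dT.
rewrite -E1 -!dT.
have e4 (u v : nat) : u = v -> u%:Z = v%:Z by lia.
have {HD'} : (D' + (n - 2) * (#|T (voo C)| * #|T (v0 C)|)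
   = \sum_(a : arrow C) #|if bad a then set0 else T (tgt a)| * #|T (src a)|
     + \sum_(l | piv l) #|T (voo C)| * #|T (armv l (m l).-1)|)%N := HD'.
rewrite [(#|T (voo C)| * #|T (v0 C)|)%N]mulnC; move/e4; rewrite !PoszD.
move: (\sum_(a : arrow C) _)%N (\sum_(l | piv l) _)%N => s2 s3.
move: ((n - 2) * _)%N => s4.
lia.
Qed.

(* Column vectors killed by the composite along a cyclic interval (a, b] of arm
   i: for a < m < b the interval passes through infinity and 0, which are
   linked by another arm j. *)
Definition degen (T : sets) (j i : 'I_n) (M : prep) (ab : nat * nat) : Prop :=
  if (ab.2 <= m i)%N then exists psi : 'cV[k]_E, [/\ psi != 0, pr k (T (armv i ab.2)) *m psi = psi
       & pr k (T (armv i ab.1)) *m cp (M i) ab.1 ab.2 *m psi = 0]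
  else if (m i <= ab.1)%N then exists psi : 'cV[k]_E, [/\ psi != 0, pr k (T (armv i (ab.2 - m i))) *m psi = psi
       & pr k (T (armv i (ab.1 - m i))) *m cp (M i) (ab.1 - m i) (ab.2 - m i) *m psi = 0]
  else exists phi psi : 'cV[k]_E, [/\ (phi != 0) || (psi != 0), pr k (T (voo C)) *m phi = phi,
       pr k (T (armv i (ab.2 - m i))) *m psi = psi, amx M j *m phi = cp (M i) 0 (ab.2 - m i) *m psi
       & pr k (T (armv i ab.1)) *m cp (M i) ab.1 (m i) *m phi = 0].

Lemma degen_onto (T : sets) (j i : 'I_n) (N : prep) (ab : nat * nat) : isrep T N ->
  ((ab.2 <= m i)%N -> (pr k (T (armv i ab.2)) <= pr k (T (armv i ab.1)) *m cp (N i) ab.1 ab.2)%MS) ->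
  ((m i <= ab.1)%N -> (pr k (T (armv i (ab.2 - m i))) <=
      pr k (T (armv i (ab.1 - m i))) *m cp (N i) (ab.1 - m i) (ab.2 - m i))%MS) ->
  ((ab.1 < m i < ab.2)%N -> (pr k (T (voo C)) <= pr k (T (armv i ab.1)) *m cp (N i) ab.1 (m i))%MS /\
     (pr k (T (armv i (ab.2 - m i))) <= cp (N i) 0 (ab.2 - m i))%MS) ->
  ~ degen T j i N ab.
Proof.
have kill (A B : mx) (psi : 'cV[k]_E) : (A <= B)%MS -> A *m psi = psi -> B *m psi = 0 -> psi = 0.
  by move=> /submxP [L AL] e Bp; rewrite -e AL -mulmxA Bp mulmx0.
move=> rN h1 h2 h3; rewrite /degen.
case: leqP => [b|b].
  by move=> [psi [p0 pT pK]]; move/eqP: p0; apply; apply: (kill _ _ _ (h1 b)).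
case: leqP => [a|a].
  by move=> [psi [p0 pT pK]]; move/eqP: p0; apply; apply: (kill _ _ _ (h2 a)).
have [o1 o2] := h3 ltac:(by lia).
move=> [phi [psi [ne pf pp e1 e2]]].
have phi0 : phi = 0 by apply: (kill _ _ _ o1).
have psi0 : psi = 0 by apply: (kill _ _ _ o2) => //; rewrite -e1 phi0 mulmx0.
by move: ne; rewrite phi0 psi0 eqxx.
Qed.

(** In the adapted basis a killed column either has a non-zero part in [T], which is killed in the
    submodule, or lies entirely in the complement and is killed in the quotient. *)
Lemma degen_cut (S : sets) (M : prep) U (T : sets) u M' (j i : 'I_n) (ab : nat * nat) :
  is_chart S M U T u M' -> isrep S M -> (ab.1 < ab.2)%N -> (ab.2 <= m i + m i)%N ->
  degen S j i M ab -> degen T j i (cut T M') ab \/ degen (compl S T) j i (cut (compl S T) M') ab.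
Proof.
move=> ch rM ab1 abm.
have [TS su _ hM [rM' tM']] := ch.
have uu x : u x *m u x = 0 := chart_unip x ch.
have uS x : pr k (S x) *m u x = u x.
  by rewrite -(su x).1 mulmxA pr_subr // (TS x).1.
have prS x (psi : 'cV[k]_E) : pr k (S x) *m psi = psi -> pr k (S x) *m ((1%:M + u x) *m psi) = (1%:M + u x) *m psi.
  by move=> e; rewrite mulmxA mulmxDr mulmx1 uS !mulmxDl mul1mx e.
have split x (psi : 'cV[k]_E) : pr k (S x) *m psi = psi ->
    psi = pr k (T x) *m psi + pr k (compl S T x) *m psi.
  by move=> e; rewrite -mulmxDl pr_setD ?(TS x).1.
have inv x (psi : 'cV[k]_E) : (1%:M + u x) *m psi = 0 -> psi = 0.
  by move=> e; rewrite -[psi]mul1mx -(unip_mul (uu x)) -mulmxA e mulmx0.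
have cpS a b (psi : 'cV[k]_E) : (a < b)%N -> (b <= m i)%N -> pr k (S (armv i a)) *m cp (M i) a b *m psi = 0 ->
    cp (M' i) a b *m ((1%:M + u (armv i b)) *m psi) = 0.
  move=> lt bm; have [-> _] := isrep_cp rM lt bm => e.
  by rewrite mulmxA (chart_cpE ch) ?(ltnW lt) // -mulmxA e mulmx0.
have cpT a b (psi : 'cV[k]_E) : (a < b)%N -> (b <= m i)%N ->
    cp (cut T M' i) a b *m (pr k (T (armv i b)) *m psi) = pr k (T (armv i a)) *m (cp (M' i) a b *m psi).
  move=> lt bm; rewrite [RHS]mulmxA -(cutT_cp ch lt bm) mulmxA.
  have [_ e] : supp (T (armv i a)) (T (armv i b)) (cp (cut T M' i) a b).
    exact: isrep_cp (isrep_cut _ _) lt bm.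
  by rewrite e.
have amT l (psi : 'cV[k]_E) : amx (cut T M') l *m (pr k (T (voo C)) *m psi) = pr k (T (v0 C)) *m (amx M' l *m psi).
  rewrite mulmxA; have [_ e] := isrep_amx l (isrep_cut T M'); rewrite e.
  by rewrite (cutT_amx ch) mulmxA.
have cpQ a b (psi : 'cV[k]_E) : (a < b)%N -> (b <= m i)%N -> pr k (T (armv i b)) *m psi = 0 ->
    pr k (S (armv i b)) *m psi = psi ->
    cp (cut (compl S T) M' i) a b *m psi = pr k (compl S T (armv i a)) *m (cp (M' i) a b *m psi).
  move=> lt bm e0 eS; rewrite (cutQ_cp ch lt bm) -!mulmxA; do 2 congr (_ *m _).
  by rewrite [RHS](split _ _ eS) e0 add0r.
have half a b (psi : 'cV[k]_E) : (a < b)%N -> (b <= m i)%N -> psi != 0 -> pr k (S (armv i b)) *m psi = psi ->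
   pr k (S (armv i a)) *m cp (M i) a b *m psi = 0 ->
   (exists psi : 'cV[k]_E, [/\ psi != 0, pr k (T (armv i b)) *m psi = psi
       & pr k (T (armv i a)) *m cp (cut T M' i) a b *m psi = 0]) \/
   (exists psi : 'cV[k]_E, [/\ psi != 0, pr k (compl S T (armv i b)) *m psi = psi
       & pr k (compl S T (armv i a)) *m cp (cut (compl S T) M' i) a b *m psi = 0]).
  move=> lt bm p0 pS pK; set psi' := (1%:M + u (armv i b)) *m psi.
  have pK' : cp (M' i) a b *m psi' = 0 by apply: cpS.
  have pS' : pr k (S (armv i b)) *m psi' = psi' by apply: prS.
  have [e0|ne0] := eqVneq (pr k (T (armv i b)) *m psi') 0; [right|left].
    exists psi'; split.
    - by apply: contra p0 => /eqP /inv ->.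
    - by rewrite [RHS](split _ _ pS') e0 add0r.
    - by rewrite -mulmxA cpQ // pK' !mulmx0.
  exists (pr k (T (armv i b)) *m psi'); split=> //; first by rewrite mulmxA pr_id.
  by rewrite -mulmxA cpT // pK' !mulmx0.
rewrite /degen; case: leqP => [b|b].
  by move=> [psi [p0 pS pK]]; apply: half b p0 pS pK.
case: leqP => [a|a].
  by move=> [psi [p0 pS pK]]; apply: half p0 pS pK; lia.
have b0 : (0 < ab.2 - m i)%N by lia.
have bm : (ab.2 - m i <= m i)%N by lia.
move=> [phi [psi [ne pf pp e1 e2]]].
set phi' := (1%:M + u (voo C)) *m phi; set psi' := (1%:M + u (armv i (ab.2 - m i))) *m psi.
have voE : voo C = armv i (m i) by rewrite armv_end.
have K1 : cp (M' i) ab.1 (m i) *m phi' = 0.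
  by rewrite /phi' voE; apply: cpS.
have K2 : amx M' j *m phi' = cp (M' i) 0 (ab.2 - m i) *m psi'.
  by rewrite !mulmxA (chart_amx ch) (chart_cpE ch) // -!mulmxA e1.
have S1 : pr k (S (voo C)) *m phi' = phi' by apply: prS.
have S2 : pr k (S (armv i (ab.2 - m i))) *m psi' = psi' by apply: prS.
have [/andP [/eqP f0 /eqP p0]|] := boolP ((pr k (T (voo C)) *m phi' == 0) && (pr k (T (armv i (ab.2 - m i))) *m psi' == 0)).
  right; exists phi', psi'; split.
  - by apply: contraLR ne; rewrite !negb_or !negbK => /andP [/eqP /inv -> /eqP /inv ->]; rewrite eqxx.
  - by rewrite [RHS](split _ _ S1) f0 add0r.
  - by rewrite [RHS](split _ _ S2) p0 add0r.
  - rewrite cpQ // (cutQ_amx ch) -!mulmxA; congr (_ *m _); rewrite -K2; congr (_ *m _).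
    by rewrite [RHS](split _ _ S1) f0 add0r.
  - by rewrite -mulmxA cpQ ?armv_end // K1 !mulmx0.
rewrite negb_and => ne'; left; exists (pr k (T (voo C)) *m phi'), (pr k (T (armv i (ab.2 - m i))) *m psi'); split=> //.
- by rewrite mulmxA pr_id.
- by rewrite mulmxA pr_id.
- by rewrite amT cpT // K2.
- by have := cpT ab.1 (m i) phi' a (leqnn _); rewrite armv_end -mulmxA => ->; rewrite K1 !mulmx0.
Qed.

(* Position t along the cycle obtained from arm i by gluing infinity to 0. *)
Definition pos (i : 'I_n) (t : nat) : vertex C :=
  if (t <= m i)%N then armv i t else armv i (t - m i).

(** The composite of arm [j] is invertible, so arm [i] closes up to a cycle. Opened at the edge
    [j0], the cycle becomes a linear chain whose singular intervals are the pairs of [Q], and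
    [singular_chain_growth] applies; the edge [j0] is then added freely. *)
Lemma cod_tube (P : prep -> Prop) (T : sets) (d : dimvec C) (i j : 'I_n) (j0 : nat) (Q : seq (nat * nat)) :
  i != j -> (forall x, #|T x| = d x) -> (j0 < m i)%N -> uniq Q -> d (v0 C) = d (voo C) ->
  (forall ab, ab \in Q -> [/\ (j0 < ab.1 < ab.2)%N, (ab.2 <= j0 + m i)%N, d (pos i ab.1) = d (pos i ab.2) &
      forall t, (ab.1 < t < ab.2)%N -> (d (pos i ab.2) < d (pos i t))%N]) ->
  (forall M, P M -> [/\ isrep T M, rels M, forall l, l != i -> (pr k (T (voo C)) <= amx M l)%MS &
      forall ab, ab \in Q -> degen T j i M ab]) ->
  cod P d (size Q)%:Z.
Proof.
move=> ij dT jm uQ d0 HQ HP [M0 PM0].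
have Binv_ex (M : prep) : exists L : mx, P M -> supp (T (voo C)) (T (v0 C)) L /\ L *m amx M j = pr k (T (voo C))
    /\ amx M j *m L = pr k (T (v0 C)).
  have [PM|] := classic (P M); last by exists 0.
  have [rM _ on _] := HP M PM; have sA := isrep_amx j rM.
  have /submxP [L HL] := on j ltac:(by rewrite eq_sym).
  pose L' := pr k (T (voo C)) *m L *m pr k (T (v0 C)).
  have LA : L' *m amx M j = pr k (T (voo C)) by rewrite -!mulmxA sA.1 -HL pr_id.
  exists L' => _; split; first exact: supp_cut; split=> //.
  have inj := onto_injon sA ltac:(by rewrite !dT) (on j ltac:(by rewrite eq_sym)).
  apply/eqP; rewrite -subr_eq0; apply/eqP; apply: inj.
    by apply/sub_prP; rewrite mulmxBl /L' -!mulmxA pr_id.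
  by rewrite mulmxBl -mulmxA LA sA.1 sA.2 subrr.
have /dep_choice [Binv HB] := Binv_ex.
(* The unrolled chain: infinity is reached at [t = m i], where the inverse of the composite of arm
   [j] leads back to 0. *)
pose F (M : prep) t : mx := if (t <= j0)%N then 0 else if (t < m i)%N then M i t else
   if t == m i then Binv M *m M i 0%N else M i (t - m i)%N.
pose Tl t := T (pos i t).
have posS t : (m i <= t)%N -> pos i t.+1 = armv i (t - m i).+1.
  by move=> h; rewrite /pos leqNgt ltnS h subSn.
have sF M : P M -> forall t, (j0.+1 <= t < j0 + m i)%N -> supp (Tl t) (Tl t.+1) (F M t).
  move=> PM t /andP [h1 h2]; have [rM _ _ _] := HP M PM; rewrite /F /Tl leqNgt h1 /=.
  case: ltnP => h; first by rewrite /pos (ltnW h) h; apply: rM.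
  rewrite posS //; case: eqP => [->|ne].
    rewrite subnn /pos leqnn armv_end; have [[e1 _] _] := HB M PM; have [_ e2] := rM i 0%N (arity_gt0 i).
    by split; [rewrite mulmxA e1|rewrite -mulmxA e2].
  by rewrite /pos leqNgt ltn_neqAle eq_sym h (introN eqP ne); apply: rM; lia.
have F_lo M : P M -> forall t, (t < j0.+1)%N -> F M t = 0.
  by move=> _ t; rewrite ltnS /F => ->.
have cpF M a b : P M -> (j0 < a)%N -> (b <= m i)%N -> cp (F M) a b = cp (M i) a b.
  move=> PM ja bm; apply: eq_cp => t /andP [h1 h2]; rewrite /F leqNgt (leq_trans ja h1) /=.
  by rewrite (leq_trans h2 bm).
have Fgt M t : (m i < t)%N -> F M t = M i (t - m i)%N.
  move=> h; rewrite /F; have -> : (t <= j0)%N = false by lia.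
  have -> : (t < m i)%N = false by lia.
  by have -> : (t == m i) = false by lia.
have Fm M : F M (m i) = Binv M *m M i 0%N by rewrite /F leqNgt jm ltnn eqxx.
have cpF3 M a b : (m i < a)%N -> (a <= b)%N -> cp (F M) a b = cp (M i) (a - m i) (b - m i).
  move=> ma ab; rewrite /cp (_ : b - m i - (a - m i) = b - a)%N; last by lia.
  move: (b - a)%N => l; elim: l a ma {ab} => [//|l IH] a ma /=; congr (_ *m _); first exact: Fgt.
  by rewrite IH ?subSn // ltnW.
have cpF2 M b : (m i < b)%N -> cp (F M) (m i) b = Binv M *m cp (M i) 0 (b - m i).
  move=> mb; rewrite cp_l // (@cp_l _ _ _ 0%N) ?subn_gt0 // mulmxA -Fm.
  by rewrite cpF3 // subSn // subnn.
have [|D1 G1 HD1] := singular_chain_growth sF F_lo uQ (ex_intro _ M0 PM0).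
  move=> ab abQ; have [/andP [ja ab1] bh e0 btw] := HQ ab abQ; split=> //.
  - by lia.
  - by rewrite !dT.
  - by move=> t ht; rewrite !dT btw.
  move=> M PM; have [rM _ on dg] := HP M PM; have := dg ab abQ; rewrite /degen /Tl.
  case: (leqP ab.2 (m i)) => b.
    rewrite /pos b (_ : (ab.1 <= m i)%N); last by lia.
    by rewrite cpF.
  case: (leqP (m i) ab.1) => a.
    move=> [psi [p0 pT pK]]; exists psi; split=> //.
      by rewrite /pos leqNgt b.
    move: a; rewrite leq_eqVlt => /orP [/eqP ea|lt].
      rewrite -ea cpF2 // /pos leqnn armv_end; move: pK; rewrite -ea subnn.
      have [-> _] : supp (T (v0 C)) (T (armv i (ab.2 - m i))) (cp (M i) 0 (ab.2 - m i)).
        by apply: isrep_cp => //; lia.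
      by move=> e; rewrite -!mulmxA e !mulmx0.
    by rewrite cpF3 ?(ltnW ab1) // /pos leqNgt lt.
  move=> [phi [psi [ne pf pp e1 e2]]]; exists psi.
  have [sB [BA AB]] := HB M PM.
  have phiE : phi = Binv M *m (cp (M i) 0 (ab.2 - m i) *m psi) by rewrite -e1 mulmxA BA.
  split.
  - by apply/eqP => p0; move: ne; rewrite phiE p0 !mulmx0 eqxx.
  - by rewrite /pos leqNgt b.
  rewrite (@cp_cat _ _ _ _ (m i)) ?(ltnW a) ?(ltnW b) // cpF // cpF2 // /pos (ltnW a).
  by rewrite -!mulmxA -phiE mulmxA.
have [|zf [Gf Af]] := @free_matrices k E unit prep P (fun=> T (armv i j0)) (fun=> T (armv i j0.+1))
   (fun _ M => M i j0).
  by move=> M PM _; have [rM _ _ _] := HP M PM; apply: rM.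
have Gz := growth_le_pair G1 Gf; rewrite -/(pairf _ _) in Gz.
apply: (solve_arm (c := (size Q)%:Z) ij dT Gz); last by exists M0.
- move=> M PM; have [rM eM on _] := HP M PM; split=> // l li lj _.
  by apply: submx_trans (on l li) _; rewrite /amx (cp_l _ (arity_gt0 l)) submxMl.
- move=> I' w zw Aj a am.
  have [->|na] := eqVneq a j0.
    by move=> x y; apply: zw; apply: mx_alg_pairr (Af tt) x y.
  have AF t : (t < j0 + m i)%N -> mx_alg P w (fun M => F M t).
    move=> th x y; apply: zw.
    have := @alg_var _ _ _ P (pairf (zv (hi := j0 + m i) F) zf) (inl (Ordinal th, (x, y))).
    by [].
  have [ja|aj] := ltnP j0 a.
    apply: mx_alg_eq (AF a _) => [M PM|]; last by lia.
    by rewrite /F leqNgt ja am.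
  have [a0|a0] := posnP a; last first.
    apply: mx_alg_eq (AF (m i + a)%N _) => [M PM|]; last by lia.
    by rewrite Fgt ?addKn //; lia.
  (* The edge at 0 occurs in the chain only after multiplication by [Binv]; the composite of arm [j]
     undoes this. *)
  have jm0 : mx_alg P w (fun M => amx M j) by apply: mx_alg_path => b bm; apply: Aj.
  apply: mx_alg_eq (mx_algM jm0 (AF (m i) _)) => [M PM|]; last by lia.
  have [rM _ _ _] := HP M PM; have [_ [_ AB]] := HB M PM.
  by rewrite a0 Fm mulmxA AB (rM i 0%N (arity_gt0 i)).1.
have e := @unroll_sum nat (fun t => #|Tl t| * #|Tl t.+1|)%N (fun a => d (armv i a) * d (armv i a.+1))%N j0 (m i) jm.
rewrite -[X in _ <= X%:Z]e.
- rewrite big_geq_mkord big_const card_unit /= addn0 !dT.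
  by rewrite -PoszD addnAC; apply: leq_add.
- by move=> t tm; rewrite !dT /pos (ltnW tm) tm.
- move=> a aj; rewrite !dT posS ?leq_addr // addKn; congr (_ * _)%N.
  rewrite /pos; case: leqP => h; last by rewrite addKn.
  have -> : a = 0%N by lia.
  by rewrite addn0 armv_end.
Qed.

Definition img (M : prep) (X : mx) : mx := (\sum_(l < n) X *m amx M l)%MS.

Lemma img_sup M (X : mx) l : (X *m amx M l <= img M X)%MS.
Proof. exact: (sumsmx_sup l). Qed.

Lemma img_pencil M (X : mx) i l : rels M -> i != l ->
  (img M X <= X *m amx M i + X *m amx M l)%MS.
Proof.
move=> r il; apply/sumsmx_subP => a _.
have := r i l a => /(congr1 (fun A => (plu i l)^-1 *: (X *m A))).
rewrite -!scalemxAr scalerA mulVf ?plu_neq0 // scale1r => ->.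
apply: scalemx_sub; rewrite mulmxDr -!scalemxAr; apply: addmx_sub.
  by apply: scalemx_sub; apply: addsmxSl.
by apply: scalemx_sub; apply: addsmxSr.
Qed.

Definition nodef (S : sets) (M : prep) : Prop :=
  forall X : mx, (X <= pr k (S (v0 C)))%MS -> (\rank X <= \rank (img M X))%N.

(* The largest X on which every other arm dominates the i-th one: its generalized
   eigenspace in the pencil of arm composites. *)
Lemma tube_space (S : sets) (M : prep) (i : 'I_n) : rels M -> nodef S M ->
  exists R : mx, [/\ (R <= pr k (S (v0 C)))%MS,
    forall l, l != i -> (img M R <= R *m amx M l)%MS, \rank (img M R) = \rank R &
    forall v : mx, (v <= pr k (S (v0 C)))%MS -> (v *m amx M i <= img M R)%MS -> (v <= R)%MS].
Proof.
move=> rM nd.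
pose Good (X : mx) := (X <= pr k (S (v0 C)))%MS /\ forall l, l != i -> (X *m amx M i <= X *m amx M l)%MS.
have [r [[R [[RS Rg] <-]] Rmax]] : exists r, (exists X, Good X /\ \rank X = r) /\
    forall y, (exists X, Good X /\ \rank X = y) -> (y <= r)%N.
  apply: (@bounded_max _ E).
    by exists 0%N, 0; rewrite mxrank0; split=> //; split=> [|l _]; rewrite ?sub0mx // mul0mx sub0mx.
  by move=> x [X [_ <-]]; apply: rank_leq_col.
have img_le l : l != i -> (img M R <= R *m amx M l)%MS.
  move=> li; apply: submx_trans (img_pencil R rM ltac:(by rewrite eq_sym; exact: li)) _.
  by rewrite addsmx_sub Rg // submx_refl.
exists R; split=> //.
  have [l li] : exists l : 'I_n, l != i.
    have n2 : (1 < n)%N := ltn_trans (isT : (1 < 2)%N) (narms_ge3 C).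
    have [E0|ne] := eqVneq i (Ordinal (ltnW n2)); last by exists (Ordinal (ltnW n2)); rewrite eq_sym.
    by exists (Ordinal n2); rewrite E0.
  apply/eqP; rewrite eqn_leq nd // andbT; apply: leq_trans (mxrankS (img_le l li)) _.
  exact: mxrankM_maxl.
move=> v vS vi.
have Rv : (R <= R + v)%MS by apply: addsmxSl.
have G : Good (R + v)%MS.
  split; first by rewrite addsmx_sub RS.
  move=> l li; rewrite addsmxMr addsmx_sub; apply/andP; split.
    by apply: submx_trans (Rg l li) _; apply: submxMr.
  apply: submx_trans vi _; apply: submx_trans (img_le l li) _; exact: submxMr.
have := Rmax _ (ex_intro _ _ (conj G erefl)) => le.
apply: submx_trans (addsmxSr R v) _.
have := mxrank_leqif_sup Rv => -[_ <-]; rewrite eqn_leq le andbT; exact: mxrankS.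
Qed.

Definition pre (S : {set 'I_E}) (A Y : mx) : mx := (pr k S :&: kermx (A *m cokermx Y))%MS.

Lemma preP S A (Y : mx) p (v : 'M[k]_(p, E)) :
  (v <= pre S A Y)%MS = (v <= pr k S)%MS && (v *m A <= Y)%MS.
Proof. by rewrite sub_capmx [(_ *m _ <= Y)%MS]submxE -mulmxA; congr (_ && _); apply/sub_kermxP/eqP. Qed.

Lemma armv_ind (P : vertex C -> Prop) : (forall l a, (a <= m l)%N -> P (armv l a)) -> forall x, P x.
Proof.
move=> H [[]|[l a]]; first by rewrite -/(voo C) -(armv_end (arm_fst C)); apply: H.
  exact: (H (arm_fst C) 0%N).
have lt : (a.+1 <= m l)%N by have := ltn_ord a; lia.
have := H l a.+1 lt; rewrite /armv insubT //.
by move=> lt'; congr (P (inr (Tagged _ _))); apply: val_inj.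
Qed.

Definition mkU (x0 xoo : mx) (g : 'I_n -> nat -> mx) (x : vertex C) : mx :=
  match x with
  | inl false => x0 | inl true => xoo
  | inr p => g (tag p) (tagged p).+1
  end.

Lemma mkU_arm x0 xoo g l a : (a <= m l)%N -> (g l 0%N :=: x0)%MS -> (g l (m l) :=: xoo)%MS ->
  (mkU x0 xoo g (armv l a) :=: g l a)%MS.
Proof.
move=> am g0 gm; case: a am => [|a] am; first exact: eqmx_sym.
rewrite /armv; case: insubP => [u ua <-|] //.
move=> na; have -> : a.+1 = m l by lia.
exact: eqmx_sym.
Qed.

(** Arms other than [i] act bijectively on such a [U], and along arm [i] it contains every row
    eventually mapped into it. The quotient is thus injective along arm [i]. *)
Definition tube (S : sets) (M : prep) (i : 'I_n) (U : vertex C -> mx) : Prop :=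
  [/\ subrep S M U, \rank (U (voo C)) = \rank (U (v0 C)), (img M (U (v0 C)) <= U (voo C))%MS,
   forall l a b, l != i -> (a <= b)%N -> (b <= m l)%N ->
     (U (armv l b) <= U (armv l a) *m cp (M l) a b)%MS &
   forall a b (w : mx), (a <= b)%N -> (b <= m i)%N -> (w <= pr k (S (armv i a)))%MS ->
     (w *m cp (M i) a b <= U (armv i b))%MS -> (w <= U (armv i a))%MS].

(** The space of [tube_space] at 0 is pushed forward along the other arms, while along arm [i] the
    preimages of its image at infinity are taken. The maximality of that space makes both
    descriptions agree at 0. *)
Lemma tube_exists (S : sets) (M : prep) (i : 'I_n) : isrep S M -> rels M -> nodef S M ->
  exists U, tube S M i U.
Proof.
move=> rS rM nd; have [R [RS Rl Rr Rmax]] := tube_space i rM nd.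
set Roo := img M R in Rl Rr Rmax.
pose g (l : 'I_n) a : mx := if l == i then pre (S (armv l a)) (cp (M l) a (m l)) Roo else R *m cp (M l) 0 a.
have RooS : (Roo <= pr k (S (voo C)))%MS.
  apply/sumsmx_subP => l _; have [_ <-] := isrep_amx l rS; by rewrite mulmxA submxMl.
have g0 l : (g l 0%N :=: R)%MS.
  rewrite /g; have [->|li] := eqVneq l i; last by rewrite mulmx1.
  apply/eqmxP/andP; split; last by rewrite preP RS; exact: img_sup.
  have := submx_refl (pre (S (armv i 0)) (cp (M i) 0 (m i)) Roo); rewrite {1}preP => /andP [h1 h2].
  exact: Rmax.
have gm l : (g l (m l) :=: Roo)%MS.
  rewrite /g; have [->|li] := eqVneq l i.
    apply/eqmxP/andP; split; last by rewrite preP cp_id mulmx1 submx_refl armv_end RooS.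
    have := submx_refl (pre (S (armv i (m i))) (cp (M i) (m i) (m i)) Roo); rewrite {1}preP cp_id mulmx1.
    by lia.
  by apply/eqmxP/andP; split; [apply: img_sup|apply: Rl].
pose U := mkU R Roo g.
have UE l a : (a <= m l)%N -> (U (armv l a) :=: g l a)%MS by move=> am; apply: mkU_arm.
have gS l a : (a <= m l)%N -> (g l a <= pr k (S (armv l a)))%MS.
  move=> am; rewrite /g; have [->|li] := eqVneq l i; first exact: capmxSl.
  case: a am => [|a] am; first by rewrite mulmx1.
  by have [_ <-] := isrep_cp rS (ltn0Sn a) am; rewrite mulmxA submxMl.
exists U; split.
- split=> [x|l a am].
    by elim/armv_ind: x => l a am; rewrite UE //; apply: gS.
  rewrite (eqmxMr _ (UE l a (ltnW am))) UE // /g; have [_|li] := eqVneq l i; last first.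
    by rewrite cp_r // mulmxA.
  rewrite preP; have [_ e2] := rS l a am.
  have := submx_refl (pre (S (armv l a)) (cp (M l) a (m l)) Roo); rewrite {1}preP => /andP [h1 h2].
  by rewrite -mulmxA -cp_l // -e2 mulmxA submxMl.
- exact: Rr.
- exact: submx_refl.
- move=> l a b li ab bm; rewrite UE // (eqmxMr _ (UE l a (leq_trans ab bm))) /g (negPf li).
  by rewrite -mulmxA -cp_cat.
- move=> a b w ab bm wS; rewrite (UE i b bm) (UE i a (leq_trans ab bm)) /g eqxx !preP wS /=.
  by move=> /andP [_]; rewrite -mulmxA -cp_cat.
Qed.

Section Quotient.

Context (S : sets) (M : prep) (U : vertex C -> mx) (T : sets) (u : vertex C -> mx) (M' : prep).
Hypothesis (ch : is_chart S M U T u M') (rS : isrep S M).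

Let N := cut (compl S T) M'.

Let uu x : u x *m u x = 0.
Proof. exact: chart_unip ch. Qed.

Let uS x : u x *m pr k (S x) = u x.
Proof.
have [TS su _ _ _] := ch; have [_ <-] := su x; rewrite -mulmxA pr_sub //.
exact: subsetDl.
Qed.

Lemma quot_injon l a b : (a < b)%N -> (b <= m l)%N ->
  (forall w : mx, (w <= pr k (S (armv l a)))%MS -> (w *m cp (M l) a b <= U (armv l b))%MS ->
     (w <= U (armv l a))%MS) -> injon (compl S T (armv l a)) (cp (N l) a b).
Proof.
move=> ab bm H X XQ XN.
have XQe : X *m pr k (compl S T (armv l a)) = X by apply/sub_prP.
have [TS su _ _ [rS' _]] := ch.
have e1 : X *m cp (M' l) a b *m pr k (compl S T (armv l b)) = 0.
  by rewrite -XN (cutQ_cp ch) // !mulmxA XQe.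
have XT : (X *m cp (M' l) a b <= pr k (T (armv l b)))%MS.
  apply/sub_prP; have [_ e] := isrep_cp rS' ab bm.
  rewrite -[in RHS]e -(pr_setD k (TS (armv l b)).1) !mulmxDr !mulmxA.
  by rewrite e1 addr0.
have : (X *m (1%:M + u (armv l a)) <= U (armv l a))%MS.
  apply: H.
    apply/sub_prP; rewrite mulmxDr mulmx1 mulmxDl -mulmxA uS; congr (_ + _).
    by apply/sub_prP; apply: submx_trans XQ _; apply/sub_prP; rewrite pr_sub // subsetDl.
  by rewrite -mulmxA -(chart_cpE ch) ?(ltnW ab) // mulmxA (chart_sub ch).
rewrite (chart_sub ch) => /sub_prP XT'.
by rewrite -XT' -XQe -mulmxA prD_pr mulmx0.
Qed.

(** The preimage in [M] of a space of the quotient; it compares the defect of the quotient with that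
    of [M]. *)
Lemma quot_pull (X : mx) : (X <= pr k (compl S T (v0 C)))%MS ->
  exists2 Z : mx, (Z <= pr k (S (v0 C)))%MS & \rank Z = (#|T (v0 C)| + \rank X)%N /\
    (\rank (img M Z) <= #|T (voo C)| + \rank (img N X))%N.
Proof.
move=> XQ; have [TS su _ _ [rS' tT]] := ch.
have XQe : X *m pr k (compl S T (v0 C)) = X by apply/sub_prP.
pose Y := (pr k (T (v0 C)) + X)%MS.
have full := unip_free (uu (v0 C)); have full' := unip_free (uu (voo C)).
have YS : (Y <= pr k (S (v0 C)))%MS.
  rewrite addsmx_sub; apply/andP; split; first by apply/sub_prP; rewrite pr_sub // (TS _).1.
  by apply: submx_trans XQ _; apply/sub_prP; rewrite pr_sub // subsetDl.
exists (Y *m (1%:M + u (v0 C))); last split.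
- apply/sub_prP; rewrite mulmxDr mulmx1 mulmxDl -mulmxA uS; congr (_ + _); exact/sub_prP.
- rewrite mxrankMfree // mxrank_disjoint_sum ?rank_pr //.
  apply/eqP; rewrite -submx0; set Z := (_ :&: _)%MS.
  have /sub_prP z1 : (Z <= pr k (T (v0 C)))%MS := capmxSl _ _.
  have /sub_prP z2 : (Z <= pr k (compl S T (v0 C)))%MS := submx_trans (capmxSr _ _) XQ.
  by rewrite -z1 -z2 -mulmxA prD_pr mulmx0.
have H l : (Y *m (1%:M + u (v0 C)) *m amx M l <= (pr k (T (voo C)) + img N X)%MS *m (1%:M + u (voo C)))%MS.
  rewrite -mulmxA -(chart_amx ch) mulmxA; apply: submxMr.
  rewrite addsmxMr addsmx_sub; apply/andP; split.
    rewrite -(cutT_amx ch); have [_ <-] := isrep_amx l (isrep_cut T M').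
    by apply: submx_trans (addsmxSl _ _); exact: submxMl.
  have [_ e] := isrep_amx l rS'.
  rewrite -e -(pr_setD k (TS (voo C)).1) mulmxDr mulmxDr !mulmxA; apply: addmx_sub_adds; first exact: submxMl.
  rewrite -[X in (X *m _ *m _ <= _)%MS]XQe -!mulmxA [pr k _ *m (_ *m _)]mulmxA -(cutQ_amx ch); exact: img_sup.
have : (img M (Y *m (1%:M + u (v0 C))) <= (pr k (T (voo C)) + img N X)%MS *m (1%:M + u (voo C)))%MS.
  by apply/sumsmx_subP => l _.
move/mxrankS => le; apply: leq_trans le _; rewrite mxrankMfree // -(rank_pr k (T (voo C))).
exact: mxrank_adds_leqif.
Qed.

End Quotient.

(** A fixed companion for each arm: cycles are closed through it and pencils are formed against
    it. *)
Definition oth (i : 'I_n) : 'I_n := if i == arm_snd C then arm_fst C else arm_snd C.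

Lemma oth_neq i : i != oth i.
Proof.
by rewrite /oth; have [e|ne] := eqVneq i (arm_snd C); [rewrite e|exact: ne].
Qed.

Lemma sum_vertex (V : nmodType) (F : vertex C -> V) :
  \sum_x F x = F (v0 C) + F (voo C) + \sum_(l < n) \sum_(a < (m l).-1) F (armv l a.+1).
Proof.
rewrite big_sumType big_bool /= [F _ + F _]addrC; congr (_ + _).
rewrite sig_big_dep; apply: eq_bigr => -[l a] _ /=; congr F.
rewrite /armv insubT // => lt; congr (inr (Tagged _ _)); exact: val_inj.
Qed.

Lemma narmsE : n%:Z = (n - 2)%:Z + 2.
Proof. have := narms_ge3 C; lia. Qed.

Lemma narms1E : (n - 1)%:Z = (n - 2)%:Z + 1.
Proof. have := narms_ge3 C; lia. Qed.

Lemma chiE (d e : dimvec C) : chi d e =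
  \sum_(l < n) \sum_(a < m l) (d (armv l a))%:Z * ((e (armv l a.+1))%:Z - (e (armv l a))%:Z)
  + (n - 1)%:Z * ((d (v0 C))%:Z * (e (v0 C))%:Z) - (d (voo C))%:Z * (e (voo C))%:Z
  - (n - 2)%:Z * ((d (v0 C))%:Z * (e (voo C))%:Z).
Proof.
rewrite /chi sum_vertex (sum_arrow (fun l a => (d (armv l a))%:Z * (e (armv l a.+1))%:Z)).
have E1 : \sum_(l < n) \sum_(a < (m l).-1) (d (armv l a.+1))%:Z * (e (armv l a.+1))%:Z =
   \sum_(l < n) \sum_(a < m l) (d (armv l a))%:Z * (e (armv l a))%:Z - n%:Z * ((d (v0 C))%:Z * (e (v0 C))%:Z).
  have -> : n%:Z * ((d (v0 C))%:Z * (e (v0 C))%:Z) = \sum_(l < n) (d (v0 C))%:Z * (e (v0 C))%:Z :> int.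
    by rewrite sumr_const card_ord -mulr_natl natz.
  rewrite -sumrB; apply: eq_bigr => l _.
  have := arity_gt0 l; move: (fun a => (d (armv l a))%:Z * (e (armv l a))%:Z) (erefl ((d (armv l 0%N))%:Z * (e (armv l 0%N))%:Z)) => F.
  rewrite -{2}/(armv l 0) => _ => m0.
  have -> : \sum_(a < m l) (d (armv l a))%:Z * (e (armv l a))%:Z = (d (v0 C))%:Z * (e (v0 C))%:Z
     + \sum_(a < (m l).-1) (d (armv l a.+1))%:Z * (e (armv l a.+1))%:Z.
    move: m0; move: (m l) => [//|mm] _; by rewrite big_ord_recl.
  by lia|| (rewrite addrAC subrr add0r).
rewrite E1.
have -> : \sum_(l < n) \sum_(a < m l) (d (armv l a))%:Z * ((e (armv l a.+1))%:Z - (e (armv l a))%:Z) =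
  \sum_(l < n) \sum_(a < m l) (d (armv l a))%:Z * (e (armv l a.+1))%:Z -
  \sum_(l < n) \sum_(a < m l) (d (armv l a))%:Z * (e (armv l a))%:Z.
  rewrite -sumrB; apply: eq_bigr => l _; rewrite -sumrB; apply: eq_bigr => a _; by lia.
have -> : (n - 1)%:Z = n%:Z - 1 by have := narms_ge3 C; lia.
move: (\sum_(l < n) _) (\sum_(l < n) _) => s1 s2; ring.
Qed.

(* The Euler form against a representation whose other arms are isomorphisms
   only sees the steps along the arm i. *)
Lemma chi_tube (d e : dimvec C) (i : 'I_n) : d (v0 C) = d (voo C) ->
  (forall l a, l != i -> (a <= m l)%N -> d (armv l a) = d (v0 C)) ->
  chi d e = \sum_(a < m i) (d (armv i a))%:Z * ((e (armv i a.+1))%:Z - (e (armv i a))%:Z).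
Proof.
move=> d0 dl; rewrite chiE (bigD1 i) //=.
have -> : \sum_(l < n | l != i) \sum_(a < m l) (d (armv l a))%:Z * ((e (armv l a.+1))%:Z - (e (armv l a))%:Z) =
   (n - 1)%:Z * ((d (v0 C))%:Z * ((e (voo C))%:Z - (e (v0 C))%:Z)).
  transitivity (\sum_(l < n | l != i) (d (v0 C))%:Z * ((e (voo C))%:Z - (e (v0 C))%:Z)).
    apply: eq_bigr => l li; rewrite -[in RHS](armv_end l).
    have -> : (e (armv l (m l)))%:Z - (e (v0 C))%:Z = \sum_(a < m l) ((e (armv l a.+1))%:Z - (e (armv l a))%:Z).
      by rewrite -(big_mkord predT (fun a => (e (armv l a.+1))%:Z - (e (armv l a))%:Z)) telescope_sumr.
    rewrite mulr_sumr; apply: eq_bigr => a _; by rewrite dl // ltnW.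
  rewrite sumr_const -mulr_natl natz; congr (_%:Z * _).
  transitivity #|predC1 i|; first by [].
  by rewrite cardC1 card_ord subn1.
rewrite -d0; rewrite narms1E.
ring.
Qed.

Section LevelBound.

Context (Q : 'I_n -> seq (nat * nat)) (jc : 'I_n -> nat).
Hypothesis jcm : forall l, (jc l < m l)%N.
Hypothesis uQ : forall l, uniq (Q l).

(** The dimension along the unrolled cycle, corrected so that crossing from infinity to 0 causes no
    jump even when the two dimensions differ: at [t = m l] both readings give
    [d (voo C) + d (v0 C)]. *)
Definition prof (d : dimvec C) (l : 'I_n) (t : nat) : nat :=
  d (pos l t) + (if (t <= m l)%N then d (v0 C) else d (voo C)).

Definition valid (d : dimvec C) (l : 'I_n) : Prop := forall ab, ab \in Q l ->
  [/\ (jc l < ab.1 < ab.2)%N, (ab.2 <= jc l + m l)%N, prof d l ab.1 = prof d l ab.2 &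
     forall t, (ab.1 < t < ab.2)%N -> (prof d l ab.2 < prof d l t)%N].

(** The classes met while arms are treated one by one: [J] lists the arms whose degeneracies remain,
    and the other arms have already become injective. *)
Definition Lev (J : seq 'I_n) (T : sets) (M : prep) : Prop :=
  [/\ isrep T M, rels M, nodef T M,
     forall l, l \notin J -> injon (T (v0 C)) (amx M l) &
     forall l, l \in J -> forall ab, ab \in Q l -> degen T (oth l) l M ab].

(** Induction on [J]: the tube of one arm is split off. It carries that arm's degeneracies, the
    quotient keeps the others and is injective along that arm, and the Euler form accounts for the
    pairs that are lost. *)
Lemma level_bound (J : seq 'I_n) (T : sets) (d : dimvec C) : uniq J ->
  (forall x, #|T x| = d x) -> (forall l, l \in J -> valid d l) ->
  cod (Lev J T) d (\sum_(l <- J) size (Q l))%N%:Z.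
Proof.
elim: J T d => [|i J IH] T d uJ dT vd.
  rewrite big_nil; apply: (cod_inj (oth_neq (arm_fst C)) dT) => M [rM eM _ inj _].
  by split=> // l _ _; apply: inj.
have [iJ uJ'] : i \notin J /\ uniq J by apply/andP.
pose Qf (f : {ffun vertex C -> 'I_E.+1}) (M : prep) :=
  Lev (i :: J) T M /\ exists U, tube T M i U /\ forall x, \rank (U x) = f x.
apply: (@cod_cover k C E _ _ Qf).
  move=> M LM; have [rM eM nd _ _] := LM; have [U tU] := tube_exists i rM eM nd.
  exists [ffun x => inord (\rank (U x))]; split=> //; exists U; split=> // x.
  by rewrite ffunE inordK // ltnS rank_leq_col.
move=> f; have [[M0 [L0 [U0 [tU0 rU0]]]]|no] := classic (exists M, Qf f M); last by [].
have [[U0S U0c] r0 i0 onto0 pull0] := tU0.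
have [d1 rd1] : exists d1 : vertex C -> nat, forall x, d1 x = f x by exists (fun x => f x : nat).
have [d2 dE] : exists d2 : vertex C -> nat, forall x, d x = (d1 x + d2 x)%N.
  exists (fun x => d x - d1 x)%N => x.
  by rewrite subnKC // rd1 -rU0 -dT -(rank_pr k (T x)); apply: mxrankS.
have [rM0 eM0 nd0 _ _] := L0.
have d10 : d1 (v0 C) = d1 (voo C) by rewrite !rd1 -!rU0.
have d1c l a : l != i -> (a <= m l)%N -> d1 (armv l a) = d1 (v0 C).
  move=> li am; rewrite !rd1 -!rU0; apply/eqP; rewrite eqn_leq; apply/andP; split.
    exact: leq_trans (mxrankS (onto0 l 0%N a li (leq0n _) am)) (mxrankM_maxl _ _).
  have := onto0 l a (m l) li am (leqnn _); rewrite armv_end => h.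
  by rewrite -r0; apply: leq_trans (mxrankS h) (mxrankM_maxl _ _).
have d2m a : (a < m i)%N -> (d2 (armv i a) <= d2 (armv i a.+1))%N.
  move=> am; have [T0 [u0 [M0' [ch0 _]]]] := chart_exists rM0 (conj U0S U0c).
  have := quot_injon ch0 (ltnSn a) am (fun w => @pull0 a a.+1 w (leqnSn a) am).
  move=> /injon_rank h.
  have cd x : #|compl T T0 x| = d2 x.
    have [/(_ x) [h1 h2] _ _ _ _] := ch0.
    by rewrite cardsD (setIidPr h1) h2 rU0 -rd1 dT dE addKn.
  rewrite -!cd -h -(rank_pr k (compl T T0 (armv i a.+1))).
  have [-> <-] : supp (compl T T0 (armv i a)) (compl T T0 (armv i a.+1)) (cp (cut (compl T T0) M0' i) a a.+1).
    by apply: isrep_cp => //; apply: isrep_cut.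
  by rewrite mxrankM_maxr.
(* A pair along which the profile of the quotient is constant constrains the tube. Any other pair
   spans a rise of that profile, and [level_count] charges it to a term of [chi d1 d2]. *)
pose Q1 := [seq ab <- Q i | prof d2 i ab.1 == prof d2 i ab.2].
have vi := vd i (mem_head i J).
have profm t : (t < jc i + m i)%N -> (prof d2 i t <= prof d2 i t.+1)%N.
  move=> th; rewrite /prof /pos; case: (ltngtP t (m i)) => h.
  - by rewrite leq_add2r d2m.
  - rewrite leq_add2r subSn ?(ltnW h) //; apply: d2m.
    by have := jcm i; lia.
  - by rewrite h subSnn armv_end [X in (X <= _)%N]addnC leq_add2r; apply: (d2m 0%N); apply: arity_gt0.
have profE t : prof d i t = (d1 (pos i t) + prof d2 i t + d1 (v0 C))%N.
  by rewrite /prof !dE; case: ifP => _; lia.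
have profmono a b : (a <= b)%N -> (b <= jc i + m i)%N -> (prof d2 i a <= prof d2 i b)%N.
  move=> ab bm; have := subnK ab; move: (b - a)%N => l; elim: l a {ab} => [|l IHl] a E0.
    by have -> : a = b by [].
  by apply: leq_trans (profm a _) (IHl a.+1 _); lia.
apply: (@cod_weak k C E _ _ ((size Q1)%:Z + (\sum_(l <- J) size (Q l))%N%:Z + chi d1 d2)).
  rewrite big_cons (chi_tube _ d10 d1c) PoszD.
  have le1 : (size (Q i) <= size Q1 + \sum_(a < m i) d1 (armv i a) * (d2 (armv i a.+1) - d2 (armv i a)))%N.
    rewrite -(count_predC (fun ab => prof d2 i ab.1 == prof d2 i ab.2) (Q i)) size_filter leq_add2l -size_filter.
    apply: leq_trans (_ : (\sum_((jc i).+1 <= t < jc i + m i) d1 (pos i t) * (prof d2 i t.+1 - prof d2 i t) <= _)%N).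
      apply: (@level_count (fun t => d1 (pos i t)) (prof d2 i)); first exact: filter_uniq.
        by move=> t /andP [_ h]; apply: profm.
      move=> ab; rewrite mem_filter /= => /andP [ne abQ]; have [/andP [h1 h2] h3 h4 h5] := vi ab abQ; split=> //.
      - by rewrite h2.
      - by move: h4; rewrite !profE => /addIn.
      - by move=> t ht; have := h5 t ht; rewrite !profE ltn_add2r.
      - by rewrite ltn_neqAle ne profmono // ltnW.
    rewrite -(@unroll_sum nat (fun t => d1 (pos i t) * (prof d2 i t.+1 - prof d2 i t))%N
      (fun a => d1 (armv i a) * (d2 (armv i a.+1) - d2 (armv i a)))%N (jc i) (m i) (jcm i)).
    - exact: leq_addr.
    - by move=> t h; rewrite /prof /pos (ltnW h) h subnDr.
    - move=> a aj; have am : (a < m i)%N by apply: ltn_trans aj (jcm i).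
      rewrite /prof /pos; case: (posnP a) => [->|a0].
        by rewrite addn0 leqnn ltnn subSnn !armv_end -d10 [(d2 (voo C) + _)%N]addnC subnDr.
      have -> : (m i + a <= m i)%N = false by lia.
      have -> : (m i + a < m i)%N = false by lia.
      by rewrite subSn ?leq_addr // addKn subnDr.
  have -> : \sum_(a < m i) (d1 (armv i a))%:Z * ((d2 (armv i a.+1))%:Z - (d2 (armv i a))%:Z)
     = (\sum_(a < m i) d1 (armv i a) * (d2 (armv i a.+1) - d2 (armv i a)))%N%:Z.
    rewrite -[RHS]natz natr_sum; apply: eq_bigr => a _.
    by rewrite natz subzn // d2m.
  move: le1; lia.
apply: (@ext_cod k C E _ (fun T1 N => [/\ isrep T1 N, rels N, forall l, l != i -> (pr k (T1 (voo C)) <= amx N l)%MS &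
      forall ab, ab \in Q1 -> degen T1 (oth i) i N ab]) (Lev J) T i (oth i) d1 d2 d _ _ (oth_neq i) dT dE).
- move=> T1 dT1; apply: (cod_tube (oth_neq i) dT1 (jcm i)) => //; first exact: filter_uniq.
  move=> ab; rewrite mem_filter => /andP [/eqP e abQ]; have [h1 h3 h4 h5] := vi ab abQ.
  split=> //; first by move: h4; rewrite !profE e => /addIn /addIn.
  move=> t /andP [ht1 ht2]; have := h5 t; rewrite ht1 ht2 => /(_ isT); rewrite !profE ltn_add2r => lt.
  have le : (prof d2 i t <= prof d2 i ab.2)%N by apply: profmono => //; apply: ltnW.
  by lia.
- move=> T2 dT2; apply: IH => // l lJ ab abQ.
  have li : l != i by apply: contraNneq iJ => <-.
  have [h1 h3 h4 h5] := vd l ltac:(by rewrite inE lJ orbT) ab abQ.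
  have pE t : (t <= jc l + m l)%N -> prof d l t = (prof d2 l t + d1 (v0 C) + d1 (v0 C))%N.
    move=> th; rewrite /prof !dE; have -> : d1 (pos l t) = d1 (v0 C).
      by rewrite /pos; case: leqP => h; apply: d1c => //; have := jcm l; lia.
    by case: ifP => _; rewrite -?d10; lia.
  split=> //; first by move: h4; rewrite !pE; lia.
  by move=> t ht; have := h5 t ht; rewrite !pE; lia.
move=> M [LM [U [tU rU]]]; have [rM eM nd inj dg] := LM; split=> //.
have [[US Uc] rr ii onto pull] := tU.
exists U; split=> //.
- by move=> x; rewrite rU.
- by move=> l li _ _; have := onto l 1%N (m l) li (arity_gt0 l) (leqnn _); rewrite armv_end.
move=> T1 u M' ch.
have T1E x : #|T1 x| = d1 x by have [/(_ x) [_ ->] _ _ _ _] := ch; rewrite rU.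
have T2E x : #|compl T T1 x| = d2 x.
  by have [/(_ x) [h1 h2] _ _ _ _] := ch; rewrite cardsD (setIidPr h1) dT T1E dE addKn.
have ontoT l a b : l != i -> (a < b)%N -> (b <= m l)%N ->
   (pr k (T1 (armv l b)) <= pr k (T1 (armv l a)) *m cp (cut T1 M' l) a b)%MS.
  by move=> li ab bm; apply: (chart_onto ch) => //; apply: onto => //; apply: ltnW.
have rT1 := isrep_cut T1 M'; have rT2 := isrep_cut (compl T T1) M'.
have qinj a b : (a < b)%N -> (b <= m i)%N -> injon (compl T T1 (armv i a)) (cp (cut (compl T T1) M' i) a b).
  by move=> ab bm; apply: (quot_injon ch ab bm) => w; apply: pull => //; apply: ltnW.
split.
  split=> //; first exact: (rels_cutT ch eM).
    move=> l li; have := ontoT l 0%N (m l) li (arity_gt0 l) (leqnn _).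
    by rewrite armv_end (isrep_amx l rT1).1.
  move=> [x y]; rewrite mem_filter => /andP [/eqP /= pe xyQ].
  have [/= /andP [h1 h2] h3 h4 h5] := vi (x, y) xyQ.
  have y2m : (y <= m i + m i)%N by apply: leq_trans h3 _; rewrite leq_add2r ltnW.
  have ym : (y - m i <= m i)%N by lia.
  have [//|] := @degen_cut T M U T1 u M' (oth i) i (x, y) ch rM h2 y2m (dg i (mem_head i J) (x, y) xyQ).
  (* Along a retained pair the quotient is injective between spaces of equal dimension, hence
     bijective, so the degeneracy must occur in the tube. *)
  have onQ a b : (a < b)%N -> (b <= m i)%N -> d2 (armv i a) = d2 (armv i b) ->
     (pr k (compl T T1 (armv i b)) <= cp (cut (compl T T1) M' i) a b)%MS.
    move=> lt bm e; apply: injon_onto (isrep_cp rT2 lt bm) _ (qinj a b lt bm).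
    by rewrite !T2E.
  have prl a b : (a < b)%N -> (b <= m i)%N ->
    pr k (compl T T1 (armv i a)) *m cp (cut (compl T T1) M' i) a b = cp (cut (compl T T1) M' i) a b.
    by move=> lt bm; have [] := isrep_cp rT2 lt bm.
  move=> dgQ; exfalso; apply: degen_onto dgQ => //=.
  - move=> b; rewrite prl //; apply: onQ => //; move: pe; rewrite /prof /pos b (leq_trans (ltnW h2) b).
    by lia.
  - move=> a; have h6 : (x - m i < y - m i)%N by lia.
    rewrite prl //; apply: onQ => //; move: pe; rewrite /prof /pos.
    rewrite (leqNgt y) (leq_ltn_trans a h2) /=.
    case: leqP => a'; last by lia.
    have -> : x = m i by lia.
    by rewrite armv_end subnn addnC => /addIn.
  - move=> /andP [a b].
    have h8 : (0 < y - m i)%N by lia.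
    have m1 := profmono x (m i) (ltnW a) (leq_trans (ltnW b) h3).
    have m2 := profmono (m i) y (ltnW b) h3.
    have e1 : prof d2 i x = prof d2 i (m i) by lia.
    have e2 : prof d2 i (m i) = prof d2 i y by lia.
    split.
      have := prl x (m i) a (leqnn _) => ->; rewrite -[X in pr k (compl T T1 X)](armv_end i); apply: onQ => //.
      by move: e1; rewrite /prof /pos leqnn (ltnW a) => /addIn.
    apply: onQ => //; move: e2; rewrite /prof /pos leqnn (leqNgt y) b /=.
    by rewrite armv_end addnC => /addIn.
split=> //.
- exact: (rels_cutQ ch eM).
- move=> X XQ; have [Z ZS [rZ rI]] := quot_pull ch XQ.
  have := leq_trans (nd Z ZS) rI; rewrite rZ !T1E; by lia.
- move=> l lJ; have := quot_injon ch (arity_gt0 l) (leqnn (m l)); rewrite armv_end; apply=> w wS wU.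
  have [El|li] := eqVneq l i.
    subst l; apply: (pull 0%N (m i) w) => //; by rewrite armv_end.
  have ol := onto l 0%N (m l) li (leq0n _) (leqnn _); rewrite armv_end in ol.
  have /submxP [L HL] := submx_trans wU ol.
  have : (w - L *m U (v0 C)) = 0.
    apply: (inj l); first by rewrite negb_or li.
      by rewrite addmx_sub // eqmx_opp; apply: submx_trans (US _); apply: submxMl.
    by rewrite mulmxBl -mulmxA [w *m _]HL subrr.
  by move/eqP; rewrite subr_eq0 => /eqP ->; apply: submxMl.
- move=> l lJ ab abQ.
  have li : l != i by apply: contraNneq iJ => <-.
  have lJ' : l \in i :: J by rewrite inE lJ orbT.
  have [/andP [h1 h2] h3 h4 h5] := vd l lJ' ab abQ.
  have y2m : (ab.2 <= m l + m l)%N by apply: leq_trans h3 _; rewrite leq_add2r ltnW.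
  have ym : (ab.2 - m l <= m l)%N by rewrite leq_subLR.
  (* Along the arms other than [i] the tube is onto, so their degeneracies pass to the quotient. *)
  have [dgT|//] := degen_cut ch rM h2 y2m (dg l lJ' ab abQ).
  exfalso; apply: degen_onto dgT => //.
  + by move=> b; apply: ontoT.
  + by move=> a; apply: ontoT => //; rewrite ltn_sub2r // (leq_ltn_trans a).
  + move=> /andP [a b]; split; first by have := ontoT l ab.1 (m l) li a (leqnn _); rewrite armv_end.
    have h8 : (0 < ab.2 - m l)%N by rewrite subn_gt0.
    by have := ontoT l 0%N _ li h8 ym; rewrite (isrep_cp rT1 h8 ym).1.
Qed.

End LevelBound.

End ClassBounds.

(** * Values of the Euler form *)

Section EulerForm.

Context (k : closedFieldType) (C : canonicalData k).

Local Notation n := (narms C).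
Local Notation m := (@arity k C).

Lemma chiDr (u d d1 d2 : dimvec C) : (forall x, d x = d1 x + d2 x)%N ->
  chi u d = chi u d1 + chi u d2.
Proof.
move=> dE; rewrite !chiE !dE.
have -> : \sum_(l < n) \sum_(a < m l) (u (armv l a))%:Z * ((d (armv l a.+1))%:Z - (d (armv l a))%:Z) =
  \sum_(l < n) \sum_(a < m l) (u (armv l a))%:Z * ((d1 (armv l a.+1))%:Z - (d1 (armv l a))%:Z) +
  \sum_(l < n) \sum_(a < m l) (u (armv l a))%:Z * ((d2 (armv l a.+1))%:Z - (d2 (armv l a))%:Z).
  rewrite -big_split; apply: eq_bigr => l _; rewrite -big_split; apply: eq_bigr => a _ /=.
  by rewrite !dE; ring.
rewrite !PoszD; ring.
Qed.

Lemma chiDl (u d d1 d2 : dimvec C) : (forall x, d x = d1 x + d2 x)%N ->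
  chi d u = chi d1 u + chi d2 u.
Proof.
move=> dE; rewrite !chiE !dE.
have -> : \sum_(l < n) \sum_(a < m l) (d (armv l a))%:Z * ((u (armv l a.+1))%:Z - (u (armv l a))%:Z) =
  \sum_(l < n) \sum_(a < m l) (d1 (armv l a))%:Z * ((u (armv l a.+1))%:Z - (u (armv l a))%:Z) +
  \sum_(l < n) \sum_(a < m l) (d2 (armv l a))%:Z * ((u (armv l a.+1))%:Z - (u (armv l a))%:Z).
  rewrite -big_split; apply: eq_bigr => l _; rewrite -big_split; apply: eq_bigr => a _ /=.
  by rewrite !dE; ring.
rewrite !PoszD; ring.
Qed.

Lemma telescope_arm (f : nat -> int) (l : 'I_n) : \sum_(a < m l) (f a.+1 - f a) = f (m l) - f 0%N.
Proof. by rewrite -(big_mkord predT (fun a => f a.+1 - f a)) telescope_sumr. Qed.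

Section Regular.

Context (d : dimvec C) (p : nat) (qc : 'I_n -> nat -> nat).
Hypothesis dv0 : (d (v0 C) = p + \sum_l qc l 0)%N.
Hypothesis dE : forall l t, (t <= m l)%N -> (d (armv l t) + qc l 0 = d (v0 C) + qc l t)%N.
Hypothesis qcm : forall l, qc l (m l) = qc l 0%N.

Lemma regular_voo : d (voo C) = d (v0 C).
Proof.
have := dE (leqnn (m (arm_fst C))); rewrite armv_end qcm => /eqP; rewrite eqn_add2r => /eqP; exact.
Qed.

Let dEz l t : (t <= m l)%N -> (d (armv l t))%:Z = (d (v0 C))%:Z + (qc l t)%:Z - (qc l 0%N)%:Z.
Proof. by move/dE; lia. Qed.

Let dv0z : (d (v0 C))%:Z = p%:Z + \sum_l (qc l 0%N)%:Z.
Proof. by rewrite dv0 PoszD -!natz natr_sum; congr (_ + _); apply: eq_bigr => l _; rewrite natz. Qed.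

(** Summation by parts along each arm moves the differences from [d] to [u]; the boundary terms
    cancel against the coefficients n - 1 and n - 2 and leave only [p]. *)
Lemma chi_regular_r (u : dimvec C) : chi u d =
  ((u (v0 C))%:Z - (u (voo C))%:Z) * p%:Z +
  \sum_(l < n) \sum_(a < m l) ((u (armv l a))%:Z - (u (armv l a.+1))%:Z) * (qc l a.+1)%:Z.
Proof.
rewrite chiE regular_voo.
have -> : \sum_(l < n) \sum_(a < m l) (u (armv l a))%:Z * ((d (armv l a.+1))%:Z - (d (armv l a))%:Z)
  = \sum_(l < n) (\sum_(a < m l) ((u (armv l a))%:Z - (u (armv l a.+1))%:Z) * (qc l a.+1)%:Z
     + ((u (voo C))%:Z - (u (v0 C))%:Z) * (qc l 0%N)%:Z).
  apply: eq_bigr => l _.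
  have -> : ((u (voo C))%:Z - (u (v0 C))%:Z) * (qc l 0%N)%:Z =
     \sum_(a < m l) ((u (armv l a.+1))%:Z * (qc l a.+1)%:Z - (u (armv l a))%:Z * (qc l a)%:Z).
    by rewrite (telescope_arm (fun a => (u (armv l a))%:Z * (qc l a)%:Z)) armv_end qcm mulrBl.
  rewrite -big_split; apply: eq_bigr => a _ /=.
  rewrite !dEz ?(ltnW (ltn_ord a)) //; ring.
rewrite big_split /= -mulr_sumr.
rewrite narms1E.
rewrite dv0z; ring.
Qed.

Lemma chi_regular_l (t : dimvec C) : chi d t =
  ((t (voo C))%:Z - (t (v0 C))%:Z) * p%:Z +
  \sum_(l < n) \sum_(a < m l) ((t (armv l a.+1))%:Z - (t (armv l a))%:Z) * (qc l a)%:Z.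
Proof.
rewrite chiE regular_voo.
have -> : \sum_(l < n) \sum_(a < m l) (d (armv l a))%:Z * ((t (armv l a.+1))%:Z - (t (armv l a))%:Z)
  = \sum_(l < n) (\sum_(a < m l) ((t (armv l a.+1))%:Z - (t (armv l a))%:Z) * (qc l a)%:Z
     + ((t (voo C))%:Z - (t (v0 C))%:Z) * ((d (v0 C))%:Z - (qc l 0%N)%:Z)).
  apply: eq_bigr => l _.
  have -> : ((t (voo C))%:Z - (t (v0 C))%:Z) = \sum_(a < m l) ((t (armv l a.+1))%:Z - (t (armv l a))%:Z).
    by rewrite (telescope_arm (fun a => (t (armv l a))%:Z)) armv_end.
  rewrite mulr_suml -big_split; apply: eq_bigr => a _ /=.
  rewrite !dEz ?(ltnW (ltn_ord a)); ring.
rewrite big_split /= -mulr_sumr sumrB sumr_const card_ord -mulr_natl natz.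
rewrite narmsE.
rewrite narms1E.
rewrite dv0z; ring.
Qed.

End Regular.

(** For the constant vector [h] one has [chi h e = - chi e h], so it lies in the radical of the
    symmetrized form. *)
Lemma chi_const (u w : dimvec C) y : (forall x, u x = w x + y)%N -> chi u u = chi w w.
Proof.
move=> uE; pose h (x : vertex C) := y.
have hl e : chi h e = y%:Z * ((e (voo C))%:Z - (e (v0 C))%:Z).
  rewrite chiE; have -> : \sum_(l < n) \sum_(a < m l) (h (armv l a))%:Z * ((e (armv l a.+1))%:Z - (e (armv l a))%:Z)
   = \sum_(l < n) (y%:Z * ((e (voo C))%:Z - (e (v0 C))%:Z)).
    apply: eq_bigr => l _; rewrite /h -mulr_sumr; congr (_ * _).
    by rewrite (telescope_arm (fun a => (e (armv l a))%:Z)) armv_end.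
  rewrite sumr_const card_ord -mulr_natl natz /h.
  rewrite narmsE narms1E; ring.
have hr e : chi e h = y%:Z * ((e (v0 C))%:Z - (e (voo C))%:Z).
  rewrite chiE big1; last by move=> l _; rewrite big1 // => a _; rewrite subrr mulr0.
  rewrite narms1E.
  rewrite /h; ring.
rewrite (chiDr u uE) (chiDl w uE) (chiDl h uE) !hl hr subrr mulr0.
ring.
Qed.

(** Subtracting the constant [u (voo C)] gives a vector vanishing at infinity, where the form is
    minus the Tits form of the star of the arms. *)
Lemma chi_tits (u : dimvec C) :
  (forall w : dimvec C, w (voo C) = 0%N ->
     (\sum_(a : arrow C) w (tgt a) * w (src a) <= \sum_x w x * w x)%N) ->
  (forall x, u (voo C) <= u x)%N -> chi u u <= 0.
Proof.
move=> tits um; rewrite (@chi_const u (fun x => u x - u (voo C))%N (u (voo C))); last by move=> x; rewrite subnK.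
rewrite /chi subnn !mulr0 subr0 subr_le0.
have := tits (fun x => u x - u (voo C))%N (subnn (u (voo C))); rewrite -lez_nat -!natz !natr_sum.
under [X in X <= _]eq_bigr => a _ do rewrite natrM !natz.
by under [X in _ <= X]eq_bigr => a _ do rewrite !natz.
Qed.

Lemma staircase_sum (l : 'I_n) (j : nat) (u F : nat -> int) (x y : int) : (j < m l)%N ->
  (forall a, (a <= j)%N -> u a = x) -> (forall a, (j < a <= m l)%N -> u a = y) ->
  \sum_(a < m l) (u a - u a.+1) * F a = (x - y) * F j.
Proof.
move=> jm h1 h2; rewrite (bigD1 (Ordinal jm)) //= h1 // h2 ?leqnn // big1 ?addr0 // => a.
rewrite -val_eqE /= => aj; have am := ltn_ord a.
have [lt|gt] : (a < j)%N \/ (j < a)%N by lia.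
  by rewrite !h1 ?(ltnW lt) // subrr mul0r.
by rewrite !h2 ?subrr ?mul0r ?(ltnW am) // (leq_trans gt).
Qed.

Lemma chi_staircase (u : dimvec C) (jc : 'I_n -> nat) : u (v0 C) = (u (voo C)).+1 ->
  (forall l, (jc l < m l)%N) -> (forall l a, (a <= jc l)%N -> u (armv l a) = u (v0 C)) ->
  (forall l a, (jc l < a <= m l)%N -> u (armv l a) = u (voo C)) -> chi u u = -1.
Proof.
move=> u0 jm h1 h2; rewrite chiE.
have -> : \sum_(l < n) \sum_(a < m l) (u (armv l a))%:Z * ((u (armv l a.+1))%:Z - (u (armv l a))%:Z)
  = \sum_(l < n) (- (u (v0 C))%:Z).
  apply: eq_bigr => l _.
  have := @staircase_sum l (jc l) (fun a => (u (armv l a))%:Z) (fun a => (u (armv l a))%:Z) (u (v0 C)) (u (voo C)) (jm l).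
  move=> H; rewrite -[LHS]opprK -sumrN; congr (- _).
  transitivity ((((u (v0 C))%:Z - (u (voo C))%:Z)) * (u (armv l (jc l)))%:Z).
    rewrite -H; first by apply: eq_bigr => a _; ring.
      by move=> a /h1 ->.
    by move=> a /h2 ->.
  by rewrite h1 // u0 -addn1 PoszD addrC addKr mul1r.
rewrite sumr_const card_ord -mulr_natl natz u0 -addn1 PoszD.
rewrite narmsE.
rewrite narms1E.
ring.
Qed.

Lemma chi_upstairs (t : dimvec C) : t (v0 C) = 0%N -> t (voo C) = 1%N ->
  (forall l a, (a < m l)%N -> (t (armv l a) <= t (armv l a.+1) <= 1)%N) -> chi t t = -1.
Proof.
move=> t0 t1 tm; rewrite chiE t0 t1 big1; first by ring.
move=> l _; rewrite big1 // => a _; have := tm l a (ltn_ord a).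
move: (t (armv l a)) (t (armv l a.+1)) => x y /andP [h1 h2].
have [->|[-> ->]] : (x = 0 \/ x = 1 /\ y = 1)%N by lia.
  by [].
by [].
Qed.

(** The single rise of [t] on each arm contributes at most 1, in all at most [n]; the relations take
    back n - 2. *)
Lemma chi_cross (u t : dimvec C) : u (v0 C) = 1%N -> u (voo C) = 0%N -> t (v0 C) = 0%N -> t (voo C) = 1%N ->
  (forall l a, (a < m l)%N -> (t (armv l a) <= t (armv l a.+1))%N) ->
  (forall l a, (a < m l)%N -> (u (armv l a) <= 1)%N) -> chi u t <= 2.
Proof.
move=> u0 u1 t0 t1 tm um; rewrite chiE u0 u1 t0 t1.
have le : \sum_(l < n) \sum_(a < m l) (u (armv l a))%:Z * ((t (armv l a.+1))%:Z - (t (armv l a))%:Z) <= n%:Z.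
  have -> : n%:Z = \sum_(l < n) ((t (armv l (m l)))%:Z - (t (armv l 0))%:Z).
    rewrite -[X in X%:Z](card_ord n) -natz -sumr_const; apply: eq_bigr => l _.
    by rewrite armv_end t1; rewrite t0.
  apply: ler_sum => l _; rewrite -(telescope_arm (fun a => (t (armv l a))%:Z)).
  apply: ler_sum => a _; have := tm l a (ltn_ord a); have := um l a (ltn_ord a).
  by case: (u (armv l a)) => [|[|b]] // _; lia.
have := narms_ge3 C; lia.
Qed.

End EulerForm.

Lemma staircase_drop (f : nat -> nat) (mm y : nat) : (forall a, (a < mm)%N -> (f a.+1 <= f a)%N) ->
  f 0%N = y.+1 -> f mm = y -> exists j, [/\ (j < mm)%N, forall a, (a <= j)%N -> f a = y.+1 &
    forall a, (j < a <= mm)%N -> f a = y].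
Proof.
move=> fm f0 fy.
have le a b : (a <= b)%N -> (b <= mm)%N -> (f b <= f a)%N.
  move=> ab bm; have := subnK ab; move: (b - a)%N => l; elim: l a {ab} => [|l IH] a H.
    by have -> : a = b by [].
  apply: leq_trans (IH a.+1 ltac:(lia)) _; apply: fm; lia.
have [j [[Pj jm] jmax]] : exists j, (f j = y.+1 /\ (j <= mm)%N) /\ forall i, f i = y.+1 /\ (i <= mm)%N -> (i <= j)%N.
  by apply: (@bounded_max _ mm); [exists 0%N|move=> ? []].
have jlt : (j < mm)%N by rewrite ltn_neqAle jm andbT; apply/eqP => e; move: Pj; rewrite e; lia.
exists j; split=> // a.
  move=> aj; have := le _ _ aj jm; have := le 0%N a (leq0n _) (leq_trans aj jm); lia.
move=> /andP [ja am]; have h1 := le _ _ am (leqnn _); have h2 := le 0%N a (leq0n _) am.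
have [e|ne] := eqVneq (f a) y.+1; first by have := jmax a (conj e am); lia.
move: ne h1 h2; lia.
Qed.

(* Each level at most the one reached after the edge [j] -> [j+1] is crossed by
   at most one pair of consecutive positions of that level. *)
Lemma crossing_count (f : nat -> nat) (mm j : nat) (P : seq (nat * nat)) : uniq P -> (j < mm)%N ->
  (forall t, f (t + mm)%N = f t) ->
  (forall a b : nat, (a, b) \in P -> [/\ (a < mm)%N, (a < b)%N, f a = f b &
     forall t, (a < t < b)%N -> (f b < f t)%N]) ->
  (count (fun ab => if (ab.1 <= j)%N then (j < ab.2)%N else (j + mm < ab.2)%N) P <= (f j.+1).+1)%N.
Proof.
move=> uP jm per HP; rewrite -size_filter; set P' := filter _ _.
have Hn (a b : nat) : (a, b) \in P' -> exists A B : nat, [/\ (A <= j + mm < B)%N, f A = f a, f B = f a,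
   forall t, (A < t < B)%N -> (f a < f t)%N &
   (a < mm)%N /\ ((a <= j)%N && (A == a + mm)%N && (B == b + mm)%N \/ (j < a)%N && (A == a) && (B == b))].
  rewrite mem_filter /= => /andP [cv /HP [h1 h2 h3 h4]]; case: ifP cv => c cv.
    exists (a + mm)%N, (b + mm)%N; rewrite !per h3; split=> //; [by lia| |by lia].
    move=> t ht; have -> : t = ((t - mm) + mm)%N by lia.
    rewrite per; apply: h4; lia.
  exists a, b; rewrite h3; split=> //; [by lia|by lia].
have inj : {in P' &, injective (fun ab => f ab.1)}.
  move=> [a b] [a' b'] abP abP' /= e.
  have [A [B [n1 n2 n3 n4 [am n5]]]] := Hn _ _ abP; have [A' [B' [n1' n2' n3' n4' [am' n5']]]] := Hn _ _ abP'.
  have eA : A = A' by case: (ltngtP A A') => // lt; [have := n4 A' ltac:(lia)|have := n4' A ltac:(lia)]; lia.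
  have eB : B = B' by case: (ltngtP B B') => // lt; [have := n4' B ltac:(lia)|have := n4 B' ltac:(lia)]; lia.
  by congr (_, _); lia.
have -> : size P' = size [seq f ab.1 | ab <- P'] by rewrite size_map.
have -> : (f j.+1).+1 = size (iota 0 (f j.+1).+1) by rewrite size_iota.
apply: uniq_leq_size; first by rewrite map_inj_in_uniq // filter_uniq.
move=> c /mapP [[a b] abP ->]; rewrite mem_iota ltnS /=.
have [A [B [n1 n2 n3 n4 _]]] := Hn _ _ abP.
rewrite -(per j.+1) addSn; have [lt|ge] := ltnP (j + mm).+1 B.
  by apply: ltnW; apply: n4; lia.
by rewrite (_ : (j + mm).+1 = B); lia.
Qed.

(** * Splitting off the submodule of maximal defect *)

Section Strata.

Context (k : closedFieldType) (C : canonicalData k) (E : nat).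

Local Notation n := (narms C).
Local Notation m := (@arity k C).
Local Notation mx := 'M[k]_E.
Local Notation sets := (vertex C -> {set 'I_E}).
Local Notation prep := (prep C E).

Lemma cod_nodef (T : sets) (d : dimvec C) : (forall x, #|T x| = d x) ->
  cod (Lev (fun=> [::]) (enum 'I_n) T) d 0.
Proof.
move=> dT; have := @level_bound k C E (fun=> [::]) (fun=> 0%N) (fun l => arity_gt0 l) (fun=> isT) (enum 'I_n) T d (enum_uniq _) dT.
by rewrite big1 // => H; apply: H.
Qed.

Definition maxdef (S : sets) (M : prep) (s : nat) : Prop :=
  (exists X : mx, (X <= pr k (S (v0 C)))%MS /\ \rank X = (\rank (img M X) + s)%N) /\
  forall X : mx, (X <= pr k (S (v0 C)))%MS -> (\rank X <= \rank (img M X) + s)%N.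

Definition dropping (S : sets) (M : prep) (s : nat) (U : vertex C -> mx) : Prop :=
  [/\ subrep S M U, \rank (U (v0 C)) = (\rank (U (voo C)) + s)%N, (img M (U (v0 C)) <= U (voo C))%MS &
   forall l a b, (a <= b)%N -> (b <= m l)%N -> (U (armv l b) <= U (armv l a) *m cp (M l) a b)%MS].

Lemma span_subrep S M (X Xoo : mx) : isrep S M -> (X <= pr k (S (v0 C)))%MS ->
  (forall l, X *m amx M l :=: Xoo)%MS -> exists U, [/\ subrep S M U, U (v0 C) = X, U (voo C) = Xoo &
    forall l a b, (a <= b)%N -> (b <= m l)%N -> (U (armv l b) <= U (armv l a) *m cp (M l) a b)%MS].
Proof.
move=> rS XS XE; pose U := mkU X Xoo (fun l a => X *m cp (M l) 0 a).
have UE l a : (a <= m l)%N -> (U (armv l a) :=: X *m cp (M l) 0 a)%MS.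
  move=> am; apply: mkU_arm; [exact: am|by rewrite mulmx1|exact: XE].
exists U; split=> // [|l a b ab bm].
  split=> [x|l a am]; last by rewrite (eqmxMr _ (UE l a (ltnW am))) UE // cp_r // mulmxA.
  elim/armv_ind: x => l [|a] am; rewrite UE //; first by rewrite mulmx1.
  by have [_ <-] := isrep_cp rS (ltn0Sn a) am; rewrite mulmxA submxMl.
by rewrite UE // (eqmxMr _ (UE l a (leq_trans ab bm))) -mulmxA -cp_cat.
Qed.

(** Among the spaces of defect [s] at 0, one of least dimension is taken. Each single arm then
    already maps it onto its whole image, and the submodule it generates has surjective maps along
    all arms. *)
Lemma dropping_exists S M s : isrep S M -> rels M -> maxdef S M s -> exists U, dropping S M s U.
Proof.
move=> rS rM [[X0 [X0S rX0]] dmax].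
pose Good (X : mx) := (X <= pr k (S (v0 C)))%MS /\ \rank X = (\rank (img M X) + s)%N.
have [r [[X [[XS rX] Xr]] Xmin]] : exists r, (exists X, Good X /\ (E - \rank X)%N = r) /\
    forall y, (exists X, Good X /\ (E - \rank X)%N = y) -> (y <= r)%N.
  apply: (@bounded_max _ E); first by exists (E - \rank X0)%N, X0.
  by move=> x [X [_ <-]]; apply: leq_subr.
have full l : (img M X <= X *m amx M l)%MS.
  have [j lj] : exists j : 'I_n, l != j by exists (oth l); apply: oth_neq.
  pose Y := (X *m amx M l)%MS; pose A := amx M j.
  (* The rows of [X] that arm [j] sends into the image of arm [l]. Passing to [X'] loses at least as
     much in the image as in [X], so the defect is still [s], and minimality gives [X' = X]. *)
  pose X' := (X :&: kermx (A *m cokermx Y))%MS.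
  have X'P p (v : 'M[k]_(p, E)) : (v <= X')%MS = (v <= X)%MS && (v *m A <= Y)%MS.
    by rewrite sub_capmx [(_ *m _ <= Y)%MS]submxE -mulmxA; congr (_ && _); apply/sub_kermxP/eqP.
  have X'X : (X' <= X)%MS by apply: capmxSl.
  have im : (img M X' <= Y)%MS.
    apply: submx_trans (img_pencil X' rM lj) _; rewrite addsmx_sub submxMr //=.
    by have := submx_refl X'; rewrite {1}X'P => /andP [].
  have YI : (Y <= img M X)%MS by apply: img_sup.
  have XI : (X *m A <= img M X)%MS by apply: img_sup.
  have le : (\rank X <= \rank X' + (\rank (img M X) - \rank Y))%N.
    rewrite -(mxrank_mul_ker X (A *m cokermx Y)) addnC leq_add2l mulmxA.
    have : (X *m A *m cokermx Y <= img M X *m cokermx Y)%MS by apply: submxMr.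
    move/mxrankS => h; apply: leq_trans h _.
    have := mxrank_mul_ker (img M X) (cokermx Y).
    have : (Y <= img M X :&: kermx (cokermx Y))%MS.
      by rewrite sub_capmx YI; apply/sub_kermxP; apply: mulmx_coker.
    move/mxrankS; move: (\rank _) (\rank _) (\rank _) (\rank _) => *; lia.
  have h1 := dmax X' (submx_trans X'X XS); have h2 := mxrankS im; have h3 := mxrankS YI.
  have eX' : \rank X' = (\rank (img M X') + s)%N by lia.
  have := Xmin _ (ex_intro _ X' (conj (conj (submx_trans X'X XS) eX') erefl)).
  have h4 := mxrankS X'X; have h5 := rank_leq_col X; rewrite -Xr => h6.
  have XX' : (X <= X')%MS by have := mxrank_leqif_sup X'X => -[_ <-]; lia.
  move: XX'; rewrite X'P submx_refl /= => XA.
  by apply: submx_trans (img_pencil X rM lj) _; rewrite addsmx_sub submx_refl.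
have [l|U [US U0 Uoo Ul]] := @span_subrep S M X (img M X) rS XS.
  by apply/eqmxP/andP; split; [apply: img_sup|apply: full].
by exists U; split; rewrite ?U0 ?Uoo.
Qed.

Lemma dropping_nodef S M s U T u M' : isrep S M -> maxdef S M s -> dropping S M s U ->
  is_chart S M U T u M' -> nodef (compl S T) (cut (compl S T) M').
Proof.
move=> rS [_ dmax] [_ rU _ _] ch X XQ; have [Z ZS [rZ rI]] := quot_pull ch XQ.
have cT x : #|T x| = \rank (U x) by have [/(_ x) []] := ch.
have := leq_trans (dmax Z ZS) (leq_add rI (leqnn s)); rewrite rZ !cT rU.
move: (\rank X) (\rank (img _ X)) (\rank (U _)) => x y z; lia.
Qed.

Lemma dropping_cod (P : prep -> Prop) (P2 : sets -> prep -> Prop) (S : sets) (d u d2 : dimvec C) s c2 :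
  (forall x, #|S x| = d x) -> (forall x, d x = u x + d2 x)%N ->
  (forall T : sets, (forall x, #|T x| = d2 x) -> cod (P2 T) d2 c2) ->
  (forall M, P M -> [/\ isrep S M, rels M & exists U, [/\ dropping S M s U, forall x, \rank (U x) = u x &
     forall T w M', is_chart S M U T w M' -> P2 (compl S T) (cut (compl S T) M')]]) ->
  cod P d (c2 + chi u d2).
Proof.
move=> dS dE H2 HP; have ij := oth_neq (arm_fst C).
pose P1 (T : sets) (N : prep) := [/\ isrep T N, rels N &
  forall l, l != arm_fst C -> l != oth (arm_fst C) -> T (v0 C) != set0 -> (pr k (T (voo C)) <= cp (N l) 1 (m l))%MS].
have := @ext_cod k C E P P1 P2 S _ _ u d2 d 0 c2 ij dS dE _ H2; rewrite add0r; apply.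
  by move=> T dT; apply: (cod_onto ij dT).
move=> M /HP [rS rM [U [[sU rU iU oU] du Q2]]]; split=> //; exists U; split=> //.
  by move=> l _ _ _; have := oU l 1%N (m l) (arity_gt0 l) (leqnn _); rewrite armv_end.
move=> T w M' ch; split; last exact: Q2 ch.
split; [exact: isrep_cut|exact: (rels_cutT ch rM)|].
move=> l _ _ _; have := chart_onto ch (arity_gt1 l) (leqnn _); rewrite armv_end => H.
apply: submx_trans (H _) (submxMl _ _).
by have := oU l 1%N (m l) (arity_gt0 l) (leqnn _); rewrite armv_end.
Qed.

Lemma dropping_dims S M s U (u : dimvec C) : dropping S M s U -> (forall x, \rank (U x) = u x) ->
  [/\ u (v0 C) = (u (voo C) + s)%N, forall x, (u (voo C) <= u x)%N &
     forall l a, (a < m l)%N -> (u (armv l a.+1) <= u (armv l a))%N].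
Proof.
move=> [[US Uc] r0 iU oU] du.
have st l a b : (a <= b)%N -> (b <= m l)%N -> (u (armv l b) <= u (armv l a))%N.
  move=> ab bm; rewrite -!du; apply: leq_trans (mxrankS (oU l a b ab bm)) (mxrankM_maxl _ _).
split; [by rewrite -!du|move=> x|by move=> l a am; apply: st].
by elim/armv_ind: x => l a am; rewrite -(armv_end l); apply: st.
Qed.

Context (d : dimvec C) (p : nat) (qc : 'I_n -> nat -> nat) (P : 'I_n -> seq (nat * nat)).
Hypothesis dv0 : (d (v0 C) = p + \sum_l qc l 0)%N.
Hypothesis dE : forall l t, (t <= m l)%N -> (d (armv l t) + qc l 0 = d (v0 C) + qc l t)%N.
Hypothesis qcm : forall l t, qc l (t + m l)%N = qc l t.
Hypothesis tits : forall w : dimvec C, w (voo C) = 0%N ->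
     (\sum_(a : arrow C) w (tgt a) * w (src a) <= \sum_x w x * w x)%N.
Hypothesis uP : forall l, uniq (P l).
Hypothesis HP : forall l (a b : nat), (a, b) \in P l -> [/\ (a < m l)%N, (a < b)%N, (b <= a + m l)%N,
  qc l a = qc l b & forall t, (a < t < b)%N -> (qc l b < qc l t)%N].

Let qc0 l : qc l (m l) = qc l 0%N. Proof. by rewrite -[m l]add0n. Qed.

Lemma rank_cover (F : prep -> Prop) (S : sets) s c : (forall x, #|S x| = d x) ->
  (forall M, F M -> [/\ isrep S M, rels M & maxdef S M s]) ->
  (forall u d2 : dimvec C, (forall x, d x = u x + d2 x)%N -> (exists M U, dropping S M s U /\ forall x, \rank (U x) = u x) ->
     cod (fun M => F M /\ exists U, dropping S M s U /\ forall x, \rank (U x) = u x) d c) ->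
  cod F d c.
Proof.
move=> dS HF H.
pose Qf (f : {ffun vertex C -> 'I_E.+1}) (M : prep) :=
  F M /\ exists U, dropping S M s U /\ forall x, \rank (U x) = f x.
apply: (@cod_cover k C E _ _ Qf).
  move=> M FM; have [rM eM mM] := HF M FM; have [U tU] := dropping_exists rM eM mM.
  exists [ffun x => inord (\rank (U x))]; split=> //; exists U; split=> // x.
  by rewrite ffunE inordK // ltnS rank_leq_col.
move=> f; have [[M0 [F0 [U0 [tU0 rU0]]]]|no] := classic (exists M, Qf f M); last by [].
have [[US _] _ _ _] := tU0.
apply: (H (fun x => f x : nat) (fun x => d x - f x)%N).
  by move=> x; rewrite subnKC // -rU0 -dS -(rank_pr k (S x)); apply: mxrankS.
by exists M0, U0.
Qed.

Lemma chi_drop (u d2 : dimvec C) : (forall x, d x = u x + d2 x)%N ->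
  chi u d2 = ((u (v0 C))%:Z - (u (voo C))%:Z) * p%:Z +
  \sum_(l < n) \sum_(a < m l) ((u (armv l a))%:Z - (u (armv l a.+1))%:Z) * (qc l a.+1)%:Z - chi u u.
Proof. by move=> /(chiDr u); rewrite (chi_regular_r dv0 dE qc0) => ->; rewrite addrC addKr. Qed.

(** Pairing the submodule with the regular vector [d] gives at least [s * p]; its own Euler form
    only helps, by non-negativity of the Tits form. *)
Lemma cod_drop_many (S : sets) s : (forall x, #|S x| = d x) -> (2 <= s)%N ->
  cod (fun M => [/\ isrep S M, rels M & maxdef S M s]) d (2 * p)%N%:Z.
Proof.
move=> dS s2; apply: (@rank_cover _ S s) => // u d2 du [M0 [U0 [t0 r0]]].
have [u0 uoo um] := dropping_dims t0 r0.
have := @dropping_cod (fun M => [/\ isrep S M, rels M & maxdef S M s] /\ exists U, dropping S M s U /\ forall x, \rank (U x) = u x)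
   _ S d u d2 s 0 dS du (fun T => @cod_nodef T d2).
rewrite add0r => H; apply: cod_weak (H _).
  rewrite chi_drop //; have -> : (u (v0 C))%:Z - (u (voo C))%:Z = s%:Z by lia.
  have := chi_tits tits uoo.
  have : 0 <= \sum_(l < n) \sum_(a < m l) ((u (armv l a))%:Z - (u (armv l a.+1))%:Z) * (qc l a.+1)%:Z.
    apply: sumr_ge0 => l _; apply: sumr_ge0 => a _.
    by apply: mulr_ge0; have := um l a (ltn_ord a); lia.
  have : (2 * p <= s * p)%N by rewrite leq_mul2r s2 orbT.
  rewrite -PoszM; lia.
move=> M [[rM eM mM] [U [tU rU]]]; split=> //; exists U; split=> // T w M' ch.
split; [exact: isrep_cut|exact: (rels_cutQ ch eM)|exact: (dropping_nodef rM mM tU ch)| |by []].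
by move=> l; rewrite mem_enum.
Qed.

(** Opening the cycle at the edge [j] destroys the pairs across that edge. The remaining ones are
    moved by one period, where necessary, into the window after [j]. *)
Definition Qseq (l : 'I_n) (j : nat) : seq (nat * nat) :=
  [seq if (ab.1 <= j)%N then (ab.1 + m l, ab.2 + m l)%N else ab | ab <- P l
   & ~~ (if (ab.1 <= j)%N then (j < ab.2)%N else (j + m l < ab.2)%N)].

Lemma Qseq_uniq l j : uniq (Qseq l j).
Proof.
rewrite map_inj_in_uniq ?filter_uniq // => -[a b] [a' b']; rewrite !mem_filter /=.
move=> /andP [_ /HP [h1 _ _ _ _]] /andP [_ /HP [h1' _ _ _ _]].
by case: ifP => c; case: ifP => c' [] e1 e2; congr (_, _); lia.
Qed.

Lemma Qseq_size l j : (j < m l)%N -> (size (P l) <= size (Qseq l j) + (qc l j.+1).+1)%N.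
Proof.
move=> jm; rewrite size_map size_filter.
have := crossing_count (uP l) jm (qcm l) ltac:(by move=> a b /HP [? ? ? ? ?]).
rewrite -(count_predC (fun ab : nat * nat => if (ab.1 <= j)%N then (j < ab.2)%N else (j + m l < ab.2)%N)).
by move=> h; rewrite [X in (X <= _)%N]addnC; apply: leq_add.
Qed.

Lemma QseqP l j (x y : nat) : (j < m l)%N -> (x, y) \in Qseq l j -> exists a b : nat, [/\ (a, b) \in P l,
  (a <= j)%N && (b <= j)%N && (x == a + m l)%N && (y == b + m l)%N
  \/ (j < a)%N && (b <= j + m l)%N && (x == a) && (y == b)
  & forall (S : sets) (i : 'I_n) (M : prep), degen S i l M (a, b) -> degen S i l M (x, y)].
Proof.
move=> jm /mapP [[a b]]; rewrite mem_filter /= => /andP [cv abP]; have [h1 h2 h3 _ _] := HP abP.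
case: ifP cv => c cv [-> ->]; exists a, b; split=> //; [by lia| |by lia].
move=> S i M; rewrite /degen /=.
have bm : (b <= m l)%N by lia.
rewrite bm; have -> : (b + m l <= m l)%N = false by lia.
by have -> : (m l <= a + m l)%N by [lia]; rewrite !addnK.
Qed.

(** The submodule drops by one at a single edge [jc l] of each arm, so the Euler form gives p + 1
    plus the sum of the values of [qc] just after these edges. By [crossing_count] the pairs lost
    across the edge of arm [l] number at most that value plus one; the rest count in full through
    [level_bound]. *)
Lemma cod_drop_one (S : sets) : (forall x, #|S x| = d x) ->
  cod (fun M => [/\ isrep S M, rels M, maxdef S M 1 &
     forall l (a b : nat), (a, b) \in P l -> degen S (oth l) l M (a, b)]) d
   (p%:Z - n%:Z + 1 + (\sum_l size (P l))%N%:Z).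
Proof.
move=> dS; apply: (@rank_cover _ S 1) => [//|M [] //|u d2 du [M0 [U0 [t0 r0]]]].
have [u0 uoo um] := dropping_dims t0 r0; rewrite addn1 in u0.
have [jc Hjc] : exists jc : 'I_n -> nat, forall l, [/\ (jc l < m l)%N,
    forall a, (a <= jc l)%N -> u (armv l a) = (u (voo C)).+1 & forall a, (jc l < a <= m l)%N -> u (armv l a) = u (voo C)].
  apply: (fin_all_exists (P := fun l j => [/\ (j < m l)%N, forall a, (a <= j)%N -> u (armv l a) = (u (voo C)).+1 & forall a, (j < a <= m l)%N -> u (armv l a) = u (voo C)])) => l.
  apply: (@staircase_drop (fun a => u (armv l a))); [exact: um|exact: u0|by rewrite armv_end].
have jm l : (jc l < m l)%N by have [] := Hjc l.
pose Q l := Qseq l (jc l).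
have H2 (T : sets) : (forall x, #|T x| = d2 x) ->
    cod (Lev Q (enum 'I_n) T) d2 (\sum_(l <- enum 'I_n) size (Q l))%N%:Z.
  move=> dT; apply: (level_bound (jc := jc)) => //; first by move=> l; apply: Qseq_uniq.
    exact: enum_uniq.
  move=> l _ [x y] xyQ; have [a [b [abP xyE _]]] := QseqP (jm l) xyQ; have [h1 h2 h3 h4 h5] := HP abP.
  have [_ j1 j2] := Hjc l.
  (* On the window after the drop the submodule has constant dimension in each turn, so the profile
     of the quotient equals [qc] up to a constant and inherits its consecutive pairs. *)
  have pE t : (jc l < t <= jc l + m l)%N ->
     (prof d2 l t + qc l 0 + u (v0 C) + u (voo C) = d (v0 C) + d (v0 C) + qc l t)%N.
    move=> ht; rewrite /prof /pos; case: leqP => tm.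
      have := dE tm; have := du (armv l t); have := du (v0 C); rewrite j2; [lia|lia].
    have tm' : (t - m l <= m l)%N by have := jm l; lia.
    have tE : qc l t = qc l (t - m l) by rewrite -[in LHS](subnK (ltnW tm)).
    have dvoo := regular_voo dE qc0.
    have := dE tm'; have := du (armv l (t - m l)); have := du (voo C); rewrite j1; last by lia.
    rewrite tE; lia.
  have qe t : qc l (t + m l) = qc l t := qcm l t.
  have [xj yj] : (jc l < x < y)%N /\ (y <= jc l + m l)%N.
    have := jm l; lia.
  have qx : qc l x = qc l a by case: xyE => /andP [/andP [_ /eqP ->] _].
  have qy : qc l y = qc l b by case: xyE => /andP [_ /eqP ->].
  have h5' t : (x < t < y)%N -> (qc l b < qc l t)%N.
    case: xyE => h ht; last by apply: h5; lia.
    by rewrite -(subnK (m := m l) (n := t)) ?qe; [apply: h5|]; lia.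
  split=> //=.
    have := pE x ltac:(lia); have := pE y ltac:(lia); lia.
  move=> t ht; have := pE t ltac:(lia); have := pE y ltac:(lia); have := h5' t ht; lia.
set F := fun M : prep => _ /\ _.
have := @dropping_cod F _ S d u d2 1 _ dS du H2.
move=> H; apply: cod_weak (H _).
  rewrite chi_drop // (chi_staircase u0 jm); last by move=> l a ha; have [_ _ ->] := Hjc l.
    have -> : \sum_(l < n) \sum_(a < m l) ((u (armv l a))%:Z - (u (armv l a.+1))%:Z) * (qc l a.+1)%:Z
      = (\sum_(l < n) qc l (jc l).+1)%N%:Z.
      rewrite -natz natr_sum; apply: eq_bigr => l _; have [_ j1 j2] := Hjc l.
      rewrite (@staircase_sum k C l (jc l) (fun a => (u (armv l a))%:Z) (fun a => (qc l a.+1)%:Z) (u (voo C)).+1%:Z (u (voo C))%:Z) //.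
        by lia.
        by move=> a /j1 ->.
      by move=> a /j2 ->.
    have le : (\sum_l size (P l) <= \sum_(l <- enum 'I_n) size (Q l) + (\sum_l qc l (jc l).+1 + n))%N.
      rewrite big_enum -[X in (_ + (_ + X))%N](card_ord n) -sum1_card -!big_split /=; apply: leq_sum => l _.
      by rewrite addn1; apply: Qseq_size.
    move: le; move: (\sum_l _)%N (\sum_(l <- _) _)%N (\sum_l _)%N => x y z; lia.
  by move=> l a ha; rewrite u0; have [_ j1 _] := Hjc l; exact: j1.
move=> M [[rM eM mM dg] [U [tU rU]]]; split=> //; exists U; split=> // T w M' ch.
have [_ _ _ oU] := tU.
have onto a b l : (a < b)%N -> (b <= m l)%N ->
   (pr k (T (armv l b)) <= pr k (T (armv l a)) *m cp (cut T M' l) a b)%MS.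
  by move=> ab bm; apply: (chart_onto ch) => //; apply: oU => //; apply: ltnW.
split; [exact: isrep_cut|exact: (rels_cutQ ch eM)|exact: (dropping_nodef rM mM tU ch)|by move=> l; rewrite mem_enum|].
move=> l _ [x y] xyQ; have [a [b [abP xyE dab]]] := QseqP (jm l) xyQ; have [h1 h2 h3 h4 h5] := HP abP.
have xy : (x < y)%N by lia.
have ym : (y <= m l + m l)%N by have := jm l; lia.
have [|//] := @degen_cut k C E S M U T w M' (oth l) l (x, y) ch rM xy ym (dab _ _ _ (dg l a b abP)).
have rT := isrep_cut T M'.
move=> bad; exfalso; apply: degen_onto bad => //=.
- by move=> h; apply: onto.
- by move=> h; apply: onto; lia.
- move=> /andP [h h']; split; first by have := onto x (m l) l h (leqnn _); rewrite armv_end.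
  have := onto 0%N (y - m l)%N l ltac:(lia) ltac:(lia).
  by rewrite (isrep_cp rT _ _).1; [|lia|lia].
Qed.

Definition row_killed (S : sets) (M : prep) : Prop :=
  exists v : mx, [/\ v != 0, (v <= pr k (S (v0 C)))%MS & forall l, v *m amx M l = 0].

Definition col_killed (S : sets) (M : prep) : Prop :=
  exists psi : 'cV[k]_E, [/\ psi != 0, pr k (S (voo C)) *m psi = psi & forall l, amx M l *m psi = 0].

Lemma killed_rank (S : sets) (M : prep) (v : mx) : maxdef S M 1 -> v != 0 -> (v <= pr k (S (v0 C)))%MS ->
  (forall l, v *m amx M l = 0) -> \rank v = 1%N /\ img M v = 0.
Proof.
move=> [_ dmax] vn vS vk; have i0 : img M v = 0 by apply: big1 => l _.
split=> //; have := dmax v vS; rewrite i0 mxrank0 add0n.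
by move: vn; rewrite -mxrank_eq0; case: (\rank v) => [|[|]].
Qed.

Lemma killed_dropping (S : sets) (M : prep) : isrep S M -> maxdef S M 1 -> row_killed S M ->
  exists U, dropping S M 1 U /\ \rank (U (v0 C)) = 1%N.
Proof.
move=> rS mM [v [vn vS vk]]; have [r1 i0] := killed_rank mM vn vS vk.
have [l|U [US U0 Uoo Ul]] := @span_subrep S M v 0 rS vS; first by rewrite vk.
by exists U; split; [split|]; rewrite ?U0 ?Uoo ?i0 ?mxrank0.
Qed.

(** The first half of [cod_two_kernels]; the subtracted [chi d' t] is restored there, when the
    quotient of dimension [t] is put back. *)
Lemma cod_row_killed (T : sets) (d' t : dimvec C) : (forall x, #|T x| = d' x) ->
  (forall x, d x = d' x + t x)%N -> t (v0 C) = 0%N -> t (voo C) = 1%N ->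
  (forall l a, (a < m l)%N -> (t (armv l a) <= t (armv l a.+1) <= 1)%N) ->
  cod (fun M => [/\ isrep T M, rels M, maxdef T M 1 & row_killed T M]) d' ((2 * p)%N%:Z - chi d' t).
Proof.
move=> dT dd t0 t1 tm.
pose F (M : prep) := [/\ isrep T M, rels M, maxdef T M 1 & row_killed T M].
pose Qf (f : {ffun vertex C -> 'I_E.+1}) (M : prep) :=
  F M /\ exists U, [/\ dropping T M 1 U, \rank (U (v0 C)) = 1%N & forall x, \rank (U x) = f x].
apply: (@cod_cover k C E _ F Qf).
  move=> M FM; have [rM eM mM kM] := FM; have [U [tU r1]] := killed_dropping rM mM kM.
  exists [ffun x => inord (\rank (U x))]; split=> //; exists U; split=> // x.
  by rewrite ffunE inordK // ltnS rank_leq_col.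
move=> f; have [[M0 [F0 [U0 [tU0 r10 rU0]]]]|no] := classic (exists M, Qf f M); last by [].
have [u uE] : exists u : dimvec C, forall x, u x = f x by exists (fun x => f x : nat).
have [[US _] _ _ _] := tU0.
have [d2 d2E] : exists d2 : dimvec C, forall x, d' x = (u x + d2 x)%N.
  exists (fun x => d' x - u x)%N => x; rewrite subnKC // uE -rU0 -dT -(rank_pr k (T x)); exact: mxrankS.
have [u0 uoo um] := dropping_dims tU0 (fun x => etrans (rU0 x) (esym (uE x))).
have u01 : u (v0 C) = 1%N by rewrite uE -rU0.
have uoo0 : u (voo C) = 0%N by lia.
have H := @dropping_cod (Qf f) _ T d' u d2 1 0 dT d2E (fun S => @cod_nodef S d2).
rewrite add0r in H; apply: cod_weak (H _).
  have e1 := chiDr u d2E; have e2 := chiDr u dd; have e3 := chiDl t dd.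
  have [jc Hjc] : exists jc : 'I_n -> nat, forall l, [/\ (jc l < m l)%N,
      forall a, (a <= jc l)%N -> u (armv l a) = 1%N & forall a, (jc l < a <= m l)%N -> u (armv l a) = 0%N].
    apply: (fin_all_exists (P := fun l j => [/\ (j < m l)%N, forall a, (a <= j)%N -> u (armv l a) = 1%N & forall a, (j < a <= m l)%N -> u (armv l a) = 0%N])) => l.
    apply: (@staircase_drop (fun a => u (armv l a))); [exact: um|exact: u01|by rewrite armv_end].
  have uu : chi u u = -1.
    apply: (chi_staircase (jc := jc)); rewrite ?u01 ?uoo0 //.
    - by move=> l; have [] := Hjc l.
    - by move=> l a ha; have [_ j1 _] := Hjc l; apply: j1.
    - by move=> l a ha; have [_ _ j1] := Hjc l; apply: j1.
  have tt := chi_upstairs t0 t1 tm.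
  (* Splitting off [u] yields at least [p - 2 + 1] and splitting off [t] at least [p + 1]: the two
     values -1 of the Euler form compensate exactly for this 2. *)
  have ut : chi u t <= 2.
    apply: chi_cross => //; first by move=> l a /tm /andP [].
    by move=> l a am; have [_ j1 j2] := Hjc l; case: (leqP a (jc l)) => h; [rewrite j1|rewrite j2 // h ltnW].
  have := chi_regular_r dv0 dE qc0 u; have := chi_regular_l dv0 dE qc0 t.
  rewrite u01 uoo0 t0 t1.
  have s1 : 0 <= \sum_(l < n) \sum_(a < m l) ((u (armv l a))%:Z - (u (armv l a.+1))%:Z) * (qc l a.+1)%:Z.
    apply: sumr_ge0 => l _; apply: sumr_ge0 => a _.
    by apply: mulr_ge0; have := um l a (ltn_ord a); lia.
  have s2 : 0 <= \sum_(l < n) \sum_(a < m l) ((t (armv l a.+1))%:Z - (t (armv l a))%:Z) * (qc l a)%:Z.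
    apply: sumr_ge0 => l _; apply: sumr_ge0 => a _.
    by apply: mulr_ge0; have := tm l a (ltn_ord a); lia.
  move: e1 e2 e3 s1 s2 uu tt ut; rewrite PoszM.
  move: (chi u d) (chi u d') (chi u d2) (chi u u) (chi d t) (chi d' t) (chi t t) (chi u t) (\sum_l _) (\sum_l _) => *; lia.
move=> M [[rM eM mM kM] [U [tU r1 rU]]]; split=> //; exists U; split=> //; first by move=> x; rewrite uE.
move=> S w M' ch.
split; [exact: isrep_cut|exact: (rels_cutQ ch eM)|exact: (dropping_nodef rM mM tU ch)| |by []].
by move=> l; rewrite mem_enum.
Qed.

(* The subrepresentation of the rows annihilated by the common column kernel vector. *)
Lemma col_killed_sub (S : sets) (M : prep) : isrep S M -> col_killed S M ->
  exists U, [/\ subrep S M U, (pr k (S (v0 C)) <= U (v0 C))%MS, (\rank (U (voo C))).+1 = #|S (voo C)| &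
    exists t : 'I_n -> nat -> nat, (forall l a, (a <= m l)%N -> \rank (U (armv l a)) + t l a = #|S (armv l a)|)%N /\
      forall l a, (a < m l)%N -> (t l a <= t l a.+1 <= 1)%N].
Proof.
move=> rS [psi [pn pS pk]].
pose c (l : 'I_n) a : 'cV[k]_E := cp (M l) a (m l) *m psi.
pose g (l : 'I_n) a : mx := (pr k (S (armv l a)) :&: kermx (c l a))%MS.
have gP l a q (v : 'M[k]_(q, E)) : (v <= g l a)%MS = (v <= pr k (S (armv l a)))%MS && (v *m c l a == 0).
  by rewrite sub_capmx; congr (_ && _); apply/sub_kermxP/eqP.
pose xoo : mx := (pr k (S (voo C)) :&: kermx psi)%MS.
have g0 l : (g l 0%N :=: pr k (S (v0 C)))%MS.
  apply/eqmxP/andP; split; first exact: capmxSl.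
  by rewrite gP submx_refl /c pk mulmx0 eqxx.
have gm l : (g l (m l) :=: xoo)%MS.
  by rewrite /g /c cp_id mul1mx armv_end.
pose U := mkU (pr k (S (v0 C))) xoo g.
have UE l a : (a <= m l)%N -> (U (armv l a) :=: g l a)%MS by move=> am; apply: mkU_arm.
have rk l a : (\rank (g l a) + \rank (pr k (S (armv l a)) *m c l a) = #|S (armv l a)|)%N.
  by rewrite addnC mxrank_mul_ker rank_pr.
have gS l a : (g l a <= pr k (S (armv l a)))%MS by apply: capmxSl.
exists U; split.
- split=> [x|l a am].
    by elim/armv_ind: x => l a am; rewrite UE.
  rewrite (eqmxMr _ (UE l a (ltnW am))) UE // gP.
  have [_ e2] := rS l a am.
  have := submx_refl (g l a); rewrite {1}gP => /andP [h1 h2].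
  apply/andP; split; first by rewrite -e2 mulmxA submxMl.
  by rewrite -mulmxA [M l a *m _]mulmxA -cp_l.
- by [].
- have := rk (arm_fst C) (m (arm_fst C)); rewrite gm armv_end /c cp_id mul1mx pS.
  have -> : \rank psi = 1%N by apply/eqP; rewrite eqn_leq rank_leq_col lt0n mxrank_eq0.
  by rewrite addn1.
- exists (fun l a => \rank (pr k (S (armv l a)) *m c l a)); split.
    by move=> l a am; rewrite UE.
  move=> l a am; rewrite rank_leq_col andbT.
  have [_ e2] := rS l a am.
  have -> : pr k (S (armv l a)) *m c l a = (pr k (S (armv l a)) *m M l a) *m (pr k (S (armv l a.+1)) *m c l a.+1).
    by rewrite mulmxA -[pr k _ *m M l a *m _]mulmxA e2 /c (cp_l _ am) !mulmxA.
  exact: mxrankM_maxr.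
Qed.

(** Each kernel yields p. The column kernel produces a quotient that is 0 at the vertex 0 and 1 at
    infinity, the row kernel a submodule that is 1 at 0 and 0 at infinity; both are split off. *)
Lemma cod_two_kernels (S : sets) : (forall x, #|S x| = d x) ->
  cod (fun M => [/\ isrep S M, rels M, maxdef S M 1, row_killed S M & col_killed S M]) d (2 * p)%N%:Z.
Proof.
move=> dS; set F := fun M : prep => _.
pose R (M : prep) U (f : vertex C -> nat) := [/\ subrep S M U, (pr k (S (v0 C)) <= U (v0 C))%MS, (\rank (U (voo C))).+1 = #|S (voo C)|,
  exists t : 'I_n -> nat -> nat, (forall l a, (a <= m l)%N -> \rank (U (armv l a)) + t l a = #|S (armv l a)|)%N /\
      forall l a, (a < m l)%N -> (t l a <= t l a.+1 <= 1)%N & forall x, \rank (U x) = f x].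
pose Qf (f : {ffun vertex C -> 'I_E.+1}) (M : prep) := F M /\ exists U, R M U (fun x => f x).
apply: (@cod_cover k C E _ F Qf).
  move=> M FM; have [rM eM mM kM cM] := FM; have [U [h1 h2 h3 h4]] := col_killed_sub rM cM.
  exists [ffun x => inord (\rank (U x))]; split=> //; exists U; split=> // x.
  by rewrite ffunE inordK // ltnS rank_leq_col.
move=> f; have [[M0 [F0 [U0 [U0s U00 U0oo [t0 [t0E t0m]] U0r]]]]|no] := classic (exists M, Qf f M); last by [].
have [d' d'E] : exists d' : dimvec C, forall x, d' x = f x by exists (fun x => f x : nat).
have [US _] := U0s.
have [t tE] : exists t : dimvec C, forall x, d x = (d' x + t x)%N.
  exists (fun x => d x - d' x)%N => x; rewrite subnKC // d'E -U0r -dS -(rank_pr k (S x)); exact: mxrankS.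
have tv0 : t (v0 C) = 0%N.
  have := tE (v0 C); rewrite d'E -U0r -dS -(rank_pr k (S (v0 C))).
  have := mxrankS U00; lia.
have tvoo : t (voo C) = 1%N by have := tE (voo C); rewrite d'E -U0r -dS; lia.
have tarm l a : (a <= m l)%N -> t (armv l a) = t0 l a.
  by move=> am; have := tE (armv l a); rewrite d'E -U0r -dS -t0E // => /addnI.
have tm l a : (a < m l)%N -> (t (armv l a) <= t (armv l a.+1) <= 1)%N.
  by move=> am; rewrite !tarm ?(ltnW am) // t0m.
have ij := oth_neq (arm_fst C).
have H2 (T : sets) : (forall x, #|T x| = t x) -> cod (fun N => isrep T N /\ rels N) t 0.
  move=> dT; apply: (cod_onto ij dT) => N [rN eN]; split=> // l _ _.
  by rewrite -cards_eq0 dT tv0.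
have H1 (T : sets) : (forall x, #|T x| = d' x) -> _ := fun dT => cod_row_killed dT tE tv0 tvoo tm.
have := @ext_cod k C E (Qf f) _ _ S _ _ d' t d _ 0 ij dS tE H1 H2.
rewrite addr0 subrK; apply.
move=> M [[rM eM [X0 dmax] [v [vn vS vk]] cM] [U [Us U0' Uoo' _ Ur]]]; split=> //; exists U; split=> //.
- by move=> x; rewrite Ur.
- by move=> l _ _; rewrite tv0.
move=> T w M' ch; split; last by split; [exact: isrep_cut|exact: (rels_cutQ ch eM)].
have [TS su hU _ [rS' tT]] := ch.
have uu x : w x *m w x = 0 := chart_unip x ch.
have TSe : T (v0 C) = S (v0 C).
  apply/eqP; rewrite eqEcard (TS _).1 (TS _).2 -(rank_pr k (S (v0 C))); exact: mxrankS.
have r1 := killed_rank (conj X0 dmax) vn vS vk.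
have free x := unip_free (uu x).
have dmax' (X : mx) : (X <= pr k (T (v0 C)))%MS -> (\rank X <= \rank (img (cut T M') X) + 1)%N.
  move=> XT; have Xe : X *m pr k (T (v0 C)) = X by apply/sub_prP.
  have ZS : (X *m (1%:M + w (v0 C)) <= pr k (S (v0 C)))%MS.
    have [/(_ (v0 C)) h _] := Us; apply: submx_trans h; rewrite (chart_sub ch) //.
  have := dmax _ ZS; rewrite mxrankMfree // => h; apply: leq_trans h _; rewrite leq_add2r.
  have : (img M (X *m (1%:M + w (v0 C))) <= img (cut T M') X *m (1%:M + w (voo C)))%MS.
    apply/sumsmx_subP => l _; rewrite -mulmxA -(chart_amx ch) mulmxA; apply: submxMr.
    by rewrite -{1}Xe -mulmxA -(cutT_amx ch); apply: img_sup.
  by move/mxrankS => h; apply: leq_trans h _; rewrite mxrankMfree.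
have vT : (v *m (1%:M - w (v0 C)) <= pr k (T (v0 C)))%MS.
  rewrite -(chart_sub ch) -mulmxA unip_mul // mulmx1; exact: submx_trans vS U0'.
have vn' : v *m (1%:M - w (v0 C)) != 0.
  apply: contraNneq vn => h; have := congr1 (mulmx^~ (1%:M + w (v0 C))) h.
  by rewrite -mulmxA unip_mul // mulmx1 mul0mx => ->.
have vk' l : v *m (1%:M - w (v0 C)) *m amx (cut T M') l = 0.
  rewrite (cutT_amx ch) mulmxA; move/sub_prP: vT => ->.
  rewrite (chart_amx' ch) !mulmxA -[v *m _ *m _]mulmxA unip_mul // mulmx1 vk mul0mx //.
have rk' : row_killed T (cut T M') by exists (v *m (1%:M - w (v0 C))).
split=> //; [exact: isrep_cut|exact: (rels_cutT ch eM)|].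
split=> //; exists (v *m (1%:M - w (v0 C))); split=> //.
rewrite /img big1; last by [].
rewrite mxrank0 mxrankMfree ?r1.1 // row_free_unit; by have /mulmx1_unit [] := unip_mul (uu (v0 C)).
Qed.

End Strata.

(** * Tame algebras and the quadratic form *)

Section Families.

Context (k : closedFieldType) (C : canonicalData k).

Local Notation n := (narms C).

Lemma isomorphic_trans (d e f : dimvec C) (M : rep k d) (N : rep k e) (L : rep k f) :
  isomorphic M N -> isomorphic N L -> isomorphic M L.
Proof.
move=> [a [b [ha hb ab ba]]] [a' [b' [ha' hb' ab' ba']]].
exists (fun x => a' x *m a x), (fun x => b x *m b' x); split=> [y|y|x|x].
- by rewrite mulmxA -ha' -!mulmxA ha.
- by rewrite mulmxA -hb -!mulmxA hb'.
- by rewrite mulmxA -[b x *m _ *m _]mulmxA ab' mulmx1.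
- by rewrite mulmxA -[a' x *m _ *m _]mulmxA ba mulmx1.
Qed.

Lemma isomorphic_dim (d e : dimvec C) (M : rep k d) (N : rep k e) : isomorphic M N -> forall x, d x = e x.
Proof.
move=> [a [b [_ _ ab ba]]] x; apply/eqP; rewrite eqn_leq.
by rewrite (mulmx1_min (ab x)) (mulmx1_min (ba x)).
Qed.

Lemma isomorphic_dsum (d d' e e' : dimvec C) (M : rep k d) (M' : rep k d') (N : rep k e) (N' : rep k e') :
  isomorphic M M' -> isomorphic N N' -> isomorphic (dsum M N) (dsum M' N').
Proof.
move=> [a [b [ha hb ab ba]]] [a' [b' [ha' hb' ab' ba']]].
exists (fun x => block_mx (a x) 0 0 (a' x)), (fun x => block_mx (b x) 0 0 (b' x)).
split=> [y|y|x|x]; rewrite !mulmx_block !(mulmx0, mul0mx, addr0, add0r).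
- by rewrite ha ha'.
- by rewrite hb hb'.
- by rewrite ab ab' -scalar_mx_block.
- by rewrite ba ba' -scalar_mx_block.
Qed.

Lemma flat_module (d : dimvec C) (M : rep k d) : d (voo C) = 0%N -> is_module M.
Proof. by move=> d0 i; apply/matrixP => a b; case: b => b lb; exfalso; rewrite d0 in lb. Qed.

Definition polyf D (f : ('I_D -> k) -> k) : Prop :=
  in_alg_gen (fun _ => True) (fun i (t : 'I_D -> k) => t i) f.

Definition parametrized (d : dimvec C) (V : rep k d -> Prop) (D : nat) : Prop :=
  exists (F : finType) (L : F -> ('I_D -> k) -> rep k d),
    (forall f a i j, polyf (fun t => L f t a i j)) /\
    forall M, V M -> exists f t, isomorphic M (L f t).

Lemma parametrized_union (G : finType) (d : dimvec C) (V : G -> rep k d -> Prop) D :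
  (forall g, parametrized (V g) D) -> parametrized (fun M => exists g, V g M) D.
Proof.
move=> /dep_choice [F /dep_choice [L HL]].
exists {g : G & F g}, (fun gf => L (tag gf) (tagged gf)); split=> [[g f] a i j|M [g Vg]].
  exact: (HL g).1.
by have [f [t H]] := (HL g).2 M Vg; exists (Tagged F f), t.
Qed.

Lemma parametrized_sub (d : dimvec C) (V W : rep k d -> Prop) D : (forall M, V M -> W M) ->
  parametrized W D -> parametrized V D.
Proof. by move=> VW [F [L [h1 h2]]]; exists F, L; split=> // M /VW; apply: h2. Qed.

Lemma parametrized_empty (d : dimvec C) (V : rep k d -> Prop) D : (forall M, ~ V M) -> parametrized V D.
Proof.
move=> no; exists void, (fun v : void => match v with end); split=> [[]|M /no []].
Qed.

Lemma polyf_sub D D' (s : 'I_D -> 'I_D') (f : ('I_D -> k) -> k) : polyf f ->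
  polyf (fun t : 'I_D' -> k => f (fun i => t (s i))).
Proof.
move=> Hf; have := @alg_sub k _ _ _ (fun t (i : 'I_D) => t (s i)) (fun _ => True) (fun _ : 'I_D' -> k => True) _ f (fun _ _ => I) Hf.
move=> [t [c _ Hc]]; apply: (@alg_eq _ _ _ _ _ (fun x => \sum_(ce <- c) ce.1 * monof (fun i x => x (s i)) ce.2 x)).
  by move=> x /Hc.
apply: alg_sum_seq => ce _; apply: algM; first exact: alg_const.
rewrite /monof; apply: alg_prod_seq => i _; apply: algX.
exact: (@alg_var k 'I_D' ('I_D' -> k) (fun _ => True) (fun i t => t i) (s i)).
Qed.

Lemma parametrized_dsum (d1 d2 : dimvec C) D1 D2 (d : dimvec C) : (fun x => d1 x + d2 x)%N = d ->
  parametrized (@is_module k C d1) D1 -> parametrized (@is_module k C d2) D2 ->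
  parametrized (fun M : rep k d => exists (M1 : rep k d1) (M2 : rep k d2),
     [/\ is_module M1, is_module M2 & isomorphic M (dsum M1 M2)]) (D1 + D2).
Proof.
move=> <- [F1 [L1 [p1 c1]]] [F2 [L2 [p2 c2]]].
exists (F1 * F2)%type, (fun f t => dsum (L1 f.1 (fun i => t (lshift D2 i))) (L2 f.2 (fun i => t (rshift D1 i)))); split.
  move=> [f1 f2] a i j /=.
  rewrite /dsum -(splitK i) -(splitK j); case: (split i) => i'; case: (split j) => j' /=.
  - apply: (@alg_eq _ _ _ _ _ (fun t => L1 f1 (fun i => t (lshift D2 i)) a i' j')).
      by move=> t _; rewrite block_mxEul.
    exact: (polyf_sub (lshift D2) (p1 f1 a i' j')).
  - by apply: alg_eq (alg_const _ _ 0) => t _; rewrite block_mxEur mxE.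
  - by apply: alg_eq (alg_const _ _ 0) => t _; rewrite block_mxEdl mxE.
  - apply: (@alg_eq _ _ _ _ _ (fun t => L2 f2 (fun i => t (rshift D1 i)) a i' j')).
      by move=> t _; rewrite block_mxEdr.
    exact: (polyf_sub (@rshift D1 D2) (p2 f2 a i' j')).
move=> M [M1 [M2 [m1 m2 iso]]]; have [f1 [t1 i1]] := c1 M1 m1; have [f2 [t2 i2]] := c2 M2 m2.
exists (f1, f2), (fun i => match split i with inl a => t1 a | inr b => t2 b end) => /=.
apply: isomorphic_trans iso _; apply: isomorphic_dsum.
  rewrite (_ : (fun i => _) = t1) //; apply: functional_extensionality => i.
  by rewrite (unsplitK (inl i)).
rewrite (_ : (fun i => _) = t2) //; apply: functional_extensionality => i.
by rewrite (unsplitK (inr i)).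
Qed.

Lemma zero_dim_sum (d : dimvec C) : (\sum_x d x = 0)%N <-> zero_dim d.
Proof.
split=> [/eqP|H]; last by rewrite big1 // => x _.
by rewrite sum_nat_eq0 => /forallP H x; apply/eqP; have := H x.
Qed.

(* Decomposing into indecomposables, each summand needs at most one parameter. *)
Lemma tame_parametrized (hC : tame C) D (d : dimvec C) : (\sum_x d x)%N = D ->
  parametrized (@is_module k C d) D.
Proof.
elim/ltn_ind: D d => D IH d dD.
have [D0|Dpos] := posnP D.
  have d0 : zero_dim d by apply/zero_dim_sum; rewrite dD.
  exists unit, (fun _ _ a => 0); split.
    by move=> _ a i j; apply: alg_eq (alg_const _ _ 0) => t _; rewrite mxE.
  move=> M _; exists tt, (fun=> 0), (fun x => 0), (fun x => 0); split=> [a|a|x|x].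
  - by rewrite mul0mx mulmx0.
  - by rewrite mul0mx mulmx0.
  - by apply/matrixP => -[i li]; exfalso; rewrite d0 in li.
  - by apply/matrixP => -[i li]; exfalso; rewrite d0 in li.
have split_case (d1 d2 : dimvec C) : parametrized (fun M : rep k d => ~ zero_dim d1 /\ ~ zero_dim d2 /\
    exists (M1 : rep k d1) (M2 : rep k d2), [/\ is_module M1, is_module M2 & isomorphic M (dsum M1 M2)]) D.
  have [n1|n1] := classic (zero_dim d1); first by apply: parametrized_empty => M [].
  have [n2|n2] := classic (zero_dim d2); first by apply: parametrized_empty => M [_ []].
  have [dE|ne] := classic ((fun x => d1 x + d2 x)%N = d); last first.
    apply: parametrized_empty => M [_ [_ [M1 [M2 [_ _ iso]]]]].
    by case: ne; apply: functional_extensionality => x; rewrite (isomorphic_dim iso).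
  have sE : (\sum_x d1 x + \sum_x d2 x)%N = D.
    by rewrite -dD -big_split; rewrite -dE.
  have l1 : (\sum_x d1 x < D)%N.
    rewrite -sE -[X in (X < _)%N]addn0 ltn_add2l lt0n; apply/eqP => h; apply: n2; exact/zero_dim_sum.
  have l2 : (\sum_x d2 x < D)%N.
    rewrite -sE -[X in (X < _)%N]add0n ltn_add2r lt0n; apply/eqP => h; apply: n1; exact/zero_dim_sum.
  have := parametrized_dsum dE (IH _ l1 _ erefl) (IH _ l2 _ erefl).
  by rewrite sE; apply: parametrized_sub => M [_ []].
pose V (o : option ({ffun vertex C -> 'I_D.+1} * {ffun vertex C -> 'I_D.+1})) (M : rep k d) : Prop :=
  match o with
  | None => indecomposable M
  | Some e => ~ zero_dim (fun x => e.1 x : nat) /\ ~ zero_dim (fun x => e.2 x : nat) /\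
      exists (M1 : rep k (fun x => e.1 x : nat)) (M2 : rep k (fun x => e.2 x : nat)),
     [/\ is_module M1, is_module M2 & isomorphic M (dsum M1 M2)]
  end.
apply: (@parametrized_sub _ _ (fun M => exists o, V o M)); last first.
  apply: parametrized_union => -[[e1 e2]|]; first exact: split_case.
  have [s [F [Fm Fi]]] := hC d.
  exists 'I_s, (fun i t => specialize (F i) (t (Ordinal Dpos))); split.
    move=> f a i j; rewrite /specialize.
    apply: (@alg_eq _ _ _ _ _ (fun t => \sum_(l < size (F f a i j)) (F f a i j)`_l * t (Ordinal Dpos) ^+ l)).
      by move=> t _; rewrite mxE horner_coef.
    apply: alg_sum_seq => l _; apply: algM; first exact: alg_const.
    apply: algX; exact: (@alg_var k 'I_D ('I_D -> k) (fun _ => True) (fun i t => t i)).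
  by move=> M /Fi [i [t iso]]; exists i, (fun=> t).
move=> M mM; have [iM|nM] := classic (indecomposable M); first by exists None.
have nz : ~ zero_dim d by move/zero_dim_sum; rewrite dD => D0; rewrite D0 in Dpos.
have [d1 [d2 [M1 [M2 [m1 m2 iso z1 z2]]]]] : exists (d1 d2 : dimvec C) (M1 : rep k d1) (M2 : rep k d2),
    [/\ is_module M1, is_module M2, isomorphic M (dsum M1 M2), ~ zero_dim d1 & ~ zero_dim d2].
  apply: NNPP => no; apply: nM; split=> // d1 d2 M1 M2 m1 m2 iso.
  have [z1|z1] := classic (zero_dim d1); first by left.
  have [z2|z2] := classic (zero_dim d2); first by right.
  by case: no; exists d1, d2, M1, M2.
have dE := isomorphic_dim iso.
have small (e : dimvec C) : (forall x, e x <= d x)%N -> exists f : {ffun vertex C -> 'I_D.+1}, (fun x => f x : nat) = e.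
  move=> ed; exists [ffun x => inord (e x)]; apply: functional_extensionality => x.
  rewrite ffunE inordK //; apply: leq_trans (ed x) _; rewrite -dD (bigD1 x) //; exact: leq_addr.
have [f1 E1] := small d1 ltac:(by move=> x; rewrite dE leq_addr).
have [f2 E2] := small d2 ltac:(by move=> x; rewrite dE leq_addl).
exists (Some (f1, f2)); subst d1 d2; split=> //; split=> //; by exists M1, M2.
Qed.

Lemma card_coord (d : dimvec C) : #|coord d| = (\sum_(a : arrow C) d (tgt a) * d (src a))%N.
Proof.
rewrite card_tagged sumnE big_map big_enum /=; apply: eq_bigr => a _.
by rewrite card_prod !card_ord.
Qed.

Definition of_point (d : dimvec C) (x : 'I_#|coord d| -> k) : rep k d :=
  fun a => \matrix_(i, j) x (enum_rank (Tagged (fun a => ('I_(d (tgt a)) * 'I_(d (src a)))%type) (i, j))).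

Lemma entry_of_point (d : dimvec C) x (c : coord d) : entry (of_point x) c = x (enum_rank c).
Proof. by case: c => a [i j]; rewrite /entry mxE. Qed.

Hypothesis hk : [pchar k] =i pred0.

(** A chain of maximal length through the origin supplies as many algebraically independent
    functions as there are coordinates. *)
Lemma growth_affine (d : dimvec C) D : growth_le (fun _ : rep k d => True) (fun c M => entry M c) D ->
  (#|coord d| <= D)%N.
Proof.
move=> G; have [r [X [le ch]]] := chain_through_point hk (s := [::]) (x0 := fun _ : 'I_#|coord d| => 0) (fun g => ltac:(by [])).
have [g ind] := chain_alg_indep (f := 1) ch ltac:(by rewrite meval1 oner_eq0).
apply: leq_trans le _; rewrite add0n.
have G' := growth_le_sub (h := @of_point d) (P' := fun x => X r x /\ (1 : {mpoly k[#|coord d|]}).@[x] != 0) (fun _ _ => I) G.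
apply: alg_indep_growth ind _ G' => i.
apply: (@alg_eq _ _ _ _ _ (fun x => \sum_(m <- msupp (g i)) (g i)@_m * \prod_j x j ^+ m j)).
  by [].
apply: alg_sum_seq => m _; apply: algM; first exact: alg_const.
apply: alg_prod_seq => j _; apply: algX.
apply: (@alg_eq _ _ _ _ _ (fun x => entry (of_point x) (enum_val j))).
  by move=> x _; rewrite entry_of_point enum_valK.
exact: (@alg_var k (coord d) _ _ (fun c x => entry (of_point x) c)).
Qed.

(** Base change adds the entries of one square matrix per vertex; the inverses become polynomial
    after multiplication by the determinants, so [growth_le_rat] applies. *)
Lemma growth_parametrized (d : dimvec C) D (V : rep k d -> Prop) : parametrized V D ->
  growth_le V (fun c M => entry M c) (D + \sum_x d x * d x)%N.
Proof.
move=> [F [L [pL cL]]].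
apply: (@growth_le_cover k _ F _ _ _ _ (fun f M => exists t, isomorphic M (L f t))).
  by [].
move=> f.
have /dep_choice [w Hw] (M : rep k d) : exists w : ('I_D -> k) * (forall x, 'M[k]_(d x)),
    (exists t, isomorphic M (L f t)) -> (forall x, w.2 x \in unitmx) /\
       forall a, M a = w.2 (tgt a) *m L f w.1 a *m invmx (w.2 (src a)).
  have [[t [a [b [ha hb ab ba]]]]|no] := classic (exists t, isomorphic M (L f t)); last by exists (fun=> 0, fun=> 0).
  exists (t, b) => _; have bu x : b x \in unitmx by have [] := mulmx1_unit (ab x).
  by split=> // y; rewrite hb mulmxK.
pose J : finType := ('I_D + {x : vertex C & ('I_(d x) * 'I_(d x))%type})%type.
pose z (j : J) (M : rep k d) : k := match j with
  | inl i => (w M).1 i | inr u => (w M).2 (tag u) (tagged u).1 (tagged u).2 end.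
set Q := fun M => _.
have cJ : #|J| = (D + \sum_x d x * d x)%N.
  rewrite card_sum card_ord card_tagged sumnE big_map big_enum /=; congr (_ + _)%N; apply: eq_bigr => x _.
  by rewrite card_prod !card_ord.
rewrite -cJ.
have gA x : mx_alg Q z (fun M => (w M).2 x).
  move=> i j; exact: (@alg_var k J _ Q z (inr (Tagged (fun x => ('I_(d x) * 'I_(d x))%type) (i, j)))).
have LA a : mx_alg Q z (fun M => L f (w M).1 a).
  move=> i j; have := @alg_sub k _ _ _ (fun M => (w M).1) (fun _ => True) Q _ _ (fun _ _ => I) (pL f a i j).
  move=> [t [c _ Hc]]; apply: (@alg_eq _ _ _ _ _ (fun x => \sum_(ce <- c) ce.1 * monof (fun i x => (w x).1 i) ce.2 x)).
    by move=> x /Hc.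
  apply: alg_sum_seq => ce _; apply: algM; first exact: alg_const.
  rewrite /monof; apply: alg_prod_seq => l _; apply: algX.
  exact: (@alg_var k J _ Q z (inl l)).
apply: (@growth_le_rat k J _ _ _ z _ (fun M => \prod_x \det ((w M).2 x))).
- by apply: alg_prod_seq => x _; apply: alg_det.
- move=> M /Hw [u _]; apply/prodf_neq0 => x _; rewrite -unitfE; exact: u.
- move=> [a [i j]].
  apply: (@alg_eq _ _ _ _ _ (fun M => ((w M).2 (tgt a) *m L f (w M).1 a *m \adj ((w M).2 (src a))) i j *
     \prod_(x | x != src a) \det ((w M).2 x))).
    move=> M /Hw [u e]; rewrite /entry e [in RHS](bigD1 (src a)) //= mulrA; congr (_ * _).
    rewrite /invmx u -scalemxAr [X in _ = X * _]mxE mulrC mulrA.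
    by rewrite mulrV ?mul1r // -unitmxE.
  apply: algM; last by apply: alg_prod_seq => x _; apply: alg_det.
  by apply: mx_algM; [apply: mx_algM|apply: mx_alg_adj].
- exact: growth_le_free.
Qed.

(** All representations of a multiple [N] of [w] satisfy the relations and fill an affine space.
    Families need a number of parameters linear in [N], while the dimensions of the space and of the
    group are quadratic; a negative value of the form would win for large [N]. *)
Lemma tame_tits (hC : tame C) (w : dimvec C) : w (voo C) = 0%N ->
  (\sum_(a : arrow C) w (tgt a) * w (src a) <= \sum_x w x * w x)%N.
Proof.
move=> w0; set A := (\sum_a _)%N; set B := (\sum_x _)%N; rewrite leqNgt; apply/negP => lt.
(* With N = c + 1 the number [N * c] of parameters is below [N * N], the least gap caused by a
   negative value. *)
pose c := (\sum_x w x)%N; pose N := c.+1; pose d : dimvec C := fun x => (N * w x)%N.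
have H := tame_parametrized hC (erefl (\sum_x d x)%N).
have G := growth_parametrized H.
have d0 : d (voo C) = 0%N by rewrite /d w0 muln0.
have := growth_affine (growth_le_sub (h := id) (P' := fun _ => True) (fun M _ => flat_module M d0) G).
rewrite card_coord.
have -> : (\sum_(a : arrow C) d (tgt a) * d (src a) = N * N * A)%N.
  by rewrite big_distrr; apply: eq_bigr => a _; rewrite mulnACA.
have -> : (\sum_x d x * d x = N * N * B)%N.
  by rewrite big_distrr; apply: eq_bigr => a _; rewrite mulnACA.
have -> : (\sum_x d x = N * c)%N by rewrite big_distrr.
have h : (N * N * B + N * N <= N * N * A)%N by rewrite -mulnSr leq_mul2l.
have h2 : (N * c < N * N)%N by lia.
move=> h3; move: (leq_trans h h3); rewrite addnC leq_add2r leqNgt h2 //.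
Qed.

End Families.

(** * King's criterion *)

Section Levels.

Context (q : nat -> nat) (g : nat -> int) (mm : nat).
Hypothesis qq : forall j l : nat, (j <= l)%N -> (l <= j + mm)%N ->
  (forall t : nat, (j < t)%N -> (t <= l)%N -> (q j <= q t)%N) -> g j <= g l.

(** The increments of [g] arriving at positions of level at least [c]. Summed over [c >= 1] they
    give the increments weighted by [q], as in a layer-cake formula. *)
Definition level_sum (c : nat) (b l : nat) : int :=
  \sum_(b <= t < l) (if (c <= q t.+1)%N then g t.+1 - g t else 0).

Lemma level_sum_cat c a b l : (a <= b)%N -> (b <= l)%N ->
  level_sum c a l = level_sum c a b + level_sum c b l.
Proof. by move=> ab bl; rewrite /level_sum (@big_cat_nat _ _ _ b). Qed.

Lemma level_sum_high c j l : (j <= l)%N -> (forall t : nat, (j < t)%N -> (t <= l)%N -> (c <= q t)%N) ->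
  level_sum c j l = g l - g j.
Proof.
move=> jl H; rewrite -(telescope_sumr g jl); apply: eq_big_nat => t /andP [h1 h2].
by rewrite H.
Qed.

Lemma last_low c b l : (b <= l)%N -> (q b < c)%N -> exists j : nat, [/\ (b <= j <= l)%N, (q j < c)%N &
  forall t : nat, (j < t)%N -> (t <= l)%N -> (c <= q t)%N].
Proof.
move=> bl qb; have := subnK bl; move: (l - b)%N => e; elim: e l {bl} => [|e IH] l E.
  by exists b; split=> //; [lia|move=> t; lia].
have [low|high] := ltnP (q l) c; first by exists l; split=> //; [lia|move=> t; lia].
have [j [h1 h2 h3]] := IH l.-1 ltac:(lia).
exists j; split=> //; first by lia.
move=> t jt tl; have [->//|ne] := eqVneq t l; apply: h3 => //.
by lia.
Qed.

(** The positions of level at least [c] form stretches, each preceded by a position of smaller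
    level; the hypothesis on [g] makes its total increment over each stretch non-negative. *)
Lemma level_sum_ge0 c b l : (b <= l)%N -> (l <= b + mm)%N -> (q b < c)%N -> 0 <= level_sum c b l.
Proof.
elim/ltn_ind: l => l IH bl lb qb.
have [j [/andP [h1 h1'] h2 h3]] := last_low bl qb.
rewrite (level_sum_cat c h1 h1') (level_sum_high h1' h3) addr_ge0 //.
  have [e|ne] := eqVneq j l; last by apply: IH => //; [rewrite ltn_neqAle ne|lia].
  subst j; have [e|ne] := eqVneq b l; first by rewrite /level_sum e big_geq.
  have -> : l = l.-1.+1 by lia.
  rewrite /level_sum big_nat_recr /=; last by lia.
  rewrite (_ : l.-1.+1 = l); last by lia.
  by rewrite leqNgt h2 addr0; apply: IH; lia.
rewrite subr_ge0; apply: qq => //; first by lia.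
by move=> t jt tl; apply: leq_trans (h3 t jt tl); apply: ltnW.
Qed.

Definition level_total (b : nat) : int := \sum_(b <= t < b + mm) (q t.+1)%:Z * (g t.+1 - g t).

Lemma level_totalE b K : (forall t, (q t <= K)%N) ->
  level_total b = \sum_(c < K) level_sum c.+1 b (b + mm).
Proof.
move=> qK; rewrite exchange_big /=; apply: eq_bigr => t _.
rewrite -big_mkcond sumr_const -mulr_natl natz; congr (_%:Z * _).
transitivity #|[pred c : 'I_K | (c < q t.+1)%N]|; last by [].
rewrite -sum1_card; have := qK t.+1; move: (q t.+1) => x xK.
by rewrite -(big_ord_widen _ (fun=> 1%N) xK) sum1_card card_ord.
Qed.

Lemma level_total_ge0 b K : (forall t, (q t <= K)%N) -> q b = 0%N -> 0 <= level_total b.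
Proof.
move=> qK qb; rewrite (level_totalE b qK); apply: sumr_ge0 => c _.
by apply: level_sum_ge0; rewrite ?leq_addr ?qb.
Qed.

Lemma level_total_flat b K : (forall t, (q t <= K)%N) -> q b = 0%N -> level_total b = 0 ->
  g (b + mm)%N = g b -> forall t : nat, (b <= t)%N -> (t <= b + mm)%N -> g t = g b.
Proof.
move=> qK qb T0 per.
have Rc c : (0 < c <= K)%N -> level_sum c b (b + mm) = 0.
  move=> /andP [c0 cK]; have lt : (c.-1 < K)%N by lia.
  have E0 := level_totalE b qK; rewrite T0 in E0.
  have /eqP := esym E0; rewrite psumr_eq0; last first.
    by move=> i _; apply: level_sum_ge0; rewrite ?leq_addr ?qb.
  move=> /allP /(_ (Ordinal lt)); rewrite mem_index_enum /= => /(_ isT) /eqP.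
  by rewrite prednK.
have step t : (b <= t)%N -> (t < b + mm)%N -> g t <= g t.+1.
  move=> bt tb; have [le|lt] := leqP (q t) (q t.+1).
    apply: qq => //; first by lia.
    by move=> s h1 h2; have -> : s = t.+1 by lia.
  (* At a descent of [q] one goes back to the last [j] of level at most [q t.+1]. The vanishing of
     the sum at the next level forces [g j = g t], and the hypothesis compares [g j] with
     [g t.+1]. *)
  have [j [/andP [h1 h1'] h2 h3]] := last_low (c := (q t.+1).+1) bt ltac:(by lia).
  have jt : (j < t)%N.
    by rewrite ltn_neqAle h1' andbT; apply/eqP => e; move: h2; rewrite e; lia.
  have gjt : g j = g t.
    have := Rc (q t.+1).+1 ltac:(by rewrite /=; apply: leq_trans (qK t)).
    rewrite (@level_sum_cat _ b j) //; last by lia.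
    rewrite (@level_sum_cat _ j t) //; last by lia.
    rewrite (@level_sum_cat _ t t.+1) // (level_sum_high (ltnW jt) h3).
    have -> : level_sum (q t.+1).+1 t t.+1 = 0 by rewrite /level_sum big_nat1 ltnn.
    have a1 : 0 <= level_sum (q t.+1).+1 b j by apply: level_sum_ge0 => //; [lia|rewrite qb].
    have a2 : 0 <= level_sum (q t.+1).+1 t.+1 (b + mm) by apply: level_sum_ge0; lia.
    have a3 : g j <= g t.
      by apply: qq => //; [lia|move=> s s1 s2; apply: leq_trans (h3 s s1 s2); apply: ltnW].
    move: a1 a2 a3; lia.
  rewrite -gjt; apply: qq; [by lia|by lia|move=> s s1 s2].
  have [->|ne] := eqVneq s t.+1; first by [].
  have st : (s <= t)%N by lia.
  by have := h3 s s1 st; lia.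
have mono s t : (b <= s)%N -> (s <= t)%N -> (t <= b + mm)%N -> g s <= g t.
  move=> bs st tb; have := subnK st; move: (t - s)%N => e; elim: e s bs {st} => [|e IH] s bs E0.
    by have -> : s = t by [].
  apply: le_trans (step s bs _) (IH s.+1 _ _); lia.
move=> t bt tb; apply/eqP; rewrite eq_le (mono b t) // andbT -per.
exact: mono.
Qed.

End Levels.

Lemma col_kernel (k : fieldType) r c (K : 'M[k]_(r, c)) (Q : 'M_c) : Q *m Q = Q -> K *m Q = K ->
  (\rank K < \rank Q)%N -> exists psi : 'cV_c, [/\ psi != 0, Q *m psi = psi & K *m psi = 0].
Proof.
move=> QQ KQ lt; pose N := (Q^T :&: kermx K^T)%MS.
have rk : (\rank K + \rank N = \rank Q)%N.
  by rewrite -(mxrank_tr Q) -(mxrank_mul_ker Q^T K^T) -trmx_mul KQ mxrank_tr.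
have N0 : N != 0 by rewrite -mxrank_eq0; lia.
exists (nz_row N)^T; have sub := nz_row_sub N; split.
- by rewrite trmx_eq0 nz_row_eq0.
- apply: trmx_inj; rewrite trmx_mul trmxK.
  have /submxP [L ->] : (nz_row N <= Q^T)%MS := submx_trans sub (capmxSl _ _).
  by rewrite -mulmxA -trmx_mul QQ.
- apply: trmx_inj; rewrite trmx_mul trmxK trmx0; apply/sub_kermxP.
  exact: submx_trans sub (capmxSr _ _).
Qed.

Section King.

Context (k : closedFieldType) (C : canonicalData k) (E : nat).

Local Notation n := (narms C).
Local Notation m := (@arity k C).
Local Notation mx := 'M[k]_E.
Local Notation cv := 'cV[k]_E.
Local Notation sets := (vertex C -> {set 'I_E}).
Local Notation prep := (prep C E).

Definition consecutive (q : nat -> nat) (mm a b : nat) : Prop :=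
  [/\ (a < mm)%N, (a < b)%N, (b <= a + mm)%N, q a = q b & forall t : nat, (a < t)%N -> (t < b)%N -> (q b < q t)%N].

(** A family of columns stable up to scalars. The rows annihilated by it form a submodule whose
    quotient has dimension at most one at each vertex. *)
Definition coquotient (S : sets) (M : prep) (c : vertex C -> cv) : Prop :=
  (forall x, pr k (S x) *m c x = c x) /\
  forall l a, (a < m l)%N -> exists s, M l a *m c (armv l a.+1) = s *: c (armv l a).

Definition mkc (c0 coo : cv) (g : 'I_n -> nat -> cv) (x : vertex C) : cv :=
  match x with
  | inl false => c0 | inl true => coo
  | inr p => g (tag p) (tagged p).+1
  end.

Lemma mkc_arm c0 coo g l a : (a <= m l)%N -> g l 0%N = c0 -> g l (m l) = coo ->
  mkc c0 coo g (armv l a) = g l a.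
Proof.
move=> am g0 gm; case: a am => [|a] am //.
rewrite /armv; case: insubP => [u ua <-|] //.
by move=> na; have -> : a.+1 = m l by lia.
Qed.

Context (S : sets) (M : prep) (tau : vertex C -> int) (qc : 'I_n -> nat -> nat).
Hypothesis rS : isrep S M.
Hypothesis rM : rels M.
Hypothesis dS : forall l t, (t <= m l)%N -> (#|S (armv l t)| + qc l 0 = #|S (v0 C)| + qc l t)%N.
Hypothesis qcm : forall l t, qc l (t + m l)%N = qc l t.
Hypothesis nocol : ~ col_killed S M.
Hypothesis dg : forall i (a b : nat), consecutive (qc i) (m i) a b -> degen S (oth i) i M (a, b).
Hypothesis hq : forall c, coquotient S M c -> 0 <= \sum_x (if c x != 0 then tau x else 0).

Let dSS l t t' : (t <= m l)%N -> (t' <= m l)%N -> (#|S (armv l t)| + qc l t' = #|S (armv l t')| + qc l t)%N.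
Proof. by move=> /(dS (l := l)) h1 /(dS (l := l)) h2; lia. Qed.

Definition tot : int := \sum_x tau x.

(** The weight along the cycle of arm [i]: both ends and all other arms are lumped into one
    position. Its partial sums [gsum] therefore grow by [tot] in each turn. *)
Definition delta (i : 'I_n) (t : nat) : int :=
  if (t %% m i == 0)%N then tot - \sum_(0 <= s < (m i).-1) tau (armv i s.+1) else tau (armv i (t %% m i)).

Definition gsum (i : 'I_n) (t : nat) : int := \sum_(0 <= s < t) delta i s.+1.

Lemma gsum_int i a b : (a <= b)%N -> (b < m i)%N -> gsum i b - gsum i a = \sum_(a <= s < b) tau (armv i s.+1).
Proof.
move=> ab bm; rewrite /gsum (@big_cat_nat _ _ _ a 0 b) // addrAC subrr add0r; apply: eq_big_nat => s /andP [h1 h2].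
by rewrite /delta modn_small //; lia.
Qed.

Lemma gsum_per i t : gsum i (t + m i) = gsum i t + tot.
Proof.
elim: t => [|t IH].
  rewrite add0n {2}/gsum big_geq // add0r; have m0 := arity_gt0 i.
  rewrite /gsum -{1}(prednK m0) big_nat_recr //= prednK // {2}/delta modnn eqxx.
  have -> : \sum_(0 <= s < (m i).-1) delta i s.+1 = \sum_(0 <= s < (m i).-1) tau (armv i s.+1).
    by apply: eq_big_nat => s /andP [h1 h2]; rewrite /delta modn_small //; lia.
  by lia.
rewrite addSn; have e s : gsum i s.+1 = gsum i s + delta i s.+1 by rewrite /gsum big_nat_recr.
rewrite !e IH; have -> : delta i (t + m i).+1 = delta i t.+1 by rewrite /delta -addSn modnDr.
by lia.
Qed.

Lemma last_zero i (j l : nat) (psi : cv) : (j < l)%N -> psi != 0 -> cp (M i) j l *m psi = 0 ->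
  exists j1 : nat, [/\ (j <= j1 < l)%N, forall t : nat, (t <= j1)%N -> cp (M i) t l *m psi = 0 &
    forall t : nat, (j1 < t)%N -> (t <= l)%N -> cp (M i) t l *m psi != 0].
Proof.
move=> jl pn pj.
have [j1 [[z1 l1] jmax]] := @bounded_max (fun t => cp (M i) t l *m psi = 0 /\ (t <= l)%N) l (ex_intro _ j (conj pj (ltnW jl))) (fun _ h => proj2 h).
have lt : (j1 < l)%N.
  by rewrite ltn_neqAle l1 andbT; apply: contraNneq pn => e; move: z1; rewrite e cp_id mul1mx => ->.
exists j1; split.
- by rewrite lt andbT; apply: jmax; split=> //; apply: ltnW.
- by move=> t tj; rewrite (@cp_cat _ _ _ t j1 l) // -mulmxA z1 mulmx0.
- by move=> t jt tl; apply/eqP => z; have := jmax t (conj z tl); rewrite leqNgt jt.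
Qed.

(** The test quotient is the column [psi] propagated down arm [i]; it is supported exactly on the
    positions after [j1] up to [l]. *)
Lemma interval_quotient i (j l : nat) (psi : cv) : (j < l)%N -> (l < m i)%N -> psi != 0 ->
  pr k (S (armv i l)) *m psi = psi -> cp (M i) j l *m psi = 0 ->
  exists j1 : nat, (j <= j1 < l)%N /\ gsum i j1 <= gsum i l.
Proof.
move=> jl lm pn pS pj; have [j1 [/andP [h1 h2] z nz]] := last_zero jl pn pj.
exists j1; rewrite h1; split=> //; rewrite -subr_ge0 gsum_int ?(ltnW h2) //.
pose g (a : 'I_n) t : cv := if (a == i) && (t <= l)%N then cp (M i) t l *m psi else 0.
have g0 a : g a 0%N = 0 by rewrite /g; case: ifP => // _; apply: z.
have gm a : g a (m a) = 0.
  by rewrite /g; case: eqVneq => //= ->; rewrite leqNgt lm.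
pose c := mkc 0 0 g.
have cE a t : (t <= m a)%N -> c (armv a t) = g a t by move=> tm; apply: mkc_arm.
have cS : coquotient S M c.
  split.
    apply: armv_ind => a t tm; rewrite cE // /g; case: ifP => [/andP [/eqP -> tl]|_]; last by rewrite mulmx0.
    have [->|ne] := eqVneq t l; first by rewrite cp_id mul1mx.
    have lt : (t < l)%N by lia.
    by rewrite mulmxA (isrep_cp rS lt (ltnW lm)).1.
  move=> a t tm; rewrite !cE ?(ltnW tm) // /g; have [->|] := eqVneq a i; last by exists 0; rewrite mulmx0 scaler0.
  rewrite /=; case: (ltnP t l) => tl; last by exists 0; rewrite mulmx0 scale0r.
  by exists 1; rewrite (ltnW tl) scale1r mulmxA -cp_l.
have := hq cS; rewrite sum_vertex eqxx !add0r.
rewrite (bigD1 i) //= [X in _ + X]big1 ?addr0; last first.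
  move=> a ai; apply: big1 => t _; rewrite cE; last by have := ltn_ord t; lia.
  by rewrite /g (negPf ai) eqxx.
congr (0 <= _).
rewrite -(big_mkord predT (fun a => if c (armv i a.+1) != 0 then tau (armv i a.+1) else 0)).
rewrite (@big_cat_nat _ _ _ j1 0) //=; last by lia.
rewrite (@big_cat_nat _ _ _ l j1) ?(ltnW h2) //=; last by lia.
rewrite big_nat big1 ?add0r; last first.
  move=> t /andP [_ tj]; rewrite cE; last by lia.
  by rewrite /g z ?if_same ?eqxx.
rewrite [X in _ + X]big_nat [X in _ + X]big1 ?addr0; last first.
  move=> t /andP [lt tm]; rewrite cE; last by lia.
  by rewrite /g eqxx leqNgt ltnS lt eqxx.
apply: eq_big_nat => t /andP [a b]; rewrite cE; last by lia.
by rewrite /g eqxx b nz.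
Qed.

(** In a pencil, a column killed by one arm composite has proportional images under all the others,
    with non-zero factors. *)
Lemma prop_arms i (phi : cv) : amx M i *m phi = 0 -> forall l, l != i ->
  exists2 s, s != 0 & amx M l *m phi = s *: (amx M (oth i) *m phi).
Proof.
move=> z l li; exists ((plu i (oth i))^-1 * plu i l).
  by rewrite mulf_neq0 ?invr_neq0 ?plu_neq0 ?oth_neq // eq_sym.
have := rM i (oth i) l => /(congr1 (fun A => A *m phi)).
rewrite mulmxDl -!scalemxAl z scaler0 add0r => H.
by rewrite -scalerA -H scalerA mulVf ?scale1r // plu_neq0 // oth_neq.
Qed.

(** Here the test quotient is non-zero everywhere except at the positions of arm [i] after [b] and
    up to [j1], so its weight is [tot] minus the weight of that gap. *)
Lemma crossing_quotient i (j b : nat) (phi psi : cv) : (b <= j)%N -> (j < m i)%N ->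
  pr k (S (voo C)) *m phi = phi -> pr k (S (armv i b)) *m psi = psi ->
  amx M (oth i) *m phi = cp (M i) 0 b *m psi -> cp (M i) j (m i) *m phi = 0 ->
  amx M (oth i) *m phi != 0 ->
  exists j1 : nat, (j <= j1 < m i)%N /\ gsum i j1 <= gsum i (b + m i).
Proof.
move=> bj jm phiS psiS e0 pj nz0.
have phin : phi != 0 by apply: contraNneq nz0 => ->; rewrite mulmx0.
have [j1 [/andP [h1 h2] z nz]] := last_zero jm phin pj.
exists j1; rewrite h1; split=> //.
rewrite gsum_per -subr_ge0 (_ : _ + _ - _ = tot - (gsum i j1 - gsum i b)); last by ring.
rewrite gsum_int //; last exact: leq_trans bj h1.
have ai0 : amx M i *m phi = 0 by apply: z.
have prp := prop_arms ai0.
set p0 := amx M (oth i) *m phi in e0 nz0 prp.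
pose g (a : 'I_n) t : cv := if a == i then (if (t <= b)%N then cp (M i) t b *m psi else cp (M i) t (m i) *m phi)
  else if t == 0%N then p0 else cp (M a) t (m a) *m phi.
have bm : (b < m i)%N by lia.
have g0 a : g a 0%N = p0 by rewrite /g; case: eqVneq => //= ->.
have gm a : g a (m a) = phi.
  rewrite /g; case: eqVneq => [->|_]; first by rewrite leqNgt bm cp_id mul1mx.
  by rewrite (gtn_eqF (arity_gt0 a)) cp_id mul1mx.
pose c := mkc p0 phi g.
have cE a t : (t <= m a)%N -> c (armv a t) = g a t by move=> tm; apply: mkc_arm.
have p0S : pr k (S (v0 C)) *m p0 = p0 by rewrite mulmxA (isrep_amx _ rS).1.
have cS : coquotient S M c.
  split.
    apply: armv_ind => a t tm; rewrite cE // /g; case: (eqVneq a i) tm => [->|ai] tm.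
      case: leqP => tb.
        have [->|ne] := eqVneq t b; first by rewrite cp_id mul1mx.
        have lt : (t < b)%N by lia.
        by rewrite mulmxA (isrep_cp rS lt (ltnW bm)).1.
      have [->|ne] := eqVneq t (m i); first by rewrite cp_id mul1mx armv_end.
      have lt : (t < m i)%N by lia.
      by rewrite mulmxA (isrep_cp rS lt (leqnn _)).1.
    case: (eqVneq t 0%N) => [->|t0]; first exact: p0S.
    have [->|ne] := eqVneq t (m a); first by rewrite cp_id mul1mx armv_end.
    have lt : (t < m a)%N by lia.
    by rewrite mulmxA (isrep_cp rS lt (leqnn _)).1.
  move=> a t tm; rewrite !cE ?(ltnW tm) // /g; case: (eqVneq a i) tm => [->|ai] tm.
    case: (ltngtP t b) => tb.
    - by exists 1; rewrite scale1r mulmxA -cp_l.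
    - by exists 1; rewrite scale1r mulmxA -cp_l.
    - by exists 0; rewrite scale0r mulmxA -cp_l // z //; lia.
  case: (eqVneq t 0%N) => [->|t0]; last by exists 1; rewrite scale1r mulmxA -cp_l.
  have [s s0 e] := prp a ai; exists s; rewrite -e /amx (cp_l _ (arity_gt0 a)) mulmxA //.
have := hq cS.
have -> : \sum_x (if c x != 0 then tau x else 0) = tot - \sum_x (if c x == 0 then tau x else 0).
  by rewrite -sumrB; apply: eq_bigr => x _; case: eqP; rewrite ?subrr ?subr0.
congr (0 <= _ - _).
rewrite sum_vertex (negPf nz0) (negPf phin) !add0r.
rewrite (bigD1 i) //= [X in _ + X]big1 ?addr0; last first.
  move=> a ai; apply: big1 => t _; rewrite cE; last by have := ltn_ord t; lia.
  rewrite /g (negPf ai); case: eqP => // w; have [s s0 e] := prp a ai; case/eqP: nz0.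
  apply/eqP; have : s *: p0 == 0 by rewrite -e /amx (@cp_cat _ _ _ 0 t.+1 (m a)) -?mulmxA ?w ?mulmx0 //; have := ltn_ord t; lia.
  by rewrite scaler_eq0 (negPf s0).
rewrite -(big_mkord predT (fun a => if c (armv i a.+1) == 0 then tau (armv i a.+1) else 0)).
rewrite (@big_cat_nat _ _ _ b 0) //=; last by lia.
rewrite (@big_cat_nat _ _ _ j1 b) //=; [|exact: leq_trans bj h1|by lia].
rewrite big_nat big1 ?add0r; last first.
  move=> t /andP [_ tj]; rewrite cE; last by lia.
  rewrite /g eqxx tj; case: eqP => // w; case/eqP: nz0.
  by rewrite e0 (@cp_cat _ _ _ 0 t.+1 b) // -mulmxA w mulmx0.
rewrite [X in _ + X]big_nat [X in _ + X]big1 ?addr0; last first.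
  move=> t /andP [lt tm]; rewrite cE; last by lia.
  rewrite /g eqxx leqNgt (_ : b < t.+1)%N /=; last by lia.
  by rewrite (negPf (nz t.+1 _ _)); lia.
apply: eq_big_nat => t /andP [a' b']; rewrite cE; last by lia.
by rewrite /g eqxx leqNgt ltnS a' z // eqxx.
Qed.

Lemma arm_kernel i (j l : nat) : (j < l)%N -> (l <= m i)%N ->
  (qc i j < qc i l)%N \/ consecutive (qc i) (m i) j l ->
  exists psi : cv, [/\ psi != 0, pr k (S (armv i l)) *m psi = psi & cp (M i) j l *m psi = 0].
Proof.
move=> jl lm [lt|con].
  have [e1 e2] := isrep_cp rS jl lm; apply: col_kernel => //; first exact: pr_id.
  rewrite rank_pr; apply: leq_ltn_trans (_ : \rank (cp (M i) j l) <= #|S (armv i j)|)%N _.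
    by rewrite -e1 -(rank_pr k); apply: mxrankM_maxl.
  by have := dSS (leq_trans (ltnW jl) lm) lm; lia.
have := dg con; rewrite /degen /= lm => -[psi [pn pS pk]]; exists psi; split=> //.
by rewrite (isrep_cp rS jl lm).1 in pk.
Qed.

Lemma cyclic_kernel i (j b : nat) : (j < m i)%N -> (0 < b)%N -> (b <= j)%N ->
  (qc i j < qc i b)%N \/ consecutive (qc i) (m i) j (b + m i) ->
  exists phi psi : cv, [/\ (phi != 0) || (psi != 0), pr k (S (voo C)) *m phi = phi, pr k (S (armv i b)) *m psi = psi,
    amx M (oth i) *m phi = cp (M i) 0 b *m psi & cp (M i) j (m i) *m phi = 0].
Proof.
move=> jm b0 bj; have bm : (b <= m i)%N by lia.
have [w1 w2] := isrep_cp rS jm (leqnn (m i)); rewrite armv_end in w2.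
have [u1 u2] := isrep_cp rS b0 bm; have [a1 a2] := isrep_amx (oth i) rS.
case=> [lt|con]; last first.
  have := dg con; rewrite /degen /= (_ : b + m i <= m i = false)%N; last by lia.
  rewrite (_ : m i <= j = false)%N; last by lia.
  rewrite addnK => -[phi [psi [h1 h2 h3 h4 h5]]]; exists phi, psi; split=> //.
  by rewrite w1 in h5.
pose K := block_mx (amx M (oth i)) (- cp (M i) 0 b) (cp (M i) j (m i)) 0.
pose Q := block_mx (pr k (S (voo C))) 0 0 (pr k (S (armv i b))).
pose P := block_mx (pr k (S (v0 C))) 0 0 (pr k (S (armv i j))).
have dvoo : #|S (voo C)| = #|S (v0 C)|.
  have := dS (leqnn (m i)); rewrite armv_end -[X in (_ + _ = _ + qc i X)%N]add0n qcm => /eqP.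
  by lia.
have [||| phi' [pn pQ pK]] := @col_kernel k _ _ K Q.
- by rewrite mulmx_block !(mulmx0, mul0mx, addr0, add0r) !pr_id.
- by rewrite mulmx_block !(mulmx0, mul0mx, addr0, add0r) mulNmx a2 u2 w2.
- have PK : P *m K = K by rewrite mulmx_block !(mulmx0, mul0mx, addr0, add0r) mulmxN a1 u1 w1.
  rewrite -PK; apply: leq_ltn_trans (mxrankM_maxl _ _) _.
  rewrite !rank_diag_block_mx !rank_pr dvoo ltn_add2l.
  by have := dSS (ltnW jm) bm; lia.
exists (usubmx phi'), (dsubmx phi').
have pE : phi' = col_mx (usubmx phi') (dsubmx phi') by rewrite vsubmxK.
move: pQ pK; rewrite pE !mul_block_col !(mulmx0, mul0mx, addr0, add0r) col_mxKu col_mxKd.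
move=> /eq_col_mx [q1 q2]; rewrite -[RHS]col_mx0 => /eq_col_mx [k1 k2]; split=> //.
  by apply: contraNT pn; rewrite negb_or !negbK => /andP [/eqP e1 /eqP e2]; rewrite pE e1 e2 col_mx0.
by apply/eqP; rewrite -subr_eq0 -mulNmx k1.
Qed.

(** Induction on the length. A kernel column over the interval, turned into a test quotient,
    compares [l] with some [j1] in between, and induction compares [j] with [j1]. *)
Lemma gsum_mono i (j l : nat) : (j <= l)%N -> (l <= j + m i)%N ->
  (forall t : nat, (j < t)%N -> (t <= l)%N -> (qc i j <= qc i t)%N) -> gsum i j <= gsum i l.
Proof.
move=> jl; have [len] := ubnP (l - j)%N; elim: len j l jl => // len IH j l jl lenE lj H.
have qcmr r t : qc i (t + r * m i) = qc i t.
  by elim: r => [|r IHr]; rewrite ?addn0 // addnCA addnC qcm.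
have gr r t : gsum i (t + r * m i) = gsum i t + tot *+ r.
  elim: r => [|r IHr]; first by rewrite addn0 addr0.
  by rewrite addnCA addnC gsum_per IHr mulrS -addrA [tot + _]addrC.
wlog jm : j l jl lenE lj H / (j < m i)%N.
  move=> W; have dj := divn_eq j (m i); set r := (j %/ m i)%N in dj; set j' := (j %% m i)%N in dj.
  have jm : (j' < m i)%N by rewrite ltn_mod arity_gt0.
  have lE : l = ((l - r * m i) + r * m i)%N by lia.
  rewrite lE {1}dj addnC !gr lerD2r; apply: W => //; [lia|lia|lia|move=> t t1 t2].
  have := H (t + r * m i)%N ltac:(lia) ltac:(lia); rewrite qcmr {1}dj addnC qcmr //.
(* If the level of [j] recurs strictly inside, the interval is cut there. Otherwise the ends either
   have different levels, so that a kernel exists by dimensions, or are consecutive, so that it is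
   given by [dg]. *)
have [E0|ne] := eqVneq j l; first by rewrite E0.
have jlt : (j < l)%N by lia.
have [[t [[t1 t2] t3]]|no] := classic (exists t : nat, (j < t /\ t < l)%N /\ (qc i t <= qc i j)%N).
  have qt : qc i t = qc i j by apply/eqP; rewrite eqn_leq t3 H // ltnW.
  apply: le_trans (IH j t _ _ _ _) (IH t l _ _ _ _); try by lia.
    by move=> s s1 s2; apply: H; lia.
  by move=> s s1 s2; rewrite qt; apply: H; lia.
have good : (qc i j < qc i l)%N \/ consecutive (qc i) (m i) j l.
  have := H l jlt (leqnn _); rewrite leq_eqVlt => /orP [/eqP e|lt]; [right|by left].
  split=> // t t1 t2; rewrite -e ltnNge; apply/negP => le; apply: no; by exists t.
have IHj j1 : (j <= j1)%N -> (j1 < l)%N -> gsum i j <= gsum i j1.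
  by move=> h1 h2; apply: IH => //; [lia|lia|move=> s s1 s2; apply: H; lia].
have fin j1 : (j <= j1)%N -> (j1 < l)%N -> gsum i j1 <= gsum i l -> gsum i j <= gsum i l.
  by move=> h1 h2; apply: le_trans; apply: IHj.
have [lm|ml] := leqP l (m i).
  have [psi [pn pS pk]] := arm_kernel jlt lm good.
  have [em|nem] := eqVneq l (m i).
    rewrite em in pS pk; rewrite armv_end in pS.
    have nz : amx M (oth i) *m psi != 0.
      apply/eqP => z; apply: nocol; exists psi; split=> // a.
      have ai : amx M i *m psi = 0 by rewrite /amx (@cp_cat _ _ _ 0 j (m i)) ?(ltnW jm) // -mulmxA pk mulmx0.
      have [->//|ne'] := eqVneq a i; have [s _ ->] := prop_arms ai ne'; by rewrite z scaler0.
    have [j1 [/andP [h1 h2] h3]] := @crossing_quotient i j 0 psi (amx M (oth i) *m psi) (leq0n _) jm pS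
       ltac:(by rewrite mulmxA (isrep_amx _ rS).1) ltac:(by rewrite mul1mx) pk nz.
    by rewrite add0n in h3; apply: (fin j1) => //; rewrite em.
  have [j1 [/andP [h1 h2] h3]] := @interval_quotient i j l psi jlt ltac:(by lia) pn pS pk.
  exact: (fin j1).
pose b := (l - m i)%N; have lE : l = (b + m i)%N by lia.
have b0 : (0 < b)%N by lia.
have bj : (b <= j)%N by lia.
rewrite lE qcm in good.
have [phi [psi [pn pS qS e0 pk]]] := cyclic_kernel jm b0 bj good.
have [z|nz] := eqVneq (amx M (oth i) *m phi) 0; last first.
  have [j1 [/andP [h1 h2] h3]] := crossing_quotient bj jm pS qS e0 pk nz.
  by apply: (fin j1) => //; [lia|rewrite lE].
have p0 : phi = 0.
  apply: NNPP => /eqP pn'; apply: nocol; exists phi; split=> // a.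
  have ai : amx M i *m phi = 0 by rewrite /amx (@cp_cat _ _ _ 0 j (m i)) ?(ltnW jm) // -mulmxA pk mulmx0.
  have [->//|ne'] := eqVneq a i; have [s _ ->] := prop_arms ai ne'; by rewrite z scaler0.
rewrite p0 eqxx /= in pn; rewrite z in e0.
have [b1 [/andP [h1 h2] h3]] := @interval_quotient i 0 b psi b0 ltac:(lia) pn qS (esym e0).
apply: (fin (b1 + m i)%N); [lia|lia|].
by rewrite lE !gsum_per lerD2r.
Qed.

Context (p : nat).
Hypothesis p0 : (0 < p)%N.
Hypothesis eE : (#|S (v0 C)| = p + \sum_l qc l 0)%N.
Hypothesis qz : forall l, exists2 b : nat, (b < m l)%N & qc l b = 0%N.
Hypothesis tau_deg : \sum_x tau x * #|S x|%:Z = 0.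

Lemma periodic_sum (f : nat -> int) (b mm : nat) : (forall t, f (t + mm)%N = f t) ->
  \sum_(b <= t < b + mm) f t = \sum_(0 <= t < mm) f t.
Proof.
move=> per; have e1 : \sum_(0 <= t < b + mm) f t = \sum_(0 <= t < b) f t + \sum_(b <= t < b + mm) f t.
  by rewrite (@big_cat_nat _ _ _ b) // leq_addr.
have e2 : \sum_(0 <= t < b + mm) f t = \sum_(0 <= t < mm) f t + \sum_(0 <= t < b) f t.
  rewrite (@big_cat_nat _ _ _ mm) //= ?leq_addl //; congr (_ + _).
  by rewrite -{1}[mm]add0n big_addn addnK; apply: eq_bigr => t _.
by lia.
Qed.

(** The degree condition reads [p * tot + \sum_i T i = 0], and by monotonicity of [gsum] every term
    is non-negative. All therefore vanish, and the equality case of the level sums makes each [gsum]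
    constant. *)
Lemma king_flat : (forall i a, (a.+1 < m i)%N -> tau (armv i a.+1) = 0) /\ tau (v0 C) + tau (voo C) = 0.
Proof.
have qcmr i r t : qc i (t + r * m i) = qc i t.
  by elim: r => [|r IHr]; rewrite ?addn0 // addnCA addnC qcm.
have qK i : exists K, forall t, (qc i t <= K)%N.
  exists (\sum_(s < m i) qc i s)%N => t; rewrite {1}(divn_eq t (m i)) addnC qcmr.
  have lt : (t %% m i < m i)%N by rewrite ltn_mod arity_gt0.
  by rewrite (bigD1 (Ordinal lt)) // leq_addr.
pose T i := \sum_(0 <= t < m i) (qc i t.+1)%:Z * (gsum i t.+1 - gsum i t).
have TE i b : level_total (qc i) (gsum i) (m i) b = T i.
  apply: periodic_sum => t; rewrite -!addSn qcm !gsum_per; ring.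
have gS i t : gsum i t.+1 - gsum i t = delta i t.+1.
  by rewrite /gsum big_nat_recr // addrAC subrr add0r.
have mono i j l := @gsum_mono i j l.
have T0 i : 0 <= T i.
  have [b bm qb] := qz i; have [K HK] := qK i; rewrite -(TE i b).
  exact: (level_total_ge0 (mono i) HK qb).
have tot0 : 0 <= tot.
  have [b bm qb] := qz (arm_fst C).
  have := @gsum_mono (arm_fst C) b (b + m (arm_fst C)) (leq_addr _ _) (leqnn _) ltac:(by lia).
  by rewrite gsum_per lerDl.
have sumE : p%:Z * tot + \sum_i T i = 0.
  rewrite -[RHS]tau_deg sum_vertex.
  have dvoo : #|S (voo C)| = #|S (v0 C)| := regular_voo (d := fun x => #|S x|) dS (fun l => qcm l 0%N).
  have TiE i : T i = \sum_(a < (m i).-1) tau (armv i a.+1) * #|S (armv i a.+1)|%:Z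
     - #|S (v0 C)|%:Z * (\sum_(a < (m i).-1) tau (armv i a.+1)) + (qc i 0%N)%:Z * tot.
    have m0 := arity_gt0 i.
    rewrite /T -{1}(prednK m0) big_nat_recr //= gS (prednK m0) /delta modnn eqxx.
    rewrite -[X in qc i X]add0n qcm !big_mkord.
    have -> : \sum_(t < (m i).-1) (qc i t.+1)%:Z * (gsum i t.+1 - gsum i t) =
       \sum_(a < (m i).-1) (tau (armv i a.+1) * #|S (armv i a.+1)|%:Z - #|S (v0 C)|%:Z * tau (armv i a.+1)
          + (qc i 0%N)%:Z * tau (armv i a.+1)).
      apply: eq_bigr => a _; have am : (a.+1 < m i)%N by have := ltn_ord a; lia.
      rewrite gS /delta modn_small //=.
      have -> : #|S (armv i a.+1)|%:Z = #|S (v0 C)|%:Z + (qc i a.+1)%:Z - (qc i 0%N)%:Z.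
        by have := dS (ltnW am); lia.
      ring.
    rewrite big_split sumrB -!mulr_sumr /=; ring.
  rewrite (eq_bigr _ (fun i _ => TiE i)) big_split sumrB -mulr_suml -mulr_sumr dvoo /=.
  have totE : tot = tau (v0 C) + tau (voo C) + \sum_(l < n) \sum_(a < (m l).-1) tau (armv l a.+1).
    by rewrite /tot sum_vertex.
  have eEz : #|S (v0 C)|%:Z = p%:Z + \sum_i (qc i 0%N)%:Z.
    by rewrite eE PoszD -!natz natr_sum; congr (_ + _); apply: eq_bigr => i _; rewrite natz.
  have -> : p%:Z = #|S (v0 C)|%:Z - \sum_i (qc i 0%N)%:Z by lia.
  rewrite totE; ring.
have sT : 0 <= \sum_i T i by apply: sumr_ge0.
have tz : tot = 0.
  have : 0 <= p%:Z * tot by lia.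
  move=> h; have : p%:Z * tot = 0 by lia.
  by lia.
have Tz i : T i = 0.
  have := sumE; rewrite tz mulr0 add0r => /eqP; rewrite psumr_eq0 //.
  by move=> /allP /(_ i); rewrite mem_index_enum => /(_ isT) /eqP.
have flat i a : (a.+1 < m i)%N -> tau (armv i a.+1) = 0.
  move=> am; have [b bm qb] := qz i; have [K HK] := qK i.
  have F := level_total_flat (mono i) HK qb (etrans (TE i b) (Tz i)) ltac:(by rewrite gsum_per tz addr0).
  have -> : tau (armv i a.+1) = gsum i a.+1 - gsum i a by rewrite gS /delta modn_small.
  have [ba|ab] := leqP b a.
    by rewrite !F; lia.
  have := gsum_per i a.+1; have := gsum_per i a; rewrite tz !addr0 => <- <-.
  by rewrite !F; lia.
split=> //; have := tz; rewrite /tot sum_vertex big1 ?addr0 // => i _.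
by apply: big1 => a _; apply: flat; have := ltn_ord a; lia.
Qed.

End King.

Lemma alg_curve (k : fieldType) (I : finType) (Z : I -> {poly k}) (f : k -> k) :
  in_alg_gen (fun _ => True) (fun i t => (Z i).[t]) f -> exists P : {poly k}, forall t, f t = P.[t].
Proof.
move=> [t [s _ Hs]]; exists (\sum_(ce <- s) ce.1 *: \prod_i Z i ^+ ce.2 i) => x.
rewrite Hs // horner_sum; apply: eq_bigr => ce _; rewrite hornerZ horner_prod; congr (_ * _).
by rewrite /monof; apply: eq_bigr => i _; rewrite horner_exp.
Qed.

Lemma pole_free (k : fieldType) (hk : [pchar k] =i pred0) (P : {poly k}) (a : int) (c : k) : c != 0 ->
  (forall t, t != 0 -> P.[t] = (t^-1) ^ a * c) -> a <= 0.
Proof.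
move=> c0 H; case: a H => [[//|a]|//] H; exfalso.
pose R := (P * 'X^(a.+1) - c%:P) * 'X.
have R0 : R = 0.
  apply: NNPP => /eqP /(poly_nonroot hk) [x]; rewrite !hornerE.
  have [->|x0] := eqVneq x 0; first by rewrite mulr0 eqxx.
  by rewrite H // -exprnP exprVn mulrAC mulVf ?mul1r ?subrr ?mul0r ?eqxx // expf_neq0.
move: R0 => /eqP; rewrite mulf_eq0 polyX_eq0 orbF => /eqP /(congr1 (fun p : {poly k} => p.[0])).
by rewrite !hornerE expr0n mulr0 sub0r => /eqP; rewrite oppr_eq0 (negPf c0).
Qed.

(** * King's inequalities from one-parameter subgroups *)

Section KingInequality.

Context (k : closedFieldType) (hk : [pchar k] =i pred0) (C : canonicalData k) (E : nat).

Local Notation n := (narms C).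
Local Notation m := (@arity k C).
Local Notation mx := 'M[k]_E.
Local Notation cv := 'cV[k]_E.
Local Notation sets := (vertex C -> {set 'I_E}).
Local Notation prep := (prep C E).

Definition gauge (S : sets) (h hi : vertex C -> mx) : Prop := forall x,
  [/\ supp (S x) (S x) (h x), supp (S x) (S x) (hi x), h x *m hi x = pr k (S x) & hi x *m h x = pr k (S x)].

Definition pact (h hi : vertex C -> mx) (M : prep) : prep :=
  fun i j => h (armv i j) *m M i j *m hi (armv i j.+1).

Definition weighted (S : sets) (sigma : vertex C -> int) (F : prep -> k) : Prop :=
  (forall M N, (forall i j, (j < m i)%N -> M i j = N i j) -> F M = F N) /\
  forall h hi M, gauge S h hi -> isrep S M -> rels M ->
    F (pact h hi M) = (\prod_x \det (hi x + pr k (~: S x)) ^ sigma x) * F M.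

Lemma pr_split (S : {set 'I_E}) : pr k S + pr k (~: S) = 1%:M.
Proof. by rewrite -setTD pr_setD // prT. Qed.

Lemma gauge_unit S h hi x : gauge S h hi -> hi x + pr k (~: S x) \in unitmx.
Proof.
move=> /(_ x) [[h1 h2] [i1 i2] e1 e2].
have z1 : pr k (S x) *m pr k (~: S x) = 0 by rewrite pr_pr setICr pr0.
have z2 : pr k (~: S x) *m pr k (S x) = 0 by rewrite pr_pr setIC setICr pr0.
have : (hi x + pr k (~: S x)) *m (h x + pr k (~: S x)) = 1%:M.
  rewrite mulmxDl !mulmxDr e2 pr_id -[in pr k (~: S x) *m h x]h1 -{1}i2.
  by rewrite -mulmxA z1 mulmx0 mulmxA z2 mul0mx addr0 add0r pr_split.
by move=> /mulmx1_unit [].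
Qed.

Context (S : sets) (sigma : vertex C -> int) (F : prep -> k).
Hypothesis Falg : in_alg_gen (fun _ => True) (fun (c : coords C E) M => cz c M) F.
Hypothesis Fw : weighted S sigma F.

Definition weight_sum (d : vertex C -> nat) : int := \sum_x sigma x * (d x)%:Z.

Lemma prod_expz (t : k) (d : vertex C -> nat) : t != 0 ->
  \prod_x (t ^+ d x) ^ sigma x = t ^ weight_sum d.
Proof.
move=> t0; rewrite (big_morph (fun a : int => t ^ a) (fun a b => expfzDr a b t0) (expr0z t)).
by apply: eq_bigr => x _; rewrite exprnP exprz_exp; congr (_ ^ _); apply: mulrC.
Qed.

Definition dilation (T Q : {set 'I_E}) (t : k) : mx := pr k T + t *: pr k Q.

Lemma det_dilation (T Q : {set 'I_E}) t : T :&: Q = set0 ->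
  \det (dilation T Q t + pr k (~: (T :|: Q))) = t ^+ #|Q|.
Proof.
move=> TQ; have -> : dilation T Q t + pr k (~: (T :|: Q)) = diag_mx (\row_j (if j \in Q then t else 1)).
  apply/matrixP => a b; rewrite !mxE.
  case: (eqVneq a b) => [->|]; last by rewrite mulr0 !addr0.
  rewrite !mulr1n; move/setP: TQ => /(_ b); rewrite !inE.
  by case: (b \in T); case: (b \in Q); rewrite ?mulr1 ?mulr0 ?addr0 ?add0r.
rewrite det_diag (bigID (fun j => j \in Q)) /= [X in _ * X]big1 ?mulr1; last by move=> j /negPf jQ; rewrite mxE jQ.
by rewrite -prodr_const; apply: eq_bigr => j jQ; rewrite mxE jQ.
Qed.

Lemma dilation_mul (T Q : {set 'I_E}) t s : T :&: Q = set0 -> t * s = 1 ->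
  dilation T Q t *m dilation T Q s = pr k (T :|: Q).
Proof.
move=> TQ ts; rewrite mulmxDl !mulmxDr -!scalemxAr -!scalemxAl !pr_id !pr_pr [Q :&: T]setIC TQ pr0.
rewrite !scaler0 add0r addr0 scalerA mulrC ts scale1r -(pr_setD k (subsetUl T Q)); congr (_ + pr k _).
by rewrite setDUl setDv set0U; apply/esym/setDidPl; rewrite -setI_eq0 setIC TQ.
Qed.

Lemma dilation_supp (T Q : {set 'I_E}) t : supp (T :|: Q) (T :|: Q) (dilation T Q t).
Proof.
have sT := subsetUl T Q; have sQ := subsetUr T Q.
by split; rewrite ?mulmxDr ?mulmxDl -?scalemxAr -?scalemxAl ?(pr_subr k sT) ?(pr_subr k sQ) ?(pr_sub k sT) ?(pr_sub k sQ).
Qed.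

Lemma dilation_gauge (T Q : sets) t : (forall x, T x :&: Q x = set0) -> (forall x, S x = T x :|: Q x) -> t != 0 ->
  gauge S (fun x => dilation (T x) (Q x) t) (fun x => dilation (T x) (Q x) t^-1).
Proof.
move=> TQ SE t0 x; rewrite SE; split; try exact: dilation_supp.
  by apply: dilation_mul; rewrite ?mulfV.
by apply: dilation_mul; rewrite ?mulVf.
Qed.

(** The one-parameter subgroup equal to 1 on [U] and to t on a complement has a limit at t = 0
    exactly because [U] is a submodule. Along it [F] is polynomial in t and also a constant times a
    power of t, whose exponent must be non-negative. *)
Lemma king_ineq M U : isrep S M -> rels M -> subrep S M U -> F M != 0 ->
  weight_sum (fun x => (#|S x| - \rank (U x))%N) <= 0.
Proof.
move=> rM eM sU FM.
have [T [u [M' [ch _]]]] := chart_exists rM sU.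
have [TS su hU hM [rM' tM']] := ch.
have uu x : u x *m u x = 0 := chart_unip x ch.
have uS x : pr k (S x) *m u x = u x by rewrite -(su x).1 mulmxA pr_subr // (TS x).1.
have uS' x : u x *m pr k (S x) = u x by rewrite -(su x).2 -mulmxA pr_sub // subsetDl.
have g1 : gauge S (fun x => pr k (S x) + u x) (fun x => pr k (S x) - u x).
  move=> x; split.
  - by split; rewrite ?mulmxDr ?mulmxDl pr_id ?uS ?uS'.
  - by split; rewrite ?mulmxBr ?mulmxBl pr_id ?uS ?uS'.
  - by rewrite mulmxDl !mulmxBr pr_id uS uS' uu subr0 subrK.
  - by rewrite mulmxBl !mulmxDr pr_id uS uS' uu addr0 addrK.
have FM' : F M' != 0.
  have -> : F M' = F (pact (fun x => pr k (S x) + u x) (fun x => pr k (S x) - u x) M).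
    apply: Fw.1 => i j jm; rewrite hM /pact; have [e1 e2] := rM i j jm.
    have -> : (pr k (S (armv i j)) + u (armv i j)) *m M i j = (1%:M + u (armv i j)) *m M i j.
      by rewrite !mulmxDl mul1mx e1.
    by rewrite !mulmxBr mulmx1 -[_ *m M i j *m pr k _]mulmxA e2.
  rewrite Fw.2 // mulf_neq0 //; apply/prodf_neq0 => x _; rewrite expfz_neq0 // -unitfE -unitmxE.
  exact: (gauge_unit x g1).
pose Q := compl S T.
have TQ x : T x :&: Q x = set0 by rewrite /Q /compl setDE setIA [T x :&: S x]setIC -setIA setICr setI0.
have SE x : S x = T x :|: Q x by lia|| (apply/setP => y; rewrite !inE; case: (y \in T x) (subsetP (TS x).1 y) => //= ->).
pose X i j := pr k (Q (armv i j)) *m M' i j *m pr k (T (armv i j.+1)).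
(* The conjugate by the dilation: the block from the quotient to the submodule is scaled by [t], so
   this makes sense at [t = 0] too. *)
pose N (t : k) : prep := fun i j => cut T M' i j + cut Q M' i j + t *: X i j.
have [P HP] : exists P : {poly k}, forall t, F (N t) = P.[t].
  apply: (@alg_curve _ (coords C E) (fun c => (cut T M' (tag c.1) (tagged c.1) c.2.1 c.2.2 + cut Q M' (tag c.1) (tagged c.1) c.2.1 c.2.2)%:P
      + X (tag c.1) (tagged c.1) c.2.1 c.2.2 *: 'X)).
  have := alg_sub (h := N) (P' := fun _ => True) (fun _ _ => I) Falg.
  move=> [t [s s1 Hs]]; exists t; exists s => // x _; rewrite Hs //; apply: eq_bigr => ce _; congr (_ * _).
  by rewrite /monof; apply: eq_bigr => c _; rewrite /cz !mxE !hornerE mulrC.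
have dQ x : #|Q x| = (#|S x| - \rank (U x))%N.
  by rewrite cardsD (setIidPr (TS x).1) (TS x).2.
have -> : weight_sum (fun x => (#|S x| - \rank (U x))%N) = weight_sum (fun x => #|Q x|).
  by apply: eq_bigr => x _; rewrite dQ.
apply: (pole_free hk FM' (P := P)) => t t0; rewrite -HP.
have -> : F (N t) = F (pact (fun x => dilation (T x) (Q x) t) (fun x => dilation (T x) (Q x) t^-1) M').
  apply: Fw.1 => i j jm; rewrite /N /pact /dilation /cut /X; have tr := tM' i j jm.
  have zz : pr k (T (armv i j)) *m M' i j *m pr k (Q (armv i j.+1)) = 0.
    by rewrite -tr -mulmxA pr_pr TQ pr0 mulmx0.
  rewrite !mulmxDl !mulmxDr -!scalemxAl -!scalemxAr zz scaler0 addr0 scalerA ?mulfV // scale1r.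
  by rewrite -addrA; congr (_ + _); rewrite addrC.
rewrite Fw.2 //; last exact: chart_rels ch eM.
  congr (_ * _); rewrite -prod_expz ?invr_eq0 //; apply: eq_bigr => x _; congr (_ ^ _).
  by rewrite SE det_dilation.
exact: dilation_gauge.
Qed.

(** Scalar matrices fix every module, so the corresponding power of t is constant; both signs follow
    from [pole_free]. *)
Lemma king_degree M : isrep S M -> rels M -> F M != 0 -> weight_sum (fun x => #|S x|) = 0.
Proof.
move=> rM eM FM.
have TQ x : set0 :&: S x = set0 by rewrite set0I.
have SE x : S x = set0 :|: S x by rewrite set0U.
have H t : t != 0 -> F M = (t^-1) ^ (weight_sum (fun x => #|S x|)) * F M.
  move=> t0; rewrite -prod_expz ?invr_eq0 //.
  have -> : \prod_x (t^-1 ^+ #|S x|) ^ sigma x = \prod_x \det (dilation set0 (S x) t^-1 + pr k (~: S x)) ^ sigma x.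
    by apply: eq_bigr => x _; rewrite {3}(SE x) det_dilation.
  rewrite -(Fw.2 _ _ M (dilation_gauge (T := fun=> set0) TQ SE t0) rM eM).
  apply: Fw.1 => i j jm; rewrite /pact /dilation pr0 !add0r -scalemxAr -!scalemxAl scalerA mulVf // scale1r.
  by have [-> ->] := rM i j jm.
apply/eqP; rewrite eq_le; apply/andP; split.
  by apply: (pole_free hk FM (P := (F M)%:P)) => t t0; rewrite hornerC; apply: H.
rewrite -oppr_le0; apply: (pole_free hk FM (P := (F M)%:P)) => t t0; rewrite hornerC.
by lia|| (have := H t^-1; rewrite invr_eq0 => /(_ t0) {1}->; rewrite -exprz_inv).
Qed.

Lemma king_sub M U : isrep S M -> rels M -> subrep S M U -> F M != 0 ->
  0 <= weight_sum (fun x => \rank (U x)).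
Proof.
move=> rM eM sU FM; have := king_ineq rM eM sU FM; have := king_degree rM eM FM.
have -> : weight_sum (fun x => (#|S x| - \rank (U x))%N) = weight_sum (fun x => #|S x|) - weight_sum (fun x => \rank (U x)).
  rewrite -sumrB; apply: eq_bigr => x _; rewrite -mulrBr subzn // -(rank_pr k (S x)).
  by apply: mxrankS; have [h _] := sU.
by lia.
Qed.

Lemma king_coquotient M c : isrep S M -> rels M -> F M != 0 -> coquotient S M c ->
  0 <= \sum_x (if c x != 0 then - sigma x else 0).
Proof.
move=> rM eM FM [cS cM].
pose U x := (pr k (S x) :&: kermx (c x))%MS.
have sU : subrep S M U.
  split=> [x|i j jm]; first exact: capmxSl.
  rewrite /U sub_capmx; apply/andP; split.
    by have [_ <-] := rM i j jm; rewrite mulmxA submxMl.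
  have [s e] := cM i j jm; apply/sub_kermxP; rewrite -mulmxA e -scalemxAr.
  have /sub_kermxP -> : (U (armv i j) <= kermx (c (armv i j)))%MS by apply: capmxSr.
  by rewrite scaler0.
have := king_ineq rM eM sU FM.
have -> : weight_sum (fun x => (#|S x| - \rank (U x))%N) = \sum_x (if c x != 0 then sigma x else 0).
  apply: eq_bigr => x _; have := mxrank_mul_ker (pr k (S x)) (c x); rewrite cS rank_pr -/(U x) => <-.
  rewrite addnK; case: eqP => [->|/eqP cn] /=; first by rewrite mxrank0 mulr0.
  have -> : \rank (c x) = 1%N by apply/eqP; rewrite eqn_leq rank_leq_col lt0n mxrank_eq0.
  by lia.
rewrite -oppr_ge0 -sumrN; congr (0 <= _); apply: eq_bigr => x _; case: ifP => _; by [].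
Qed.

End KingInequality.

Lemma row_kernel (k : fieldType) r c (K : 'M[k]_(r, c)) (P : 'M_r) : P *m P = P -> P *m K = K ->
  (\rank K < \rank P)%N -> exists w : 'rV_r, [/\ w != 0, w *m P = w & w *m K = 0].
Proof.
move=> PP PK lt; have [||| psi [n0 e1 e2]] := @col_kernel k _ _ K^T P^T.
- by rewrite -trmx_mul PP.
- by rewrite -trmx_mul PK.
- by rewrite !mxrank_tr.
exists psi^T; split; first by rewrite trmx_eq0.
  by rewrite -{2}e1 trmx_mul trmxK.
by apply: trmx_inj; rewrite trmx_mul trmxK trmx0.
Qed.

(** * The dual representation *)

Section Duality.

Context (k : closedFieldType) (C : canonicalData k) (E : nat).

Local Notation n := (narms C).
Local Notation m := (@arity k C).
Local Notation mx := 'M[k]_E.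
Local Notation cv := 'cV[k]_E.
Local Notation sets := (vertex C -> {set 'I_E}).
Local Notation prep := (prep C E).

Definition rev_vertex (x : vertex C) : vertex C :=
  match x with
  | inl false => voo C | inl true => v0 C
  | inr p => armv (tag p) (m (tag p) - (tagged p).+1)
  end.

Lemma rev_arm l t : (t <= m l)%N -> rev_vertex (armv l t) = armv l (m l - t).
Proof.
move=> tm; case: t tm => [|t] tm; first by rewrite subn0 armv_end.
rewrite {1}/armv; case: insubP => [u ua <-|] //.
by move=> na; have -> : (m l - t.+1 = 0)%N by lia.
Qed.

Lemma rev_vertexK x : rev_vertex (rev_vertex x) = x.
Proof.
elim/armv_ind: x => l a am; rewrite !rev_arm ?leq_subr // subKn //.
Qed.

(** Arms are reversed and matrices transposed, which exchanges row kernels with column kernels and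
    test quotients with submodules. *)
Definition opp_rep (M : prep) : prep := fun i j => (M i ((m i).-1 - j)%N)^T.

Context (S : sets) (M : prep).
Hypothesis rS : isrep S M.

Let S' x := S (rev_vertex x).
Let N := opp_rep M.

Lemma opp_isrep : isrep S' N.
Proof.
move=> i j jm; have am : ((m i).-1 - j < m i)%N by lia.
have := tr_supp (rS am); rewrite /N /opp_rep /S' !rev_arm ?(ltnW jm) //.
have -> : (((m i).-1 - j).+1 = m i - j)%N by lia.
by have -> : ((m i).-1 - j = m i - j.+1)%N by lia.
Qed.

Lemma opp_cp i a b : (a <= b)%N -> (b <= m i)%N -> cp (N i) a b = (cp (M i) (m i - b) (m i - a))^T.
Proof.
move=> ab bm; have := subnK ab; move: (b - a)%N => l; elim: l a {ab} => [|l IH] a.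
  by rewrite add0n => ->; rewrite !cp_id trmx1.
move=> H; have lt : (a < b)%N by lia.
rewrite cp_l // IH; last by lia.
have -> : (m i - a = (m i - a.+1).+1)%N by lia.
rewrite [in RHS]cp_r; last by lia.
by rewrite trmx_mul; congr ((M i _)^T *m _); lia.
Qed.

Lemma opp_amx i : amx N i = (amx M i)^T.
Proof. by rewrite /amx opp_cp // subnn subn0. Qed.

Lemma opp_rels : rels M -> rels N.
Proof. by move=> r i j l; rewrite !opp_amx -!linearZ -linearD r. Qed.

Lemma opp_col_killed : col_killed S' N -> row_killed S M.
Proof.
move=> [psi [pn pS pk]].
pose v : mx := \matrix_(i, j) psi j 0.
have vE : v = (const_mx 1 : 'cV_E) *m psi^T.
  by apply/matrixP => a b; rewrite !mxE big_ord1 !mxE mul1r.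
exists v; split.
- apply: contraNneq pn => h; apply/eqP/matrixP => a b; rewrite ord1.
  by have := congr1 (fun A : mx => A a a) h; rewrite !mxE.
- rewrite vE; apply: submx_trans (submxMl _ _) _; apply/sub_prP.
  have := congr1 trmx pS; by rewrite trmx_mul tr_pr.
- move=> l; rewrite vE -mulmxA; have := congr1 trmx (pk l).
  by rewrite trmx_mul opp_amx trmxK trmx0 => ->; rewrite mulmx0.
Qed.

Lemma opp_coquotient c : coquotient S' N c -> exists U, subrep S M U /\
  forall x, \rank (U x) = (c (rev_vertex x) != 0).
Proof.
move=> [cS cM].
pose U x : mx := (const_mx 1 : 'cV_E) *m (c (rev_vertex x))^T.
exists U; split; last first.
  move=> x; rewrite /U; have [->|cn] := eqVneq (c (rev_vertex x)) 0.
    by rewrite trmx0 mulmx0 mxrank0.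
  have E0 : (0 < E)%N by case: (E) (c _) cn => // w; rewrite [w]flatmx0 eqxx.
  rewrite mxrankMfree; last first.
    by rewrite /row_free mxrank_tr eqn_leq rank_leq_col lt0n mxrank_eq0.
  have nz : (const_mx 1 : 'cV[k]_E) != 0.
    apply/eqP => /matrixP /(_ (Ordinal E0) 0); rewrite !mxE => /eqP; by rewrite oner_eq0.
  by apply/eqP; rewrite eqn_leq rank_leq_col lt0n mxrank_eq0.
split=> [x|i j jm].
  apply: submx_trans (submxMl _ _) _; apply/sub_prP.
  have := congr1 trmx (cS (rev_vertex x)); by rewrite trmx_mul tr_pr /S' rev_vertexK.
rewrite /U !rev_arm ?(ltnW jm) // -mulmxA.
have am : ((m i).-1 - j < m i)%N by lia.
have [s] := cM i _ am; rewrite /N /opp_rep.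
have -> : ((m i).-1 - ((m i).-1 - j) = j)%N by lia.
have -> : (((m i).-1 - j).+1 = m i - j)%N by lia.
have -> : ((m i).-1 - j = m i - j.+1)%N by lia.
move=> /(congr1 trmx); rewrite trmx_mul trmxK linearZ /= => ->.
by rewrite -scalemxAr scalemx_sub.
Qed.

Context (qc : 'I_n -> nat -> nat).
Hypothesis dS : forall l t, (t <= m l)%N -> (#|S (armv l t)| + qc l 0 = #|S (v0 C)| + qc l t)%N.
Hypothesis qcm : forall l t, qc l (t + m l)%N = qc l t.
Hypothesis dg : forall i (a b : nat), consecutive (qc i) (m i) a b -> degen S (oth i) i M (a, b).

Let dSS l t t' : (t <= m l)%N -> (t' <= m l)%N -> (#|S (armv l t)| + qc l t' = #|S (armv l t')| + qc l t)%N.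
Proof. by move=> /(dS (l := l)) h1 /(dS (l := l)) h2; lia. Qed.

Let dvoo : #|S (voo C)| = #|S (v0 C)|.
Proof. exact: (regular_voo (d := fun x => #|S x|) dS (fun l => qcm l 0%N)). Qed.

Definition qrev (i : 'I_n) (t : nat) : nat := qc i (m i - t %% m i).

Lemma qrev_per i t : qrev i (t + m i) = qrev i t.
Proof. by rewrite /qrev modnDr. Qed.

Lemma qrevE i t : (t <= 2 * m i)%N -> qrev i t = qc i (2 * m i - t).
Proof.
move=> tm; have m0 := arity_gt0 i; rewrite /qrev.
have [lt|ge] := ltnP t (m i).
  by rewrite modn_small // -qcm; congr qc; lia.
have [lt2|ge2] := ltnP t (2 * m i).
  rewrite -{1}(subnK ge) modnDr modn_small; last by lia.
  by congr qc; lia.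
have -> : t = (2 * m i)%N by lia.
by rewrite modnMl subn0 subnn -[X in qc i X]add0n.
Qed.

Lemma qrev_le i t : (t <= m i)%N -> qrev i t = qc i (m i - t).
Proof. by move=> tm; rewrite qrevE; [rewrite -[RHS]qcm; congr qc|]; lia. Qed.

Lemma opp_dim l t : (t <= m l)%N -> (#|S' (armv l t)| + qrev l 0 = #|S' (v0 C)| + qrev l t)%N.
Proof.
move=> tm; rewrite !qrev_le // /S' rev_arm // subn0 dvoo.
have -> : qc l (m l) = qc l 0 by rewrite -[m l]add0n.
exact: dS (leq_subr _ _).
Qed.

Lemma consecutive_rev i (a b : nat) : consecutive (qrev i) (m i) a b ->
  exists a0 b0 : nat, [/\ consecutive (qc i) (m i) a0 b0,
   (b <= m i)%N -> a0 = (m i - b)%N /\ b0 = (m i - a)%N &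
   (m i < b)%N -> a0 = (2 * m i - b)%N /\ b0 = (2 * m i - a)%N].
Proof.
move=> [h1 h2 h3 h4 h5]; have b2 : (b <= 2 * m i)%N by lia.
have main : [/\ (2 * m i - b < 2 * m i - a)%N, (2 * m i - a <= (2 * m i - b) + m i)%N,
   qc i (2 * m i - b) = qc i (2 * m i - a) & forall t : nat, (2 * m i - b < t)%N -> (t < 2 * m i - a)%N -> (qc i (2 * m i - a) < qc i t)%N].
  split; [by lia|by lia|by rewrite -!qrevE; lia|].
  move=> t t1 t2; have := h5 (2 * m i - t)%N ltac:(lia) ltac:(lia); rewrite -h4 !qrevE; [|lia|lia].
  by have -> : (2 * m i - (2 * m i - t) = t)%N by lia.
have [bm|mb] := leqP b (m i); last first.
  exists (2 * m i - b)%N, (2 * m i - a)%N; split=> //.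
  by have [g1 g2 g3 g4] := main; split=> //; lia.
exists (m i - b)%N, (m i - a)%N; split=> //.
have sh (t : nat) : (t <= m i)%N -> qc i (m i - t) = qc i (2 * m i - t).
  by move=> tm; rewrite -qcm; congr qc; lia.
have [g1 g2 g3 g4] := main; split; [by lia|by lia|by lia|by rewrite !sh; lia|].
by move=> t t1 t2; rewrite sh; [rewrite -(qcm i t); apply: g4|]; lia.
Qed.

(** The matrices involved are square on their supports, since the levels at the two ends agree; a
    killed column hence gives a killed row, which is a killed column of the dual. *)
Lemma opp_degen i (a b : nat) : consecutive (qrev i) (m i) a b -> degen S' (oth i) i N (a, b).
Proof.
move=> con; have [h1 h2 h3 h4 h5] := con; have [a0 [b0 [con0 nowrap wrap]]] := consecutive_rev con.
have [g1 g2 g3 g4 g5] := con0; rewrite /degen /=.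
have := dg con0; rewrite /degen /=.
case: (leqP b (m i)) => bm.
  have [ea eb] := nowrap bm.
  have b0m : (b0 <= m i)%N by lia.
  rewrite b0m => -[psi [pn pS pk]]; have [s1 s2] := isrep_cp rS g2 b0m; rewrite s1 in pk.
  have [||| w [wn wP wK]] := @row_kernel k _ _ (cp (M i) a0 b0) (pr k (S (armv i a0))).
  - exact: pr_id.
  - exact: s1.
  - rewrite rank_pr ltnNge; apply/negP => le.
    have eqd : #|S (armv i a0)| = #|S (armv i b0)| by have := dSS (ltnW g1) b0m; lia.
    have inj : injon (S (armv i a0)) (cp (M i) a0 b0).
      apply: rank_injon; rewrite s1; apply/eqP; rewrite eqn_leq le andbT -s1 -[X in (_ <= X)%N](rank_pr k).
      exact: mxrankM_maxl.
    have /submxP [L e] := injon_onto (conj s1 s2) eqd inj.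
    by case/eqP: pn; rewrite -pS e -mulmxA pk mulmx0.
  exists w^T; rewrite /S' rev_arm // -ea; split; first by rewrite trmx_eq0.
    by rewrite -{2}wP trmx_mul tr_pr.
  rewrite opp_cp ?(ltnW h2) // -ea -eb -mulmxA -trmx_mul wK trmx0 mulmx0 //.
have [ea eb] := wrap bm; have ma : (a < m i)%N := h1.
have b0m : (m i < b0)%N by lia.
rewrite leqNgt b0m (leqNgt (m i)) g1 (leqNgt (m i)) ma /=.
have bb : (b0 - m i = m i - a)%N by lia.
have bb' : (b - m i = m i - a0)%N by lia.
rewrite bb bb' => -[phi [psi [pn pS qS e1 e2]]].
have am' : (0 < m i - a)%N by lia.
have [w1 w2] := isrep_cp rS g1 (leqnn (m i)); rewrite armv_end in w2.
have [u1 u2] := isrep_cp rS am' (leq_subr a (m i)); have [a1 a2] := isrep_amx (oth i) rS.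
pose K := block_mx (amx M (oth i)) (- cp (M i) 0 (m i - a)) (cp (M i) a0 (m i)) 0.
pose Q := block_mx (pr k (S (voo C))) 0 0 (pr k (S (armv i (m i - a)))).
pose P := block_mx (pr k (S (v0 C))) 0 0 (pr k (S (armv i a0))).
have PP : P *m P = P by rewrite mulmx_block !(mulmx0, mul0mx, addr0, add0r) !pr_id.
have PK : P *m K = K by rewrite mulmx_block !(mulmx0, mul0mx, addr0, add0r) mulmxN a1 u1 w1.
have KQ : K *m Q = K by rewrite mulmx_block !(mulmx0, mul0mx, addr0, add0r) mulNmx a2 u2 w2.
have rPQ : \rank P = \rank Q.
  rewrite !rank_diag_block_mx !rank_pr dvoo; congr addn.
  have eq0 : qc i a0 = qc i (m i - a) by rewrite g4 -[RHS]qcm; congr qc; lia.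
  have := dSS (ltnW g1) (leq_subr a (m i)); rewrite eq0.
  by lia.
have Kpsi : K *m col_mx phi psi = 0.
  rewrite w1 in e2; rewrite mul_block_col e1 e2 mulNmx subrr mul0mx addr0 -col_mx0 //.
have Qpsi : Q *m col_mx phi psi = col_mx phi psi.
  by rewrite mul_block_col !mul0mx addr0 add0r pS qS.
have psin : col_mx phi psi != 0.
  by apply: contraTneq pn => h; have /eq_col_mx [-> ->] := etrans h (esym (@col_mx0 _ _ _ _)); rewrite eqxx.
have [||| w [wn wP wK]] := @row_kernel k _ _ K P => //.
  rewrite ltnNge; apply/negP => le; case/eqP: psin.
  have QK : (Q <= K)%MS.
    have KQs : (K <= Q)%MS by rewrite -KQ submxMl.
    have := mxrank_leqif_sup KQs => -[_ <-]; rewrite eqn_leq -rPQ le andbT -PK; exact: mxrankM_maxl.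
  have /submxP [L e] := QK; by rewrite -Qpsi e -mulmxA Kpsi mulmx0.
have wE : w = row_mx (lsubmx w) (rsubmx w) by rewrite hsubmxK.
move: wP wK; rewrite wE !mul_row_block !(mulmx0, mul0mx, addr0, add0r).
move=> /eq_row_mx [p1 p2]; rewrite -[RHS]row_mx0 => /eq_row_mx [k1 k2].
exists (lsubmx w)^T, (- (rsubmx w)^T); split.
- apply: contraNT wn; rewrite negb_or !negbK oppr_eq0 !trmx_eq0 => /andP [/eqP h /eqP h'].
  by rewrite wE h h' row_mx0.
- by rewrite -{2}p1 trmx_mul tr_pr.
- rewrite /S' rev_arm ?leq_subr // subKn ?(ltnW g1) // mulmxN; congr (- _).
  by rewrite -{2}p2 trmx_mul tr_pr.
- rewrite opp_amx opp_cp ?leq_subr // subn0 subKn ?(ltnW g1) // mulmxN -!trmx_mul -linearN; congr (_^T).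
  by apply/eqP; rewrite -addr_eq0 k1.
- rewrite opp_cp ?(ltnW h1) // subnn -mulmxA -trmx_mul.
  have -> : lsubmx w *m cp (M i) 0 (m i - a) = 0 by apply/eqP; rewrite -oppr_eq0 -mulmxN k2.
  by rewrite trmx0 mulmx0.
Qed.

End Duality.

(** * Vanishing of the weight *)

Section KingTheorem.

Context (k : closedFieldType) (hk : [pchar k] =i pred0) (C : canonicalData k) (E : nat).

Local Notation n := (narms C).
Local Notation m := (@arity k C).
Local Notation mx := 'M[k]_E.
Local Notation sets := (vertex C -> {set 'I_E}).
Local Notation prep := (prep C E).

Lemma sum_rev (V : nmodType) (f : vertex C -> V) : \sum_x f (rev_vertex x) = \sum_x f x.
Proof.
rewrite [RHS](reindex (@rev_vertex k C)) //; exists (@rev_vertex k C) => x _; exact: rev_vertexK.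
Qed.

(** One of the two kernels is missing, so [king_flat] applies to the module or to its dual. The
    weight is then concentrated at the two ends, with sum zero, and two submodules force both values
    to be non-negative. *)
Lemma king_weight (S : sets) (M : prep) (sigma : vertex C -> int) (F : prep -> k) (p : nat)
    (qc : 'I_n -> nat -> nat) :
  in_alg_gen (fun _ => True) (fun (c : coords C E) M => cz c M) F -> weighted S sigma F ->
  isrep S M -> rels M -> (0 < p)%N -> (#|S (v0 C)| = p + \sum_l qc l 0)%N ->
  (forall l t, (t <= m l)%N -> (#|S (armv l t)| + qc l 0 = #|S (v0 C)| + qc l t)%N) ->
  (forall l t, qc l (t + m l)%N = qc l t) -> (forall l, exists2 b : nat, (b < m l)%N & qc l b = 0%N) ->
  (forall i (a b : nat), consecutive (qc i) (m i) a b -> degen S (oth i) i M (a, b)) ->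
  maxdef S M 1 -> ~ (row_killed S M /\ col_killed S M) -> F M != 0 -> forall x, sigma x = 0.
Proof.
move=> Falg Fw rS rM p0 eE dS qcm qz dg mM nk FM.
have dvoo : #|S (voo C)| = #|S (v0 C)| := regular_voo (d := fun x => #|S x|) dS (fun l => qcm l 0%N).
have deg := king_degree hk Fw rS rM FM.
have [flat fsum] : (forall i a, (a.+1 < m i)%N -> sigma (armv i a.+1) = 0) /\ sigma (v0 C) + sigma (voo C) = 0.
  have [nc|] := classic (~ col_killed S M).
    have [] := @king_flat k C E S M (fun x => - sigma x) qc rS rM dS qcm nc dg _ p p0 eE qz.
    - by move=> c cc; apply: (king_coquotient hk Falg Fw rS rM FM cc).
    - transitivity (- weight_sum sigma (fun x => #|S x|)); last by lia.
      by rewrite -sumrN; apply: eq_bigr => x _; rewrite mulNr.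
    - move=> h1 h2; split; first by move=> i a am; apply/eqP; rewrite -oppr_eq0 h1.
      by lia.
  move=> /NNPP ck; have nr : ~ row_killed S M by move=> rk; apply: nk.
  have nc : ~ col_killed (fun x => S (rev_vertex x)) (opp_rep M) by move=> h; apply: nr; apply: opp_col_killed h.
  have q0 l : qrev qc l 0 = qc l 0%N by rewrite (qrev_le dS qcm) // subn0 -[m l]add0n.
  have [] := @king_flat k C E (fun x => S (rev_vertex x)) (opp_rep M) (fun x => sigma (rev_vertex x)) (qrev qc)
     (opp_isrep rS) (opp_rels rM) (opp_dim dS qcm) (qrev_per qc) nc (opp_degen rS dS qcm dg) _ p p0.
  - move=> c /opp_coquotient [U [sU rU]]; have := king_sub hk Falg Fw rS rM sU FM.
    congr (0 <= _); rewrite /weight_sum -sum_rev; apply: eq_bigr => x _; rewrite rU rev_vertexK.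
    by case: eqP; rewrite ?mulr0 ?mulr1.
  - by rewrite dvoo eE; congr addn; apply: eq_bigr => l _.
  - move=> l; have [b bm qb] := qz l; have [e0|b0] := posnP b.
      by exists 0%N; [exact: arity_gt0|rewrite -[RHS]qb e0].
    by exists (m l - b)%N; rewrite ?(qrev_le dS qcm) ?subKn; lia.
  - by rewrite (sum_rev (fun x => sigma x * #|S x|%:Z)).
  move=> h1 h2; split; last by rewrite addrC.
  move=> i a am; have := h1 i (m i - a.+2)%N ltac:(lia); rewrite rev_arm; last by lia.
  by have -> : (m i - (m i - a.+2).+1 = a.+1)%N by lia.
have e0 : (0 < #|S (voo C)|)%N by lia.
have sum2 (f : vertex C -> nat) : weight_sum sigma f = sigma (v0 C) * (f (v0 C))%:Z + sigma (voo C) * (f (voo C))%:Z.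
  rewrite /weight_sum sum_vertex [X in _ + X]big1 ?addr0 // => l _; apply: big1 => a _.
  by rewrite flat; have := ltn_ord a; lia.
have soo : 0 <= sigma (voo C).
  (* Rows are mapped from 0 towards infinity, so the full space at infinity is a submodule. *)
  pose U x : mx := if x == voo C then pr k (S (voo C)) else 0.
  have sU : subrep S M U.
    split=> [x|i j jm]; rewrite /U; first by case: eqP => [->|_]; rewrite ?sub0mx.
    have -> : (armv i j == voo C) = false.
      case: j jm => [|j] jm //; rewrite /armv insubT //; by lia.
    by rewrite mul0mx sub0mx.
  have := king_sub hk Falg Fw rS rM sU FM; rewrite sum2 mxrank0 mulr0 add0r rank_pr.
  by lia.
have s0 : 0 <= sigma (v0 C).
  (* For the submodule of defect one the dimensions at the ends differ by one; as the two weights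
     cancel, the inequality reduces to the sign of [sigma (v0 C)]. *)
  have [U dU] := dropping_exists rS rM mM; have [sU rU _ _] := dU.
  have := king_sub hk Falg Fw rS rM sU FM; rewrite sum2 rU PoszD.
  move: fsum; nia.
have z0 : sigma (v0 C) = 0 by lia.
have zoo : sigma (voo C) = 0 by lia.
elim/armv_ind => l a am; case: a am => [|a] am; first exact: z0.
have [lt|ge] := ltnP a.+1 (m l); first exact: flat.
by have -> : a.+1 = m l by [lia]; rewrite armv_end.
Qed.

End KingTheorem.

(** * The equations of the zero set *)

Section Padding.

Context (k : closedFieldType) (E : nat).

Definition seg (a : nat) : {set 'I_E} := [set i : 'I_E | (i < a)%N].

Definition padc (a : nat) : 'M[k]_(a, E) := \matrix_(i, j) (i == j :> nat)%:R.

Lemma padcK a : (a <= E)%N -> padc a *m (padc a)^T = 1%:M.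
Proof.
move=> aE; apply/matrixP => i j; rewrite !mxE (bigD1 (widen_ord aE i)) // !mxE /= eqxx mul1r big1 ?addr0.
  by rewrite eq_sym.
by move=> l; rewrite -val_eqE => /negPf li; rewrite !mxE eq_sym li mul0r.
Qed.

Lemma padcT a : (padc a)^T *m padc a = pr k (seg a).
Proof.
apply/matrixP => i j; rewrite prE !mxE inE.
have [lt|ge] := ltnP i a; last first.
  rewrite andbF big1 // => l _; rewrite !mxE; case: eqP => [e|]; last by rewrite mul0r.
  by have := ltn_ord l; rewrite e ltnNge ge.
rewrite andbT (bigD1 (Ordinal lt)) //= !mxE eqxx mul1r big1 ?addr0 //.
by move=> l; rewrite -val_eqE => /negPf li; rewrite !mxE li mul0r.
Qed.

Lemma card_seg a : (a <= E)%N -> #|seg a| = a.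
Proof.
move=> aE; have := padcT a => /(congr1 mxrank); rewrite rank_pr => <-.
have f : row_free (padc a).
  rewrite -row_leq_rank; have := mxrankM_maxl (padc a) (padc a)^T.
  by rewrite padcK // mxrank1.
by rewrite mxrankMfree // mxrank_tr; apply/eqP.
Qed.

Definition pad a b (A : 'M[k]_(a, b)) : 'M[k]_E := (padc a)^T *m A *m padc b.
Definition up a b (X : 'M[k]_E) : 'M[k]_(a, b) := padc a *m X *m (padc b)^T.

Lemma up_pad a b (A : 'M_(a, b)) : (a <= E)%N -> (b <= E)%N -> up a b (pad A) = A.
Proof. by move=> aE bE; rewrite /up !mulmxA padcK // mul1mx -mulmxA padcK // mulmx1. Qed.

Lemma pad_up a b (X : 'M_E) : supp (seg a) (seg b) X -> pad (up a b X) = X.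
Proof. by move=> [e1 e2]; rewrite /pad !mulmxA padcT e1 -mulmxA padcT. Qed.

Lemma pad_supp a b (A : 'M_(a, b)) : (a <= E)%N -> (b <= E)%N -> supp (seg a) (seg b) (pad A).
Proof.
move=> aE bE; split; rewrite -padcT /pad.
  by rewrite !mulmxA -[_ *m padc a *m _]mulmxA padcK // mulmx1.
by rewrite -!mulmxA [padc b *m (_ *m _)]mulmxA padcK // mul1mx.
Qed.

Lemma pad_mul a b c (A : 'M_(a, b)) (B : 'M_(b, c)) : (b <= E)%N -> pad A *m pad B = pad (A *m B).
Proof. by move=> bE; rewrite /pad -!mulmxA [padc b *m (_ *m _)]mulmxA padcK // mul1mx. Qed.

Lemma up_mul a b c (X Y : 'M_E) : X *m pr k (seg b) = X -> up a c (X *m Y) = up a b X *m up b c Y.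
Proof. by move=> e; rewrite /up -[in LHS]e -padcT !mulmxA. Qed.

Lemma pad1 a : pad (1%:M : 'M_a) = pr k (seg a).
Proof. by rewrite /pad mulmx1 padcT. Qed.

Lemma up1 a : (a <= E)%N -> up a a (pr k (seg a)) = 1%:M.
Proof. by move=> aE; rewrite -pad1 up_pad. Qed.

Lemma pad_castmx a b b' (e : b = b') (A : 'M_(a, b)) : pad (castmx (erefl, e) A) = pad A.
Proof. by case: b' / e. Qed.

Lemma pad_linear a b c (A B : 'M_(a, b)) : pad (A + c *: B) = pad A + c *: pad B.
Proof. by rewrite /pad mulmxDr mulmxDl -scalemxAr -scalemxAl. Qed.

Lemma pad_inj a b (A B : 'M_(a, b)) : (a <= E)%N -> (b <= E)%N -> pad A = pad B -> A = B.
Proof. by move=> aE bE h; rewrite -(up_pad A aE bE) h up_pad. Qed.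

Lemma det_sylvester r s (A : 'M[k]_(r, s)) (B : 'M_(s, r)) : \det (1%:M + A *m B) = \det (1%:M + B *m A).
Proof.
have h1 : block_mx 1%:M (- A) B 1%:M *m block_mx 1%:M A 0 1%:M = block_mx 1%:M 0 B (1%:M + B *m A).
  by rewrite mulmx_block !(mulmx0, mul0mx, mulmx1, mul1mx, addr0, add0r) subrr addrC.
have h2 : block_mx 1%:M A 0 1%:M *m block_mx 1%:M (- A) B 1%:M = block_mx (1%:M + A *m B) 0 B 1%:M.
  by rewrite mulmx_block !(mulmx0, mul0mx, mulmx1, mul1mx, addr0, add0r) addNr.
have := congr1 determinant h1; have := congr1 determinant h2.
by rewrite !det_mulmx !det_lblock !det_ublock !det1 !(mul1r, mulr1) => <- <-.
Qed.

Lemma det_up a (X : 'M_E) : (a <= E)%N -> supp (seg a) (seg a) X ->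
  \det (X + pr k (~: seg a)) = \det (up a a X).
Proof.
move=> aE sX; have -> : X + pr k (~: seg a) = 1%:M + (padc a)^T *m ((up a a X - 1%:M) *m padc a).
  by rewrite mulmxBl mul1mx mulmxBr padcT mulmxA -/(pad _) pad_up // -(pr_split k (seg a)) [RHS]addrC addrA subrK.
by rewrite det_sylvester -mulmxA padcK // mulmx1 addrC subrK.
Qed.

End Padding.

(** * Representations as padded modules *)

Section Embedding.

Context (k : closedFieldType) (C : canonicalData k) (d : dimvec C).

Local Notation n := (narms C).
Local Notation m := (@arity k C).

Definition esize : nat := \sum_x d x.

Local Notation E := esize.

Lemma dim_le x : (d x <= E)%N.
Proof. by rewrite /esize (bigD1 x) // leq_addr. Qed.

Definition seg_of (x : vertex C) : {set 'I_E} := seg E (d x).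

Lemma card_seg_of x : #|seg_of x| = d x.
Proof. exact: (card_seg k (dim_le x)). Qed.

Definition emb (M : rep k d) : prep C E := fun i j =>
  if @idP (j < m i)%N is ReflectT h then pad E (M (arm_arrow h)) else 0.

Definition uprep (N : prep C E) : rep k d :=
  fun a => up (d (tgt a)) (d (src a)) (N (tag a) (tagged a)).

Lemma embE M i j (h : (j < m i)%N) : emb M i j = pad E (M (arm_arrow h)).
Proof. by rewrite /emb; case: {-}_ / idP => [h'|//]; rewrite (bool_irrelevance h' h). Qed.

Lemma emb_arrow M (a : arrow C) : emb M (tag a) (tagged a) = pad E (M a).
Proof. by case: a => i [j h]; rewrite (embE M h). Qed.

Lemma emb_isrep M : isrep seg_of (emb M).
Proof.
move=> i j h; rewrite (embE M h); apply: pad_supp; exact: dim_le.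
Qed.

Lemma uprep_emb M : uprep (emb M) = M.
Proof.
apply: functional_extensionality_dep => a; rewrite /uprep emb_arrow up_pad //; exact: dim_le.
Qed.

Lemma emb_uprep N i j : isrep seg_of N -> (j < m i)%N -> emb (uprep N) i j = N i j.
Proof. by move=> rN h; rewrite (embE _ h) pad_up //; apply: rN. Qed.

Lemma emb_path M i j (h : (j <= m i)%N) : (0 < j)%N -> cp (emb M i) 0 j = pad E (path_mx M h).
Proof.
case: j h => // j h _; elim: j h => [|j IH] h.
  by rewrite cp1 (embE M h) /= mul1mx.
rewrite cp_r // (IH (ltnW h)) (embE M h) pad_mul //; exact: dim_le.
Qed.

Lemma emb_amx M i : amx (emb M) i = pad E (arm_mx M i).
Proof. by rewrite /amx (emb_path M (leqnn _) (arity_gt0 i)) pad_castmx. Qed.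

Lemma slope_rest (i : 'I_(n - 2)) : slope (arm_rest i) = (1, coeff i).
Proof. by rewrite /slope /= valK || (rewrite /=). Qed.

Lemma arm_cases (l : 'I_n) : [\/ l = arm_fst C, l = arm_snd C | exists i, l = arm_rest i].
Proof.
case: l => -[|[|l]] h; [apply: Or31|apply: Or32|apply: Or33].
- exact: val_inj.
- exact: val_inj.
have h' : (l < n - 2)%N by lia.
exists (Ordinal h'); exact: val_inj.
Qed.

Lemma rels_slope (M : prep C E) : (forall l, amx M l = (slope l).1 *: amx M (arm_fst C) + (slope l).2 *: amx M (arm_snd C)) ->
  rels M.
Proof.
move=> H i j l; rewrite (H i) (H j) (H l) /plu !scalerDr !scalerA.
rewrite addrACA -!scalerDl; congr (_ *: _ + _ *: _); ring.
Qed.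

Lemma module_rels M : is_module M <-> rels (emb M).
Proof.
split=> [mM|r i].
  apply: rels_slope => l; have [->|->|[i ->]] := arm_cases l.
  - by rewrite scale1r scale0r addr0.
  - by rewrite scale1r scale0r add0r.
  rewrite slope_rest /= scale1r !emb_amx -pad_linear; congr (pad E _).
  by apply/eqP; rewrite eq_sym -subr_eq0; apply/eqP.
apply/eqP; rewrite subr_eq0; apply/eqP; apply: (@pad_inj _ E); try exact: dim_le.
rewrite pad_linear -!emb_amx; have := r (arm_fst C) (arm_snd C) (arm_rest i).
have -> : plu (arm_fst C) (arm_snd C) = 1 by rewrite /plu /=; ring.
have -> : plu (arm_rest i) (arm_snd C) = 1 by rewrite /plu /=; ring.
have -> : plu (arm_fst C) (arm_rest i) = coeff i by rewrite /plu slope_rest /=; ring.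
by rewrite !scale1r => ->.
Qed.

Lemma rels_eq (M N : prep C E) : (forall i j, (j < m i)%N -> M i j = N i j) -> rels M -> rels N.
Proof.
move=> MN r i j l; have e a : amx N a = amx M a by apply: eq_cp => b hb; rewrite MN.
by rewrite !e.
Qed.

Lemma evalp_alg (X : Type) (P : X -> Prop) (I : finType) (z : I -> X -> k) (h : X -> rep k d) (f : polyfun d) :
  (forall c, in_alg_gen P z (fun x => entry (h x) c)) -> in_alg_gen P z (fun x => evalp f (h x)).
Proof.
move=> H; apply: (@alg_eq _ _ _ _ _ (fun x => \sum_(e <- msupp f) f@_e * \prod_j entry (h x) (enum_val j) ^+ e j)).
  by [].
apply: alg_sum_seq => e _; apply: algM; first exact: alg_const.
by apply: alg_prod_seq => j _; apply: algX.
Qed.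

Lemma mx_alg_up (X : Type) (P : X -> Prop) (I : finType) (z : I -> X -> k) a b (A : X -> 'M[k]_E) :
  mx_alg P z A -> mx_alg P z (fun x => up a b (A x)).
Proof. by move=> HA; apply: mx_algM; [apply: mx_algM|]; try exact: mx_alg_const. Qed.

Lemma mx_alg_pad (X : Type) (P : X -> Prop) (I : finType) (z : I -> X -> k) a b (A : X -> 'M[k]_(a, b)) :
  mx_alg P z A -> mx_alg P z (fun x => pad E (A x)).
Proof. by move=> HA; apply: mx_algM; [apply: mx_algM|]; try exact: mx_alg_const. Qed.

Lemma mx_alg_cz (P : prep C E -> Prop) (a : arrow C) :
  mx_alg P (fun (c : coords C E) M => cz c M) (fun M => M (tag a) (tagged a)).
Proof. by move=> i j; apply: (@alg_var _ (coords C E) _ P (fun c M => cz c M) (a, (i, j))). Qed.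

Lemma evalp_uprep_alg (f : polyfun d) :
  in_alg_gen (fun _ => True) (fun (c : coords C E) M => cz c M) (fun N => evalp f (uprep N)).
Proof.
apply: evalp_alg => -[a [i j]].
exact: alg_eq (mx_alg_up (@mx_alg_cz (fun _ => True) a) i j).
Qed.

Lemma emb_alg (P : rep k d -> Prop) i j :
  mx_alg P (fun (c : coord d) M => entry M c) (fun M => emb M i j).
Proof.
have [h|h] := boolP (j < m i)%N; last first.
  by apply: mx_alg_eq (mx_alg_const _ _ 0) => M _; rewrite /emb; case: {-}_ / idP => // h'; rewrite h' in h.
apply: mx_alg_eq (mx_alg_pad (A := fun M : rep k d => M (arm_arrow h)) _) => [M _|a b]; first by rewrite (embE M h).
exact: (@alg_var _ (coord d) _ P (fun c M => entry M c) (Tagged (fun a => ('I_(d (tgt a)) * 'I_(d (src a)))%type) (a, b))).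
Qed.

Lemma alg_evalp (F : rep k d -> k) : in_alg_gen (fun _ => True) (fun (c : coord d) M => entry M c) F ->
  exists f : polyfun d, forall M, evalp f M = F M.
Proof.
move=> [t [s _ Hs]].
exists (\sum_(ce <- s) ce.1 *: \prod_(c : coord d) 'X_(enum_rank c) ^+ ce.2 c) => M.
rewrite Hs // /evalp raddf_sum /=; apply: eq_bigr => ce _; rewrite mevalZ; congr (_ * _).
rewrite rmorph_prod; apply: eq_bigr => c _; rewrite rmorphXn /=.
by rewrite mevalXU enum_rankK.
Qed.

Lemma semi_invariant_weighted (sigma : {ffun vertex C -> int}) (f : polyfun d) : semi_invariant sigma f ->
  weighted seg_of sigma (fun N => evalp f (uprep N)).
Proof.
move=> sf; split.
  move=> M N MN; congr (evalp f _); apply: functional_extensionality_dep => a; rewrite /uprep MN //.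
move=> h hi M g rM eM.
pose gg x : 'M[k]_(d x) := up (d x) (d x) (hi x).
have hu x : up (d x) (d x) (h x) *m gg x = 1%:M.
  have [[_ h2] _ e _] := g x; by rewrite -up_mul // e up1 // dim_le.
have gu x : gg x \in unitmx by have [] := mulmx1_unit (hu x).
have inv x : invmx (gg x) = up (d x) (d x) (h x).
  by rewrite -[LHS]mul1mx -(hu x) -mulmxA mulmxV // mulmx1.
have mm : is_module (uprep M).
  apply/module_rels; apply: rels_eq eM => i j jm; by rewrite emb_uprep.
have := sf gg gu (uprep M) mm.
have -> : act (fun x => invmx (gg x)) (uprep M) = uprep (pact h hi M).
  apply: functional_extensionality_dep => a; rewrite /act /uprep /pact invmxK inv /gg.
  have [h1 [i1 i2] _ _] := g (src a); have [[t1 t2] _ _ _] := g (tgt a).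
  have [r1 r2] := rM (tag a) (tagged a) (ltn_ord _).
  by rewrite -!up_mul -?mulmxA ?r2.
move=> ->; congr (_ * _); apply: eq_bigr => x _; rewrite det_up ?dim_le //.
by have [] := g x.
Qed.

End Embedding.

Lemma det0_col (F : fieldType) r (A : 'M[F]_r) : \det A = 0 -> exists2 v : 'cV_r, v != 0 & A *m v = 0.
Proof.
rewrite -det_tr => /eqP /det0P [v v0 vA]; exists v^T; first by rewrite trmx_eq0.
by apply: trmx_inj; rewrite trmx_mul trmxK trmx0.
Qed.

Lemma col_det0 (F : fieldType) r (A : 'M[F]_r) (v : 'cV_r) : v != 0 -> A *m v = 0 -> \det A = 0.
Proof.
move=> v0 Av; apply/eqP; rewrite -det_tr; apply/det0P; exists v^T; first by rewrite trmx_eq0.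
by rewrite -trmx_mul Av trmx0.
Qed.

Lemma det_pencil_mul (F : fieldType) r (H A B K : 'M[F]_r) :
  \det (map_mx polyC (H *m A *m K) + 'X *: map_mx polyC (H *m B *m K))
  = (\det H * \det K) *: \det (map_mx polyC A + 'X *: map_mx polyC B).
Proof.
rewrite !map_mxM /=; set H' := map_mx polyC H; set K' := map_mx polyC K.
have -> : H' *m map_mx polyC A *m K' + 'X *: (H' *m map_mx polyC B *m K') = H' *m (map_mx polyC A + 'X *: map_mx polyC B) *m K'.
  by rewrite mulmxDr mulmxDl -scalemxAr -scalemxAl.
rewrite !det_mulmx !det_map_mx -mul_polyC; ring.
Qed.

(** * Determinantal semi-invariants *)

Section Equations.

Context (k : closedFieldType) (C : canonicalData k) (d : dimvec C).

Local Notation n := (narms C).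
Local Notation m := (@arity k C).
Local Notation E := (esize d).
Local Notation prep := (prep C E).
Local Notation e := (d (v0 C)).
Local Notation S := (@seg_of k C d).

Hypothesis doo : d (voo C) = d (v0 C).

(** The determinant detecting [degen]. When the interval passes through infinity, the block matrix
    expresses the linear system for the pair of columns at infinity and at the end of the
    interval. *)
Definition xdet (i : 'I_n) (ab : nat * nat) (M : prep) : k :=
  if (ab.2 <= m i)%N then \det (up (d (armv i ab.2)) (d (armv i ab.2)) (cp (M i) ab.1 ab.2))
  else \det (block_mx (up e e (amx M (oth i))) (up e (d (armv i ab.1)) (cp (M i) 0 (ab.2 - m i)))
                      (up (d (armv i ab.1)) e (cp (M i) ab.1 (m i))) 0).

Definition fits (i : 'I_n) (a b : nat) : Prop := [/\ (a < m i)%N, (a < b)%N, (b <= a + m i)%N &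
  d (armv i a) = if (b <= m i)%N then d (armv i b) else d (armv i (b - m i))].

Lemma padcT_psi r (psi : 'cV[k]_r) : (r <= E)%N -> pr k (seg E r) *m ((padc k E r)^T *m psi) = (padc k E r)^T *m psi.
Proof. by move=> rE; rewrite -padcT -!mulmxA [padc k E r *m (_ *m _)]mulmxA padcK // mul1mx. Qed.

Lemma padcT_eq0 r (psi : 'cV[k]_r) : (r <= E)%N -> ((padc k E r)^T *m psi == 0) = (psi == 0).
Proof.
move=> rE; apply/eqP/eqP => [h|->]; last by rewrite mulmx0.
by rewrite -[psi]mul1mx -(padcK k rE) -mulmxA h mulmx0.
Qed.

Lemma xdet_degen i (a b : nat) (M : prep) : isrep S M -> fits i a b -> xdet i (a, b) M = 0 ->
  degen S (oth i) i M (a, b).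
Proof.
move=> rM [am ab bam de]; rewrite /xdet /degen (leqNgt (m i)) am /=.
case: (leqP b (m i)) de => [bm de|mb de].
  move=> /det0_col [v v0 Av]; exists ((padc k E (d (armv i b)))^T *m v).
  have rE := dim_le d (armv i b).
  rewrite padcT_eq0 // padcT_psi //; split=> //.
  by rewrite /seg_of de -padcT; move: Av; rewrite -!mulmxA => ->; rewrite mulmx0.
move=> /det0_col [v vn Av].
have rE := dim_le d (armv i a); have eE := dim_le d (v0 C).
move: vn Av; rewrite -[v]vsubmxK; move: (usubmx v) (dsubmx v) => {v} f g vn.
rewrite mul_block_col mul0mx addr0 -[RHS]col_mx0 => /eq_col_mx [h1 h2].
exists ((padc k E e)^T *m f), (- ((padc k E (d (armv i a)))^T *m g)); split.
- rewrite oppr_eq0 !padcT_eq0 //; apply: contraNT vn; rewrite negb_or !negbK => /andP [/eqP -> /eqP ->].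
  by rewrite col_mx0.
- by rewrite /seg_of doo padcT_psi.
- by rewrite /seg_of -de mulmxN padcT_psi.
- have [s1 _] := isrep_amx (oth i) rM.
  have bm' : (b - m i <= m i)%N by lia.
  have b0 : (0 < b - m i)%N by lia.
  have [t1 _] := isrep_cp rM b0 bm'.
  have := congr1 (mulmx (padc k E e)^T) h1; rewrite mulmx0 mulmxDr !mulmxA !padcT -!/(seg_of _ _).
  rewrite s1 t1 mulmxN => /eqP.
  by rewrite addr_eq0 -!mulmxA => /eqP.
- rewrite -padcT; move: h2; rewrite -!mulmxA => ->; by rewrite mulmx0.
Qed.

Definition wdet (hi : vertex C -> 'M[k]_E) (x : vertex C) : k := \det (up (d x) (d x) (hi x)).

Section Gauge.

Context (h hi : vertex C -> 'M[k]_E).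
Hypothesis g : gauge S h hi.

Lemma wdet_inv r x : r = d x -> \det (up r r (h x)) = (wdet hi x)^-1 /\ wdet hi x != 0.
Proof.
move=> ->; have [[_ h2] _ eh _] := g x.
have e1 : up (d x) (d x) (h x) *m up (d x) (d x) (hi x) = 1%:M by rewrite -up_mul // eh up1 // dim_le.
have := congr1 determinant e1; rewrite det_mulmx det1 -/(wdet hi x) => e2.
have w0 : wdet hi x != 0 by apply/eqP => z; move: e2; rewrite z mulr0 => /eqP; rewrite eq_sym oner_eq0.
by split=> //; apply: (mulIf w0); rewrite mulVf.
Qed.

Lemma wdet_hi r x : r = d x -> \det (up r r (hi x)) = wdet hi x.
Proof. by move=> ->. Qed.

Lemma pact_cp (M : prep) i a b : isrep S M -> (a < b)%N -> (b <= m i)%N ->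
  cp (pact h hi M i) a b = h (armv i a) *m cp (M i) a b *m hi (armv i b).
Proof.
move=> rM; elim: b => // b IH ab bm; have [E0|ne] := eqVneq a b; first by rewrite E0 !cp1.
have lt : (a < b)%N by lia.
rewrite !cp_r // IH //; last exact: ltnW.
have [_ _ _ e2] := g (armv i b).
rewrite !mulmxA -[_ *m hi (armv i b) *m h _]mulmxA e2.
by have [e1 _] := rM i b bm; rewrite -[_ *m pr k _ *m M i b]mulmxA e1.
Qed.

Lemma up_pact_cp (M : prep) i a b r s : isrep S M -> (a < b)%N -> (b <= m i)%N -> r = d (armv i a) -> s = d (armv i b) ->
  up r s (cp (pact h hi M i) a b) = up r r (h (armv i a)) *m up r s (cp (M i) a b) *m up s s (hi (armv i b)).
Proof.
move=> rM ab bm -> ->; rewrite pact_cp //; have [[_ h2] _ _ _] := g (armv i a).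
have [_ c2] := isrep_cp rM ab bm.
by rewrite -!up_mul; rewrite -?mulmxA ?c2.
Qed.

Lemma xdet_pact i (a b : nat) (M : prep) : isrep S M -> fits i a b ->
  xdet i (a, b) (pact h hi M) = (if (b <= m i)%N then wdet hi (armv i b) * (wdet hi (armv i a))^-1
     else wdet hi (voo C) * wdet hi (armv i (b - m i)) * (wdet hi (v0 C))^-1 * (wdet hi (armv i a))^-1) * xdet i (a, b) M.
Proof.
move=> rM [am ab bam de]; rewrite /xdet /=; case: (leqP b (m i)) de => [bm de|mb de].
  rewrite (up_pact_cp rM ab bm) // !det_mulmx (wdet_inv (esym de)).1 (wdet_hi (erefl _)).
  by rewrite mulrC mulrA.
have bm' : (b - m i <= m i)%N by lia.
have b0 : (0 < b - m i)%N by lia.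
rewrite (up_pact_cp rM b0 bm' (erefl _) de).
have [m0 mo] := (arity_gt0 (oth i), arity_gt0 i).
rewrite (@up_pact_cp M (oth i) 0 (m (oth i)) e e rM m0 (leqnn _) (erefl _)) ?armv_end //.
rewrite (@up_pact_cp M i a (m i) _ e rM am (leqnn _) (erefl _)) ?armv_end //.
rewrite -/(amx M (oth i)).
set A := up e e (amx _ _); set U := up e _ (cp _ 0 _); set W := up _ e (cp _ a _).
have -> : block_mx (up e e (h (armv (oth i) 0)) *m A *m up e e (hi (voo C)))
     (up e e (h (armv i 0)) *m U *m up (d (armv i a)) (d (armv i a)) (hi (armv i (b - m i))))
     (up (d (armv i a)) (d (armv i a)) (h (armv i a)) *m W *m up e e (hi (voo C))) 0 =
   block_mx (up e e (h (v0 C))) 0 0 (up (d (armv i a)) (d (armv i a)) (h (armv i a))) *m block_mx A U W 0 *m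
   block_mx (up e e (hi (voo C))) 0 0 (up (d (armv i a)) (d (armv i a)) (hi (armv i (b - m i)))).
  by rewrite !mulmx_block !(mulmx0, mul0mx, addr0, add0r).
rewrite !det_mulmx !det_ublock (wdet_inv (erefl _)).1 (wdet_inv (erefl (d (armv i a)))).1 (wdet_hi (esym doo)) (wdet_hi de).
ring.
Qed.

End Gauge.

Definition pencil (M : prep) : {poly k} :=
  \det (map_mx polyC (up e e (amx M (arm_fst C))) + 'X *: map_mx polyC (up e e (amx M (arm_snd C)))).

Lemma up_pact_amx h hi (M : prep) i : gauge S h hi -> isrep S M ->
  up e e (amx (pact h hi M) i) = up e e (h (v0 C)) *m up e e (amx M i) *m up e e (hi (voo C)).
Proof.
move=> g rM; have := @up_pact_cp h hi g M i 0 (m i) e e rM (arity_gt0 i) (leqnn _) (erefl _).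
by rewrite armv_end => ->.
Qed.

Lemma pencil_pact h hi (M : prep) : gauge S h hi -> isrep S M ->
  pencil (pact h hi M) = (wdet hi (voo C) * (wdet hi (v0 C))^-1) *: pencil M.
Proof.
move=> g rM; by rewrite /pencil !up_pact_amx // det_pencil_mul (wdet_inv g (erefl _)).1 (wdet_hi hi (esym doo)) mulrC.
Qed.

Section PolyAlg.

Context (X : Type) (P : X -> Prop) (I : finType) (z : I -> X -> k).

Definition poly_alg (p : X -> {poly k}) : Prop := forall l, in_alg_gen P z (fun x => (p x)`_l).

Lemma poly_alg_eq p q : (forall x, p x = q x) -> poly_alg p -> poly_alg q.
Proof. by move=> pq Hp l; apply: alg_eq (Hp l) => x _; rewrite pq. Qed.

Lemma poly_algC f : in_alg_gen P z f -> poly_alg (fun x => (f x)%:P).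
Proof.
move=> Hf l; case: l => [|l]; first by apply: alg_eq Hf => x _; rewrite coefC.
by apply: alg_eq (alg_const _ _ 0) => x _; rewrite coefC.
Qed.

Lemma poly_alg_const (p : {poly k}) : poly_alg (fun=> p).
Proof. by move=> l; apply: alg_const. Qed.

Lemma poly_algD p q : poly_alg p -> poly_alg q -> poly_alg (fun x => p x + q x).
Proof. by move=> Hp Hq l; apply: alg_eq (algD (Hp l) (Hq l)) => x _; rewrite coefD. Qed.

Lemma poly_algM p q : poly_alg p -> poly_alg q -> poly_alg (fun x => p x * q x).
Proof.
move=> Hp Hq l; apply: (@alg_eq _ _ _ _ _ (fun x => \sum_(j < l.+1) (p x)`_j * (q x)`_(l - j))).
  by move=> x _; rewrite coefM.
by apply: alg_sum_seq => j _; apply: algM.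
Qed.

Lemma poly_alg_det r (A : X -> 'M[{poly k}]_r) : (forall i j, poly_alg (fun x => A x i j)) -> poly_alg (fun x => \det (A x)).
Proof.
move=> HA; rewrite /determinant.
have sum (J : Type) (s : seq J) (f : J -> X -> {poly k}) : (forall j, poly_alg (f j)) -> poly_alg (fun x => \sum_(j <- s) f j x).
  move=> Hf; elim: s => [|j s IH]; first by apply: poly_alg_eq (poly_alg_const 0) => x; rewrite big_nil.
  by apply: poly_alg_eq (poly_algD (Hf j) IH) => x; rewrite big_cons.
have prod (J : Type) (s : seq J) (f : J -> X -> {poly k}) : (forall j, poly_alg (f j)) -> poly_alg (fun x => \prod_(j <- s) f j x).
  move=> Hf; elim: s => [|j s IH]; first by apply: poly_alg_eq (poly_alg_const 1) => x; rewrite big_nil.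
  by apply: poly_alg_eq (poly_algM (Hf j) IH) => x; rewrite big_cons.
by apply: sum => s; apply: poly_algM; [apply: poly_alg_const|apply: prod].
Qed.

End PolyAlg.

Local Notation ez := (fun (c : coord d) (M : rep k d) => entry M c).

Lemma amx_alg (P : rep k d -> Prop) i a b : mx_alg P ez (fun M => cp (emb M i) a b).
Proof. by apply: mx_alg_path => j _; apply: emb_alg. Qed.

Lemma xdet_alg (P : rep k d -> Prop) i ab : in_alg_gen P ez (fun M => xdet i ab (emb M)).
Proof.
rewrite /xdet; case: (ab.2 <= m i)%N; first by apply: alg_det; apply: mx_alg_up; apply: amx_alg.
apply: alg_det => x y; rewrite -(splitK x) -(splitK y); case: (split x) => x'; case: (split y) => y' /=.
- apply: alg_eq (mx_alg_up (A := fun M => amx (emb M) (oth i)) _ x' y') => [M _|]; first by rewrite block_mxEul.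
  exact: amx_alg.
- apply: alg_eq (mx_alg_up (A := fun M => cp (emb M i) 0 (ab.2 - m i)) _ x' y') => [M _|]; first by rewrite block_mxEur.
  exact: amx_alg.
- apply: alg_eq (mx_alg_up (A := fun M => cp (emb M i) ab.1 (m i)) _ x' y') => [M _|]; first by rewrite block_mxEdl.
  exact: amx_alg.
- by apply: alg_eq (alg_const _ _ 0) => M _; rewrite block_mxEdr mxE.
Qed.

Lemma pencil_alg (P : rep k d -> Prop) : poly_alg P ez (fun M => pencil (emb M)).
Proof.
apply: poly_alg_det => i j.
apply: (@poly_alg_eq _ _ _ _ (fun M => (up e e (amx (emb M) (arm_fst C)) i j)%:P + 'X * (up e e (amx (emb M) (arm_snd C)) i j)%:P)).
  by move=> M; rewrite !mxE.
apply: poly_algD; first by apply: poly_algC; apply: (mx_alg_up (A := fun M => amx (emb M) (arm_fst C))); apply: amx_alg.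
apply: poly_algM; first exact: poly_alg_const.
by apply: poly_algC; apply: (mx_alg_up (A := fun M => amx (emb M) (arm_snd C))); apply: amx_alg.
Qed.

Hypothesis dpos : forall x, (0 < d x)%N.

(** A polynomial function of padded modules that transforms by [sigma] is a semi-invariant; all
    dimensions being positive, every [sigma] is an admissible weight. *)
Lemma Zset_kill (Phi : prep -> k) (sigma : {ffun vertex C -> int}) (M : rep k d) :
  in_alg_gen (fun _ => True) ez (fun M => Phi (emb M)) ->
  (forall M N, (forall i j, (j < m i)%N -> M i j = N i j) -> Phi M = Phi N) ->
  (forall h hi N, gauge S h hi -> isrep S N -> Phi (pact h hi N) = (\prod_x wdet hi x ^ sigma x) * Phi N) ->
  sigma != 0 -> Zset M -> Phi (emb M) = 0.
Proof.
move=> Phialg Phiext Phig s0 [mM ZM]; have [f Hf] := alg_evalp Phialg.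
rewrite -Hf; apply: (ZM sigma) => //.
  by move=> x dx; have := dpos x; rewrite dx.
move=> g gu N mN; rewrite !Hf.
pose h x := pad E (invmx (g x)); pose hi x := pad E (g x).
have gg : gauge S h hi.
  move=> x; have xE := dim_le d x; split; try exact: pad_supp.
    by rewrite pad_mul // mulVmx // pad1.
  by rewrite pad_mul // mulmxV // pad1.
have -> : Phi (emb (act (fun x => invmx (g x)) N)) = Phi (pact h hi (emb N)).
  apply: Phiext => i j jm; rewrite /pact !(embE _ jm) /act /h /hi invmxK.
  by rewrite !pad_mul //; exact: dim_le.
rewrite Phig //; last exact: emb_isrep.
congr (_ * _); apply: eq_bigr => x _; rewrite /wdet up_pad //; exact: dim_le.
Qed.

Lemma prod_unit_vec (w : vertex C -> k) y : \prod_x w x ^ unit_vec y x = w y.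
Proof.
rewrite (bigD1 y) //= ffunE eqxx big1 ?mulr1 // => x /negPf xy.
by rewrite ffunE xy.
Qed.

Lemma prod_expzD (w : vertex C -> k) (s t : {ffun vertex C -> int}) : (forall x, w x != 0) ->
  \prod_x w x ^ (s + t) x = (\prod_x w x ^ s x) * \prod_x w x ^ t x.
Proof. by move=> w0; rewrite -big_split; apply: eq_bigr => x _; rewrite ffunE expfzDr. Qed.

Lemma prod_expzN (w : vertex C -> k) (s : {ffun vertex C -> int}) : \prod_x w x ^ (- s) x = (\prod_x w x ^ s x)^-1.
Proof. by rewrite -prodfV; apply: eq_bigr => x _; rewrite ffunE invr_expz. Qed.

Lemma armv_inj i a b : (a <= m i)%N -> (b <= m i)%N -> armv i a = armv i b -> a = b.
Proof.
have inner l t : (0 < t)%N -> (t < m l)%N -> exists u : 'I_(m l).-1, armv l t = inr (Tagged (fun i => 'I_(m i).-1) u) /\ u.+1 = t :> nat.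
  by case: t => // t _ tm; rewrite /armv insubT => [|lt]; [lia|exists (Sub t lt)].
move=> am bm; have [a0|a0] := posnP a; have [b0|b0] := posnP b.
- by lia.
- rewrite a0; have [->|ne] := eqVneq b (m i); first by rewrite armv_end.
  by have [u [-> _]] := inner i b b0 ltac:(lia).
- rewrite b0; have [->|ne] := eqVneq a (m i); first by rewrite armv_end.
  by have [u [-> _]] := inner i a a0 ltac:(lia).
have [ea|na] := eqVneq a (m i); have [eb|nb] := eqVneq b (m i).
- by lia.
- by rewrite ea armv_end; have [u [-> _]] := inner i b b0 ltac:(lia).
- by rewrite eb armv_end; have [u [-> _]] := inner i a a0 ltac:(lia).
have [u [-> <-]] := inner i a a0 ltac:(lia); have [v [-> <-]] := inner i b b0 ltac:(lia).
by case=> /eqP; rewrite eq_Tagged /= => /eqP ->.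
Qed.

Lemma Zset_xdet (M : rep k d) i (a b : nat) : fits i a b -> Zset M -> xdet i (a, b) (emb M) = 0.
Proof.
move=> ft ZM; have [am ab bam de] := ft.
pose sigma : {ffun vertex C -> int} := if (b <= m i)%N then unit_vec (armv i b) - unit_vec (armv i a)
  else unit_vec (voo C) + unit_vec (armv i (b - m i)) - unit_vec (v0 C) - unit_vec (armv i a).
apply: (@Zset_kill (xdet i (a, b)) sigma) => //.
- exact: xdet_alg.
- move=> N N' NN; have e1 l x y : (y <= m l)%N -> cp (N l) x y = cp (N' l) x y.
    by move=> ym; apply: eq_cp => c hc; apply: NN; lia.
  rewrite /xdet /= /amx; case: ifP => bm; first by rewrite e1.
  by rewrite !e1 //; lia.
- move=> h hi N g rN; rewrite (xdet_pact g rN ft) /sigma.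
  have w0 x : wdet hi x != 0 by have [] := wdet_inv g (erefl (d x)).
  by case: ifP => _; rewrite !prod_expzD // !prod_expzN !prod_unit_vec.
apply/eqP => /ffunP s0; move: s0; rewrite /sigma; case: ifP => bm s0.
  have := s0 (armv i a); rewrite !ffunE eqxx; case: eqP => // /armv_inj; lia.
have := s0 (v0 C); rewrite !ffunE eqxx.
have -> : (v0 C == armv i (b - m i)) = false.
  apply/eqP => h; have := @armv_inj i 0 (b - m i) (leq0n _) ltac:(lia) h; lia.
have -> : (v0 C == armv i a) = false.
  apply/eqP => h; have := @armv_inj i 0 a (leq0n _) ltac:(lia) h; lia.
by [].
Qed.

Lemma Zset_pencil (M : rep k d) l : Zset M -> (pencil (emb M))`_l = 0.
Proof.
move=> ZM; apply: (@Zset_kill (fun N => (pencil N)`_l) (unit_vec (voo C) - unit_vec (v0 C))) => //.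
- exact: pencil_alg.
- move=> N N' NN; have e1 i : amx N i = amx N' i by apply: eq_cp => c hc; apply: NN.
  by rewrite /pencil !e1.
- move=> h hi N g rN; rewrite pencil_pact // coefZ.
  have w0 x : wdet hi x != 0 by have [] := wdet_inv g (erefl (d x)).
  by rewrite prod_expzD // prod_expzN !prod_unit_vec.
by apply/eqP => /ffunP /(_ (v0 C)); rewrite !ffunE.
Qed.

End Equations.

(** * Matrix pencils *)

Section Pencils.

Context (k : fieldType) (hk : [pchar k] =i pred0).

Definition pencil_det r (A B : 'M[k]_r) : {poly k} := \det (map_mx polyC A + 'X *: map_mx polyC B).

Lemma poly_ext (p q : {poly k}) : (forall x, p.[x] = q.[x]) -> p = q.
Proof.
move=> H; apply/eqP; rewrite -subr_eq0; apply/negPn/negP => /(poly_nonroot hk) [x].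
by rewrite hornerD hornerN H subrr eqxx.
Qed.

Lemma poly_ext0 (p q : {poly k}) : (forall x, x != 0 -> p.[x] = q.[x]) -> p = q.
Proof.
move=> H; apply: (@mulIf _ 'X); first by rewrite polyX_eq0.
apply: poly_ext => x; rewrite !hornerMX; have [->|x0] := eqVneq x 0; first by rewrite !mulr0.
by rewrite H.
Qed.

Lemma horner_det r (A : 'M[{poly k}]_r) x : (\det A).[x] = \det (map_mx (fun p => p.[x]) A).
Proof. by rewrite -horner_evalE -det_map_mx. Qed.

Lemma pencil_horner r (A B : 'M[k]_r) x : (pencil_det A B).[x] = \det (A + x *: B).
Proof. by rewrite horner_det; congr (\det _); apply/matrixP => i j; rewrite !mxE !hornerE. Qed.

Lemma Xn_dvd_coef (p : {poly k}) r l : 'X^r %| p -> (l < r)%N -> p`_l = 0.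
Proof. by move=> /dvdpP [q ->] lr; rewrite coefMXn lr. Qed.

Lemma coef_Xn_dvd (p : {poly k}) r : (forall l : nat, (l < r)%N -> p`_l = 0) -> 'X^r %| p.
Proof.
move=> H; apply/dvdpP; exists (\poly_(i < size p) p`_(i + r)); apply/polyP => i.
rewrite coefMXn; case: ltnP => ir; first exact: H.
rewrite coef_poly subnK //; case: ltnP => // le; rewrite nth_default //.
exact: leq_trans le (leq_subr _ _).
Qed.

(* If a factor through dimension [r] of the product is compatible with a kernel
   vector, the determinant vanishes to one order more than forced by the rank. *)
Lemma pencil_mult e r (B : 'M[k]_e) (U : 'M_(e, r)) (W : 'M_(r, e)) (phi : 'cV_e) (psi : 'cV_r) :
  (r <= e)%N -> (phi != 0) || (psi != 0) -> B *m phi = U *m psi -> W *m phi = 0 ->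
  'X^((e - r).+1) %| pencil_det (U *m W) B.
Proof.
move=> re nz e1 e2.
pose K := \det (block_mx (map_mx polyC B) (map_mx polyC U) (- map_mx polyC W) ('X%:M : 'M_r)).
have Kh x : K.[x] = \det (block_mx B U (- W) (x%:M : 'M_r)).
  rewrite horner_det; congr (\det _); rewrite map_block_mx; congr block_mx; apply/matrixP => i j; rewrite !mxE ?hornerE //.
  by case: (i == j); rewrite ?hornerE.
have H : 'X^r * pencil_det (U *m W) B = 'X^r * ('X^(e - r) * K).
  apply: poly_ext => x; rewrite mulrA -exprD subnKC // !hornerM !hornerXn pencil_horner Kh.
  have h1 : block_mx (x *: B) U (- W) 1%:M *m block_mx 1%:M 0 W 1%:M = block_mx (U *m W + x *: B) U 0 (1%:M : 'M_r).
    by rewrite mulmx_block !(mulmx0, mul0mx, mulmx1, mul1mx, addr0, add0r) addNr [x *: B + _]addrC.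
  have h2 : block_mx (x *: B) U (- W) 1%:M *m block_mx 1%:M 0 0 (x%:M : 'M_r) =
            block_mx (x%:M : 'M_e) 0 0 1%:M *m block_mx B U (- W) (x%:M : 'M_r).
    by rewrite !mulmx_block !(mulmx0, mul0mx, mulmx1, mul1mx, addr0, add0r) mul_scalar_mx mul_mx_scalar mul_scalar_mx.
  have := congr1 determinant h2; have := congr1 determinant h1.
  rewrite !det_mulmx !det_lblock !det_ublock !det1 !det_scalar !(mulr1, mul1r) => ->.
  by rewrite mulrC.
have {}H := mulfI (monic_neq0 (monicXn k r)) H; rewrite H exprSr dvdp_mul //.
rewrite -[X in X %| _]subr0 dvdp_XsubCl /root Kh.
apply/eqP; apply: (@col_det0 _ _ _ (col_mx phi (- psi))).
  by apply: contraTneq nz => h; have /eq_col_mx [/eqP -> /eqP] := etrans h (esym (@col_mx0 _ _ _ _)); rewrite oppr_eq0 => ->.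
by rewrite mul_block_col mulmxN e1 subrr mulNmx e2 oppr0 mul_scalar_mx scale0r addr0 col_mx0.
Qed.

Lemma prod_roots_dvd (T : eqType) (s : seq T) (c : T -> k) (r : T -> nat) (D : {poly k}) : uniq [seq c i | i <- s] ->
  (forall i, i \in s -> ('X - (c i)%:P) ^+ r i %| D) -> \prod_(i <- s) ('X - (c i)%:P) ^+ r i %| D.
Proof.
elim: s => [|a s IH] /=; first by rewrite big_nil dvd1p.
move=> /andP [ua us] H; rewrite big_cons Gauss_dvdp; last first.
  apply: coprimep_expl; elim: s ua {IH us H} => [|b s IH]; first by rewrite big_nil coprimep1.
  rewrite inE negb_or => /andP [ab bs]; rewrite big_cons coprimepMr IH // andbT.
  by apply: coprimep_expr; apply: coprimep_XsubC2; rewrite subr_eq0 eq_sym.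
by rewrite H ?mem_head // IH // => i si; apply: H; rewrite inE si orbT.
Qed.

Lemma size_prod_roots (T : eqType) (s : seq T) (c : T -> k) (r : T -> nat) :
  size (\prod_(i <- s) ('X - (c i)%:P) ^+ r i) = (\sum_(i <- s) r i).+1.
Proof.
elim: s => [|a s IH]; first by rewrite !big_nil size_poly1.
rewrite !big_cons size_monicM ?monic_exp ?monicXsubC //; last by rewrite -size_poly_eq0 IH.
by rewrite IH size_exp_XsubC addnS.
Qed.

(* Vanishing at infinity, read off the reversed pencil. *)
Lemma pencil_degree r (A B : 'M[k]_r) q : pencil_det A B != 0 -> 'X^q %| pencil_det B A ->
  ((size (pencil_det A B)).-1 + q <= r)%N.
Proof.
set D := pencil_det A B; move=> D0 /dvdpP [Q HQ].
pose N := (size D).-1; have sD : size D = N.+1 by rewrite prednK // size_poly_gt0.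
pose R := \sum_(l < N.+1) D`_l *: 'X^(N - l).
have Rx x : x != 0 -> R.[x] = x ^+ N * D.[x^-1].
  move=> x0; rewrite horner_sum horner_coef sD mulr_sumr; apply: eq_bigr => l _.
  rewrite hornerZ hornerXn exprVn mulrCA; congr (_ * _).
  have -> : x ^+ N = x ^+ (N - l) * x ^+ l by rewrite -exprD subnK // -ltnS.
  by rewrite mulfK // expf_neq0.
have R0 : R.[0] != 0.
  rewrite horner_sum (bigD1 ord_max) //= big1 ?addr0.
    by rewrite subnn hornerZ hornerXn mulr1 lead_coef_eq0.
  move=> l; rewrite -val_eqE /= => lN; rewrite hornerZ hornerXn expr0n.
  case: eqP => [h|_]; last by rewrite mulr0.
  exfalso; have := ltn_ord l; lia.
have key : 'X^r * R = 'X^(N + q) * Q.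
  apply: poly_ext0 => x x0; rewrite !hornerM !hornerXn Rx // exprD -mulrA [x ^+ q * _]mulrC.
  have := congr1 (fun p : {poly k} => p.[x]) HQ; rewrite hornerM hornerXn => <-.
  rewrite mulrCA; congr (_ * _); rewrite !pencil_horner.
  have -> : B + x *: A = x *: (A + x^-1 *: B).
    by rewrite scalerDr scalerA mulfV // scale1r addrC.
  by rewrite detZ.
have : 'X^(N + q) %| 'X^r * R by rewrite key dvdp_mulIl.
rewrite Gauss_dvdpl; last first.
  apply: coprimep_expl; rewrite -['X]subr0 coprimep_sym coprimep_XsubC //.
by move=> /(dvdp_leq (monic_neq0 (monicXn k r))); rewrite !size_polyXn.
Qed.

(** A polynomial row in the kernel of a singular pencil has coefficients satisfying
    [w j.+1 *m A = - (w j *m B)]. Their span is mapped by [B] into its image under [A], and the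
    lowest non-zero coefficient is killed by [A]. *)
Lemma pencil_kernel e (A B : 'M[k]_e) : pencil_det A B = 0 ->
  exists X : 'M[k]_e, (X *m B <= X *m A)%MS /\ (\rank (X *m A) < \rank X)%N.
Proof.
move=> /eqP /det0P [v vn vP].
pose w (j : nat) : 'rV[k]_e := \row_i (v 0 i)`_j.
have rel0 : w 0%N *m A = 0.
  apply/rowP => i; have := congr1 (fun M : 'rV[{poly k}]_e => (M 0 i)`_0) vP; rewrite !mxE coef0 coef_sum => h; rewrite -[RHS]h.
  apply: eq_bigr => l _; rewrite !mxE mulrDr coefD mulrCA coefXM addr0 coefMC //.
have relS j : w j.+1 *m A = - (w j *m B).
  apply/eqP; rewrite -addr_eq0; apply/eqP/rowP => i.
  have := congr1 (fun M : 'rV[{poly k}]_e => (M 0 i)`_j.+1) vP; rewrite !mxE coef0 coef_sum => h; rewrite -[RHS]h.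
  rewrite -big_split; apply: eq_bigr => l _; rewrite !mxE mulrDr coefD mulrCA coefXM !coefMC //.
have [N HN] : exists N : nat, forall j, (N <= j)%N -> w j = 0.
  exists (\max_(i < e) size (v 0%R i)) => j jN; apply/rowP => i; rewrite !mxE nth_default //.
  by apply: leq_trans jN; apply: (leq_bigmax i).
have [j0 [nz0 min0]] : exists j0 : nat, w j0 != 0 /\ forall j, (j < j0)%N -> w j = 0.
  have ex : exists j, w j != 0.
    apply: NNPP => no; case/eqP: vn; apply/rowP => i; rewrite mxE; apply/polyP => j; rewrite coef0.
    have [h|h] := eqVneq (w j) 0; last by case: no; exists j.
    by have := congr1 (fun M : 'rV[k]_e => M 0 i) h; rewrite !mxE.
  exists (ex_minn ex); case: ex_minnP => j h1 h2; split=> // j' lt.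
  by apply/eqP; apply/negPn/negP => h; have := h2 _ h; rewrite leqNgt lt.
have wA : w j0 *m A = 0.
  case: j0 nz0 min0 => [|j0] nz0 min0; first exact: rel0.
  by rewrite relS min0 // mul0mx oppr0.
pose X : 'M[k]_e := (\sum_(j < N) <<w j>>)%MS.
have wX j : (w j <= X)%MS.
  have [lt|ge] := ltnP j N; last by rewrite HN // sub0mx.
  by apply: (sumsmx_sup (Ordinal lt)) => //; rewrite genmxE.
exists X; split.
  rewrite /X sumsmxMr; apply/sumsmx_subP => j _; rewrite (eqmxMr _ (genmxE _)) -[_ *m B]opprK -relS eqmx_opp.
  exact: submxMr.
rewrite -(mxrank_mul_ker X A) -[X in (X < _)%N]addn0 ltn_add2l lt0n mxrank_eq0.
apply: contraNneq nz0 => K0; rewrite -submx0 -K0 sub_capmx wX; exact/sub_kermxP.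
Qed.

End Pencils.

(** * Positive defect on the zero locus *)

Section Defect.

Context (k : closedFieldType) (hk : [pchar k] =i pred0) (C : canonicalData k) (d : dimvec C).

Local Notation n := (narms C).
Local Notation m := (@arity k C).
Local Notation E := (esize d).
Local Notation prep := (prep C E).
Local Notation e := (d (v0 C)).
Local Notation S := (@seg_of k C d).

Context (p : nat) (qc : 'I_n -> nat -> nat) (M : prep).
Hypothesis eE : (e = p + \sum_l qc l 0)%N.
Hypothesis dE : forall l t, (t <= m l)%N -> (d (armv l t) + qc l 0 = e + qc l t)%N.
Hypothesis qcm : forall l t, qc l (t + m l)%N = qc l t.
Hypothesis qz : forall l, exists2 b : nat, (b < m l)%N & qc l b = 0%N.
Hypothesis rM : isrep S M.
Hypothesis eM : rels M.
Hypothesis dg : forall i (a b : nat), consecutive (qc i) (m i) a b -> degen S (oth i) i M (a, b).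

Let doo : d (voo C) = e.
Proof. exact: (regular_voo dE (fun l => qcm l 0%N)). Qed.

Let A i := up e e (amx M i).

Lemma unpad_nz r (psi : 'cV[k]_E) : pr k (seg E r) *m psi = psi -> (padc k E r *m psi == 0) = (psi == 0).
Proof.
move=> e1; apply/eqP/eqP => [h|->]; last by rewrite mulmx0.
by rewrite -e1 -padcT -mulmxA h mulmx0.
Qed.

Lemma up_amx_split i b : (b <= m i)%N -> A i = up e (d (armv i b)) (cp (M i) 0 b) *m up (d (armv i b)) e (cp (M i) b (m i)).
Proof.
move=> bm; have [b0|bp] := posnP b.
  rewrite b0 /up mulmx1 padcK ?mul1mx //; exact: dim_le.
by rewrite -up_mul -?cp_cat; have [] := isrep_cp rM bp bm.
Qed.

(** The composite of arm [i] factors through a vertex where [qc] vanishes, so its rank is at most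
    the dimension at 0 minus [qc i 0]. The degeneracy of the pair of zeros of [qc] around 0 adds one
    more to the multiplicity. *)
Lemma arm_mult i : 'X^((qc i 0).+1) %| pencil_det (A i) (A (oth i)).
Proof.
have mi := arity_gt0 i.
have qmm : qc i (m i) = qc i 0 by rewrite -[m i]add0n.
have [q0|qp] := posnP (qc i 0).
  have ex : exists b : nat, (0 < b)%N && (qc i b == 0)%N by exists (m i); rewrite mi qmm q0.
  case: (ex_minnP ex) => b /andP [b0 /eqP qb] bmin.
  have bm : (b <= m i)%N by apply: bmin; rewrite mi qmm q0.
  have con : consecutive (qc i) (m i) 0 b.
    split=> //; first by lia.
    move=> t t0 tb; have := bmin t; lia.
  have := dg con; rewrite /degen /= bm => -[psi [pn pS pk]].
  have [c1 c2] := isrep_cp rM b0 bm; rewrite c1 in pk.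
  have db : d (armv i b) = e by have := dE bm; lia.
  rewrite q0 -['X^1]subr0 dvdp_XsubCl /root pencil_horner scale0r addr0 (up_amx_split bm) db det_mulmx mulf_eq0.
  apply/orP; left; apply/eqP; rewrite /seg_of db in pS c2; apply: (@col_det0 _ _ _ (padc k E e *m psi)).
    by rewrite unpad_nz.
  by rewrite -!mulmxA [(padc k E e)^T *m (_ *m _)]mulmxA padcT pS pk mulmx0.
have [z zm qz0] := qz i.
have ex : exists b : nat, (qc i b == 0)%N by exists z; rewrite qz0.
case: (ex_minnP ex) => b /eqP qb bmin.
have bz : (b <= z)%N by apply: bmin; rewrite qz0.
have b0 : (0 < b)%N by rewrite lt0n; apply/negP => /eqP h; move: qp; rewrite -[in qc i 0]h qb.
(* The last zero of [qc] before infinity, paired with the first zero [b] after 0 in the next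
   turn. *)
have [a [[qa am] amax]] := @bounded_max (fun t => qc i t = 0%N /\ (t < m i)%N) (m i) (ex_intro _ z (conj qz0 zm)) (fun _ h => ltnW (proj2 h)).
have ba : (b <= a)%N by apply: leq_trans bz _; apply: amax.
have bm : (b <= m i)%N by lia.
have con : consecutive (qc i) (m i) a (b + m i).
  split=> //; [by lia|by lia|by rewrite qcm qb|].
  move=> t t1 t2; rewrite qcm qb lt0n; apply/negP => /eqP qt.
  have [lt|] := ltnP t (m i); first by have := amax t (conj qt lt); lia.
  rewrite leq_eqVlt => /orP [/eqP h|gt]; first by move: qp; rewrite -qmm h qt.
  have e1 : qc i (t - m i) = 0%N by rewrite -qcm subnK // ltnW.
  have := bmin (t - m i)%N; lia.
have := dg con; rewrite /degen /= (_ : b + m i <= m i = false)%N; last by lia.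
rewrite (leqNgt (m i)) am addnK => -[phi [psi [nz pS qS e1 e2]]].
have dab : d (armv i b) = d (armv i a) by have := dE bm; have := dE (ltnW am); lia.
have re : (d (armv i b) + qc i 0 = e)%N by have := dE bm; rewrite qb addn0.
have -> : (qc i 0 = e - d (armv i b))%N by lia.
rewrite (up_amx_split bm); apply: (@pencil_mult k hk _ _ _ _ _ (padc k E e *m phi) (padc k E (d (armv i b)) *m psi)).
- by lia.
- by rewrite !unpad_nz; rewrite /seg_of doo in pS.
- rewrite -!mulmxA [(padc k E e)^T *m (_ *m _)]mulmxA [(padc k E (d (armv i b)))^T *m (_ *m _)]mulmxA !padcT.
  by rewrite /seg_of doo in pS; rewrite pS qS e1.
- rewrite -!mulmxA [(padc k E e)^T *m (_ *m _)]mulmxA padcT.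
  rewrite /seg_of doo in pS; rewrite pS.
  have [c1 c2] := isrep_cp rM am (leqnn (m i)); rewrite c1 in e2.
  by rewrite (@cp_cat _ _ _ b a (m i)) ?(ltnW am) // -mulmxA e2 mulmx0 mulmx0.
Qed.

Lemma amx_slope i : amx M i = (slope i).1 *: amx M (arm_fst C) + (slope i).2 *: amx M (arm_snd C).
Proof.
have := eM (arm_fst C) (arm_snd C) i.
have -> : plu (arm_fst C) (arm_snd C) = 1 by rewrite /plu /=; ring.
have -> : plu i (arm_snd C) = (slope i).1 by rewrite /plu /=; ring.
have -> : plu (arm_fst C) i = (slope i).2 by rewrite /plu /=; ring.
by rewrite scale1r.
Qed.

Lemma slope_fst i : i != arm_snd C -> (slope i).1 = 1.
Proof.
have [->|->|[a ->]] := arm_cases i; [by []|by []|by []].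
Qed.

Hypothesis np : (n <= p)%N.
Hypothesis coefs : forall l, (qc (arm_fst C) 0 < l)%N -> (l <= qc (arm_fst C) 0 + 1 + (p - n))%N -> (pencil M)`_l = 0.

(** Each arm forces a root of multiplicity [qc i 0 + 1], with [arm_snd] at infinity, and the
    prescribed coefficients add p - n + 1 to the root at 0. Together these exceed the size of the
    matrices by one. *)
Lemma pencil0 : pencil M = 0.
Proof.
apply/eqP; apply/negPn/negP => D0; have cf := coefs.
rewrite -[pencil M]/(pencil_det (A (arm_fst C)) (A (arm_snd C))) in D0 cf.
set D := pencil_det _ _ in D0 cf.
have deg := @pencil_degree k hk _ _ _ (qc (arm_snd C) 0).+1 D0.
have := arm_mult (arm_snd C); rewrite /oth => /deg {}deg.
have mult i : i != arm_snd C -> ('X - ((slope i).2)%:P) ^+ (qc i 0).+1 %| D.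
  move=> ni; have := arm_mult i; rewrite /oth (negPf ni) => /dvdpP [Q HQ].
  (* The pencil of arm [i] against [arm_snd] is the basic pencil translated by the slope of arm
     [i]. *)
  apply/dvdpP; exists (Q \Po ('X - ((slope i).2)%:P)).
  apply: (poly_ext hk) => x; rewrite hornerM horner_comp horner_exp !hornerXsubC.
  have := congr1 (fun p : {poly k} => p.[x - (slope i).2]) HQ; rewrite hornerM hornerXn => <-.
  rewrite !pencil_horner; congr (\det _).
  rewrite /A (amx_slope i) slope_fst // scale1r /up mulmxDr mulmxDl -scalemxAr -scalemxAl scalerBl.
  by rewrite [RHS]addrACA subrr addr0.
pose r (i : 'I_n) := if i == arm_fst C then (qc i 0 + 2 + (p - n))%N else (qc i 0).+1.
have mult' i : i != arm_snd C -> ('X - ((slope i).2)%:P) ^+ r i %| D.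
  move=> ni; rewrite /r; case: eqP => [ei|_]; last exact: mult.
  rewrite ei in ni *; have -> : ('X - ((slope (arm_fst C)).2)%:P) = 'X :> {poly k} by rewrite subr0.
  apply: coef_Xn_dvd => l lr; have [lt|gt] := leqP l (qc (arm_fst C) 0).
    apply: (Xn_dvd_coef (r := (qc (arm_fst C) 0).+1)) => //.
    by have := mult (arm_fst C) ni; rewrite subr0.
  by apply: cf; lia.
pose s := [seq i <- enum 'I_n | i != arm_snd C].
have us : uniq [seq (slope i).2 | i <- s].
  have us0 : uniq s by apply: filter_uniq; apply: enum_uniq.
  rewrite map_inj_in_uniq => [//|i j]; rewrite !mem_filter => /andP [ni _] /andP [nj _] h.
  apply/eqP; apply/negPn/negP => /plu_neq0; rewrite /plu !slope_fst // h mul1r mulr1 subrr eqxx //.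
have := prod_roots_dvd us (fun i (si : i \in s) => mult' i ltac:(by move: si; rewrite mem_filter => /andP [])).
move=> /(dvdp_leq D0); rewrite size_prod_roots big_filter big_enum_cond /= => sz.
have cnt : (\sum_(i < n | i != arm_snd C) r i = p + \sum_(i < n | i != arm_snd C) qc i 0)%N.
  rewrite (bigD1 (arm_fst C)) // [in RHS](bigD1 (arm_fst C)) //= {1}/r eqxx.
  have -> : (\sum_(i < n | (i != arm_snd C) && (i != arm_fst C)) r i =
    \sum_(i < n | (i != arm_snd C) && (i != arm_fst C)) qc i 0 + (n - 2))%N.
    rewrite -(card_pivots (i := arm_snd C) (j := arm_fst C)) // -sum1_card -big_split /=.
    by apply: eq_bigr => i /andP [_ /negPf ni]; rewrite /r ni addn1.
  move: np (narms_ge3 C); set Z := (\sum_(i < n | _) _)%N; lia.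
rewrite cnt in sz; have := eE; rewrite (bigD1 (arm_snd C)) //=.
move: deg sz; move: (size D) (\sum_(i < n | _) _)%N => x y; lia.
Qed.

Lemma positive_defect : exists X : 'M[k]_E, (X <= pr k (S (v0 C)))%MS /\ (\rank (img M X) < \rank X)%N.
Proof.
have [X [X1 X2]] := @pencil_kernel k e (A (arm_fst C)) (A (arm_snd C)) pencil0.
have eEE := dim_le d (v0 C).
pose Z : 'M[k]_E := <<X *m padc k E e>>%MS.
have fr : row_free (padc k E e).
  by rewrite -row_leq_rank; have := mxrankM_maxl (padc k E e) (padc k E e)^T; rewrite padcK // mxrank1.
exists Z; split.
  rewrite genmxE; apply/sub_prP; rewrite -padcT -!mulmxA [padc k E e *m (_ *m _)]mulmxA padcK // mul1mx //.
have rZ : \rank Z = \rank X by rewrite genmxE mxrankMfree.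
rewrite rZ; apply: leq_ltn_trans X2.
have H i : (Z *m amx M i <= X *m A i *m padc k E e)%MS.
  rewrite (eqmxMr _ (genmxE _)) -!mulmxA padcT.
  by have [_] := isrep_amx i rM; rewrite /seg_of doo => ->.
have fs : arm_fst C != arm_snd C by [].
apply: leq_trans (mxrankS (img_pencil Z eM fs)) _.
apply: leq_trans (_ : \rank (X *m A (arm_fst C) *m padc k E e) <= _)%N; last by rewrite mxrankM_maxl.
apply: mxrankS; rewrite addsmx_sub H; apply: submx_trans (H _) _; exact: submxMr.
Qed.

End Defect.

Lemma posz_sum (I : finType) (f : I -> nat) : (\sum_i f i)%N%:Z = \sum_i (f i)%:Z.
Proof. by rewrite -natz natr_sum; apply: eq_bigr => i _; rewrite natz. Qed.

Lemma sum_single (V : nmodType) (I : finType) (i0 : I) (F : I -> V) :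
  (forall i, i != i0 -> F i = 0) -> \sum_i F i = F i0.
Proof. by move=> h; rewrite (bigD1 i0) //= big1 ?addr0. Qed.

(** * Dimension vectors from the canonical decomposition *)

Section Dimensions.

Context (k : closedFieldType) (C : canonicalData k) (d : dimvec C).

Local Notation n := (narms C).
Local Notation m := (@arity k C).

Context (p : nat) (q : forall i : 'I_n, 'I_(m i) -> nat).
Hypothesis dec : canonical_decomposition d p q.

(** The coefficients of arm [i] extended periodically, so that pairs around the cycle are pairs of
    natural numbers. *)
Definition qcyc (i : 'I_n) (t : nat) : nat := q (Ordinal (ltn_pmod t (arity_gt0 i))).

Lemma qcyc_per i t : qcyc i (t + m i) = qcyc i t.
Proof. by rewrite /qcyc; congr q; apply: val_inj; rewrite /= modnDr. Qed.

Lemma qcyc_ord i (j : 'I_(m i)) : qcyc i j = q j.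
Proof. by rewrite /qcyc; congr q; apply: val_inj; rewrite /= modn_small. Qed.

Lemma qcyc_zero i : exists2 b : nat, (b < m i)%N & qcyc i b = 0%N.
Proof. by have [_ /(_ i) [j qj]] := dec; exists j; rewrite ?qcyc_ord. Qed.

Lemma h_vecE x : @h_vec k C x = 1.
Proof.
rewrite sum_ffunE (bigD1 x) //= ffunE eqxx big1 // => y /negPf yx.
by rewrite ffunE eq_sym yx.
Qed.

Lemma armv_eq i j l t : (0 < j < m i)%N -> (0 < t < m l)%N -> (armv i j == armv l t) = (i == l) && (j == t).
Proof.
case: j t => [|j] [|t] //= jm tm; rewrite /armv !insubT; [lia|lia|move=> h1 h2].
apply/eqP/andP => [[e1 e2]|[/eqP e /eqP [ej]]]; first by rewrite e1 e2.
by subst l j; congr (inr (Tagged _ _)); apply: val_inj.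
Qed.

Lemma armv_inner i j : (0 < j < m i)%N -> (armv i j != v0 C) && (armv i j != voo C).
Proof. by case: j => [|j] //= jm; rewrite /armv insubT //; lia. Qed.

Lemma e_vec_end i (j : nat) x : (j < m i)%N -> (x == v0 C) || (x == voo C) -> e_vec i j x = (j == 0%N)%:Z.
Proof.
move=> jm xe; have off l : (0 < l < m i)%N -> unit_vec (armv i l) x = 0.
  move=> lm; rewrite ffunE; have /andP [h1 h2] := armv_inner lm.
  by case/orP: xe => /eqP ->; rewrite eq_sym ?(negPf h1) ?(negPf h2).
case: j jm => [|j] jm /=; last by rewrite off.
rewrite !ffunE h_vecE sum_ffunE big_nat big1 // => l /off.
Qed.

Lemma e_vec_inner i (j : nat) l t : (j < m i)%N -> (0 < t < m l)%N ->
  e_vec i j (armv l t) = if j is 0 then (i != l)%:Z else ((i == l) && (j == t))%:Z.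
Proof.
move=> jm tm; case: j jm => [|j] jm; last by rewrite ffunE eq_sym armv_eq.
rewrite !ffunE h_vecE sum_ffunE; case: (eqVneq i l) => [E0|il].
  subst l; rewrite (bigD1_seq t) ?mem_index_iota ?iota_uniq // ffunE eqxx big_nat_cond big1 //.
  by move=> a /andP [am at']; rewrite ffunE armv_eq // eqxx eq_sym (negPf at').
rewrite big_nat big1 // => a am; by rewrite ffunE armv_eq // eq_sym (negPf il).
Qed.

Lemma dim_sum x : (d x)%:Z = p%:Z + \sum_(i < n) \sum_(j < m i) e_vec i j x * (q j)%:Z.
Proof.
have [/ffunP /(_ x)] := dec; rewrite !ffunE => -> _.
have mul (f : {ffun vertex C -> int}) a : (f *+ a) x = f x * a%:Z.
  by elim: a => [|a IH]; rewrite ?ffunE ?mulr0 // mulrS ffunE IH -[a.+1]add1n PoszD mulrDr mulr1.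
rewrite mul h_vecE mul1r; congr (_ + _); rewrite sum_ffunE; apply: eq_bigr => i _.
by rewrite sum_ffunE; apply: eq_bigr => j _.
Qed.

Lemma arm_sum_end i x : (x == v0 C) || (x == voo C) -> \sum_(j < m i) e_vec i j x * (q j)%:Z = (qcyc i 0)%:Z.
Proof.
move=> xe; rewrite (sum_single (i0 := Ordinal (arity_gt0 i))) => [|j].
  rewrite e_vec_end // mul1r; congr q; apply: val_inj.
  by rewrite /= mod0n.
by rewrite -val_eqE => /negPf j0; rewrite e_vec_end // j0.
Qed.

Lemma dim_end x : (x == v0 C) || (x == voo C) -> d x = (p + \sum_i qcyc i 0)%N.
Proof.
move=> xe; have := dim_sum x; rewrite (eq_bigr _ (fun i _ => arm_sum_end i xe)) => h.
by apply/eqP; rewrite -eqz_nat h PoszD posz_sum.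
Qed.

Lemma dim_arm l t : (t <= m l)%N -> (d (armv l t) + qcyc l 0 = d (v0 C) + qcyc l t)%N.
Proof.
move=> tm; have [t0|tp] := posnP t; first by rewrite t0.
have [tm'|tm'] := eqVneq t (m l).
  by rewrite tm' armv_end (dim_end (x := voo C)) // (dim_end (x := v0 C)) // -(qcyc_per l 0).
have ti : (0 < t < m l)%N by lia.
have key : \sum_(i < n) \sum_(j < m i) e_vec i j (armv l t) * (q j)%:Z + (qcyc l 0)%:Z =
   \sum_(i < n) (qcyc i 0)%:Z + (qcyc l t)%:Z.
  rewrite (bigD1 l) // [in RHS](bigD1 l) //=.
  have -> : \sum_(i < n | i != l) \sum_(j < m i) e_vec i j (armv l t) * (q j)%:Z = \sum_(i < n | i != l) (qcyc i 0)%:Z.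
    apply: eq_bigr => i il; rewrite (sum_single (i0 := Ordinal (arity_gt0 i))) => [|j].
      rewrite e_vec_inner // il mul1r; congr q.
      by apply: val_inj; rewrite /= mod0n.
    rewrite -val_eqE /= => j0; rewrite e_vec_inner // (negPf il).
    by case: (j : nat) j0 => // a _.
  have -> : \sum_(j < m l) e_vec l j (armv l t) * (q j)%:Z = (qcyc l t)%:Z.
    have tm2 : (t < m l)%N by lia.
    rewrite (sum_single (i0 := Ordinal tm2)) => [|j].
      by rewrite e_vec_inner // -(qcyc_ord (Ordinal tm2)) /=; case: (t) tp => // a _; rewrite !eqxx mul1r.
    rewrite -val_eqE /= => jt; rewrite e_vec_inner // eqxx /=.
    by case: (j : nat) jt => [|a] // /negPf ->.
  ring.
have h1 := dim_sum (armv l t); have h2 := dim_end (x := v0 C) ltac:(by []).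
have h3 : (d (v0 C))%:Z = p%:Z + \sum_(i < n) (qcyc i 0)%:Z.
  by rewrite h2 PoszD posz_sum.
apply/eqP; rewrite -eqz_nat !PoszD h1 h3 -!addrA key //.
Qed.

End Dimensions.

Section ConsecutivePairs.

Context (q : nat -> nat) (mm : nat).

Definition consecutive_pairs : seq (nat * nat) :=
  [seq ab <- [seq (a, b) | a <- iota 0 mm, b <- iota 1 (2 * mm)] |
    [&& (ab.1 < ab.2)%N, (ab.2 <= ab.1 + mm)%N, q ab.1 == q ab.2 &
        all (fun t => (q ab.2 < q t)%N) (iota ab.1.+1 (ab.2 - ab.1.+1))]].

Lemma consecutive_pairsP a b : (a, b) \in consecutive_pairs <-> consecutive q mm a b.
Proof.
rewrite mem_filter /=; split.
  case/andP => /and4P [ab bm /eqP qab /allP al] /allpairsP [[x y] /= [xi _ [ex ey]]]; subst x y.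
  split=> //; first by move: xi; rewrite mem_iota.
  by move=> t at' tb; apply: al; rewrite mem_iota subnKC ?at'.
move=> [am ab bm qab lt]; rewrite ab bm qab eqxx /=; apply/andP; split.
  by apply/allP => t; rewrite mem_iota subnKC // => /andP [h1 h2]; rewrite lt.
by apply/allpairsP; exists (a, b); rewrite !mem_iota /=; split=> //; lia.
Qed.

Lemma consecutive_pairs_uniq : uniq consecutive_pairs.
Proof.
apply: filter_uniq; apply: allpairs_uniq; [exact: iota_uniq|exact: iota_uniq|].
by move=> [a b] [a' b'] _ _ [-> ->].
Qed.

Lemma consecutive_pairs_size : (size consecutive_pairs <= 2 * mm ^ 2)%N.
Proof. by rewrite size_filter (leq_trans (count_size _ _)) // size_allpairs !size_iota; lia. Qed.

End ConsecutivePairs.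

(** * Krull dimension and growth *)

Section Transfer.

Context (k : closedFieldType) (hk : [pchar k] =i pred0) (C : canonicalData k) (d : dimvec C).

Local Notation rp := (rep k d).
Local Notation ez := (fun (c : coord d) (M : rp) => entry M c).

Definition to_point (M : rp) : 'I_#|coord d| -> k := fun c => entry M (enum_val c).

Lemma of_pointK x : to_point (of_point x) = x.
Proof. by apply: functional_extensionality => c; rewrite /to_point entry_of_point enum_valK. Qed.

Lemma to_pointK M : of_point (to_point M) = M.
Proof.
apply: functional_extensionality_dep => a; apply/matrixP => i j.
by rewrite mxE /to_point enum_rankK.
Qed.

Lemma irreducible_to (V : rp -> Prop) : irreducible_closed V -> irreducible_set (fun x => V (of_point x)).
Proof.
have toC (W : ('I_#|coord d| -> k) -> Prop) : closed_set W -> zariski_closed (fun M => W (to_point M)).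
  by move=> [S HS]; exists S => M.
move=> [[S HS] [M VM] irr]; split.
- by exists S => x; rewrite HS /evalp -/(to_point _) of_pointK.
- by exists (to_point M); rewrite to_pointK.
move=> V1 V2 c1 c2 cov; have [|h|h] := irr _ _ (toC _ c1) (toC _ c2).
- by move=> N VN; apply: cov; rewrite to_pointK.
- by left=> x /h; rewrite of_pointK.
- by right=> x /h; rewrite of_pointK.
Qed.

Lemma irreducible_from (W : ('I_#|coord d| -> k) -> Prop) : irreducible_set W -> irreducible_closed (fun M => W (to_point M)).
Proof.
have fromC (V : rp -> Prop) : zariski_closed V -> closed_set (fun x => V (of_point x)).
  by move=> [S HS]; exists S => x; rewrite HS /evalp -/(to_point _) of_pointK.
move=> [[S HS] [x Wx] irr]; split.
- by exists S => M.
- by exists (of_point x); rewrite of_pointK.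
move=> V1 V2 c1 c2 cov; have [|h|h] := irr _ _ (fromC _ c1) (fromC _ c2).
- by move=> y Wy; apply: cov; rewrite of_pointK.
- by left=> M /h; rewrite to_pointK.
- by right=> M /h; rewrite to_pointK.
Qed.

(** Growth is needed only on the open part [f != 0], because the chain passes through a point where
    [f] is non-zero. *)
Lemma chain_growth V x0 r X (f : polyfun d) D : chain_at V x0 r X -> f.@[x0] != 0 ->
  growth_le (fun M => V (to_point M) /\ evalp f M != 0) ez D -> (r <= D)%N.
Proof.
move=> ch f0 G; have [g ind] := chain_alg_indep ch f0.
have [X1 _] := ch.
have sub x : X r x /\ f.@[x] != 0 -> V (to_point (of_point x)) /\ evalp f (of_point x) != 0.
  move=> [Xx fx]; rewrite /evalp -/(to_point _) of_pointK; split=> //.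
  by have [_ h _] := X1 r (leqnn r); apply: h.
apply: (@alg_indep_growth _ _ _ _ _ _ _ _ ind _ (growth_le_sub sub G)).
  move=> i; apply: (@alg_eq _ _ _ _ _ (fun x => \sum_(m <- msupp (g i)) (g i)@_m * \prod_j x j ^+ m j)).
    by [].
  apply: alg_sum_seq => m _; apply: algM; first exact: alg_const.
  apply: alg_prod_seq => j _; apply: algX.
  apply: (@alg_eq _ _ _ _ _ (fun x => entry (of_point x) (enum_val j))).
    by move=> x _; rewrite entry_of_point enum_valK.
  exact: (@alg_var k (coord d) _ _ (fun c x => entry (of_point x) c)).
Qed.

Lemma has_chain_growth (V : rp -> Prop) r D : growth_le V ez D -> has_chain V r -> (r <= D)%N.
Proof.
move=> G [X [X1 X2]]; have [[_ [M0 XM0] _] _] := X1 0%N (leq0n r).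
have mono i : (i <= r)%N -> X i M0.
  by elim: i => // i IH ir; have [h _] := X2 i ir; apply: h; apply: IH; apply: ltnW.
apply: (@chain_growth (fun x => V (of_point x)) (to_point M0) r (fun i x => X i (of_point x)) 1).
- split=> [i ir|i ir].
    have [irr sub] := X1 i ir; split; [exact: irreducible_to|by move=> x /sub|by rewrite to_pointK; apply: mono].
  have [h1 h2] := X2 i ir; split=> [x /h1 //|h]; apply: h2 => M XM.
  by have := h (to_point M); rewrite to_pointK; apply.
- by rewrite meval1 oner_eq0.
by apply: (growth_le_sub (h := id)) G => M [h _]; rewrite to_pointK in h.
Qed.

Lemma chain_has_chain (V : ('I_#|coord d| -> k) -> Prop) x0 r X : chain_at V x0 r X -> has_chain (fun M => V (to_point M)) r.
Proof.
move=> [X1 X2]; exists (fun i M => X i (to_point M)); split=> [i ir|i ir].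
  by have [h1 h2 _] := X1 i ir; split; [apply: irreducible_from|move=> M; apply: h2].
have [h1 h2] := X2 i ir; split=> [M|h]; first exact: h1.
by apply: h2 => x Xx; have := h (of_point x); rewrite of_pointK; apply.
Qed.

Lemma has_chain_eq (V W : rp -> Prop) r : (forall M, V M <-> W M) -> has_chain V r -> has_chain W r.
Proof.
move=> VW [X [X1 X2]]; exists X; split=> // i ir; have [h1 h2] := X1 i ir; split=> // M /h2 /VW //.
Qed.

Lemma emb_growth (V : rp -> Prop) (P : prep C (esize d) -> Prop) D : (forall M, V M -> P (emb M)) ->
  growth_le P (fun c N => cz c N) D -> growth_le V ez D.
Proof.
move=> VP G; have G' := growth_le_sub (h := @emb k C d) VP G.
apply: growth_le_alg G' => -[a [i j]].
have H : mx_alg V (fun (c : coords C (esize d)) M => cz c (emb M)) (fun M : rp => emb M (tag a) (tagged a)).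
  move=> x y; exact: (@alg_var _ (coords C (esize d)) _ V (fun c M => cz c (emb M)) (a, (x, y))).
apply: alg_eq (mx_alg_up (a := d (tgt a)) (b := d (src a)) H i j) => M _.
by rewrite emb_arrow up_pad //; apply: dim_le.
Qed.

Lemma equations_of (I : finType) (F : I -> rp -> k) :
  (forall i, in_alg_gen (fun _ => True) ez (F i)) -> exists s : seq (polyfun d),
  size s = #|I| /\ forall M, (forall g, g \in s -> evalp g M = 0) <-> (forall i, F i M = 0).
Proof.
move=> algF; pose f i := proj1_sig (constructive_indefinite_description _ (alg_evalp (algF i))).
have fE i M : evalp (f i) M = F i M by rewrite /f; case: constructive_indefinite_description.
exists [seq f i | i <- enum I]; split=> [|M]; first by rewrite size_map -cardE.
split=> [h i|h g /mapP [i _ ->]]; last by rewrite fE.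
by rewrite -fE; apply: h; apply: map_f; rewrite mem_enum.
Qed.

(** A chain through one point bounds the dimension from below by the number of coordinates minus the
    number of equations; growth bounds it from above by the same number. *)
Lemma complete_intersection_of_growth (V : rp -> Prop) (s : seq (polyfun d)) D :
  (forall M, V M <-> (forall g, g \in s -> evalp g M = 0)) -> (exists M, V M) ->
  growth_le V ez D -> (D + size s <= #|coord d|)%N -> complete_intersection V.
Proof.
move=> Vs [M0 V0] G le.
have [r0 [X0 [le0 ch0]]] := @chain_through_point k hk #|coord d| [::] (to_point M0) (fun g h => False_ind _ (notF h)).
have [|r [X [ler ch]]] := @chain_through_point k hk #|coord d| s (to_point M0).
  by move=> g gs; apply: ((Vs M0).1 V0).
have hV : has_chain V r.
  apply: has_chain_eq (chain_has_chain ch) => M; split=> [h|/Vs h]; first by apply/Vs.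
  exact: h.
have hT : has_chain (fun _ : rp => True) r0 by apply: has_chain_eq (chain_has_chain ch0) => M.
have bT r' : has_chain (fun _ : rp => True) r' -> (r' <= #|coord d|)%N.
  exact: (has_chain_growth (growth_le_free _ _)).
have bV r' : has_chain V r' -> (r' <= D)%N by exact: (has_chain_growth G).
have rD : r = D by have := bV r hV; move: ler le; move: #|coord d| (size s) => x y; lia.
have r0E : r0 = #|coord d| by have := bT r0 hT; move: le0 => /=; move: #|coord d| => x; lia.
have sz : (#|coord d| - D)%N = size s by move: ler le; move: #|coord d| (size s) => x y; lia.
rewrite r0E in hT; rewrite rD in hV; exists #|coord d|, D; split; [by []|by []|].
exists (fun i => nth 0 s i) => M; split=> [VM i|h].
  by apply: ((Vs M).1 VM); apply: mem_nth; rewrite -sz.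
apply/Vs => g gs; have ix : (index g s < #|coord d| - D)%N by rewrite sz index_mem.
by have := h (Ordinal ix); rewrite nth_index.
Qed.

End Transfer.

(** * Comparison of the locus with the zero set *)

Section ZeroSet.

Context (k : closedFieldType) (hk : [pchar k] =i pred0) (C : canonicalData k) (hC : tame C) (d : dimvec C).

Local Notation n := (narms C).
Local Notation m := (@arity k C).
Local Notation rp := (rep k d).
Local Notation ez := (fun (c : coord d) (M : rp) => entry M c).
Local Notation E := (esize d).
Local Notation prep := ('I_n -> nat -> 'M[k]_E).
Local Notation S := (seg_of d).

Context (p : nat) (q : forall i : 'I_n, 'I_(m i) -> nat).
Hypothesis dec : canonical_decomposition d p q.
Hypothesis pbig : ((\sum_(i < n) 2 * m i ^ 2) + n + 1 <= p)%N.

Local Notation qc := (qcyc q).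
Local Notation P i := (consecutive_pairs (qc i) (m i)).

Definition extra : nat := (p - n + 1 + \sum_l size (P l))%N.

Lemma extra_lt : (extra < 2 * p)%N.
Proof.
have : (\sum_l size (P l) <= \sum_(i < n) 2 * m i ^ 2)%N by apply: leq_sum => i _; apply: consecutive_pairs_size.
have n3 := narms_ge3 C; rewrite /extra; move: n3 pbig; move: (\sum_l size (P l))%N (\sum_(i < n) 2 * m i ^ 2)%N => x y.
move: (narms C) => z; lia.
Qed.

Lemma n_le_p : (n <= p)%N.
Proof. by lia. Qed.

Lemma dim_v0 : d (v0 C) = (p + \sum_l qc l 0)%N.
Proof. exact: (dim_end dec). Qed.

Lemma dim_voo : d (voo C) = d (v0 C).
Proof. by rewrite dim_v0; apply: (dim_end dec). Qed.

Lemma dim_pos x : (0 < d x)%N.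
Proof.
elim/armv_ind: x => l t tm; have := dim_arm dec tm; rewrite dim_v0 (bigD1 l) //=; lia.
Qed.

Lemma consecutive_fits i a b : consecutive (qc i) (m i) a b -> fits d i a b.
Proof.
move=> [am ab bm qab _]; split=> //.
have h1 := dim_arm dec (ltnW am); case: leqP => bmi.
  by have := dim_arm dec bmi; lia.
have h2 : (b - m i <= m i)%N by lia.
by have := dim_arm dec h2; have := qcyc_per q i (b - m i); rewrite subnK; lia.
Qed.

Definition equation_type : finType :=
  ('I_(n - 2) * ('I_(d (v0 C)) * 'I_(d (voo C))) + ({i : 'I_n & 'I_(size (P i))} + 'I_(p - n + 1)))%type.

(** Pencil coefficients of index at most [qc (arm_fst C) 0] vanish by [arm_mult] once the
    determinants of the first arm do, so the list starts just after them. *)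
Definition equation (t : equation_type) (M : rp) : k :=
  match t with
  | inl (i, (x, y)) =>
      (arm_mx M (arm_fst C) + coeff i *: arm_mx M (arm_snd C) - arm_mx M (arm_rest i)) x y
  | inr (inl u) => xdet (tag u) (nth (0, 0)%N (P (tag u)) (tagged u)) (emb M)
  | inr (inr l) => (pencil (emb M))`_(qc (arm_fst C) 0 + 1 + l)
  end.

Definition locus (M : rp) : Prop := forall t, equation t M = 0.

Lemma card_equation : #|equation_type| = ((n - 2) * (d (v0 C) * d (voo C)) + extra)%N.
Proof.
rewrite !card_sum !card_prod !card_ord card_tagged /extra; congr (_ + _)%N; rewrite addnC.
by congr (_ + _)%N; rewrite sumnE big_map big_enum; apply: eq_bigr => i _; rewrite card_ord.
Qed.

Lemma arm_mx_alg i : mx_alg (fun _ => True) ez (fun M : rp => arm_mx M i).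
Proof.
move=> x y; have H := @amx_alg k C d (fun _ => True) i 0 (m i).
apply: alg_eq (mx_alg_up (a := d (v0 C)) (b := d (voo C)) H x y) => M _.
by rewrite -[cp _ _ _]/(amx (emb M) i) emb_amx up_pad // dim_le.
Qed.

Lemma equation_alg t : in_alg_gen (fun _ => True) ez (equation t).
Proof.
case: t => [[i [x y]]|[u|l]].
- apply: (@alg_eq _ _ _ _ _ (fun M : rp => arm_mx M (arm_fst C) x y + coeff i * arm_mx M (arm_snd C) x y
     + (-1) * arm_mx M (arm_rest i) x y)); first by move=> M _; rewrite [RHS]mxE [in RHS]mxE [in RHS]mxE [in RHS]mxE mulN1r.
  by apply: algD; [apply: algD|]; [|apply: algM; first exact: alg_const|apply: algM; first exact: alg_const]; apply: arm_mx_alg.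
- exact: xdet_alg.
exact: pencil_alg.
Qed.

Lemma locusP M : locus M <-> [/\ is_module M, forall i a b, consecutive (qc i) (m i) a b -> xdet i (a, b) (emb M) = 0 &
  forall l, (qc (arm_fst C) 0 < l)%N -> (l <= qc (arm_fst C) 0 + 1 + (p - n))%N -> (pencil (emb M))`_l = 0].
Proof.
split=> [h|[h1 h2 h3] [[i [x y]]|[u|l]] /=].
- split.
  + by move=> i; apply/matrixP => x y; rewrite [RHS]mxE; apply: (h (inl (i, (x, y)))).
  + move=> i a b /consecutive_pairsP ab; have ix := ab; rewrite -index_mem in ix.
    have := h (inr (inl (Tagged (fun i => 'I_(size (P i))) (Ordinal ix)))).
    by rewrite /= nth_index.
  move=> l l1 l2; have ix : (l - (qc (arm_fst C) 0 + 1) < p - n + 1)%N by lia.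
  have := h (inr (inr (Ordinal ix))); rewrite /= subnKC //; lia.
- by rewrite h1 mxE.
- set ab := nth _ _ _; have : ab \in P (tag u) by apply: mem_nth.
  by case: ab => a b /consecutive_pairsP; apply: h2.
by apply: h3; have := ltn_ord l; lia.
Qed.

Lemma Zset_locus M : Zset M -> locus M.
Proof.
move=> Z; apply/locusP; split=> [|i a b ab|l _ _]; first by case: Z.
  exact: (Zset_xdet dim_voo dim_pos (consecutive_fits ab) Z).
exact: (Zset_pencil dim_voo dim_pos l Z).
Qed.

Definition defective s (N : prep) : Prop := [/\ isrep S N, rels N, maxdef S N s &
  forall i a b, consecutive (qc i) (m i) a b -> degen S (oth i) i N (a, b)].

Lemma maxdef_exists (N : prep) : (exists X : 'M[k]_E, (X <= pr k (S (v0 C)))%MS /\ (\rank (img N X) < \rank X)%N) ->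
  exists s : 'I_E, maxdef S N s.+1.
Proof.
move=> [X0 [X0p X0d]].
pose Q x := exists X : 'M[k]_E, (X <= pr k (S (v0 C)))%MS /\ \rank X = (\rank (img N X) + x)%N.
have [||s [[X [Xp Xs]] ms]] := @bounded_max Q E.
- by exists (\rank X0 - \rank (img N X0))%N; exists X0; lia.
- by move=> x [X [_ h]]; have := rank_leq_row X; lia.
have s0 : (0 < s)%N.
  have : (\rank X0 - \rank (img N X0) <= s)%N by apply: ms; exists X0; lia.
  lia.
have sE : (s.-1 < E)%N by have := rank_leq_row X; lia.
exists (Ordinal sE); rewrite prednK //; split; first by exists X.
move=> Y Yp; have [h|h] := leqP (\rank Y) (\rank (img N Y)); first by lia.
have : (\rank Y - \rank (img N Y) <= s)%N by apply: ms; exists Y; lia.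
lia.
Qed.

Lemma locus_defective M : locus M -> exists s : 'I_E, defective s.+1 (emb M).
Proof.
move=> /locusP [h1 h2 h3].
have dg i a b : consecutive (qc i) (m i) a b -> degen S (oth i) i (emb M) (a, b).
  by move=> c; apply: (xdet_degen dim_voo (emb_isrep M) (consecutive_fits c)); apply: h2.
have [|s ms] := @maxdef_exists (emb M); last by exists s; split=> //; [exact: emb_isrep|exact/module_rels].
apply: (positive_defect hk dim_v0 (@dim_arm _ _ _ _ _ dec) (@qcyc_per _ _ q) (qcyc_zero dec) (emb_isrep M) _ dg n_le_p h3).
exact/module_rels.
Qed.

Lemma cod_defective_many s : (2 <= s)%N -> cod (defective s) d (2 * p)%N%:Z.
Proof.
move=> s2; apply: cod_sub (cod_drop_many dim_v0 (@dim_arm _ _ _ _ _ dec) (@qcyc_per _ _ q)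
  (fun w => @tame_tits k C hk hC w) (card_seg_of d) s2); by move=> N [].
Qed.

Lemma cod_defective : cod (fun N => exists s : 'I_E, defective s.+1 N) d extra%:Z.
Proof.
apply: (cod_cover (F := 'I_E) (Q := fun s N => defective s.+1 N)) => // s.
(* The index is shifted by one: [s = 0] is defect one. Larger defects have codimension at least
   [2 * p], which exceeds [extra]. *)
have [s0|s0] := posnP s; last first.
  by apply: cod_weak (cod_defective_many _); [have := extra_lt; lia|lia].
have HP l a b : (a, b) \in P l -> [/\ (a < m l)%N, (a < b)%N, (b <= a + m l)%N, qc l a = qc l b &
    forall t, (a < t < b)%N -> (qc l b < qc l t)%N].
  by case/consecutive_pairsP => h1 h2 h3 h4 h5; split=> // t /andP [? ?]; apply: h5.
have H := cod_drop_one dim_v0 (@dim_arm _ _ _ _ _ dec) (@qcyc_per _ _ q)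
  (fun l => consecutive_pairs_uniq (qc l) (m l)) HP (card_seg_of d).
apply: (cod_weak _ (cod_sub _ H)).
  by have := n_le_p; rewrite /extra; lia.
by move=> N [h1 h2 h3 h4]; rewrite s0 in h3; split=> // l a b /consecutive_pairsP; apply: h4.
Qed.

Lemma cod_exceptional : cod (fun N => (exists s : 'I_E, defective s.+2 N) \/
  [/\ isrep S N, rels N, maxdef S N 1, row_killed S N & col_killed S N]) d (2 * p)%N%:Z.
Proof.
apply: (cod_cover (F := option 'I_E) (Q := fun s N => if s is Some s' then defective s'.+2 N else
  [/\ isrep S N, rels N, maxdef S N 1, row_killed S N & col_killed S N])).
  by move=> N [[s h]|h]; [exists (Some s)|exists None].
case=> [s|]; first exact: cod_defective_many.
exact: (cod_two_kernels dim_v0 (@dim_arm _ _ _ _ _ dec) (@qcyc_per _ _ q) (card_seg_of d)).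
Qed.

Lemma det_zero (R : comNzRingType) r : (0 < r)%N -> \det (0 : 'M[R]_r) = 0.
Proof. by case: r => // r _; rewrite det0. Qed.

Lemma locus0 : locus (fun a => 0).
Proof.
have e0 i j : (j < m i)%N -> emb (fun a => 0 : 'M[k]_(d (tgt a), d (src a))) i j = 0.
  by move=> jm; rewrite (embE _ jm) /pad mulmx0 mul0mx.
have c0 i a b : (a < b)%N -> (b <= m i)%N -> cp (emb (fun a => 0 : 'M[k]_(d (tgt a), d (src a))) i) a b = 0.
  by move=> ab bm; rewrite cp_l // e0 ?mul0mx //; lia.
have u0 r s : up r s (0 : 'M[k]_E) = 0 by rewrite /up mulmx0 mul0mx.
have a0 i : amx (emb (fun a => 0 : 'M[k]_(d (tgt a), d (src a)))) i = 0 by apply: c0; rewrite ?arity_gt0.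
have dp := dim_pos.
apply/locusP; split=> [i|i a b [am ab bm _ _]|l _ _].
- have z j : arm_mx (fun a => 0 : 'M[k]_(d (tgt a), d (src a))) j = 0.
    by rewrite -[LHS](up_pad (E := E)) ?dim_le // -emb_amx a0.
  by rewrite !z scaler0 addr0 subr0.
- rewrite /xdet /=; case: leqP => bmi; first by rewrite c0 // u0 det_zero.
  by rewrite a0 !c0 ?u0 ?block_mx_const ?det_zero ?addn_gt0 ?dp //; lia.
by rewrite /pencil !a0 u0 map_mx0 scaler0 addr0 det_zero ?coef0.
Qed.

Lemma coord_Ed : #|coord d|%:Z = Ed d + ((n - 2) * (d (v0 C) * d (voo C)))%N%:Z.
Proof. by rewrite EdE card_coord subrK. Qed.

Lemma locus_growth : exists2 D, growth_le locus ez D & (D + #|equation_type| <= #|coord d|)%N.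
Proof.
have [|D [le G]] := cod_defective; first by exists (emb (fun a => 0)); apply: locus_defective locus0.
exists D; first by apply: (emb_growth _ G); apply: locus_defective.
move: le coord_Ed; rewrite card_equation; move: (Ed d) #|coord d| ((n - 2) * _)%N extra => x y z w; lia.
Qed.

(** If some semi-invariant [f] of non-zero weight were non-zero at [M], a long chain in the locus
    through [M] would keep its length on the open part [f != 0]. The exceptional strata are too
    small to contain that part, so [king_weight] applies at another of its points. *)
Lemma locus_Zset M : locus M -> Zset M.
Proof.
move=> LM; split=> [|sigma f _ s0 sf]; first by have /locusP [] := LM.
apply/eqP/negP => /negP fM.
have [s [sz sP]] := equations_of equation_alg.
have [|r [X [ler ch]]] := @chain_through_point k hk #|coord d| s (to_point M).
  by move=> g gs; apply: ((sP M).2 LM).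
have key : exists N, [/\ locus N, evalp f N != 0, maxdef S (emb N) 1 & ~ (row_killed S (emb N) /\ col_killed S (emb N))].
  apply: Classical_Prop.NNPP => no.
  have ex N : locus N /\ evalp f N != 0 -> (exists s : 'I_E, defective s.+2 (emb N)) \/
    [/\ isrep S (emb N), rels (emb N), maxdef S (emb N) 1, row_killed S (emb N) & col_killed S (emb N)].
    move=> [LN fN]; have [[[|t] tE] /= df] := locus_defective LN; last by left; exists (Ordinal (ltnW tE)).
    right; have [h1 h2 h3 _] := df.
    have [//|nk] := Classical_Prop.classic (row_killed S (emb N) /\ col_killed S (emb N)); first by case.
    by case: no; exists N.
  (* Were all points with [f != 0] exceptional, the chain through [M] would require codimension at
     most [extra], while they have at least [2 * p]. *)
  have [|D [le G]] := cod_exceptional; first by exists (emb M); apply: ex.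
  have : (r <= D)%N.
    apply: (chain_growth ch fM); apply: (growth_le_sub (h := id) _ (emb_growth ex G)).
    by move=> N [h1 h2]; split=> //; apply/sP.
  move: ler le coord_Ed extra_lt; rewrite sz card_equation.
  move: (Ed d) #|coord d| ((n - 2) * _)%N extra => x y z w; lia.
have [N [LN fN md nk]] := key; have [s' [h1 h2 _ h4]] := locus_defective LN.
have p1 : (0 < p)%N by lia.
have c0 : #|S (v0 C)| = (p + \sum_l qc l 0)%N by rewrite card_seg_of dim_v0.
have cE l t : (t <= m l)%N -> (#|S (armv l t)| + qc l 0 = #|S (v0 C)| + qc l t)%N.
  by move=> tm; rewrite !card_seg_of; apply: (dim_arm dec).
have F0 : evalp f (uprep (emb N)) != 0 by rewrite uprep_emb.
have := king_weight hk (evalp_uprep_alg f) (semi_invariant_weighted sf) h1 h2 p1 c0 cE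
  (@qcyc_per _ _ q) (qcyc_zero dec) h4 md nk F0.
by move=> z; move/eqP: s0; apply; apply/ffunP => x; rewrite ffunE.
Qed.

Lemma Zset_complete_intersection : complete_intersection (@Zset k C d).
Proof.
have [s [sz sP]] := equations_of equation_alg.
have [D G le] := locus_growth.
have Zl M : Zset M <-> locus M by split; [exact: Zset_locus|exact: locus_Zset].
apply: (complete_intersection_of_growth hk (s := s) (D := D)).
- by move=> M; rewrite Zl; split=> h; apply/sP.
- by exists (fun a => 0); apply/Zl; apply: locus0.
- by apply: (growth_le_sub (h := id) _ G) => M /Zl.
by lia.
Qed.

End ZeroSet.

Theorem mainTheorem1 (k : closedFieldType) (hk : [pchar k] =i pred0)
    (C : canonicalData k) (hC : tame C) :
  exists N : nat, forall d : dimvec C, regular_dim d ->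
    forall (p : nat) (q : forall i : 'I_(narms C), 'I_(arity i) -> nat),
      canonical_decomposition d p q -> (N <= p)%N ->
      complete_intersection (@Zset k C d).
Proof.
(* Each [2 * arity i ^ 2] bounds the number of consecutive pairs on one arm, so that [extra] stays
   below [2 * p]; the term [narms C] gives [n <= p]. *)
exists ((\sum_(i < narms C) 2 * arity i ^ 2) + narms C + 1)%N => d _ p q dec pbig.
exact: (Zset_complete_intersection hk hC dec pbig).
Qed.
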